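(* Let $J_{\rm BS}$, $\omega_1$, $\rho_x$, $\theta_x$ be as defined in the context. (i) The series expansion $J_{\rm BS}(\omega)=\sum_{n=0}^\infty c_{J,n}(\omega-1)^n$ of the rate function around $\omega=1$ has radius of convergence $R_J=1$. Its first few terms are $$J_{\rm BS}(\omega)=\tfrac32(\omega-1)^2-\tfrac95(\omega-1)^3+\tfrac{333}{175}(\omega-1)^4+O((\omega-1)^5)\quad(\omega\to1),$$ and as $n\to\infty$ $$c_{J,n}=(-1)^n\,2+O\big((1-\omega_1)^{-n}\big).$$ (ii) The series expansion $J_{\rm BS}(e^y)=\sum_{n=0}^\infty d_{J,n}y^n$ around $y=0$ converges for $|y|<\rho_x$. Its first few terms are $$J_{\rm BS}(e^y)=\tfrac32y^2-\tfrac3{10}y^3+\tfrac{109}{1400}y^4+O(y^5)\quad(y\to0),$$ and there is a real constant $d_J\approx-23.4048$ such that, as $n\to\infty$, $$d_{J,n}=d_J\,\rho_x^{-n}\cos\!\Big[\theta_x\big(\tfrac32-n\big)\Big]n^{-5/2}+O\big(\rho_x^{-n}n^{-7/2}\big).$$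
   Context: The rate function $J_{\rm BS}:(0,\infty)\to[0,\infty)$ is defined by $$J_{\rm BS}(x)=\begin{cases}\frac12\xi^2-\xi\tanh(\xi/2), & x\ge1,\\ \zeta\tan(\zeta/2)-\frac12\zeta^2, & 0<x\le1,\end{cases}$$ where $\xi\ge0$ is the solution of $\frac{\sinh\xi}{\xi}=x$ and $\zeta\in[0,\pi]$ is the solution of $\frac{\sin\zeta}{\zeta}=x$ (both quotients being interpreted as $1$ at $0$). It is real-analytic near $x=1$ and is identified with its analytic continuation. Equivalently, $J_{\rm BS}(\omega)=\mathcal J(h(\omega))$ with $\mathcal J(z)=\frac12z-\sqrt z\tanh(\sqrt z/2)$ (well defined, since $w\mapsto w\tanh(w/2)$ is even), where $h$ is the analytic function near $\omega=1$ determined by $h(1)=0$ and $g(h(\omega))=\omega$, with $g(z)=\sum_{n\ge0}\frac{z^n}{(2n+1)!}=\frac{\sinh\sqrt z}{\sqrt z}$. Let $\eta_1\approx4.4934$ be the smallest positive solution of $\tan\eta=\eta$, and put $\omega_1=\frac{\sin\eta_1}{\eta_1}\approx-0.2172$, $\rho_x=\big|\log|\omega_1|+i\pi\big|\approx3.49295$, $\theta_x=\arg(i\pi+\log|\omega_1|)\approx2.02317$. The symbol $\approx$ indicates a decimal approximation. *)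

(* Defs.v *)
From Stdlib Require Export Reals Factorial.
From Coquelicot Require Export Coquelicot.
Open Scope R_scope.

(* Coquelicot's [iota P] is definite description: it is the unique point
   satisfying [P] whenever there is exactly one.  It is used below only where
   existence and uniqueness hold. *)

Definition sinhc (t : R) : R := if Req_EM_T t 0 then 1 else sinh t / t.

Definition sinc (t : R) : R := if Req_EM_T t 0 then 1 else sin t / t.

Definition xi (x : R) : R := iota (fun t : R => 0 <= t /\ sinhc t = x).

Definition zeta (x : R) : R := iota (fun t : R => 0 <= t <= PI /\ sinc t = x).

(* The domain of the rate function is (0, +oo); the value for x <= 0 is
   irrelevant.  At x = 1 both branches give 0. *)
Definition J_BS (x : R) : R :=
  if Rle_dec 1 x
  then / 2 * xi x ^ 2 - xi x * tanh (xi x / 2)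
  else zeta x * tan (zeta x / 2) - / 2 * zeta x ^ 2.

(* [cos t <> 0] excludes the points where the tangent is undefined and Stdlib's
   total [tan] takes a conventional value. *)
Definition tan_fixpoint (t : R) : Prop := 0 < t /\ cos t <> 0 /\ tan t = t.

Definition eta1 : R :=
  iota (fun t : R => tan_fixpoint t /\ forall s, tan_fixpoint s -> t <= s).

Definition omega1 : R := sin eta1 / eta1.

(* Principal value of the argument, in (-PI, PI], for z <> 0. *)
Definition Carg (z : C) : R :=
  iota (fun t : R =>
    - PI < t <= PI /\ z = (Cmod z * cos t, Cmod z * sin t)).

Definition log_omega1 : C := (RtoC (ln (Rabs omega1)) + Ci * RtoC PI)%C.

Definition rho_x : R := Cmod log_omega1.

Definition theta_x : R := Carg log_omega1.

Definition taylor_coef (f : R -> R) (a : R) (n : nat) : R :=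
  Derive_n f n a / INR (fact n).

Definition cJ_coef : nat -> R := taylor_coef J_BS 1.

Definition dJ_coef : nat -> R := taylor_coef (fun y => J_BS (exp y)) 0.

(* f = O(g) along the filter F. *)
Definition is_bigO {T : Type} (F : (T -> Prop) -> Prop) (f g : T -> R) : Prop :=
  exists K : R, F (fun x => Rabs (f x) <= K * Rabs (g x)).

(* Main.v *)
Require Import Defs.
From Stdlib Require Import Lra Lia List Machin Ranalysis5.
From Stdlib Require ClassicalEpsilon.
Import ListNotations.

(** Parametrize [omega = sinh w / w]: the real half-axis [w = xi] covers [omega >= 1] and the segment
    [w = i zeta] covers [0 < omega <= 1].  In this variable [dJ / d log omega = w tanh (w / 2)] and
    [dJ / d omega = w ^ 2 / (1 + cosh w)].

    The expansions come from one Cauchy integral in [w], without any inverse function or analytic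
    continuation.  Let [p] be [omega - 1] or [log omega], let [F] be the derivative of [J] with
    respect to [p], possibly with a pole removed, and [f = dF / dw].  Take a region of the quadrant
    [Re w >= 0, Im w >= 0] that touches both axes.  For real [y] and small [e > 0] the function
    [f / (p - (y - i e))] is holomorphic on it, because [sinh w / w] takes no value just below the
    positive real axis ([no_crossing]), so its integral round the region vanishes ([goursat],
    [goursat_corner]).  On the two sides that meet at [0], [p] is real and [f] is real or imaginary; the imaginary parts
    of the integrals there are Poisson integrals, which as [e] tends to [0] concentrate at the point
    where [p = y] and give [PI f / p' = PI dF / dp] ([poisson_limit], [cauchy_real], [cauchy_imag]).
    On the remaining sides [|p| >= r], so that their contribution is a power series in [y] with
    coefficients [O(r ^ - n)] ([cauchy_expansion]).  Two integrations ([double_integral]) give [J].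

    In part (i) the pole [2 / omega] of [J] is subtracted and the region is cut off at the height
    [eta1] of the saddle point [i eta1] of [sinh w / w]; there [Re omega <= omega1], hence
    [r = 1 - omega1], and the pole contributes [2 (-1) ^ n] ([cJ_form_asym]).

    In part (ii) the contour goes round [i PI], where [omega = 0], and then follows the imaginary axis,
    on which [log omega = ell v + i PI] and [ell] is largest at [v = eta1].  So [|log omega| >= rho_x]
    with equality only at the saddle point, and the coefficients are governed by Laplace's method:
    near the saddle point [log omega] is [log omega1 - s ^ 2 / 2] up to cubic terms, the first of which
    cancels by oddness ([integrand_error]).  The integrals of the powers of
    [1 / (log omega1 - s ^ 2 / 2)] over the line satisfy a two-term recursion whose solution is a
    Wallis product ([modelint_tends]); this yields the modulus, the phase and [n ^ (- 5 / 2)]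
    ([Elog_asym], [dJ_asym]).

    The first terms of both expansions follow from Taylor polynomials of [sinh] and [cosh] in
    [T = w ^ 2], negative on the second branch: each error is a fifth power times a bounded polynomial
    ([J_expansion]). *)

Set Bullet Behavior "Strict Subproofs".

(** * A decimal enclosure of [PI] *)

Lemma PI_bounds : 3141592653 / 10 ^ 9 < PI < 3141592654 / 10 ^ 9.
Proof.
  generalize (PI_2_3_7_ineq 5). unfold tg_alt, PI_2_3_7_tg, Ratan_seq.
  change (S (2 * 5)) with 11%nat. change (2 * 5)%nat with 10%nat.
  unfold sum_f_R0. cbn [Nat.add Nat.mul]. rewrite !INR_IZR_INZ.
  cbn [Z.of_nat Pos.of_succ_nat Pos.succ]. intros H. lra.
Qed.

(** * Complex derivatives and integrals *)

Notation C_NM := (AbsRing_NormedModule C_AbsRing).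
Notation Chol := (@ex_derive C_AbsRing (AbsRing_NormedModule C_AbsRing)).
Notation Cder := (@is_derive C_AbsRing (AbsRing_NormedModule C_AbsRing)).
Notation Cint := (@RInt C_R_CompleteNormedModule).

Lemma Cder_eps (f : C -> C) (z l : C) :
  Cder f z l <->
  forall eps, 0 < eps -> exists d, 0 < d /\
    forall w, Cmod (w - z) < d ->
      Cmod (f w - f z - l * (w - z)) <= eps * Cmod (w - z).
Proof.
  split.
  - intros [_ H] eps He.
    assert (H1 := H z (fun P HP => HP) (mkposreal eps He)).
    destruct H1 as [d Hd]. exists d. split; [apply d|].
    intros w Hw. specialize (Hd w Hw).
    replace (l * (w - z))%C with ((w - z) * l)%C by ring. exact Hd.
  - intros H. split.
    + apply is_linear_scal_l.
    + intros x Hx.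
      assert (x = z).
      { symmetry. apply (is_filter_lim_locally_unique (K := C_AbsRing) (V := C_NM)). exact Hx. }
      subst x. intros eps. destruct (H eps (cond_pos eps)) as [d [Hd0 Hd]].
      exists (mkposreal d Hd0). intros w Hw. specialize (Hd w Hw).
      replace (l * (w - z))%C with ((w - z) * l)%C in Hd by ring. exact Hd.
Qed.

Notation Ccont := (@continuous (AbsRing_UniformSpace C_AbsRing) (AbsRing_UniformSpace C_AbsRing)).

Lemma Ccont_eps (f : C -> C) (z : C) :
  Ccont f z <->
  forall eps, 0 < eps -> exists d, 0 < d /\
    forall w, Cmod (w - z) < d -> Cmod (f w - f z) < eps.
Proof.
  split.
  - intros H eps He.
    destruct (H (fun y => Cmod (y - f z) < eps)) as [d Hd].
    { exists (mkposreal eps He). intros y Hy. exact Hy. }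
    exists d. split; [apply d|]. intros w Hw. apply Hd. exact Hw.
  - intros H P [eps HP].
    destruct (H eps (cond_pos eps)) as [d [Hd0 Hd]].
    exists (mkposreal d Hd0). intros w Hw. apply HP. apply Hd. exact Hw.
Qed.

Lemma Chol_cont (f : C -> C) z : Chol f z -> Ccont f z.
Proof. exact (@ex_derive_continuous C_AbsRing C_NM f z). Qed.

Lemma Cnorm_R (z : C) : @norm _ C_R_NormedModule z = Cmod z.
Proof.
  unfold norm; simpl. unfold prod_norm, Cmod. f_equal.
  unfold norm; simpl; unfold abs; simpl.
  rewrite !Rmult_1_r. f_equal; symmetry; apply (Rsqr_abs _).
Qed.

Lemma path_continuous (f : C -> C) (z0 d : C) (t : R) :
  Ccont f (z0 + RtoC t * d)%C ->
  @continuous R_UniformSpace C_R_NormedModule (fun t => f (z0 + RtoC t * d)%C) t.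
Proof.
  intros H. apply filterlim_locally_ball_norm. intros eps.
  destruct (proj1 (Ccont_eps _ _) H eps (cond_pos eps)) as [dl [Hd0 Hd]].
  assert (Hp : 0 < dl / (Cmod d + 1)).
  { apply Rdiv_lt_0_compat; auto. generalize (Cmod_ge_0 d); lra. }
  exists (mkposreal _ Hp). intros s Hs.
  unfold ball_norm.
  change (@norm _ C_R_NormedModule (f (z0 + RtoC s * d)%C - f (z0 + RtoC t * d)%C)%C < eps).
  rewrite Cnorm_R. apply Hd.
  replace (z0 + RtoC s * d - (z0 + RtoC t * d))%C with (RtoC (s - t) * d)%C
    by (rewrite RtoC_minus; ring).
  rewrite Cmod_mult, Cmod_R.
  change (Rabs (s - t) < dl / (Cmod d + 1)) in Hs.
  generalize (Cmod_ge_0 d); intros Hge.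
  apply Rle_lt_trans with (Rabs (s-t) * (Cmod d + 1)).
  - apply Rmult_le_compat_l; [apply Rabs_pos | lra].
  - apply Rmult_lt_reg_r with (/ (Cmod d + 1)); [apply Rinv_0_lt_compat; lra|].
    rewrite Rmult_assoc, Rinv_r by lra. lra.
Qed.

Lemma is_Cint_pair (f : R -> C) a b (l : C) :
  is_RInt (fun t => Re (f t)) a b (Re l) ->
  is_RInt (fun t => Im (f t)) a b (Im l) ->
  @is_RInt C_R_NormedModule f a b l.
Proof.
  intros H1 H2. destruct l as [l1 l2].
  exact (is_RInt_fct_extend_pair (U := R_NormedModule) (V := R_NormedModule) f a b l1 l2 H1 H2).
Qed.

Lemma is_Cint_Re (f : R -> C) a b (l : C) :
  @is_RInt C_R_NormedModule f a b l -> is_RInt (fun t => Re (f t)) a b (Re l).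
Proof. exact (is_RInt_fct_extend_fst (U := R_NormedModule) (V := R_NormedModule) f a b l). Qed.

Lemma is_Cint_Im (f : R -> C) a b (l : C) :
  @is_RInt C_R_NormedModule f a b l -> is_RInt (fun t => Im (f t)) a b (Im l).
Proof. exact (is_RInt_fct_extend_snd (U := R_NormedModule) (V := R_NormedModule) f a b l). Qed.

Lemma is_Cint_scal (f : R -> C) a b (c l : C) :
  @is_RInt C_R_NormedModule f a b l ->
  @is_RInt C_R_NormedModule (fun t => c * f t)%C a b (c * l)%C.
Proof.
  intros H. assert (H1 := is_Cint_Re _ _ _ _ H). assert (H2 := is_Cint_Im _ _ _ _ H).
  apply is_Cint_pair.
  - rewrite re_mult. eapply is_RInt_ext; [intros; symmetry; apply re_mult|].
    apply (is_RInt_minus (V := R_NormedModule));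
      apply (is_RInt_scal (V := R_NormedModule)); assumption.
  - rewrite im_mult. eapply is_RInt_ext; [intros; symmetry; apply im_mult|].
    apply (is_RInt_plus (V := R_NormedModule));
      apply (is_RInt_scal (V := R_NormedModule)); assumption.
Qed.

Lemma Cint_norm_le (f : R -> C) a b l M :
  a <= b -> @is_RInt C_R_NormedModule f a b l ->
  (forall t, a <= t <= b -> Cmod (f t) <= M) -> Cmod l <= (b - a) * M.
Proof.
  intros Hab Hl HM. rewrite <- Cnorm_R.
  apply (norm_RInt_le_const (V := C_R_NormedModule) f a b l M); auto.
  intros; rewrite Cnorm_R; auto.
Qed.

(** * Cauchy's theorem on rectangles *)

Definition seg (f : C -> C) (z d : C) (a b : R) : C :=
  (d * Cint (fun t => f (z + RtoC t * d)%C) a b)%C.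

Definition segcont (f : C -> C) (z d : C) (a b : R) : Prop :=
  forall t, Rmin a b <= t <= Rmax a b -> Ccont f (z + RtoC t * d)%C.

Lemma segcont_int f z d a b : segcont f z d a b ->
  @is_RInt C_R_NormedModule (fun t => f (z + RtoC t * d)%C) a b
   (Cint (fun t => f (z + RtoC t * d)%C) a b).
Proof.
  intros H. apply (RInt_correct (V := C_R_CompleteNormedModule)). apply (ex_RInt_continuous (V := C_R_CompleteNormedModule)).
  intros t Ht. apply path_continuous. auto.
Qed.

Lemma seg_norm_le f z d a b M : a <= b -> segcont f z d a b ->
  (forall t, a <= t <= b -> Cmod (f (z + RtoC t * d)%C) <= M) ->
  Cmod (seg f z d a b) <= Cmod d * ((b - a) * M).
Proof.
  intros Hab Hc HM. unfold seg. rewrite Cmod_mult.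
  apply Rmult_le_compat_l; [apply Cmod_ge_0|].
  exact (Cint_norm_le _ a b _ M Hab (segcont_int _ _ _ _ _ Hc) HM).
Qed.

Lemma seg_chasles f z d a b c : a <= b <= c -> segcont f z d a c ->
  seg f z d a c = (seg f z d a b + seg f z d b c)%C.
Proof.
  intros Habc H. unfold seg. rewrite <- Cmult_plus_distr_l. f_equal.
  symmetry. unfold segcont in H. rewrite Rmin_left, Rmax_right in H by lra.
  apply (RInt_Chasles (V := C_R_CompleteNormedModule));
   apply (ex_RInt_continuous (V := C_R_CompleteNormedModule)); intros t;
   rewrite ?Rmin_left, ?Rmax_right by lra; intros; apply path_continuous; apply H; lra.
Qed.

Lemma seg_lin f g z d a b (k : C) : segcont f z d a b -> segcont g z d a b ->
  seg (fun w => f w + k * g w)%C z d a b = (seg f z d a b + k * seg g z d a b)%C.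
Proof.
  intros Hf Hg. unfold seg.
  assert (E : @is_RInt C_R_NormedModule (fun t => f (z + RtoC t * d) + k * g (z + RtoC t * d))%C a b
    (Cint (fun t => f (z + RtoC t * d)%C) a b + k * Cint (fun t => g (z + RtoC t * d)%C) a b)%C).
  { apply (is_RInt_plus (V := C_R_NormedModule)); [|apply is_Cint_scal]; apply segcont_int; auto. }
  rewrite (is_RInt_unique (V := C_R_CompleteNormedModule) _ _ _ _ E). ring.
Qed.

Lemma seg_ext f g z d a b : a <= b ->
  (forall t, a <= t <= b -> f (z + RtoC t * d)%C = g (z + RtoC t * d)%C) ->
  seg f z d a b = seg g z d a b.
Proof.
  intros Hab H. unfold seg. f_equal. apply (RInt_ext (V := C_R_CompleteNormedModule)).
  rewrite Rmin_left, Rmax_right by lra. intros; apply H; lra.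
Qed.

(** Around the boundary of [[a, b] x [c, d]], counterclockwise. *)
Definition rint (f : C -> C) (a b c d : R) : C :=
  (seg f (0, c) 1 a b + seg f (b, 0) Ci c d - seg f (0, d) 1 a b - seg f (a, 0) Ci c d)%C.

Definition inrect (a b c d : R) (z : C) : Prop := a <= Re z <= b /\ c <= Im z <= d.

Lemma hpt c t : ((0, c) + RtoC t * 1)%C = (t, c).
Proof. unfold Cplus, Cmult, RtoC; simpl; f_equal; ring. Qed.
Lemma vpt c t : ((c, 0) + RtoC t * Ci)%C = (c, t).
Proof. unfold Cplus, Cmult, RtoC, Ci; simpl; f_equal; ring. Qed.

Lemma segcont_h f a b c : a <= b ->
  (forall t, a <= t <= b -> Ccont f (t, c)) -> segcont f (0, c) 1 a b.
Proof.
  intros Hab H t. rewrite Rmin_left, Rmax_right by lra. intros. rewrite hpt. auto.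
Qed.
Lemma segcont_v f a b c : a <= b ->
  (forall t, a <= t <= b -> Ccont f (c, t)) -> segcont f (c, 0) Ci a b.
Proof.
  intros Hab H t. rewrite Rmin_left, Rmax_right by lra. intros. rewrite vpt. auto.
Qed.

Lemma rint_split_h f a m b c d : a <= m <= b -> c <= d ->
  (forall z, inrect a b c d z -> Ccont f z) ->
  rint f a b c d = (rint f a m c d + rint f m b c d)%C.
Proof.
  intros Hm Hcd H. unfold rint.
  rewrite (seg_chasles f (0, c) 1 a m b), (seg_chasles f (0, d) 1 a m b).
  - ring.
  - lra.
  - apply segcont_h; [lra|]. intros; apply H; split; simpl; lra.
  - lra.
  - apply segcont_h; [lra|]. intros; apply H; split; simpl; lra.
Qed.

Lemma rint_split_v f a b c m d : a <= b -> c <= m <= d ->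
  (forall z, inrect a b c d z -> Ccont f z) ->
  rint f a b c d = (rint f a b c m + rint f a b m d)%C.
Proof.
  intros Hm Hcd H. unfold rint.
  rewrite (seg_chasles f (b, 0) Ci c m d), (seg_chasles f (a, 0) Ci c m d).
  - ring.
  - lra.
  - apply segcont_v; [lra|]. intros; apply H; split; simpl; lra.
  - lra.
  - apply segcont_v; [lra|]. intros; apply H; split; simpl; lra.
Qed.

Lemma rint_lin f g a b c d (k : C) : a <= b -> c <= d ->
  (forall z, inrect a b c d z -> Ccont f z) ->
  (forall z, inrect a b c d z -> Ccont g z) ->
  rint (fun w => f w + k * g w)%C a b c d = (rint f a b c d + k * rint g a b c d)%C.
Proof.
  intros Hab Hcd Hf Hg. unfold rint.
  assert (HH : forall h, (forall z, inrect a b c d z -> Ccont h z) ->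
    (segcont h (0, c) 1 a b /\ segcont h (b, 0) Ci c d) /\ (segcont h (0, d) 1 a b /\ segcont h (a, 0) Ci c d)).
  { intros h Hh. repeat split; [apply segcont_h|apply segcont_v|apply segcont_h|apply segcont_v]; try lra;
      intros; apply Hh; split; simpl; lra. }
  destruct (HH f Hf) as [[? ?] [? ?]]. destruct (HH g Hg) as [[? ?] [? ?]].
  rewrite !seg_lin by assumption. ring.
Qed.

Lemma rint_norm_le f a b c d M : a <= b -> c <= d ->
  (forall z, inrect a b c d z -> Ccont f z) ->
  (forall z, inrect a b c d z -> Cmod (f z) <= M) ->
  Cmod (rint f a b c d) <= 2 * ((b - a) + (d - c)) * M.
Proof.
  intros Hab Hcd Hf HM. unfold rint, Cminus.
  assert (T : forall p q r s : C, Cmod (p + q + - r + - s) <= Cmod p + Cmod q + Cmod r + Cmod s).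
  { intros. eapply Rle_trans; [apply Cmod_triangle|]. rewrite Cmod_opp.
    apply Rplus_le_compat_r. eapply Rle_trans; [apply Cmod_triangle|]. rewrite Cmod_opp.
    apply Rplus_le_compat_r. apply Cmod_triangle. }
  eapply Rle_trans; [apply T|].
  assert (Hh : forall e, c <= e <= d -> Cmod (seg f (0, e) 1 a b) <= (b - a) * M).
  { intros e He. replace ((b-a) * M) with (Cmod 1 * ((b - a) * M)) by (rewrite Cmod_1; ring).
    apply seg_norm_le; auto.
    - apply segcont_h; auto. intros; apply Hf; split; simpl; lra.
    - intros t Ht. rewrite hpt. apply HM; split; simpl; lra. }
  assert (Hv : forall e, a <= e <= b -> Cmod (seg f (e, 0) Ci c d) <= (d - c) * M).
  { intros e He. replace ((d-c) * M) with (Cmod Ci * ((d - c) * M)) by (rewrite Cmod_Ci; ring).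
    apply seg_norm_le; auto.
    - apply segcont_v; auto. intros; apply Hf; split; simpl; lra.
    - intros t Ht. rewrite vpt. apply HM; split; simpl; lra. }
  generalize (Hh c ltac:(lra)) (Hh d ltac:(lra)) (Hv a ltac:(lra)) (Hv b ltac:(lra)). lra.
Qed.

Lemma Chol_affine (l k z : C) : Chol (fun w => k + l * w)%C z.
Proof.
  exists l. apply Cder_eps. intros eps He. exists 1. split; [lra|]. intros w _.
  replace (k + l * w - (k + l * z) - l * (w - z))%C with (RtoC 0) by ring.
  rewrite Cmod_0. apply Rmult_le_pos; [lra|apply Cmod_ge_0].
Qed.

Lemma RInt_affine p q a b : is_RInt (fun u : R => p + q * u) a b (p * (b - a) + q * (b ^ 2 - a ^ 2) / 2).
Proof.
  replace (p * (b - a) + q * (b ^ 2 - a ^ 2) / 2)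
    with (minus (p * b + q * b ^ 2 / 2) (p * a + q * a ^ 2 / 2)) by (unfold minus, plus, opp; simpl; field).
  apply (is_RInt_derive (fun u => p * u + q * u ^ 2 / 2)).
  - intros x _. auto_derive; auto. field.
  - intros x _. apply (ex_derive_continuous (K := R_AbsRing) (V := R_NormedModule)). auto_derive; auto.
Qed.

Lemma rint_affine l k a b c d : rint (fun w => k + l * w)%C a b c d = 0.
Proof.
  destruct l as [l1 l2]; destruct k as [k1 k2].
  assert (Hh : forall e, Cint (fun t => ((k1, k2) + (l1, l2) * ((0, e) + RtoC t * 1))%C) a b =
    ((k1 - l2 * e) * (b - a) + l1 * (b ^ 2 - a ^ 2) / 2,
     (k2 + l1 * e) * (b - a) + l2 * (b ^ 2 - a ^ 2) / 2)).
  { intros e. apply (is_RInt_unique (V := C_R_CompleteNormedModule)).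
    apply is_Cint_pair; simpl; (eapply is_RInt_ext; [|apply RInt_affine]); intros; simpl; ring. }
  assert (Hv : forall e, Cint (fun t => ((k1, k2) + (l1, l2) * ((e, 0) + RtoC t * Ci))%C) c d =
    ((k1 + l1 * e) * (d - c) + - l2 * (d ^ 2 - c ^ 2) / 2,
     (k2 + l2 * e) * (d - c) + l1 * (d ^ 2 - c ^ 2) / 2)).
  { intros e. apply (is_RInt_unique (V := C_R_CompleteNormedModule)).
    apply is_Cint_pair; simpl; (eapply is_RInt_ext; [|apply RInt_affine]); intros; simpl; ring. }
  unfold rint, seg. rewrite !Hh, !Hv. unfold Cminus, Cplus, Cmult, Copp, Ci, RtoC; simpl. f_equal; field.
Qed.

Lemma Cmod_inrect a b c d z w : inrect a b c d z -> inrect a b c d w ->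
  Cmod (w - z) <= (b - a) + (d - c).
Proof.
  intros [H1 H2] [H3 H4]. destruct z as [x y], w as [x' y']; simpl in *.
  replace (((x', y') - (x, y))%C) with (RtoC (x' - x) + Ci * RtoC (y' - y))%C
    by (apply injective_projections; simpl; ring).
  eapply Rle_trans; [apply Cmod_triangle|]. rewrite Cmod_mult, Cmod_Ci, !Cmod_R, Rmult_1_l.
  apply Rplus_le_compat; apply Rabs_le; lra.
Qed.

(** Goursat's argument: halving both sides, a rectangle violating the bound [kap * s ^ 2] (with [s]
    its scale) contains one of half the scale that violates it too.  The nested rectangles shrink
    to a point, and near that point [f] is affine up to a small error, while the integral of an
    affine function round a rectangle vanishes. *)
Lemma goursat (f : C -> C) a b c d : a <= b -> c <= d ->
  (forall z, inrect a b c d z -> Chol f z) -> rint f a b c d = 0.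
Proof.
  intros Hab Hcd H.
  assert (Hc : forall z, inrect a b c d z -> Ccont f z) by (intros; apply Chol_cont; auto).
  set (A := b - a). set (D := d - c).
  assert (HA : 0 <= A) by (unfold A; lra). assert (HD : 0 <= D) by (unfold D; lra).
  apply Cmod_eq_0. apply Rle_antisym; [|apply Cmod_ge_0].
  apply Rnot_lt_le. intros Hpos.
  set (S := A + D).
  assert (HS : 0 <= S) by (unfold S; lra).
  set (kap := Cmod (rint f a b c d) / 2).
  set (valid := fun (p : R * R) s => 0 <= s /\ a <= fst p /\ fst p + s * A <= b /\
                                     c <= snd p /\ snd p + s * D <= d).
  set (I := fun (p : R * R) s => rint f (fst p) (fst p + s * A) (snd p) (snd p + s * D)).
  set (bad := fun p s => kap * (s * s) < Cmod (I p s)).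
  assert (Step : forall q : (R * R) * R, exists p' : R * R,
    valid (fst q) (snd q) -> bad (fst q) (snd q) ->
    valid p' (snd q / 2) /\ bad p' (snd q / 2) /\
    fst (fst q) <= fst p' /\ fst p' + snd q / 2 * A <= fst (fst q) + snd q * A /\
    snd (fst q) <= snd p' /\ snd p' + snd q / 2 * D <= snd (fst q) + snd q * D).
  { intros [[x y] s]; simpl.
    set (h := s / 2 * A). set (k := s / 2 * D).
    destruct (Rlt_dec (kap * (s / 2 * (s / 2))) (Cmod (I (x, y) (s / 2)))) as [h1|h1].
    { exists (x, y). intros (V1 & V2 & V3 & V4 & V5) Hb. simpl in *.
      assert (0 <= s / 2 * A) by (apply Rmult_le_pos; lra).
      assert (0 <= s / 2 * D) by (apply Rmult_le_pos; lra).
      unfold valid, h, k in *; simpl; repeat split; auto; lra. }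
    destruct (Rlt_dec (kap * (s / 2 * (s / 2))) (Cmod (I (x + h, y) (s / 2)))) as [h2|h2].
    { exists (x + h, y). intros (V1 & V2 & V3 & V4 & V5) Hb. simpl in *.
      assert (0 <= s / 2 * A) by (apply Rmult_le_pos; lra).
      assert (0 <= s / 2 * D) by (apply Rmult_le_pos; lra).
      unfold valid, h, k in *; simpl; repeat split; auto; lra. }
    destruct (Rlt_dec (kap * (s / 2 * (s / 2))) (Cmod (I (x, y + k) (s / 2)))) as [h3|h3].
    { exists (x, y + k). intros (V1 & V2 & V3 & V4 & V5) Hb. simpl in *.
      assert (0 <= s / 2 * A) by (apply Rmult_le_pos; lra).
      assert (0 <= s / 2 * D) by (apply Rmult_le_pos; lra).
      unfold valid, h, k in *; simpl; repeat split; auto; lra. }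
    destruct (Rlt_dec (kap * (s / 2 * (s / 2))) (Cmod (I (x + h, y + k) (s / 2)))) as [h4|h4].
    { exists (x + h, y + k). intros (V1 & V2 & V3 & V4 & V5) Hb. simpl in *.
      assert (0 <= s / 2 * A) by (apply Rmult_le_pos; lra).
      assert (0 <= s / 2 * D) by (apply Rmult_le_pos; lra).
      unfold valid, h, k in *; simpl; repeat split; auto; lra. }
    exists (x, y). intros (V1 & V2 & V3 & V4 & V5) Hb. exfalso. simpl in *.
    assert (Hh : 0 <= h) by (apply Rmult_le_pos; lra).
    assert (Hk : 0 <= k) by (apply Rmult_le_pos; lra).
    assert (E1 : s * A = h + h) by (unfold h; field).
    assert (E2 : s * D = k + k) by (unfold k; field).
    apply Rnot_lt_le in h1; apply Rnot_lt_le in h2; apply Rnot_lt_le in h3; apply Rnot_lt_le in h4.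
    set (I1 := I (x, y) (s / 2)) in *. set (I2 := I (x + h, y) (s / 2)) in *.
    set (I3 := I (x, y + k) (s / 2)) in *. set (I4 := I (x + h, y + k) (s / 2)) in *.
    assert (E : I (x, y) s = (I1 + I3 + (I2 + I4))%C).
    { unfold I1, I2, I3, I4, I; simpl. fold h k. rewrite E1, E2.
      replace (x + (h + h)) with (x + h + h) by ring.
      replace (y + (k + k)) with (y + k + k) by ring.
      rewrite (rint_split_h f x (x + h) (x + h + h)).
      - rewrite (rint_split_v f x (x+h) y (y + k) (y+k+k)), (rint_split_v f (x+h) (x+h+h) y (y + k) (y+k+k)); auto; try lra;
        intros z [? ?]; apply Hc; split; lra.
      - lra.
      - lra.
      - intros z [? ?]; apply Hc; split; lra. }
    unfold bad in Hb. rewrite E in Hb.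
    assert (T : Cmod (I1 + I3 + (I2 + I4)) <= 4 * (kap * (s / 2 * (s / 2)))).
    { eapply Rle_trans; [apply Cmod_triangle|].
      generalize (Cmod_triangle I1 I3) (Cmod_triangle I2 I4).
      lra. }
    apply (Rlt_irrefl (kap * (s * s))). eapply Rlt_le_trans; [exact Hb|].
    eapply Rle_trans; [exact T|]. right. field. }
  destruct (ClassicalEpsilon.choice _ Step) as [nxt Hnxt].
  set (pt := fix pt n := match n with O => (a, c) | Datatypes.S n => nxt (pt n, / 2 ^ n) end).
  assert (Inv : forall n, valid (pt n) (/ 2 ^ n) /\ bad (pt n) (/ 2 ^ n)).
  { induction n.
    - simpl. rewrite Rinv_1. split.
      + unfold valid; simpl. unfold A, D; repeat split; lra.
      + unfold bad, I; simpl. replace (a + 1 * A) with b by (unfold A; ring).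
        replace (c + 1 * D) with d by (unfold D; ring). unfold kap. lra.
    - destruct IHn as [V Bd]. destruct (Hnxt (pt n, / 2 ^ n) V Bd) as (V' & Bd' & _).
      simpl snd in V', Bd'.
      replace (/ 2 ^ Datatypes.S n) with (/ 2 ^ n / 2) by (simpl; field; apply pow_nonzero; lra).
      split; assumption. }
  assert (Mono : forall n m, fst (pt n) <= fst (pt (n + m)%nat) /\ fst (pt (n + m)%nat) + / 2 ^ (n + m) * A <= fst (pt n) + / 2 ^ n * A
     /\ snd (pt n) <= snd (pt (n + m)%nat) /\ snd (pt (n + m)%nat) + / 2 ^ (n + m) * D <= snd (pt n) + / 2 ^ n * D).
  { intros n m. induction m.
    - rewrite Nat.add_0_r. lra.
    - rewrite Nat.add_succ_r. destruct (Inv (n + m)%nat) as [V Bd].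
      destruct (Hnxt (pt (n + m)%nat, / 2 ^ (n + m)) V Bd) as (_ & _ & M1 & M2 & M3 & M4).
      simpl snd in *. simpl fst in *.
      replace (/ 2 ^ Datatypes.S (n + m)) with (/ 2 ^ (n + m) / 2) by (simpl; field; apply pow_nonzero; lra).
      change (pt (Datatypes.S (n + m))) with (nxt (pt (n + m)%nat, / 2 ^ (n + m))). lra. }
  assert (P2 : forall n, 0 < / 2 ^ n) by (intros; apply Rinv_0_lt_compat, pow_lt; lra).
  assert (Cross : forall n m, fst (pt n) <= fst (pt m) + / 2 ^ m * A /\ snd (pt n) <= snd (pt m) + / 2 ^ m * D).
  { intros n m.
    assert (0 <= / 2 ^ (n + m) * A) by (apply Rmult_le_pos; [left; auto|auto]).
    assert (0 <= / 2 ^ (n + m) * D) by (apply Rmult_le_pos; [left; auto|auto]).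
    generalize (Mono n m) (Mono m n). rewrite (Nat.add_comm m n). lra. }
  destruct (completeness (fun x => exists n, x = fst (pt n))) as [X [HX1 HX2]].
  { exists b. intros x [n ->]. destruct (Inv n) as [(V1 & V2 & V3 & _) _].
    assert (0 <= / 2 ^ n * A) by (apply Rmult_le_pos; [left; auto|auto]). lra. }
  { exists a, 0%nat. reflexivity. }
  destruct (completeness (fun x => exists n, x = snd (pt n))) as [Y [HY1 HY2]].
  { exists d. intros x [n ->]. destruct (Inv n) as [(V1 & _ & _ & V2 & V3) _].
    assert (0 <= / 2 ^ n * D) by (apply Rmult_le_pos; [left; auto|auto]). lra. }
  { exists c, 0%nat. reflexivity. }
  assert (Hin : forall n, inrect (fst (pt n)) (fst (pt n) + / 2 ^ n * A) (snd (pt n)) (snd (pt n) + / 2 ^ n * D) (X, Y)).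
  { intros n. split; simpl; split.
    - apply HX1; eauto.
    - apply HX2. intros x [m ->]. apply Cross.
    - apply HY1; eauto.
    - apply HY2. intros x [m ->]. apply Cross. }
  assert (HXY : inrect a b c d (X, Y)).
  { generalize (Hin 0%nat). simpl. rewrite Rinv_1. unfold A, D, inrect; simpl. lra. }
  destruct (H _ HXY) as [l Hl].
  set (eps := kap / (2 * (S * S) + 1)).
  assert (HSS : 0 <= S * S) by (apply Rmult_le_pos; auto).
  assert (Heps : 0 < eps) by (apply Rdiv_lt_0_compat; unfold kap; lra).
  destruct (proj1 (Cder_eps f (X, Y) l) Hl eps Heps) as [dl [Hdl0 Hdl]].
  destruct (pow_lt_1_zero (/ 2) ltac:(rewrite Rabs_pos_eq; lra) (dl / (S + 1))) as [n Hn].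
  { apply Rdiv_lt_0_compat; lra. }
  specialize (Hn n (Nat.le_refl n)). rewrite pow_inv in Hn.
  specialize (P2 n). rewrite Rabs_pos_eq in Hn by lra.
  destruct (Inv n) as [(V1 & V2 & V3 & V4 & V5) Bd]. specialize (Hin n).
  set (s := / 2 ^ n) in *. unfold bad, I in Bd.
  set (x := fst (pt n)) in *. set (y := snd (pt n)) in *.
  assert (HsA : 0 <= s * A) by (apply Rmult_le_pos; lra).
  assert (HsD : 0 <= s * D) by (apply Rmult_le_pos; lra).
  assert (HsS : s * S < dl).
  { apply Rle_lt_trans with (s * (S + 1)); [apply Rmult_le_compat_l; lra|].
    apply Rmult_lt_reg_r with (/ (S + 1)); [apply Rinv_0_lt_compat; lra|].
    rewrite Rmult_assoc, Rinv_r by lra. lra. }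
  set (k := (f (X, Y) - l * (X, Y))%C).
  apply (Rlt_irrefl (kap * (s * s))). eapply Rlt_le_trans; [exact Bd|].
  assert (Hdiff : forall w, inrect x (x + s * A) y (y + s * D) w ->
    Cmod (f w + - (1) * (k + l * w)) <= eps * (s * S)).
  { intros w Hw.
    assert (Hwz : Cmod (w - (X, Y)) <= s * S).
    { eapply Rle_trans; [exact (Cmod_inrect _ _ _ _ _ _ Hin Hw)|]. apply Req_le; unfold S; ring. }
    replace (f w + - (1) * (k + l * w))%C with (f w - f (X, Y) - l * (w - (X, Y)))%C
      by (unfold k; ring).
    eapply Rle_trans; [apply Hdl; lra|]. apply Rmult_le_compat_l; lra. }
  replace (rint f x (x + s * A) y (y + s * D)) with
    (rint (fun w => f w + - (1) * (k + l * w))%C x (x + s * A) y (y + s * D)).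
  - eapply Rle_trans; [apply rint_norm_le; [lra|lra| |exact Hdiff]|].
    + intros z [? ?]. apply Chol_cont.
      assert (Hz : inrect a b c d z) by (split; lra).
      destruct (H z Hz) as [l' Hl'].
      exists (plus l' (- l)%C).
      apply (is_derive_plus (V := C_NM) f (fun w => - (1) * (k + l * w))%C); auto.
      apply Cder_eps. intros e He. exists 1. split; [lra|]. intros w _.
      replace (- (1) * (k + l * w) - - (1) * (k + l * z) - - l * (w - z))%C with (RtoC 0) by ring.
      rewrite Cmod_0. apply Rmult_le_pos; [lra|apply Cmod_ge_0].
    + replace (2 * (x + s * A - x + (y + s * D - y)) * (eps * (s * S)))
        with (eps * (2 * (S * S)) * (s * s)) by (unfold S; ring).
      apply Rmult_le_compat_r; [apply Rmult_le_pos; lra|].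
      apply Rle_trans with (eps * (2 * (S * S) + 1)); [apply Rmult_le_compat_l; lra|].
      right. unfold eps. field. lra.
  - rewrite (rint_lin f (fun w => k + l * w)%C); [|lra|lra| |].
    + rewrite rint_affine. ring.
    + intros z [? ?]. apply Hc; split; lra.
    + intros z _. apply Chol_cont, Chol_affine.
Qed.

(** Cutting off a small square at the corner leaves rectangles to which Goursat's argument
    applies; the square contributes as little as one likes. *)
Lemma goursat_corner (f : C -> C) a b c d : a < b -> c < d ->
  (forall z, inrect a b c d z -> z <> (a, c) -> Chol f z) -> Ccont f (a, c) ->
  rint f a b c d = 0.
Proof.
  intros Hab Hcd H H0.
  assert (Hc : forall z, inrect a b c d z -> Ccont f z).
  { intros z Hz. destruct (Ceq_dec z (a, c)) as [->|Hne]; auto. apply Chol_cont; auto. }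
  destruct (proj1 (Ccont_eps _ _) H0 1 Rlt_0_1) as [dl [Hdl0 Hdl]].
  set (M := Cmod (f (a, c)) + 1).
  assert (HM : 0 < M) by (unfold M; generalize (Cmod_ge_0 (f (a, c))); lra).
  apply Cmod_eq_0. apply Rle_antisym; [|apply Cmod_ge_0].
  apply le_epsilon. intros eps Heps. rewrite Rplus_0_l.
  set (h := Rmin (Rmin (b - a) (d - c)) (Rmin (dl / 3) (eps / (4 * M)))).
  assert (Hh : 0 < h).
  { unfold h. repeat apply Rmin_pos; try lra. apply Rdiv_lt_0_compat; lra. }
  assert (Hh1 : h <= b - a) by (unfold h; eapply Rle_trans; [apply Rmin_l|apply Rmin_l]).
  assert (Hh2 : h <= d - c) by (unfold h; eapply Rle_trans; [apply Rmin_l|apply Rmin_r]).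
  assert (Hh3 : h <= dl / 3) by (unfold h; eapply Rle_trans; [apply Rmin_r|apply Rmin_l]).
  assert (Hh4 : h <= eps / (4 * M)) by (unfold h; eapply Rle_trans; [apply Rmin_r|apply Rmin_r]).
  rewrite (rint_split_h f a (a + h) b), (rint_split_v f a (a + h) c (c + h) d); try lra; auto;
    [|intros z [? ?]; apply Hc; split; lra].
  rewrite (goursat f (a + h) b c d); try lra;
    [|intros z [Hz1 Hz2]; apply H; [split; lra| intros ->; simpl in *; lra]].
  rewrite (goursat f a (a + h) (c + h) d); try lra;
    [|intros z [Hz1 Hz2]; apply H; [split; lra| intros ->; simpl in *; lra]].
  rewrite !Cplus_0_r.
  eapply Rle_trans; [apply (rint_norm_le f a (a + h) c (c + h) M); try lra|].
  - intros z [? ?]; apply Hc; split; lra.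
  - intros z Hz.
    assert (Hd : Cmod (z - (a, c)) < dl).
    { eapply Rle_lt_trans; [eapply Cmod_inrect; [|exact Hz]; split; simpl; lra|]. lra. }
    specialize (Hdl z Hd). unfold M.
    replace (f z) with (f (a, c) + (f z - f (a, c)))%C by ring.
    eapply Rle_trans; [apply Cmod_triangle|]. lra.
  - apply Rle_trans with (h * (4 * M)); [right; ring|].
    apply Rle_trans with (eps / (4 * M) * (4 * M)).
    + apply Rmult_le_compat_r; lra.
    + right. field. lra.
Qed.

(** * Holomorphic functions *)

Lemma Chol_const (k z : C) : Chol (fun _ => k) z.
Proof. apply (ex_derive_const (V := C_NM)). Qed.
Lemma Chol_id (z : C) : Chol (fun w => w) z.
Proof. exact (@ex_derive_id C_AbsRing z). Qed.
Lemma Chol_plus (f g : C -> C) z : Chol f z -> Chol g z -> Chol (fun w => f w + g w)%C z.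
Proof. exact (@ex_derive_plus C_AbsRing C_NM f g z). Qed.
Lemma Chol_opp (f : C -> C) z : Chol f z -> Chol (fun w => - f w)%C z.
Proof. exact (@ex_derive_opp C_AbsRing C_NM f z). Qed.
Lemma Chol_minus (f g : C -> C) z : Chol f z -> Chol g z -> Chol (fun w => f w - g w)%C z.
Proof. exact (@ex_derive_minus C_AbsRing C_NM f g z). Qed.
Lemma Chol_mult (f g : C -> C) z : Chol f z -> Chol g z -> Chol (fun w => f w * g w)%C z.
Proof.
  intros [l Hl] [k Hk]. eexists.
  exact (@is_derive_mult C_AbsRing f g z l k Hl Hk Cmult_comm).
Qed.
Lemma Chol_comp (f g : C -> C) z : Chol f (g z) -> Chol g z -> Chol (fun w => f (g w)) z.
Proof.
  intros [l Hl] [k Hk]. eexists. exact (@is_derive_comp C_AbsRing C_NM f g z l k Hl Hk).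
Qed.

Lemma Cmod_lip (w z : C) : Rabs (Cmod w - Cmod z) <= Cmod (w - z).
Proof.
  assert (T : forall p q : C, Cmod p <= Cmod q + Cmod (p - q)).
  { intros p q. replace p with (q + (p - q))%C at 1 by ring. apply Cmod_triangle. }
  assert (E : Cmod (z - w) = Cmod (w - z)).
  { rewrite <- Cmod_opp. f_equal. ring. }
  generalize (T w z) (T z w). intros. apply Rabs_le. lra.
Qed.

Lemma Chol_inv_id (z : C) : z <> 0 -> Chol (fun w => / w)%C z.
Proof.
  intros Hz. assert (Hm : 0 < Cmod z) by (apply Cmod_gt_0; auto).
  exists (- / (z * z))%C. apply Cder_eps. intros eps He.
  set (m := Cmod z) in *.
  assert (Hd : 0 < eps * (m * (m * m) / 2)).
  { apply Rmult_lt_0_compat; auto. apply Rdiv_lt_0_compat; [|lra]. repeat apply Rmult_lt_0_compat; auto. }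
  exists (Rmin (m / 2) (eps * (m * (m * m) / 2))). split; [apply Rmin_pos; lra|].
  intros w Hw.
  assert (Hw1 : Cmod (w - z) < m / 2) by (eapply Rlt_le_trans; [exact Hw|apply Rmin_l]).
  assert (Hw2 : Cmod (w - z) < eps * (m * (m * m) / 2)) by (eapply Rlt_le_trans; [exact Hw|apply Rmin_r]).
  assert (Hwm : m / 2 <= Cmod w).
  { generalize (Cmod_lip w z). fold m. intros Hl. apply Rabs_le_between in Hl. lra. }
  assert (Hw0 : w <> 0) by (intros ->; rewrite Cmod_0 in Hwm; lra).
  replace (/ w - / z - - / (z * z) * (w - z))%C with ((w - z) * ((w - z) * / (w * (z * z))))%C
    by (field; auto).
  rewrite !Cmod_mult, Cmod_inv, !Cmod_mult by (repeat apply Cmult_neq_0; auto). fold m.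
  rewrite Rmult_comm. apply Rmult_le_compat_r; [apply Cmod_ge_0|].
  apply Rmult_le_reg_r with (Cmod w * (m * m)); [repeat apply Rmult_lt_0_compat; lra|].
  rewrite Rmult_assoc, Rinv_l, Rmult_1_r.
  2: { apply Rgt_not_eq. repeat apply Rmult_lt_0_compat; lra. }
  eapply Rle_trans; [left; exact Hw2|]. apply Rmult_le_compat_l; [lra|].
  replace (m * (m * m) / 2) with (m / 2 * (m * m)) by field.
  apply Rmult_le_compat_r; [|lra]. apply Rmult_le_pos; lra.
Qed.

Lemma Chol_inv (f : C -> C) z : f z <> 0 -> Chol f z -> Chol (fun w => / f w)%C z.
Proof. intros H0 H. apply (Chol_comp (fun w => / w)%C f); auto. apply Chol_inv_id; auto. Qed.
Lemma Chol_div (f g : C -> C) z : g z <> 0 -> Chol f z -> Chol g z -> Chol (fun w => f w / g w)%C z.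
Proof. intros. apply Chol_mult; auto. apply Chol_inv; auto. Qed.

Lemma Chol_ext_loc (f g : C -> C) z d : 0 < d ->
  (forall w, Cmod (w - z) < d -> f w = g w) -> Chol f z -> Chol g z.
Proof.
  intros Hd E [l Hl]. exists l. apply Cder_eps. intros eps He.
  destruct (proj1 (Cder_eps f z l) Hl eps He) as [d' [Hd' H]].
  exists (Rmin d d'). split; [apply Rmin_pos; auto|]. intros w Hw.
  rewrite <- !E.
  - apply H. eapply Rlt_le_trans; [exact Hw|apply Rmin_r].
  - replace (z - z)%C with (RtoC 0) by ring. rewrite Cmod_0. auto.
  - eapply Rlt_le_trans; [exact Hw|apply Rmin_l].
Qed.

(** * The complex exponential, hyperbolic functions and logarithm *)

Definition Cexp (z : C) : C := (exp (Re z) * cos (Im z), exp (Re z) * sin (Im z)).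
Definition Csinh (z : C) : C := (sinh (Re z) * cos (Im z), cosh (Re z) * sin (Im z)).
Definition Ccosh (z : C) : C := (cosh (Re z) * cos (Im z), sinh (Re z) * sin (Im z)).

Lemma Cexp_plus z w : Cexp (z + w) = (Cexp z * Cexp w)%C.
Proof.
  unfold Cexp. rewrite re_plus, im_plus, exp_plus, cos_plus, sin_plus.
  apply injective_projections; simpl; ring.
Qed.

Lemma Cmod_Cexp z : Cmod (Cexp z) = exp (Re z).
Proof.
  assert (E : Cmod (Cexp z) ^ 2 = exp (Re z) ^ 2).
  { rewrite Cmod2_alt. unfold Cexp; simpl. generalize (sin2_cos2 (Im z)). unfold Rsqr. intros E.
    transitivity (exp (Re z) * exp (Re z) * (sin (Im z) * sin (Im z) + cos (Im z) * cos (Im z)));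
      [|rewrite E]; ring. }
  apply Rsqr_inj; [apply Cmod_ge_0|left; apply exp_pos|]. unfold Rsqr. lra.
Qed.

Lemma mvt_bound (f df : R -> R) (x M : R) :
  (forall t, Rabs t <= Rabs x -> is_derive f t (df t)) ->
  (forall t, Rabs t <= Rabs x -> Rabs (df t) <= M) ->
  Rabs (f x - f 0) <= M * Rabs x.
Proof.
  intros Hd HM.
  assert (Hin : forall t, Rmin 0 x <= t <= Rmax 0 x -> Rabs t <= Rabs x).
  { intros t. unfold Rmin, Rmax. destruct (Rle_dec 0 x); intros;
    unfold Rabs; destruct (Rcase_abs t), (Rcase_abs x); lra. }
  destruct (MVT_gen f 0 x df) as [c [Hc E]].
  - intros t Ht. apply Hd, Hin. lra.
  - intros t Ht. apply continuity_pt_filterlim.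
    apply (ex_derive_continuous (K := R_AbsRing) (V := R_NormedModule)). exists (df t). apply Hd, Hin. auto.
  - rewrite E, Rminus_0_r, Rabs_mult. apply Rmult_le_compat_r; [apply Rabs_pos|]. apply HM, Hin; auto.
Qed.

Lemma exp_le_3' x : Rabs x <= 1 -> exp x <= 3.
Proof.
  intros H. apply Rabs_le_between in H. eapply Rle_trans; [|apply exp_le_3].
  destruct (Req_dec x 1) as [->|]; [lra|]. left; apply exp_increasing; lra.
Qed.

Lemma exp_1_bound x : Rabs x <= 1 -> Rabs (exp x - 1) <= 3 * Rabs x.
Proof.
  intros H. replace (exp x - 1) with (exp x - exp 0) by (rewrite exp_0; ring).
  apply (mvt_bound exp exp).
  - intros; auto_derive; auto; ring.
  - intros t Ht. rewrite Rabs_pos_eq by (left; apply exp_pos). apply exp_le_3'; lra.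
Qed.

Lemma exp_2_bound x : Rabs x <= 1 -> Rabs (exp x - 1 - x) <= 3 * Rabs x * Rabs x.
Proof.
  intros H. replace (exp x - 1 - x) with ((exp x - 1 - x) - (exp 0 - 1 - 0)) by (rewrite exp_0; ring).
  apply (mvt_bound (fun x => exp x - 1 - x) (fun x => exp x - 1)).
  - intros; auto_derive; auto; ring.
  - intros t Ht. eapply Rle_trans; [apply exp_1_bound; lra|]. lra.
Qed.

Lemma sin_1_bound x : Rabs (sin x) <= Rabs x.
Proof.
  replace (sin x) with (sin x - sin 0) by (rewrite sin_0; ring). rewrite <- (Rmult_1_l (Rabs x)).
  apply (mvt_bound sin cos).
  - intros; auto_derive; auto; ring.
  - intros. apply Rabs_le, COS_bound.
Qed.

Lemma cos_2_bound x : Rabs (cos x - 1) <= Rabs x * Rabs x.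
Proof.
  replace (cos x - 1) with (cos x - cos 0) by (rewrite cos_0; ring).
  apply (mvt_bound cos (fun t => - sin t)).
  - intros; auto_derive; auto; ring.
  - intros. rewrite Rabs_Ropp. eapply Rle_trans; [apply sin_1_bound|]; auto.
Qed.

Lemma sin_3_bound x : Rabs (sin x - x) <= Rabs x * Rabs x * Rabs x.
Proof.
  replace (sin x - x) with ((sin x - x) - (sin 0 - 0)) by (rewrite sin_0; ring).
  apply (mvt_bound (fun x => sin x - x) (fun t => cos t - 1)).
  - intros; auto_derive; auto; ring.
  - intros t Ht. eapply Rle_trans; [apply cos_2_bound|]. generalize (Rabs_pos t); intros.
    apply Rmult_le_compat; lra.
Qed.

Lemma Cmod_le_sum (z : C) : Cmod z <= Rabs (Re z) + Rabs (Im z).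
Proof.
  replace z with (RtoC (Re z) + Ci * RtoC (Im z))%C at 1
    by (destruct z; apply injective_projections; simpl; ring).
  eapply Rle_trans; [apply Cmod_triangle|]. rewrite Cmod_mult, Cmod_Ci, !Cmod_R. lra.
Qed.
Lemma im_minus (a b : C) : Im (a - b) = Im a - Im b.
Proof. reflexivity. Qed.
Lemma re_minus (a b : C) : Re (a - b) = Re a - Re b.
Proof. reflexivity. Qed.
Lemma Re_le_Cmod (z : C) : Rabs (Re z) <= Cmod z.
Proof. eapply Rle_trans; [|apply Rmax_Cmod]. apply Rmax_l. Qed.
Lemma Im_le_Cmod (z : C) : Rabs (Im z) <= Cmod z.
Proof. eapply Rle_trans; [|apply Rmax_Cmod]. apply Rmax_r. Qed.

Lemma Cexp_2_bound (h : C) : Cmod h <= 1 -> Cmod (Cexp h - 1 - h) <= 20 * Cmod h * Cmod h.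
Proof.
  intros Hh. assert (Hx := Re_le_Cmod h). assert (Hy := Im_le_Cmod h).
  set (m := Cmod h) in *. assert (Hm : 0 <= m) by apply Cmod_ge_0.
  destruct h as [x y]; simpl in Hx, Hy.
  assert (Hxy : forall p q, 0 <= p <= m -> 0 <= q <= m -> p * q <= m * m)
    by (intros; apply Rmult_le_compat; lra).
  assert (PX := Rabs_pos x). assert (PY := Rabs_pos y).
  assert (A1 := exp_2_bound x ltac:(lra)). assert (A2 := exp_1_bound x ltac:(lra)).
  assert (A3 := cos_2_bound y). assert (A4 := sin_3_bound y). assert (A5 := sin_1_bound y).
  assert (Ee : Rabs (exp x) <= 3) by (rewrite Rabs_pos_eq by (left; apply exp_pos); apply exp_le_3'; lra).
  assert (X2 := Hxy (Rabs x) (Rabs x) ltac:(lra) ltac:(lra)).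
  assert (Y2 := Hxy (Rabs y) (Rabs y) ltac:(lra) ltac:(lra)).
  assert (XY := Hxy (Rabs x) (Rabs y) ltac:(lra) ltac:(lra)).
  assert (Y3 : Rabs y * Rabs y * Rabs y <= m * m).
  { apply Rle_trans with (Rabs y * Rabs y * 1); [apply Rmult_le_compat_l; [apply Rmult_le_pos; lra|lra]|lra]. }
  eapply Rle_trans; [apply Cmod_le_sum|]. simpl.
  replace (exp x * cos y + - (1) + - x) with ((exp x - 1 - x) + exp x * (cos y - 1)) by ring.
  replace (exp x * sin y + - 0 + - y) with ((exp x - 1) * sin y + (sin y - y)) by ring.
  assert (B1 : Rabs (exp x * (cos y - 1)) <= 3 * (m * m)).
  { rewrite Rabs_mult. apply Rmult_le_compat; try apply Rabs_pos; lra. }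
  assert (B2 : Rabs ((exp x - 1) * sin y) <= 3 * (m * m)).
  { rewrite Rabs_mult. apply Rle_trans with (3 * Rabs x * Rabs y).
    - apply Rmult_le_compat; try apply Rabs_pos; lra.
    - lra. }
  generalize (Rabs_triang (exp x - 1 - x) (exp x * (cos y - 1))) (Rabs_triang ((exp x - 1) * sin y) (sin y - y)).
  nra.
Qed.

Lemma Cexp_der (z : C) : Cder Cexp z (Cexp z).
Proof.
  apply Cder_eps. intros eps He. assert (Hp := exp_pos (Re z)).
  assert (Hq : 0 < eps / (20 * exp (Re z))) by (apply Rdiv_lt_0_compat; lra).
  exists (Rmin 1 (eps / (20 * exp (Re z)))). split; [apply Rmin_pos; lra|].
  intros w Hw.
  assert (Hw1 : Cmod (w - z) < 1) by (eapply Rlt_le_trans; [exact Hw|apply Rmin_l]).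
  assert (Hw2 : Cmod (w - z) < eps / (20 * exp (Re z))) by (eapply Rlt_le_trans; [exact Hw|apply Rmin_r]).
  replace (Cexp w) with (Cexp z * Cexp (w - z))%C by (rewrite <- Cexp_plus; f_equal; ring).
  replace (Cexp z * Cexp (w - z) - Cexp z - Cexp z * (w - z))%C
    with (Cexp z * (Cexp (w - z) - 1 - (w - z)))%C by ring.
  rewrite Cmod_mult, Cmod_Cexp.
  eapply Rle_trans; [apply Rmult_le_compat_l; [lra|apply Cexp_2_bound; lra]|].
  rewrite <- !Rmult_assoc. apply Rmult_le_compat_r; [apply Cmod_ge_0|].
  apply Rle_trans with (exp (Re z) * 20 * (eps / (20 * exp (Re z)))).
  - apply Rmult_le_compat_l; lra.
  - right. field. lra.
Qed.

Lemma Chol_Cexp z : Chol Cexp z.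
Proof. eexists; apply Cexp_der. Qed.

Lemma Csinh_exp z : Csinh z = (/ 2 * (Cexp z - Cexp (- z)))%C.
Proof.
  destruct z as [x y]. unfold Csinh, Cexp, sinh, cosh. simpl. rewrite cos_neg, sin_neg.
  apply injective_projections; simpl; field.
Qed.
Lemma Ccosh_exp z : Ccosh z = (/ 2 * (Cexp z + Cexp (- z)))%C.
Proof.
  destruct z as [x y]. unfold Ccosh, Cexp, sinh, cosh. simpl. rewrite cos_neg, sin_neg.
  apply injective_projections; simpl; field.
Qed.

Lemma Chol_Csinh z : Chol Csinh z.
Proof.
  apply (Chol_ext_loc (fun z => / 2 * (Cexp z - Cexp (- z)))%C _ _ 1); [lra|intros; symmetry; apply Csinh_exp|].
  apply Chol_mult; [apply Chol_const|]. apply Chol_minus; [apply Chol_Cexp|].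
  apply (Chol_comp Cexp (fun w => - w)%C); [apply Chol_Cexp|apply Chol_opp, Chol_id].
Qed.
Lemma Chol_Ccosh z : Chol Ccosh z.
Proof.
  apply (Chol_ext_loc (fun z => / 2 * (Cexp z + Cexp (- z)))%C _ _ 1); [lra|intros; symmetry; apply Ccosh_exp|].
  apply Chol_mult; [apply Chol_const|]. apply Chol_plus; [apply Chol_Cexp|].
  apply (Chol_comp Cexp (fun w => - w)%C); [apply Chol_Cexp|apply Chol_opp, Chol_id].
Qed.

(** This locates the zeros of [sinh] and bounds it below on vertical lines. *)
Lemma Cmod_Csinh_sqr u v : Cmod (Csinh (u, v)) ^ 2 = sinh u ^ 2 + sin v ^ 2.
Proof.
  rewrite Cmod2_alt. simpl. assert (E1 := sin2_cos2 v). unfold Rsqr in E1.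
  assert (E2 : cosh u * cosh u = 1 + sinh u * sinh u).
  { unfold cosh, sinh. assert (exp u * exp (- u) = 1) by (rewrite <- exp_plus, Rplus_opp_r; apply exp_0). nra. }
  ring_simplify. replace (cosh u ^ 2) with (1 + sinh u * sinh u) by (rewrite <- E2; ring).
  replace (cos v ^ 2) with (1 - sin v * sin v) by (rewrite <- E1; ring). ring.
Qed.

(** ** The logarithm *)

(** The half-angle formula gives the argument as [2 atan (Im z / (|z| + Re z))] off the closed negative
    axis; [slit] excludes that axis. *)
Definition slit (z : C) : Prop := 0 < Cmod z + Re z.
Definition Clogp (z : C) : C := (ln (Cmod z), 2 * atan (Im z / (Cmod z + Re z))).

Lemma slit_nz z : slit z -> 0 < Cmod z.
Proof. unfold slit. generalize (Re_le_Cmod z). intros H1 H2. apply Rabs_le_between in H1. lra. Qed.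

Lemma not_slit z : ~ slit z -> Im z = 0 /\ Re z <= 0.
Proof.
  unfold slit. intros H. apply Rnot_lt_le in H.
  assert (E := Cmod2_alt z). assert (P := Cmod_ge_0 z). split; nra.
Qed.

Lemma Cexp_Clogp z : slit z -> Cexp (Clogp z) = z.
Proof.
  intros H. assert (Hm := slit_nz z H). unfold slit in H.
  assert (E := Cmod2_alt z). unfold Cexp, Clogp; simpl. rewrite exp_ln by auto.
  set (r := Cmod z) in *. set (t := Im z / (r + Re z)).
  rewrite cos_2a, sin_2a, cos_atan, sin_atan.
  assert (Ht : 0 < 1 + t²) by (generalize (Rle_0_sqr t); lra).
  assert (Hs : 0 < sqrt (1 + t²)) by (apply sqrt_lt_R0; auto).
  assert (Hss : sqrt (1 + t²) * sqrt (1 + t²) = 1 + t²) by (apply sqrt_sqrt; lra).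
  assert (Et : (1 + t²) * (r + Re z) = 2 * r).
  { unfold t, Rsqr. field_simplify; [|lra].
    replace (Im z ^ 2) with (r ^ 2 - Re z ^ 2) by lra. field; lra. }
  assert (E1 : / (sqrt (1 + t²) * sqrt (1 + t²)) = (r + Re z) / (2 * r)).
  { rewrite Hss. rewrite <- Et. field. lra. }
  assert (Etz : t * (r + Re z) = Im z) by (unfold t; field; lra).
  apply injective_projections; simpl.
  - replace (1 / sqrt (1 + t²) * (1 / sqrt (1 + t²)) - t / sqrt (1 + t²) * (t / sqrt (1 + t²)))
      with ((1 - t * t) * / (sqrt (1 + t²) * sqrt (1 + t²))) by (field; lra).
    rewrite E1. replace (1 - t * t) with (2 - (1 + t²)) by (unfold Rsqr; ring).
    replace (r * ((2 - (1 + t²)) * ((r + Re z) / (2 * r)))) with ((2 * (r + Re z) - (1 + t²) * (r + Re z)) / 2) by (field; lra).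
    rewrite Et. unfold Re. field.
  - replace (2 * (t / sqrt (1 + t²)) * (1 / sqrt (1 + t²))) with
      (2 * t * / (sqrt (1 + t²) * sqrt (1 + t²))) by (field; lra).
    rewrite E1. replace (r * (2 * t * ((r + Re z) / (2 * r)))) with (t * (r + Re z)) by (field; lra).
    exact Etz.
Qed.

Lemma Im_Clogp_bound z : - PI < Im (Clogp z) < PI.
Proof. simpl. generalize (atan_bound (Im z / (Cmod z + Re z))). lra. Qed.

Notation CRcont := (@continuous (AbsRing_UniformSpace C_AbsRing) R_UniformSpace).

Lemma CRcont_lip (f : C -> R) z : (forall w, Rabs (f w - f z) <= Cmod (w - z)) -> CRcont f z.
Proof.
  intros H. apply filterlim_locally. intros eps. exists eps. intros w Hw.
  change (Rabs (f w - f z) < eps). eapply Rle_lt_trans; [apply H|]. exact Hw.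
Qed.

Lemma Ccont_pair (f : C -> C) z : CRcont (fun w => Re (f w)) z -> CRcont (fun w => Im (f w)) z -> Ccont f z.
Proof.
  intros H1 H2. apply Ccont_eps. intros eps He.
  destruct (proj1 (filterlim_locally _ _) H1 (mkposreal (eps / 2) ltac:(lra))) as [d1 Hd1].
  destruct (proj1 (filterlim_locally _ _) H2 (mkposreal (eps / 2) ltac:(lra))) as [d2 Hd2].
  exists (Rmin d1 d2). split; [apply Rmin_pos; [apply d1|apply d2]|]. intros w Hw.
  eapply Rle_lt_trans; [apply Cmod_le_sum|].
  assert (A1 : Rabs (Re (f w) - Re (f z)) < eps / 2).
  { apply (Hd1 w). eapply Rlt_le_trans; [exact Hw|apply Rmin_l]. }
  assert (A2 : Rabs (Im (f w) - Im (f z)) < eps / 2).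
  { apply (Hd2 w). eapply Rlt_le_trans; [exact Hw|apply Rmin_r]. }
  unfold Cminus. rewrite re_plus, im_plus, re_opp, im_opp.
  unfold Rminus in A1, A2. lra.
Qed.

Lemma CRcont_Re z : CRcont Re z.
Proof. apply CRcont_lip. intros w. replace (Re w - Re z) with (Re (w - z)%C) by (unfold Re; simpl; ring). apply Re_le_Cmod. Qed.
Lemma CRcont_Im z : CRcont Im z.
Proof. apply CRcont_lip. intros w. replace (Im w - Im z) with (Im (w - z)%C) by (unfold Im; simpl; ring). apply Im_le_Cmod. Qed.
Lemma CRcont_Cmod z : CRcont Cmod z.
Proof. apply CRcont_lip. intros w. apply Cmod_lip. Qed.

Lemma Ccont_Clogp z : slit z -> Ccont Clogp z.
Proof.
  intros H. assert (Hm := slit_nz z H). unfold slit in H. apply Ccont_pair; simpl.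
  - apply (continuous_comp (U := AbsRing_UniformSpace C_AbsRing) (V := R_UniformSpace) (W := R_UniformSpace) Cmod ln).
    + apply CRcont_Cmod.
    + apply continuity_pt_filterlim. apply derivable_continuous_pt. apply ex_derive_Reals_0. auto_derive; auto.
  - apply (continuous_mult (U := AbsRing_UniformSpace C_AbsRing) (K := R_AbsRing) (fun _ => 2)); [apply continuous_const|].
    apply (continuous_comp (U := AbsRing_UniformSpace C_AbsRing) (V := R_UniformSpace) (W := R_UniformSpace)
      (fun z => Im z / (Cmod z + Re z)) atan).
    + apply (continuous_mult (U := AbsRing_UniformSpace C_AbsRing) (K := R_AbsRing) Im (fun z => / (Cmod z + Re z))); [apply CRcont_Im|].
      apply (continuous_comp (U := AbsRing_UniformSpace C_AbsRing) (V := R_UniformSpace) (W := R_UniformSpace)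
        (fun z => Cmod z + Re z) Rinv).
      * apply (continuous_plus (U := AbsRing_UniformSpace C_AbsRing) (V := R_NormedModule) Cmod Re); [apply CRcont_Cmod|apply CRcont_Re].
      * apply continuous_Rinv. lra.
    + apply continuity_pt_filterlim. apply derivable_continuous_pt. apply derivable_pt_atan.
Qed.

(** A continuous branch of the inverse of [exp] is differentiable. *)
Lemma Chol_Clogp z : slit z -> Chol Clogp z.
Proof.
  intros Hz. assert (Hm := slit_nz z Hz). assert (Hz0 : z <> 0) by (apply Cmod_gt_0; auto).
  exists (/ z)%C. apply Cder_eps. intros eps He.
  set (m := Cmod z) in *.
  set (e1 := Rmin (m / 2) (eps * (m * m) / 2)).
  assert (Hmm : 0 < m * m) by (apply Rmult_lt_0_compat; auto).
  assert (He1 : 0 < e1).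
  { apply Rmin_pos; [lra|]. apply Rdiv_lt_0_compat; [apply Rmult_lt_0_compat; auto|lra]. }
  destruct (proj1 (Cder_eps _ _ _) (Cexp_der (Clogp z)) e1 He1) as [eta [Heta0 Heta]].
  destruct (proj1 (Ccont_eps _ _) (Ccont_Clogp z Hz) eta Heta0) as [d [Hd0 Hd]].
  assert (Hs : 0 < (m + Re z) / 2) by (unfold slit in Hz; fold m in Hz; lra).
  exists (Rmin d ((m + Re z) / 2)). split; [apply Rmin_pos; auto|]. intros w Hw.
  assert (Hw1 : Cmod (w - z) < d) by (eapply Rlt_le_trans; [exact Hw|apply Rmin_l]).
  assert (Hw2 : Cmod (w - z) < (m + Re z) / 2) by (eapply Rlt_le_trans; [exact Hw|apply Rmin_r]).
  assert (Hws : slit w).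
  { unfold slit. generalize (Cmod_lip w z) (Re_le_Cmod (w - z)). fold m.
    replace (Re (w - z)%C) with (Re w - Re z) by (unfold Re; simpl; ring).
    intros A B. apply Rabs_le_between in A. apply Rabs_le_between in B. lra. }
  specialize (Heta (Clogp w) (Hd w Hw1)). rewrite !Cexp_Clogp in Heta by auto.
  set (h := (Clogp w - Clogp z)%C) in *.
  assert (Hh : Cmod h <= 2 * Cmod (w - z) / m).
  { assert (T : m * Cmod h <= Cmod (w - z) + e1 * Cmod h).
    { unfold m. rewrite <- Cmod_mult.
      replace (z * h)%C with ((w - z) + - (w - z - z * h))%C by ring.
      eapply Rle_trans; [apply Cmod_triangle|]. rewrite Cmod_opp. lra. }
    assert (e1 * Cmod h <= m / 2 * Cmod h).
    { apply Rmult_le_compat_r; [apply Cmod_ge_0|]. apply Rmin_l. }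
    apply Rmult_le_reg_r with (m / 2); [lra|].
    replace (2 * Cmod (w - z) / m * (m / 2)) with (Cmod (w - z)) by (field; lra). lra. }
  replace (h - / z * (w - z))%C with (- (/ z * (w - z - z * h)))%C by (field; auto).
  rewrite Cmod_opp, Cmod_mult, Cmod_inv by auto. fold m.
  apply Rmult_le_reg_l with m; auto. rewrite <- Rmult_assoc, Rinv_r, Rmult_1_l by lra.
  eapply Rle_trans; [exact Heta|].
  apply Rle_trans with (eps * (m * m) / 2 * (2 * Cmod (w - z) / m)).
  - apply Rmult_le_compat; [lra|apply Cmod_ge_0|apply Rmin_r|exact Hh].
  - right. field. lra.
Qed.

(** * Contours *)

(** The entry [(k, z, d, a, b)] stands for [k] times the integral along [z + t d], [a <= t <= b];
    [k = -1] reverses the direction. *)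
Definition piece : Type := (C * C * C * R * R)%type.
Definition contour := list piece.

Fixpoint cint (f : C -> C) (G : contour) : C :=
  match G with
  | nil => 0
  | (k, z, d, a, b) :: G' => (k * seg f z d a b + cint f G')%C
  end.

Fixpoint on (G : contour) (w : C) : Prop :=
  match G with
  | nil => False
  | (k, z, d, a, b) :: G' => (exists t, a <= t <= b /\ w = (z + RtoC t * d)%C) \/ on G' w
  end.

Fixpoint oriented (G : contour) : Prop :=
  match G with
  | nil => True
  | (k, z, d, a, b) :: G' => a <= b /\ oriented G'
  end.

Fixpoint clen (G : contour) : R :=
  match G with
  | nil => 0
  | (k, z, d, a, b) :: G' => Cmod k * Cmod d * (b - a) + clen G'
  end.

Lemma clen_pos G : oriented G -> 0 <= clen G.
Proof.
  induction G as [|[[[[k z] d] a] b] G IH]; simpl; [lra|]. intros [H1 H2].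
  apply Rplus_le_le_0_compat; auto. apply Rmult_le_pos; [|lra].
  apply Rmult_le_pos; apply Cmod_ge_0.
Qed.

Lemma on_segcont f k z d a b G : a <= b ->
  (forall w, on ((k, z, d, a, b) :: G) w -> Ccont f w) -> segcont f z d a b.
Proof.
  intros Hab H t. rewrite Rmin_left, Rmax_right by lra. intros Ht. apply H. left; eauto.
Qed.

Lemma cint_lin f g G (k : C) : oriented G ->
  (forall w, on G w -> Ccont f w) -> (forall w, on G w -> Ccont g w) ->
  cint (fun w => f w + k * g w)%C G = (cint f G + k * cint g G)%C.
Proof.
  induction G as [|[[[[k' z] d] a] b] G IH]; intros Ho Hf Hg.
  - simpl. ring.
  - destruct Ho as [Hab Ho]. simpl cint. rewrite IH; auto.
    + rewrite seg_lin; [ring| |]; eapply on_segcont; eauto.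
    + intros; apply Hf; right; auto.
    + intros; apply Hg; right; auto.
Qed.

Lemma cint_norm_le f G M : oriented G -> (forall w, on G w -> Ccont f w) ->
  (forall w, on G w -> Cmod (f w) <= M) -> Cmod (cint f G) <= clen G * M.
Proof.
  induction G as [|[[[[k' z] d] a] b] G IH]; intros Ho Hf HM.
  - simpl. rewrite Cmod_0. lra.
  - destruct Ho as [Hab Ho]. simpl cint. simpl clen.
    eapply Rle_trans; [apply Cmod_triangle|]. rewrite Rmult_plus_distr_r.
    apply Rplus_le_compat.
    + rewrite Cmod_mult, !Rmult_assoc. apply Rmult_le_compat_l; [apply Cmod_ge_0|].
      apply seg_norm_le; auto.
      * eapply on_segcont; eauto.
      * intros t Ht. apply HM. left; eauto.
    + apply IH; auto; intros; [apply Hf|apply HM]; right; auto.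
Qed.

Lemma cint_ext f g G : oriented G -> (forall w, on G w -> f w = g w) -> cint f G = cint g G.
Proof.
  induction G as [|[[[[k' z] d] a] b] G IH]; intros Ho H; auto.
  destruct Ho as [Hab Ho]. simpl. rewrite IH; auto.
  - rewrite (seg_ext f g); auto. intros; apply H; left; eauto.
  - intros; apply H; right; auto.
Qed.

Lemma seg_bounded (f : C -> C) z d a b : a <= b -> (forall t, a <= t <= b -> Ccont f (z + RtoC t * d)%C) ->
  exists M, forall t, a <= t <= b -> Cmod (f (z + RtoC t * d)%C) <= M.
Proof.
  intros Hab H.
  destruct (continuity_ab_maj (fun t => Cmod (f (z + RtoC t * d)%C)) a b Hab) as [m [Hm _]].
  - intros t Ht. apply continuity_pt_filterlim.
    apply (filterlim_ext (fun t => @norm _ C_R_NormedModule (f (z + RtoC t * d)%C)));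
      [intros; apply Cnorm_R|].
    rewrite <- Cnorm_R.
    eapply filterlim_comp; [exact (path_continuous f z d t (H t Ht))|].
    apply (filterlim_norm (K := R_AbsRing) (V := C_R_NormedModule)).
  - eexists. exact Hm.
Qed.

Lemma cint_bounded (f : C -> C) G : oriented G -> (forall w, on G w -> Ccont f w) ->
  exists M, 0 <= M /\ forall w, on G w -> Cmod (f w) <= M.
Proof.
  induction G as [|[[[[k' z] d] a] b] G IH]; intros Ho H.
  - exists 0. split; [lra|]. intros w [].
  - destruct Ho as [Hab Ho]. destruct IH as [M [HM0 HM]]; auto.
    { intros; apply H; right; auto. }
    destruct (seg_bounded f z d a b Hab) as [M' HM'].
    { intros; apply H; left; eauto. }
    exists (Rmax M M'). split; [eapply Rle_trans; [exact HM0|apply Rmax_l]|].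
    intros w [[t [Ht ->]]|Hw].
    + eapply Rle_trans; [apply HM'; auto|apply Rmax_r].
    + eapply Rle_trans; [apply HM; auto|apply Rmax_l].
Qed.

Lemma Ccont_mult (f g : C -> C) z : Ccont f z -> Ccont g z -> Ccont (fun w => f w * g w)%C z.
Proof. exact (continuous_mult (U := AbsRing_UniformSpace C_AbsRing) (K := C_AbsRing) f g z). Qed.
Lemma Ccont_const (k z : C) : Ccont (fun _ => k) z.
Proof. apply Chol_cont, Chol_const. Qed.
Lemma Ccont_comp (f g : C -> C) z : Ccont f (g z) -> Ccont g z -> Ccont (fun w => f (g w)) z.
Proof.
  intros Hf Hg. exact (continuous_comp (U := AbsRing_UniformSpace C_AbsRing)
   (V := AbsRing_UniformSpace C_AbsRing) (W := AbsRing_UniformSpace C_AbsRing) g f z Hg Hf).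
Qed.
Lemma Ccont_inv (f : C -> C) z : f z <> 0 -> Ccont f z -> Ccont (fun w => / f w)%C z.
Proof. intros H0 H. apply (Ccont_comp (fun w => / w)%C f); auto. apply Chol_cont, Chol_inv_id; auto. Qed.
Lemma Ccont_minus_c (f : C -> C) k z : Ccont f z -> Ccont (fun w => f w - k)%C z.
Proof.
  intros H. apply (Ccont_comp (fun w => w - k)%C f); auto.
  apply Chol_cont, Chol_minus; [apply Chol_id|apply Chol_const].
Qed.
Lemma Ccont_div (f g : C -> C) z : g z <> 0 -> Ccont f z -> Ccont g z -> Ccont (fun w => f w / g w)%C z.
Proof. intros. apply Ccont_mult; auto. apply Ccont_inv; auto. Qed.
Lemma Ccont_pow (f : C -> C) n z : Ccont f z -> Ccont (fun w => f w ^ n)%C z.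
Proof.
  intros H. induction n; [apply Ccont_const|].
  exact (Ccont_mult f (fun w => f w ^ n)%C z H IHn).
Qed.

(** ** Expansion of a Cauchy integral in powers of its parameter *)

Definition ccoef (f p : C -> C) (G : contour) (m : nat) : C := cint (fun w => f w / p w ^ S m)%C G.

Lemma Cmod_nz (z : C) : 0 < Cmod z -> z <> 0.
Proof. intros H ->. rewrite Cmod_0 in H. lra. Qed.

(** The pole is pushed below the real axis, because [p] is real on the sides that lie on the axes. *)
Definition below (y e : R) : C := (y, - e).

Section Expansion.
Variables (f p : C -> C) (G : contour) (r : R).
Hypothesis Ho : oriented G.
Hypothesis Hr : 0 < r.
Hypothesis Hf : forall w, on G w -> Ccont f w.
Hypothesis Hp : forall w, on G w -> Ccont p w.
Hypothesis Hpr : forall w, on G w -> r <= Cmod (p w).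

Lemma ccoef_bound : exists M, 0 <= M /\ forall m, Cmod (ccoef f p G m) <= M * / r ^ m.
Proof.
  destruct (cint_bounded f G Ho Hf) as [M [HM0 HM]].
  assert (HL := clen_pos G Ho).
  exists (clen G * (M * / r)). split.
  { apply Rmult_le_pos; auto. apply Rmult_le_pos; auto. left; apply Rinv_0_lt_compat; auto. }
  intros m. unfold ccoef. rewrite Rmult_assoc. apply cint_norm_le; auto.
  - intros w Hw. apply Ccont_div.
    + apply Cpow_nz, Cmod_nz. generalize (Hpr w Hw); lra.
    + auto.
    + apply Ccont_pow; auto.
  - intros w Hw. specialize (Hpr w Hw).
    rewrite Cmod_div by (apply Cpow_nz, Cmod_nz; lra). rewrite Cmod_pow.
    unfold Rdiv. rewrite Rmult_assoc. apply Rmult_le_compat; auto.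
    + apply Cmod_ge_0.
    + left; apply Rinv_0_lt_compat, pow_lt; lra.
    + rewrite <- Rinv_mult. apply Rinv_le_contravar; [apply (pow_lt r (S m)); auto|].
      apply (pow_incr r (Cmod (p w)) (S m)). lra.
Qed.

Lemma pminus_nz y w : Cmod y < r -> on G w -> r - Cmod y <= Cmod (p w - y).
Proof.
  intros Hy Hw. generalize (Cmod_lip (p w) (p w - y)). specialize (Hpr w Hw).
  replace (p w - (p w - y))%C with y by ring. intros H. apply Rabs_le_between in H. lra.
Qed.

(** The geometric series of [1 / (p - y)]: after [N] terms the remainder is again a contour integral,
    with the extra factor [(y / p) ^ N]. *)
Lemma cauchy_expansion (y : R) : Rabs y < r ->
  is_pseries (fun m => Im (ccoef f p G m)) y (Im (cint (fun w => f w / (p w - RtoC y))%C G)).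
Proof.
  intros Hy.
  set (Rem := fun N => cint (fun w => f w * (RtoC y / p w) ^ N / (p w - RtoC y))%C G).
  assert (Hyc : Cmod (RtoC y) < r) by (rewrite Cmod_R; auto).
  assert (Hnz : forall w, on G w -> p w <> 0) by (intros w Hw; apply Cmod_nz; generalize (Hpr w Hw); lra).
  assert (Hnz' : forall w, on G w -> (p w - RtoC y)%C <> 0).
  { intros w Hw; apply Cmod_nz; generalize (pminus_nz _ w Hyc Hw); lra. }
  assert (C1' : forall N w, on G w -> Ccont (fun w => f w * (RtoC y / p w) ^ N / (p w - RtoC y))%C w).
  { intros N w Hw. apply Ccont_div; auto.
    - apply Ccont_mult; auto. apply (Ccont_pow (fun w => RtoC y / p w)%C).
      apply Ccont_div; auto. apply Ccont_const.
    - apply Ccont_minus_c; auto. }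
  assert (C2' : forall N w, on G w -> Ccont (fun w => f w / p w ^ S N)%C w).
  { intros N w Hw. apply Ccont_div; auto.
    - apply Cpow_nz; auto.
    - apply Ccont_pow; auto. }
  assert (Step : forall N, Rem N = (RtoC (y ^ N) * ccoef f p G N + Rem (S N))%C).
  { intros N. unfold Rem, ccoef. rewrite Cplus_comm. rewrite <- cint_lin; auto.
    apply cint_ext; auto. intros w Hw. rewrite RtoC_pow. rewrite !Cpow_S.
    assert (Q1 : ((RtoC y / p w) ^ N = RtoC y ^ N / p w ^ N)%C).
    { unfold Cdiv. rewrite Cpow_mult_l, Cpow_inv; auto. }
    rewrite Q1. assert (Q2 : (p w ^ N)%C <> 0) by (apply Cpow_nz; auto).
    specialize (Hnz w Hw). specialize (Hnz' w Hw). field. auto. }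
  assert (Sum : forall N, Im (Rem O) = sum_n (fun m => Im (ccoef f p G m) * y ^ m) N + Im (Rem (S N))).
  { induction N.
    - rewrite sum_O, Step, im_plus, im_scal_l. ring.
    - rewrite sum_Sn, IHN, (Step (S N)), im_plus, im_scal_l. unfold plus; simpl. ring. }
  destruct (cint_bounded (fun w => f w * (RtoC y / p w) ^ 0 / (p w - RtoC y))%C G Ho (C1' 0%nat)) as [M [HM0 HM]].
  assert (RB : forall N, Rabs (Im (Rem N)) <= clen G * M * (Rabs y / r) ^ N).
  { intros N. eapply Rle_trans; [apply Im_le_Cmod|]. rewrite Rmult_assoc. apply cint_norm_le; auto.
    intros w Hw. specialize (HM w Hw). simpl in HM.
    replace (f w * (RtoC y / p w) ^ N / (p w - RtoC y))%C with
      ((f w * 1 / (p w - RtoC y)) * (RtoC y / p w) ^ N)%C by (unfold Cdiv; ring).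
    rewrite Cmod_mult. apply Rmult_le_compat; auto; try apply Cmod_ge_0.
    rewrite Cmod_pow. apply pow_incr. split; [apply Cmod_ge_0|].
    rewrite Cmod_div, Cmod_R by auto. apply Rmult_le_compat_l; [apply Rabs_pos|].
    apply Rinv_le_contravar; auto. }
  apply is_pseries_R. unfold is_series.
  change (is_lim_seq (sum_n (fun n => Im (ccoef f p G n) * y ^ n)) (Im (cint (fun w => f w / (p w - RtoC y))%C G))).
  assert (E0 : Im (cint (fun w => f w / (p w - RtoC y))%C G) = Im (Rem O)).
  { f_equal. apply cint_ext; auto. intros. simpl. unfold Cdiv. ring. }
  rewrite E0.
  apply is_lim_seq_ext with (fun N => Im (Rem O) - Im (Rem (S N))).
  { intros N. rewrite (Sum N). ring. }
  replace (Finite (Im (Rem O))) with (Finite (Im (Rem O) - 0)) by (f_equal; ring).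
  apply is_lim_seq_minus'; [apply is_lim_seq_const|].
  apply is_lim_seq_abs_0.
  assert (Hq : Rabs y / r < 1) by (apply Rmult_lt_reg_r with r; auto; unfold Rdiv; rewrite Rmult_assoc, Rinv_l by lra; lra).
  assert (Hq0 : 0 <= Rabs y / r) by (apply Rmult_le_pos; [apply Rabs_pos|left; apply Rinv_0_lt_compat; auto]).
  apply (is_lim_seq_le_le (fun _ => 0) _ (fun N => clen G * M * (Rabs y / r) ^ S N)).
  - intros N. split; [apply Rabs_pos|apply RB].
  - apply is_lim_seq_const.
  - replace (Finite 0) with (Rbar_mult (clen G * M) 0) by (simpl; f_equal; ring).
    apply is_lim_seq_scal_l. apply (is_lim_seq_incr_1 (fun n => (Rabs y / r) ^ n)).
    apply is_lim_seq_geom. rewrite Rabs_pos_eq; auto.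
Qed.

(** On the contour [p] stays at distance [r - |y|] from the pole, so the integral depends continuously
    on the position of the pole. *)
Lemma cint_near_real (y : R) : Rabs y < r -> forall eta, 0 < eta -> exists e0, 0 < e0 /\
  forall e, 0 < e < e0 ->
   Cmod (cint (fun w => f w / (p w - below y e))%C G - cint (fun w => f w / (p w - RtoC y))%C G) <= eta.
Proof.
  intros Hy eta Heta.
  destruct (cint_bounded f G Ho Hf) as [M [HM0 HM]].
  assert (HL := clen_pos G Ho).
  set (d := r - Rabs y). assert (Hd : 0 < d) by (unfold d; lra).
  set (K := clen G * (M * / (d / 2 * d))).
  assert (HK : 0 <= K).
  { apply Rmult_le_pos; auto. apply Rmult_le_pos; auto. left. apply Rinv_0_lt_compat, Rmult_lt_0_compat; lra. }
  exists (Rmin (d / 2) (eta / (K + 1))). split; [apply Rmin_pos; [lra|apply Rdiv_lt_0_compat; lra]|].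
  intros e He.
  assert (He1 : e < d / 2) by (eapply Rlt_le_trans; [apply He|apply Rmin_l]).
  assert (He2 : e < eta / (K + 1)) by (eapply Rlt_le_trans; [apply He|apply Rmin_r]).
  assert (Hyc : Cmod (RtoC y) < r) by (rewrite Cmod_R; auto).
  assert (N1 : forall w, on G w -> d <= Cmod (p w - RtoC y)).
  { intros w Hw. generalize (pminus_nz _ w Hyc Hw). rewrite Cmod_R. auto. }
  assert (N2 : forall w, on G w -> d / 2 <= Cmod (p w - below y e)).
  { intros w Hw. generalize (Cmod_lip (p w - below y e) (p w - RtoC y)) (N1 w Hw).
    replace (p w - below y e - (p w - RtoC y))%C with (Ci * RtoC e)%C
      by (unfold below; apply injective_projections; simpl; ring).
    rewrite Cmod_mult, Cmod_Ci, Cmod_R, (Rabs_pos_eq e) by lra. intros A. apply Rabs_le_between in A. lra. }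
  assert (Z1 : forall w, on G w -> (p w - RtoC y)%C <> 0) by (intros w Hw; apply Cmod_nz; generalize (N1 w Hw); lra).
  assert (Z2 : forall w, on G w -> (p w - below y e)%C <> 0) by (intros w Hw; apply Cmod_nz; generalize (N2 w Hw); lra).
  assert (CA : forall w, on G w -> Ccont (fun w => f w / (p w - below y e))%C w).
  { intros w Hw. apply Ccont_div; auto. apply Ccont_minus_c; auto. }
  assert (CB : forall w, on G w -> Ccont (fun w => f w / (p w - RtoC y))%C w).
  { intros w Hw. apply Ccont_div; auto. apply Ccont_minus_c; auto. }
  replace (cint (fun w => f w / (p w - below y e))%C G - cint (fun w => f w / (p w - RtoC y))%C G)%C
    with (cint (fun w => f w / (p w - below y e) + - (1) * (f w / (p w - RtoC y)))%C G).
  2: { rewrite (cint_lin (fun w => f w / (p w - below y e))%C (fun w => f w / (p w - RtoC y))%C) by auto.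
       set (X := cint _ G). set (Y := cint _ G). change (X + - (1) * Y = X - Y)%C. ring. }
  apply Rle_trans with (e * K).
  2: { apply Rle_trans with (eta / (K + 1) * (K + 1)).
       - apply Rmult_le_compat; lra.
       - right. field. lra. }
  replace (e * K) with (clen G * (M * / (d / 2 * d) * e)) by (unfold K; ring).
  apply cint_norm_le; auto.
  - intros w Hw.
    apply (continuous_plus (U := AbsRing_UniformSpace C_AbsRing) (V := C_NM) (fun w => f w / (p w - below y e))%C
      (fun w => - (1) * (f w / (p w - RtoC y)))%C); [apply CA; auto|].
    apply Ccont_mult; [apply Ccont_const|apply CB; auto].
  - intros w Hw. assert (A := Z1 w Hw). assert (B := Z2 w Hw).
    replace (f w / (p w - below y e) + - (1) * (f w / (p w - RtoC y)))%C with
       (f w * / ((p w - below y e) * (p w - RtoC y)) * (below y e - RtoC y))%C by (field; auto).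
    replace (below y e - RtoC y)%C with (- (Ci * RtoC e))%C by (unfold below; apply injective_projections; simpl; ring).
    rewrite !Cmod_mult, Cmod_opp, Cmod_inv, !Cmod_mult, Cmod_Ci, Cmod_R, (Rabs_pos_eq e), Rmult_1_l by
      first [lra | apply Cmult_neq_0; auto].
    apply Rmult_le_compat_r; [lra|]. apply Rmult_le_compat; auto; try apply Cmod_ge_0.
    + left. apply Rinv_0_lt_compat, Rmult_lt_0_compat; generalize (N1 w Hw) (N2 w Hw); lra.
    + apply Rinv_le_contravar; [apply Rmult_lt_0_compat; lra|].
      apply Rmult_le_compat; try lra; auto.
Qed.
End Expansion.

(** * The Poisson kernel *)

(** The Poisson kernel of height [e] at [y], in the variable [phi t]. *)
Definition poisson (k phi : R -> R) (y e t : R) : R := k t * (e / ((phi t - y) ^ 2 + e ^ 2)).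

Lemma poisson_den (phi : R -> R) y e t : 0 < e -> 0 < (phi t - y) ^ 2 + e ^ 2.
Proof. intros. generalize (pow2_ge_0 (phi t - y)) (pow_lt e 2 H). lra. Qed.

Lemma cont_ex_RInt (f : R -> R) a b : a <= b -> (forall t, a <= t <= b -> continuous f t) -> ex_RInt f a b.
Proof.
  intros Hab H. apply (ex_RInt_continuous (V := R_CompleteNormedModule)).
  rewrite Rmin_left, Rmax_right by lra. auto.
Qed.

Lemma continuous_smooth (f : R -> R) t : ex_derive f t -> continuous f t.
Proof. apply (ex_derive_continuous (K := R_AbsRing) (V := R_NormedModule)). Qed.

Lemma poisson_cont k phi y e t : 0 < e -> continuous k t -> continuous phi t -> continuous (poisson k phi y e) t.
Proof.
  intros He Hk Hphi. unfold poisson. apply (continuous_mult (U := R_UniformSpace) (K := R_AbsRing)); auto.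
  apply (continuous_comp phi (fun x => e / ((x - y) ^ 2 + e ^ 2))); auto.
  apply continuous_smooth. auto_derive.
  generalize (poisson_den (fun x => x) y e (phi t) He). simpl. lra.
Qed.

Lemma RInt_abs_le (f g : R -> R) a b : a <= b ->
  (forall t, a <= t <= b -> continuous f t) -> (forall t, a <= t <= b -> continuous g t) ->
  (forall t, a <= t <= b -> Rabs (f t) <= g t) -> Rabs (RInt f a b) <= RInt g a b.
Proof.
  intros Hab Hf Hg H.
  apply (norm_RInt_le (V := R_NormedModule) f g a b (RInt f a b) (RInt g a b) Hab H).
  - apply (RInt_correct (V := R_CompleteNormedModule)), cont_ex_RInt; auto.
  - apply (RInt_correct (V := R_CompleteNormedModule)), cont_ex_RInt; auto.
Qed.

Lemma RInt_abs_le_const (f : R -> R) a b M : a <= b ->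
  (forall t, a <= t <= b -> continuous f t) ->
  (forall t, a <= t <= b -> Rabs (f t) <= M) -> Rabs (RInt f a b) <= (b - a) * M.
Proof.
  intros Hab Hf H.
  apply (norm_RInt_le_const (V := R_NormedModule) f a b (RInt f a b) M Hab H).
  apply (RInt_correct (V := R_CompleteNormedModule)), cont_ex_RInt; auto.
Qed.

(** Away from the solutions of [phi t = y] the integral is [O(e)]. *)
Lemma poisson_away k phi a b y d M e : a <= b -> 0 < e -> 0 < d ->
  (forall t, a <= t <= b -> continuous k t) -> (forall t, a <= t <= b -> continuous phi t) ->
  (forall t, a <= t <= b -> d <= Rabs (phi t - y)) ->
  (forall t, a <= t <= b -> Rabs (k t) <= M) ->
  Rabs (RInt (poisson k phi y e) a b) <= (b - a) * (M * (e / d ^ 2)).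
Proof.
  intros Hab He Hd Hk Hphi Hdist HM.
  apply RInt_abs_le_const; auto.
  - intros; apply poisson_cont; auto.
  - intros t Ht. unfold poisson. rewrite Rabs_mult.
    assert (D := poisson_den phi y e t He).
    rewrite (Rabs_pos_eq (e / _)) by (left; apply Rdiv_lt_0_compat; lra).
    apply Rmult_le_compat; auto.
    + apply Rabs_pos.
    + left; apply Rdiv_lt_0_compat; lra.
    + apply Rmult_le_compat_l; [lra|]. apply Rinv_le_contravar; [apply pow_lt; auto|].
      assert (d ^ 2 <= (phi t - y) ^ 2).
      { rewrite <- (pow2_abs (phi t - y)). apply pow_incr. split; auto. lra. }
      generalize (pow2_ge_0 e); lra.
Qed.

Lemma atan_far x : 0 < x -> PI / 2 - / x <= atan x.
Proof.
  intros Hx. assert (E := atan_inv x Hx).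
  assert (Rabs (atan (/ x) - atan 0) <= 1 * Rabs (/ x)).
  { apply (mvt_bound atan (fun t => / (1 + t ^ 2))).
    - intros. apply is_derive_Reals, derivable_pt_lim_atan.
    - intros. assert (0 <= t ^ 2) by apply pow2_ge_0.
      rewrite Rabs_pos_eq by (left; apply Rinv_0_lt_compat; lra).
      rewrite <- Rinv_1. apply Rinv_le_contravar; lra. }
  assert (0 < / x) by (apply Rinv_0_lt_compat; auto).
  rewrite atan_0, Rminus_0_r, (Rabs_pos_eq (/ x)) in H by lra.
  apply Rabs_le_between in H. lra.
Qed.

Lemma strict_incr (phi dphi : R -> R) a b :
  (forall t, a <= t <= b -> continuous phi t) ->
  (forall t, a < t < b -> is_derive phi t (dphi t)) ->
  (forall t, a < t < b -> 0 < dphi t) ->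
  forall s t, a <= s -> s < t -> t <= b -> phi s < phi t.
Proof.
  intros Hc Hd Hp s t Hs Hst Ht.
  destruct (MVT_gen phi s t (fun x => if Rlt_dec a x then if Rlt_dec x b then dphi x else 1 else 1)) as [c [Hc1 E]].
  - rewrite Rmin_left, Rmax_right by lra. intros x Hx.
    destruct (Rlt_dec a x); [|lra]. destruct (Rlt_dec x b); [|lra]. apply Hd; lra.
  - rewrite Rmin_left, Rmax_right by lra. intros x Hx. apply continuity_pt_filterlim. apply Hc; lra.
  - destruct (Rlt_dec a c); [destruct (Rlt_dec c b)|].
    + generalize (Hp c ltac:(lra)). nra.
    + lra.
    + lra.
Qed.

(** Near [t0] the density [k] is close to [k t0 / dphi t0] times [dphi], and [dphi] times the kernel is the
    derivative of [atan ((phi t - y) / e)], whose increment across [t0] tends to [PI]. *)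
Lemma poisson_limit k phi dphi a t0 b : a < t0 < b ->
  (forall t, a <= t <= b -> continuous k t) -> (forall t, a <= t <= b -> continuous phi t) ->
  (forall t, a < t < b -> is_derive phi t (dphi t)) ->
  (forall t, a < t < b -> continuous dphi t) ->
  (forall t, a < t < b -> 0 < dphi t) ->
  forall eta, 0 < eta -> exists e0, 0 < e0 /\ forall e, 0 < e < e0 ->
    Rabs (RInt (poisson k phi (phi t0) e) a b - PI * (k t0 / dphi t0)) <= eta.
Proof.
  intros Ht0 Hk Hphi Hd Hdc Hpos eta Heta.
  assert (HPI := PI_RGT_0).
  set (c := k t0 / dphi t0). set (y := phi t0).
  assert (Hm := Hpos t0 Ht0). set (m := dphi t0 / 2).
  set (eta1 := eta / (4 * PI)).
  assert (Heta1 : 0 < eta1) by (apply Rdiv_lt_0_compat; lra).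
  assert (Hh : continuous (fun t => k t - c * dphi t) t0).
  { apply (continuous_minus (V := R_NormedModule)); [apply Hk; lra|].
    apply (continuous_mult (U := R_UniformSpace) (K := R_AbsRing)); [apply continuous_const|apply Hdc; lra]. }
  assert (Hmp : 0 < eta1 * m) by (apply Rmult_lt_0_compat; unfold m; lra).
  destruct (proj1 (filterlim_locally _ _) Hh (mkposreal _ Hmp)) as [d1 Hd1].
  destruct (proj1 (filterlim_locally _ _) (Hdc t0 Ht0) (mkposreal m ltac:(unfold m; lra))) as [d2 Hd2].
  set (dl := Rmin (Rmin (d1 / 2) (d2 / 2)) (Rmin ((t0 - a) / 2) ((b - t0) / 2))).
  assert (Hdl : 0 < dl).
  { unfold dl. generalize (cond_pos d1) (cond_pos d2). intros. repeat apply Rmin_pos; lra. }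
  assert (L1 : dl <= d1 / 2) by (unfold dl; eapply Rle_trans; [apply Rmin_l|apply Rmin_l]).
  assert (L2 : dl <= d2 / 2) by (unfold dl; eapply Rle_trans; [apply Rmin_l|apply Rmin_r]).
  assert (L3 : dl <= (t0 - a) / 2) by (unfold dl; eapply Rle_trans; [apply Rmin_r|apply Rmin_l]).
  assert (L4 : dl <= (b - t0) / 2) by (unfold dl; eapply Rle_trans; [apply Rmin_r|apply Rmin_r]).
  assert (Hnear : forall t, t0 - dl <= t <= t0 + dl -> Rabs (k t - c * dphi t) <= eta1 * dphi t).
  { intros t Ht.
    assert (B1 : Rabs (k t - c * dphi t - (k t0 - c * dphi t0)) < eta1 * m).
    { apply (Hd1 t). change (Rabs (t - t0) < d1). apply Rabs_lt_between. generalize (cond_pos d1). lra. }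
    assert (B2 : Rabs (dphi t - dphi t0) < m).
    { apply (Hd2 t). change (Rabs (t - t0) < d2). apply Rabs_lt_between. generalize (cond_pos d2). lra. }
    replace (k t0 - c * dphi t0) with 0 in B1 by (unfold c; field; lra). rewrite Rminus_0_r in B1.
    apply Rabs_lt_between in B2. eapply Rle_trans; [left; exact B1|].
    apply Rmult_le_compat_l; unfold m in *; lra. }
  set (s := t0 - dl). set (u := t0 + dl).
  assert (SI := strict_incr phi dphi a b Hphi Hd Hpos).
  set (d := Rmin (y - phi s) (phi u - y)).
  assert (Hds : phi s < y) by (apply SI; unfold s; lra).
  assert (Hdu : y < phi u) by (apply SI; unfold u; lra).
  assert (Hd0 : 0 < d) by (apply Rmin_pos; lra).
  assert (Dl : d <= y - phi s) by apply Rmin_l. assert (Dr : d <= phi u - y) by apply Rmin_r.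
  assert (Hbd : exists M, 0 <= M /\ forall t, a <= t <= b -> Rabs (k t) <= M).
  { destruct (continuity_ab_maj (fun t => Rabs (k t)) a b) as [mx [Hmx _]]; [lra| |].
    - intros t Ht. apply (continuity_pt_comp k Rabs); [|apply Rcontinuity_abs].
      apply continuity_pt_filterlim, Hk; auto.
    - exists (Rabs (k mx)). split; [apply Rabs_pos|auto]. }
  destruct Hbd as [M [HM0 HM]].
  set (K := 2 * ((b - a) * (M * / d ^ 2)) + Rabs c * (2 / d)).
  assert (HK : 0 <= K).
  { assert (0 < / d ^ 2) by (apply Rinv_0_lt_compat, pow_lt; auto).
    assert (0 < 2 / d) by (apply Rdiv_lt_0_compat; lra).
    unfold K. apply Rplus_le_le_0_compat; repeat apply Rmult_le_pos; try lra; apply Rabs_pos. }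
  exists (eta / (2 * (K + 1))). split; [apply Rdiv_lt_0_compat; lra|].
  intros e He.
  assert (Cpk : forall t, a <= t <= b -> continuous (poisson k phi y e) t) by (intros; apply poisson_cont; auto; lra).
  assert (I1 : Rabs (RInt (poisson k phi y e) a s) <= (b - a) * (M * / d ^ 2) * e).
  { eapply Rle_trans; [apply (poisson_away k phi a s y d M e); try (unfold s; lra); auto|].
    - intros; apply Hk; unfold s in *; lra.
    - intros; apply Hphi; unfold s in *; lra.
    - intros t Ht. assert (phi t <= phi s).
      { destruct (Req_dec t s) as [->|]; [lra|]. left. apply SI; unfold s in *; lra. }
      rewrite Rabs_left by lra. lra.
    - intros; apply HM; unfold s in *; lra.
    - replace ((b - a) * (M * / d ^ 2) * e) with ((b - a) * (M * (e / d ^ 2))) by (unfold Rdiv; ring).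
      apply Rmult_le_compat_r; [|unfold s; lra].
      apply Rmult_le_pos; auto. apply Rmult_le_pos; [lra|]. left; apply Rinv_0_lt_compat, pow_lt; auto. }
  assert (I2 : Rabs (RInt (poisson k phi y e) u b) <= (b - a) * (M * / d ^ 2) * e).
  { eapply Rle_trans; [apply (poisson_away k phi u b y d M e); try (unfold u; lra); auto|].
    - intros; apply Hk; unfold u in *; lra.
    - intros; apply Hphi; unfold u in *; lra.
    - intros t Ht. assert (phi u <= phi t).
      { destruct (Req_dec t u) as [->|]; [lra|]. left. apply SI; unfold u in *; lra. }
      rewrite Rabs_right by lra. lra.
    - intros; apply HM; unfold u in *; lra.
    - replace ((b - a) * (M * / d ^ 2) * e) with ((b - a) * (M * (e / d ^ 2))) by (unfold Rdiv; ring).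
      apply Rmult_le_compat_r; [|unfold u; lra].
      apply Rmult_le_pos; auto. apply Rmult_le_pos; [lra|]. left; apply Rinv_0_lt_compat, pow_lt; auto. }
  set (A := atan ((phi u - y) / e) - atan ((phi s - y) / e)).
  assert (Hin : forall t, s <= t <= u -> a < t < b) by (unfold s, u; intros; lra).
  assert (IA : is_RInt (poisson dphi phi y e) s u A).
  { apply (is_RInt_derive (fun t => atan ((phi t - y) / e))).
    - rewrite Rmin_left, Rmax_right by (unfold s, u; lra). intros t Ht. specialize (Hin t Ht).
      assert (D := poisson_den phi y e t ltac:(lra)).
      evar_last.
      { apply (is_derive_comp atan (fun t => (phi t - y) / e)).
        - apply is_derive_Reals, derivable_pt_lim_atan.
        - apply (is_derive_ext (fun t => / e * (phi t - y))); [intros; apply Rmult_comm|].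
          apply is_derive_scal. apply (is_derive_minus phi (fun _ => y)); [apply Hd; auto|apply (is_derive_const y)]. }
      unfold poisson, scal, minus, plus, opp, zero; simpl. unfold mult; simpl. unfold Rsqr.
      field. simpl in D. split; [nra|lra].
    - rewrite Rmin_left, Rmax_right by (unfold s, u; lra). intros t Ht. specialize (Hin t Ht).
      apply poisson_cont; [lra|apply Hdc; auto|apply Hphi; lra]. }
  assert (HA1 : A <= PI) by (unfold A; generalize (atan_bound ((phi u - y) / e)) (atan_bound ((phi s - y) / e)); lra).
  assert (HA2 : PI - 2 / d * e <= A).
  { assert (F : forall x, d <= x -> PI / 2 - / d * e <= atan (x / e)).
    { intros x Hx. assert (0 < x / e) by (apply Rdiv_lt_0_compat; lra).
      eapply Rle_trans; [|apply atan_far; auto].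
      replace (/ (x / e)) with (/ x * e) by (field; lra).
      assert (/ x <= / d) by (apply Rinv_le_contravar; lra).
      apply Rplus_le_compat_l, Ropp_le_contravar. apply Rmult_le_compat_r; lra. }
    unfold A. replace ((phi s - y) / e) with (- ((y - phi s) / e)) by (field; lra).
    rewrite atan_opp. generalize (F _ Dl) (F _ Dr). lra. }
  assert (I3 : Rabs (RInt (poisson k phi y e) s u - c * A) <= eta1 * A).
  { rewrite <- (is_RInt_unique _ _ _ _ IA).
    replace (RInt (poisson k phi y e) s u - c * RInt (poisson dphi phi y e) s u) with
      (RInt (fun t => poisson k phi y e t - c * poisson dphi phi y e t) s u).
    - replace (eta1 * RInt (poisson dphi phi y e) s u) with (RInt (fun t => eta1 * poisson dphi phi y e t) s u).
      + assert (Cdp : forall t, s <= t <= u -> continuous (poisson dphi phi y e) t).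
        { intros t Ht; specialize (Hin t Ht). apply poisson_cont; [lra|apply Hdc; auto|apply Hphi; lra]. }
        apply RInt_abs_le; [unfold s, u; lra| | |].
        * intros t Ht. apply (continuous_minus (V := R_NormedModule)); [apply Cpk; specialize (Hin t Ht); lra|].
          apply (continuous_mult (U := R_UniformSpace) (K := R_AbsRing)); [apply continuous_const|auto].
        * intros t Ht. apply (continuous_mult (U := R_UniformSpace) (K := R_AbsRing)); [apply continuous_const|auto].
        * intros t Ht. unfold poisson.
          replace (k t * (e / ((phi t - y) ^ 2 + e ^ 2)) - c * (dphi t * (e / ((phi t - y) ^ 2 + e ^ 2))))
            with ((k t - c * dphi t) * (e / ((phi t - y) ^ 2 + e ^ 2))) by ring.
          assert (D : 0 < e / ((phi t - y) ^ 2 + e ^ 2)) by (apply Rdiv_lt_0_compat; [lra|apply poisson_den; lra]).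
          rewrite Rabs_mult, (Rabs_pos_eq (e / _)) by lra. rewrite <- Rmult_assoc.
          apply Rmult_le_compat_r; [lra|]. apply Hnear. unfold s, u in Ht; lra.
      + apply (RInt_scal (V := R_CompleteNormedModule)). eexists; exact IA.
    - rewrite (RInt_minus (V := R_CompleteNormedModule) (poisson k phi y e) (fun t => c * poisson dphi phi y e t)).
      + unfold minus, plus, opp; simpl. unfold Rminus. f_equal. f_equal.
        apply (RInt_scal (V := R_CompleteNormedModule)). eexists; exact IA.
      + apply cont_ex_RInt; [unfold s, u; lra|]. intros t Ht; apply Cpk; specialize (Hin t Ht); lra.
      + apply (ex_RInt_scal (V := R_NormedModule)). eexists; exact IA. }
  assert (Ch : RInt (poisson k phi y e) a b = RInt (poisson k phi y e) a s + (RInt (poisson k phi y e) s u + RInt (poisson k phi y e) u b)).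
  { rewrite <- (RInt_Chasles (V := R_CompleteNormedModule) _ a s b), <- (RInt_Chasles (V := R_CompleteNormedModule) _ s u b);
     try reflexivity; apply cont_ex_RInt; try (unfold s, u; lra); intros t Ht; apply Cpk; unfold s, u in *; lra. }
  rewrite Ch. fold c.
  replace (RInt (poisson k phi y e) a s + (RInt (poisson k phi y e) s u + RInt (poisson k phi y e) u b) - PI * c)
    with (RInt (poisson k phi y e) a s + (RInt (poisson k phi y e) s u - c * A) + RInt (poisson k phi y e) u b + - (c * (PI - A))) by ring.
  assert (T4 : forall p q r s, Rabs (p + q + r + s) <= Rabs p + Rabs q + Rabs r + Rabs s).
  { intros p q r s0. generalize (Rabs_triang (p + q + r) s0) (Rabs_triang (p + q) r) (Rabs_triang p q). lra. }
  eapply Rle_trans; [apply T4|].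
  assert (I4 : Rabs (- (c * (PI - A))) <= Rabs c * (2 / d * e)).
  { rewrite Rabs_Ropp, Rabs_mult. apply Rmult_le_compat_l; [apply Rabs_pos|]. apply Rabs_le. lra. }
  assert (I5 : eta1 * A <= eta / 4).
  { apply Rle_trans with (eta1 * PI); [apply Rmult_le_compat_l; lra|]. right. unfold eta1. field. lra. }
  assert (I6 : K * e <= eta / 2).
  { apply Rle_trans with ((K + 1) * (eta / (2 * (K + 1)))).
    - apply Rmult_le_compat; lra.
    - right. field. lra. }
  unfold K in I6. lra.
Qed.

(** * Evaluation of a Cauchy integral over the boundary of a quadrant region *)

(** The region is bounded by [[0, B]] below, by [i [0, al]] on the left and by [G] elsewhere.  On the
    bottom [p] increases from its value at the corner, on the left it decreases, so each real [y] is taken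
    on one of the two sides only.  As [f] is real on the bottom and imaginary on the left, the
    imaginary part of the Cauchy integral over either side is a Poisson integral. *)
Section Boundary.
Variables (f p : C -> C) (G : contour) (r0 r B al : R) (dphi dpsi : R -> R).
Let phi (t : R) : R := Re (p (t, 0)).
Let psi (v : R) : R := Re (p (0, v)).
Let kR (t : R) : R := Re (f (t, 0)).
Let kI (v : R) : R := Im (f (0, v)).
Hypothesis Ho : oriented G.
Hypothesis Hr : 0 < r0 <= r.
Hypothesis Hf : forall w, on G w -> Ccont f w.
Hypothesis Hp : forall w, on G w -> Ccont p w.
Hypothesis Hpr : forall w, on G w -> r <= Cmod (p w).
Hypothesis HB : 0 < B.
Hypothesis Hal : 0 < al.
Hypothesis HR : forall t, 0 <= t <= B -> Ccont f (t, 0) /\ Ccont p (t, 0) /\ Im (f (t, 0)) = 0 /\ Im (p (t, 0)) = 0.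
Hypothesis HI : forall v, 0 <= v <= al -> Ccont f (0, v) /\ Ccont p (0, v) /\ Re (f (0, v)) = 0 /\ Im (p (0, v)) = 0.
Hypothesis Hphi : forall t, 0 < t < B -> is_derive phi t (dphi t) /\ continuous dphi t /\ 0 < dphi t.
Hypothesis Hpsi : forall v, 0 < v < al -> is_derive psi v (dpsi v) /\ continuous dpsi v /\ dpsi v < 0.
Hypothesis Hcauchy : forall y, Rabs y < r0 -> exists e1, 0 < e1 /\ forall e, 0 < e < e1 ->
  (cint (fun w => f w / (p w - below y e)) G
   + seg (fun w => f w / (p w - below y e)) (0, 0) 1 0 B
   - seg (fun w => f w / (p w - below y e)) (0, 0) Ci 0 al)%C = 0.

Lemma below_nz z y e : Im z = 0 -> 0 < e -> (z - below y e)%C <> 0.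
Proof. intros H He E. apply (f_equal Im) in E. unfold below in E. destruct z; simpl in *. lra. Qed.

Lemma cont_hor (h : C -> C) t : Ccont h (t, 0) -> continuous (fun t => Re (h (t, 0))) t.
Proof.
  intros H. rewrite <- (hpt 0 t) in H. apply path_continuous in H.
  apply (continuous_ext (fun t => fst (h ((0, 0) + RtoC t * 1)%C))).
  - intros s. rewrite hpt. reflexivity.
  - apply (continuous_comp (V := C_R_NormedModule) _ fst); [exact H|].
    apply (continuous_fst (U := R_UniformSpace) (V := R_UniformSpace)).
Qed.
Lemma cont_ver_Re (h : C -> C) t : Ccont h (0, t) -> continuous (fun t => Re (h (0, t))) t.
Proof.
  intros H. rewrite <- (vpt 0 t) in H. apply path_continuous in H.
  apply (continuous_ext (fun t => fst (h ((0, 0) + RtoC t * Ci)%C))).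
  - intros s. rewrite vpt. reflexivity.
  - apply (continuous_comp (V := C_R_NormedModule) _ fst); [exact H|].
    apply (continuous_fst (U := R_UniformSpace) (V := R_UniformSpace)).
Qed.
Lemma cont_ver_Im (h : C -> C) t : Ccont h (0, t) -> continuous (fun t => Im (h (0, t))) t.
Proof.
  intros H. rewrite <- (vpt 0 t) in H. apply path_continuous in H.
  apply (continuous_ext (fun t => snd (h ((0, 0) + RtoC t * Ci)%C))).
  - intros s. rewrite vpt. reflexivity.
  - apply (continuous_comp (V := C_R_NormedModule) _ snd); [exact H|].
    apply (continuous_snd (U := R_UniformSpace) (V := R_UniformSpace)).
Qed.

Lemma bottom_poisson y e : 0 < e ->
  Im (seg (fun w => f w / (p w - below y e))%C (0, 0) 1 0 B) = - RInt (poisson kR phi y e) 0 B.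
Proof.
  intros He. set (F := fun w => (f w / (p w - below y e))%C).
  assert (HC : segcont F (0, 0) 1 0 B).
  { apply segcont_h; [lra|]. intros t Ht. destruct (HR t Ht) as (A1 & A2 & A3 & A4).
    apply Ccont_div; auto; [apply below_nz; auto|apply Ccont_minus_c; auto]. }
  unfold seg. rewrite Cmult_1_l.
  rewrite <- (is_RInt_unique _ _ _ _ (is_Cint_Im _ _ _ _ (segcont_int _ _ _ _ _ HC))).
  rewrite <- (RInt_opp (V := R_CompleteNormedModule)).
  - apply RInt_ext. rewrite Rmin_left, Rmax_right by lra. intros t Ht. rewrite hpt.
    destruct (HR t ltac:(lra)) as (A1 & A2 & A3 & A4). unfold F, poisson, kR, phi.
    destruct (f (t, 0)) as [a b], (p (t, 0)) as [c d]. simpl in A3, A4. subst b d.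
    assert (D := poisson_den (fun x => x) y e c He). simpl in D.
    unfold opp, below; simpl. field. nra.
  - apply cont_ex_RInt; [lra|]. intros t Ht. destruct (HR t Ht) as (A1 & A2 & A3 & A4).
    apply poisson_cont; auto; [apply (cont_hor f)|apply (cont_hor p)]; auto.
Qed.

Lemma left_poisson y e : 0 < e ->
  Im (seg (fun w => f w / (p w - below y e))%C (0, 0) Ci 0 al) = RInt (poisson kI psi y e) 0 al.
Proof.
  intros He. set (F := fun w => (f w / (p w - below y e))%C).
  assert (HC : segcont F (0, 0) Ci 0 al).
  { apply segcont_v; [lra|]. intros t Ht. destruct (HI t Ht) as (A1 & A2 & A3 & A4).
    apply Ccont_div; auto; [apply below_nz; auto|apply Ccont_minus_c; auto]. }
  unfold seg.
  replace (Im (Ci * Cint (fun t => F ((0, 0) + t * Ci)%C) 0 al)) with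
    (Re (Cint (fun t => F ((0, 0) + t * Ci)%C) 0 al)) by (rewrite im_mult; simpl; ring).
  rewrite <- (is_RInt_unique _ _ _ _ (is_Cint_Re _ _ _ _ (segcont_int _ _ _ _ _ HC))).
  apply RInt_ext. rewrite Rmin_left, Rmax_right by lra. intros t Ht. rewrite vpt.
  destruct (HI t ltac:(lra)) as (A1 & A2 & A3 & A4). unfold F, poisson, kI, psi.
  destruct (f (0, t)) as [a b], (p (0, t)) as [c d]. simpl in A3, A4. subst a d.
  assert (D := poisson_den (fun x => x) y e c He). simpl in D.
  unfold below; simpl. field. nra.
Qed.

Lemma cauchy_limit y L : Rabs y < r0 ->
  (forall eta, 0 < eta -> exists e0, 0 < e0 /\ forall e, 0 < e < e0 ->
     Rabs (RInt (poisson kR phi y e) 0 B + RInt (poisson kI psi y e) 0 al - L) <= eta) ->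
  Im (cint (fun w => f w / (p w - RtoC y))%C G) = L.
Proof.
  intros Hy HL. set (X := Im (cint _ G)).
  apply Rminus_diag_uniq. apply Rabs_eq_0. apply Rle_antisym; [|apply Rabs_pos].
  apply le_epsilon. intros eta Heta. rewrite Rplus_0_l.
  assert (Hy1 : Rabs y < r) by lra.
  destruct (cint_near_real f p G r Ho Hf Hp Hpr y Hy1 (eta / 2) ltac:(lra)) as [e0 [He0 H0]].
  destruct (HL (eta / 2) ltac:(lra)) as [e2 [He2 H2]].
  destruct (Hcauchy y Hy) as [e1 [He1 H1]].
  set (e := Rmin e0 (Rmin e1 e2) / 2).
  assert (Hm : 0 < Rmin e0 (Rmin e1 e2)) by (repeat apply Rmin_pos; auto).
  assert (M1 : Rmin e0 (Rmin e1 e2) <= e0) by apply Rmin_l.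
  assert (M2 : Rmin e0 (Rmin e1 e2) <= e1) by (eapply Rle_trans; [apply Rmin_r|apply Rmin_l]).
  assert (M3 : Rmin e0 (Rmin e1 e2) <= e2) by (eapply Rle_trans; [apply Rmin_r|apply Rmin_r]).
  specialize (H0 e ltac:(unfold e; lra)). specialize (H1 e ltac:(unfold e; lra)). specialize (H2 e ltac:(unfold e; lra)).
  apply (f_equal Im) in H1. rewrite im_minus, im_plus, im_RtoC in H1.
  rewrite bottom_poisson, left_poisson in H1 by (unfold e; lra).
  assert (H3 := Rle_trans _ _ _ (Im_le_Cmod _) H0). rewrite im_minus in H3. fold X in H3.
  apply Rabs_le_between in H3. apply Rabs_le_between in H2. apply Rabs_le. lra.
Qed.

Lemma phi_cont t : 0 <= t <= B -> continuous phi t.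
Proof. intros Ht. apply (cont_hor p), HR; auto. Qed.
Lemma psi_cont t : 0 <= t <= al -> continuous psi t.
Proof. intros Ht. apply (cont_ver_Re p), HI; auto. Qed.
Lemma kR_cont t : 0 <= t <= B -> continuous kR t.
Proof. intros Ht. apply (cont_hor f), HR; auto. Qed.
Lemma kI_cont t : 0 <= t <= al -> continuous kI t.
Proof. intros Ht. apply (cont_ver_Im f), HI; auto. Qed.

Lemma phi_incr s t : 0 <= s -> s < t -> t <= B -> phi s < phi t.
Proof. apply (strict_incr phi dphi 0 B); [exact phi_cont|apply Hphi|apply Hphi]. Qed.
Lemma psi_decr s t : 0 <= s -> s < t -> t <= al -> psi t < psi s.
Proof.
  intros H1 H2 H3. apply Ropp_lt_cancel.
  apply (strict_incr (fun v => - psi v) (fun v => - dpsi v) 0 al); auto.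
  - intros x Hx. apply (continuous_opp (V := R_NormedModule)), psi_cont; auto.
  - intros x Hx. apply (is_derive_opp psi), Hpsi; auto.
  - intros x Hx. destruct (Hpsi x Hx) as (_ & _ & ?). lra.
Qed.

Lemma bounded_on (k : R -> R) b : 0 < b -> (forall t, 0 <= t <= b -> continuous k t) ->
  exists M, 0 <= M /\ forall t, 0 <= t <= b -> Rabs (k t) <= M.
Proof.
  intros Hb Hk.
  destruct (continuity_ab_maj (fun t => Rabs (k t)) 0 b) as [mx [Hmx _]]; [lra| |].
  - intros t Ht. apply (continuity_pt_comp k Rabs); [|apply Rcontinuity_abs].
    apply continuity_pt_filterlim, Hk; auto.
  - exists (Rabs (k mx)). split; [apply Rabs_pos|auto].
Qed.

Lemma vanish (k ph : R -> R) b y d : 0 < b -> 0 < d ->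
  (forall t, 0 <= t <= b -> continuous k t) -> (forall t, 0 <= t <= b -> continuous ph t) ->
  (forall t, 0 <= t <= b -> d <= Rabs (ph t - y)) ->
  forall eta, 0 < eta -> exists e0, 0 < e0 /\ forall e, 0 < e < e0 -> Rabs (RInt (poisson k ph y e) 0 b) <= eta.
Proof.
  intros Hb Hd Hk Hph Hdist eta Heta.
  destruct (bounded_on k b Hb Hk) as [M [HM0 HM]].
  assert (P : 0 < / d ^ 2) by (apply Rinv_0_lt_compat, pow_lt; auto).
  set (K := b * (M * / d ^ 2)).
  assert (HK : 0 <= K) by (apply Rmult_le_pos; [lra|apply Rmult_le_pos; lra]).
  exists (eta / (K + 1)). split; [apply Rdiv_lt_0_compat; lra|]. intros e He.
  eapply Rle_trans; [apply (poisson_away k ph 0 b y d M e); auto; lra|].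
  apply Rle_trans with ((K + 1) * (eta / (K + 1))).
  - replace ((b - 0) * (M * (e / d ^ 2))) with (K * e) by (unfold K, Rdiv; ring).
    apply Rmult_le_compat; lra.
  - right. field. lra.
Qed.

(** The left side does not contribute in the limit: [psi] stays below [psi 0 = phi 0 < phi t0]. *)
Lemma cauchy_real t0 : 0 < t0 < B -> Rabs (phi t0) < r0 ->
  Im (cint (fun w => f w / (p w - RtoC (phi t0)))%C G) = PI * (kR t0 / dphi t0).
Proof.
  intros Ht Hy. apply cauchy_limit; auto. intros eta Heta.
  destruct (poisson_limit kR phi dphi 0 t0 B Ht kR_cont phi_cont
    (fun t H => proj1 (Hphi t H)) (fun t H => proj1 (proj2 (Hphi t H)))
    (fun t H => proj2 (proj2 (Hphi t H))) (eta / 2) ltac:(lra)) as [e1 [He1 H1]].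
  assert (Hd : 0 < phi t0 - phi 0) by (generalize (phi_incr 0 t0 ltac:(lra) ltac:(lra) ltac:(lra)); lra).
  destruct (vanish kI psi al (phi t0) (phi t0 - phi 0) Hal Hd kI_cont psi_cont) with (eta := eta / 2) as [e2 [He2 H2]].
  - intros v Hv. assert (psi v <= psi 0).
    { destruct (Req_dec v 0) as [->|]; [lra|]. left; apply psi_decr; lra. }
    change (psi 0) with (phi 0) in H. rewrite Rabs_left1; lra.
  - lra.
  - exists (Rmin e1 e2). split; [apply Rmin_pos; auto|]. intros e He.
    specialize (H1 e ltac:(generalize (Rmin_l e1 e2); intros; lra)). specialize (H2 e ltac:(generalize (Rmin_r e1 e2); intros; lra)).
    apply Rabs_le_between in H1. apply Rabs_le_between in H2. apply Rabs_le. lra.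
Qed.

Lemma cauchy_imag v0 : 0 < v0 < al -> Rabs (psi v0) < r0 ->
  Im (cint (fun w => f w / (p w - RtoC (psi v0)))%C G) = PI * (kI v0 / - dpsi v0).
Proof.
  intros Ht Hy. apply cauchy_limit; auto. intros eta Heta.
  destruct (poisson_limit kI (fun v => - psi v) (fun v => - dpsi v) 0 v0 al Ht kI_cont) with (eta := eta / 2) as [e1 [He1 H1]].
  - intros x Hx. apply (continuous_opp (V := R_NormedModule)), psi_cont; auto.
  - intros x Hx. apply (is_derive_opp psi), Hpsi; auto.
  - intros x Hx. apply (continuous_opp (V := R_NormedModule)), Hpsi; auto.
  - intros x Hx. destruct (Hpsi x Hx) as (_ & _ & ?). lra.
  - lra.
  - assert (Hd : 0 < psi 0 - psi v0) by (generalize (psi_decr 0 v0 ltac:(lra) ltac:(lra) ltac:(lra)); lra).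
    destruct (vanish kR phi B (psi v0) (psi 0 - psi v0) HB Hd kR_cont phi_cont) with (eta := eta / 2) as [e2 [He2 H2]].
    + intros v Hv. assert (phi 0 <= phi v).
      { destruct (Req_dec v 0) as [->|]; [lra|]. left; apply phi_incr; lra. }
      change (phi 0) with (psi 0) in H. rewrite Rabs_right; lra.
    + lra.
    + exists (Rmin e1 e2). split; [apply Rmin_pos; auto|]. intros e He.
      specialize (H1 e ltac:(generalize (Rmin_l e1 e2); intros; lra)). specialize (H2 e ltac:(generalize (Rmin_r e1 e2); intros; lra)).
      replace (RInt (poisson kI psi (psi v0) e) 0 al) with (RInt (poisson kI (fun v => - psi v) (- psi v0) e) 0 al).
      * change (Rabs (RInt (poisson kI (fun v : R => - psi v) (- psi v0) e) 0 al - PI * (kI v0 / - dpsi v0)) <= eta / 2) in H1.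
        apply Rabs_le_between in H1. apply Rabs_le_between in H2. apply Rabs_le. lra.
      * apply RInt_ext. intros x _. unfold poisson. do 3 f_equal. ring.
Qed.

Definition bcoef (m : nat) : R := Im (ccoef f p G m) / PI.

Lemma bcoef_series y : Rabs y < r0 ->
  is_pseries bcoef y (Im (cint (fun w => f w / (p w - RtoC y))%C G) / PI).
Proof.
  intros Hy. assert (H := cauchy_expansion f p G r Ho ltac:(lra) Hf Hp Hpr y ltac:(lra)).
  apply (is_pseries_scal (/ PI)) in H; [|apply Rmult_comm].
  unfold Rdiv; rewrite (Rmult_comm _ (/ PI)).
  eapply is_pseries_ext; [|exact H]. intros n. unfold PS_scal, bcoef, scal; simpl. unfold mult; simpl.
  unfold Rdiv. ring.
Qed.

Lemma bcoef_real t0 : 0 < t0 < B -> Rabs (phi t0) < r0 -> is_pseries bcoef (phi t0) (kR t0 / dphi t0).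
Proof.
  intros Ht Hy. assert (H := bcoef_series _ Hy). rewrite cauchy_real in H by auto.
  replace (kR t0 / dphi t0) with (PI * (kR t0 / dphi t0) / PI); auto.
  assert (D := proj2 (proj2 (Hphi t0 Ht))). assert (P := PI_RGT_0). field. split; lra.
Qed.
Lemma bcoef_imag v0 : 0 < v0 < al -> Rabs (psi v0) < r0 -> is_pseries bcoef (psi v0) (kI v0 / - dpsi v0).
Proof.
  intros Ht Hy. assert (H := bcoef_series _ Hy). rewrite cauchy_imag in H by auto.
  replace (kI v0 / - dpsi v0) with (PI * (kI v0 / - dpsi v0) / PI); auto.
  assert (D := proj2 (proj2 (Hpsi v0 Ht))). assert (P := PI_RGT_0). field. split; lra.
Qed.

Lemma bcoef_bound : exists M, 0 <= M /\ forall m, Rabs (bcoef m) <= M * / r ^ m.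
Proof.
  destruct (ccoef_bound f p G r Ho ltac:(lra) Hf Hp Hpr) as [M [HM0 HM]].
  assert (HPI := PI_RGT_0). assert (0 < / PI) by (apply Rinv_0_lt_compat; auto).
  exists (M / PI). split; [apply Rmult_le_pos; lra|].
  intros m. unfold bcoef, Rdiv. rewrite Rabs_mult, (Rabs_pos_eq (/ PI)) by lra.
  replace (M * / PI * / r ^ m) with (M * / r ^ m * / PI) by ring.
  apply Rmult_le_compat_r; [lra|]. eapply Rle_trans; [apply Im_le_Cmod|apply HM].
Qed.
End Boundary.

(** * Real facts on [sinh t / t] and [sin t / t] *)

Lemma is_derive_sinh x : is_derive sinh x (cosh x).
Proof. apply is_derive_Reals, derivable_pt_lim_sinh. Qed.
Lemma is_derive_cosh x : is_derive cosh x (sinh x).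
Proof. apply is_derive_Reals, derivable_pt_lim_cosh. Qed.

Lemma cosh_sinh x : cosh x * cosh x = 1 + sinh x * sinh x.
Proof.
  unfold cosh, sinh. assert (exp x * exp (- x) = 1) by (rewrite <- exp_plus, Rplus_opp_r; apply exp_0). nra.
Qed.
Lemma cosh_pos x : 0 < cosh x.
Proof. unfold cosh. generalize (exp_pos x) (exp_pos (- x)). lra. Qed.
Lemma cosh_ge_1 x : 1 <= cosh x.
Proof. generalize (cosh_sinh x) (cosh_pos x) (Rle_0_sqr (sinh x)). unfold Rsqr. nra. Qed.

Lemma incr_zero (f df : R -> R) b x : 0 < x <= b -> f 0 = 0 ->
  (forall t, 0 <= t <= b -> is_derive f t (df t)) -> (forall t, 0 < t < b -> 0 < df t) -> 0 < f x.
Proof.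
  intros Hx H0 Hd Hp. rewrite <- H0.
  apply (strict_incr f df 0 b); try lra; auto.
  - intros; apply continuous_smooth; exists (df t); auto.
  - intros; apply Hd; lra.
Qed.

Lemma sinh_pos x : 0 < x -> 0 < sinh x.
Proof.
  intros Hx. apply (incr_zero sinh cosh x); [lra|apply sinh_0| |].
  - intros; apply is_derive_sinh.
  - intros; apply cosh_pos.
Qed.
Lemma cosh_gt_1 x : 0 < x -> 1 < cosh x.
Proof. intros H. generalize (cosh_sinh x) (cosh_pos x) (sinh_pos x H). nra. Qed.
Lemma sinh_gt x : 0 < x -> x < sinh x.
Proof.
  intros Hx. apply Rlt_0_minus. apply (incr_zero (fun x => sinh x - x) (fun x => cosh x - 1) x); [lra|rewrite sinh_0; ring| |].
  - intros. apply (is_derive_minus sinh (fun x => x)); [apply is_derive_sinh|apply (is_derive_id t)].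
  - intros t Ht. generalize (cosh_gt_1 t ltac:(lra)). lra.
Qed.

(** Numerators of the derivatives of [sinh t / t] and, up to sign, of [sin t / t]; the equation
    [tan t = t] is [Nt t = 0]. *)
Definition Nh (t : R) : R := t * cosh t - sinh t.
Definition Nt (t : R) : R := sin t - t * cos t.

Lemma Nh_derive t : is_derive Nh t (t * sinh t).
Proof.
  unfold Nh. evar_last.
  { apply (is_derive_minus (fun t => t * cosh t) sinh); [|apply is_derive_sinh].
    apply (is_derive_mult (fun t => t) cosh); [apply is_derive_id|apply is_derive_cosh|apply Rmult_comm]. }
  unfold minus, plus, opp, mult, one; simpl. ring.
Qed.
Lemma Nt_derive t : is_derive Nt t (t * sin t).
Proof. unfold Nt. auto_derive; auto. ring. Qed.

Lemma Nh_pos t : 0 < t -> 0 < Nh t.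
Proof.
  intros Ht. apply (incr_zero Nh (fun t => t * sinh t) t); [lra| | |].
  - unfold Nh. rewrite sinh_0; ring.
  - intros; apply Nh_derive.
  - intros s Hs. apply Rmult_lt_0_compat; [lra|apply sinh_pos; lra].
Qed.
Lemma Nt_pos t : 0 < t <= PI -> 0 < Nt t.
Proof.
  intros Ht. apply (incr_zero Nt (fun t => t * sin t) PI); [lra| | |].
  - unfold Nt. rewrite sin_0; ring.
  - intros; apply Nt_derive.
  - intros s Hs. apply Rmult_lt_0_compat; [lra|apply sin_gt_0; lra].
Qed.

Lemma Nt_decr s t : PI <= s -> s < t -> t <= 2 * PI -> Nt t < Nt s.
Proof.
  intros H1 H2 H3. apply Ropp_lt_cancel.
  apply (strict_incr (fun t => - Nt t) (fun t => - (t * sin t)) PI (2 * PI)); auto.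
  - intros x Hx. apply continuous_smooth. eexists. apply (is_derive_opp Nt), Nt_derive.
  - intros x Hx. apply (is_derive_opp Nt), Nt_derive.
  - intros x Hx. generalize (sin_lt_0 x ltac:(lra) ltac:(lra)). generalize PI_RGT_0. nra.
Qed.

Lemma sinhc_pos t : 0 < t -> sinhc t = sinh t / t.
Proof. intros. unfold sinhc. destruct (Req_EM_T t 0); [lra|auto]. Qed.
Lemma sinc_pos t : 0 < t -> sinc t = sin t / t.
Proof. intros. unfold sinc. destruct (Req_EM_T t 0); [lra|auto]. Qed.
Lemma sinhc_0 : sinhc 0 = 1.
Proof. unfold sinhc. destruct (Req_EM_T 0 0); [auto|lra]. Qed.
Lemma sinc_0 : sinc 0 = 1.
Proof. unfold sinc. destruct (Req_EM_T 0 0); [auto|lra]. Qed.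

Lemma is_derive_sinhc t : 0 < t -> is_derive sinhc t (Nh t / t ^ 2).
Proof.
  intros Ht. apply (is_derive_ext_loc (fun t => sinh t / t)).
  - exists (mkposreal t Ht). intros s Hs. apply Rabs_lt_between' in Hs. simpl in Hs.
    rewrite sinhc_pos; auto. lra.
  - unfold Nh. evar_last.
    { apply (is_derive_div sinh (fun t => t)); [apply is_derive_sinh|apply is_derive_id|lra]. }
    unfold one; simpl. field. lra.
Qed.
Lemma is_derive_sinc t : 0 < t -> is_derive sinc t (- Nt t / t ^ 2).
Proof.
  intros Ht. apply (is_derive_ext_loc (fun t => sin t / t)).
  - exists (mkposreal t Ht). intros s Hs. apply Rabs_lt_between' in Hs. simpl in Hs.
    rewrite sinc_pos; auto. lra.
  - unfold Nt. auto_derive; [lra|]. field. lra.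
Qed.

Lemma sinh_3_bound x : Rabs x <= 1 -> Rabs (sinh x - x) <= 3 * Rabs x * Rabs x * Rabs x.
Proof.
  intros H.
  replace (sinh x - x) with ((sinh x - x) - (sinh 0 - 0)) by (rewrite sinh_0; ring).
  apply (mvt_bound (fun x => sinh x - x) (fun x => cosh x - 1)).
  - intros. apply (is_derive_minus sinh (fun x => x)); [apply is_derive_sinh|apply (is_derive_id t)].
  - intros s Hs.
    replace (cosh s - 1) with (((exp s - 1 - s) + (exp (- s) - 1 - - s)) / 2) by (unfold cosh; field).
    generalize (exp_2_bound s ltac:(lra)) (exp_2_bound (- s) ltac:(rewrite Rabs_Ropp; lra)).
    rewrite !Rabs_Ropp. intros A B.
    assert (3 * Rabs s * Rabs s <= 3 * Rabs x * Rabs x) by (generalize (Rabs_pos s); nra).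
    apply Rabs_le_between in A. apply Rabs_le_between in B. apply Rabs_le. lra.
Qed.
Lemma sinh_bounds t : 0 < t <= 1 -> sinh t - t <= 3 * t * t * t.
Proof.
  intros Ht. assert (E := sinh_3_bound t). rewrite (Rabs_pos_eq t) in E by lra.
  specialize (E ltac:(lra)). apply Rabs_le_between in E. lra.
Qed.

Lemma sinhc_lim : filterlim sinhc (at_right 0) (locally 1).
Proof.
  apply filterlim_locally. intros eps.
  assert (Hd : 0 < Rmin 1 (eps / 4)) by (apply Rmin_pos; [lra|generalize (cond_pos eps); lra]).
  exists (mkposreal _ Hd). intros t Ht Ht0. apply Rabs_lt_between' in Ht. simpl in Ht.
  assert (M1 := Rmin_l 1 (eps / 4)). assert (M2 := Rmin_r 1 (eps / 4)).
  change (Rabs (sinhc t - 1) < eps). rewrite sinhc_pos by auto.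
  assert (B := sinh_bounds t ltac:(lra)). assert (B2 := sinh_gt t Ht0).
  replace (sinh t / t - 1) with ((sinh t - t) / t) by (field; lra).
  assert (Rabs ((sinh t - t) / t) <= 3 * t * t).
  { rewrite Rabs_pos_eq by (apply Rdiv_le_0_compat; lra).
    apply Rmult_le_reg_r with t; auto. unfold Rdiv. rewrite Rmult_assoc, Rinv_l; lra. }
  generalize (cond_pos eps). nra.
Qed.
Lemma sinc_lim : filterlim sinc (at_right 0) (locally 1).
Proof.
  apply filterlim_locally. intros eps.
  assert (Hd : 0 < Rmin 1 eps) by (apply Rmin_pos; [lra|apply cond_pos]).
  exists (mkposreal _ Hd). intros t Ht Ht0. apply Rabs_lt_between' in Ht. simpl in Ht.
  assert (M1 := Rmin_l 1 eps). assert (M2 := Rmin_r 1 eps).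
  change (Rabs (sinc t - 1) < eps). rewrite sinc_pos by auto.
  assert (B := sin_3_bound t). rewrite (Rabs_pos_eq t) in B by lra.
  replace (sin t / t - 1) with ((sin t - t) / t) by (field; lra).
  unfold Rdiv. rewrite Rabs_mult, (Rabs_pos_eq (/ t)) by (left; apply Rinv_0_lt_compat; auto).
  apply Rle_lt_trans with (t * t); [|nra].
  apply Rmult_le_reg_r with t; auto. rewrite Rmult_assoc, Rinv_l by lra. lra.
Qed.

Lemma sinhc_gt_1 t : 0 < t -> 1 < sinhc t.
Proof.
  intros Ht. rewrite sinhc_pos by auto. generalize (sinh_gt t Ht). intros.
  apply Rmult_lt_reg_r with t; auto. unfold Rdiv. rewrite Rmult_assoc, Rinv_l; lra.
Qed.
Lemma sinhc_incr s t : 0 <= s -> s < t -> sinhc s < sinhc t.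
Proof.
  intros Hs Hst. destruct (Req_dec s 0) as [->|Hs0].
  - rewrite sinhc_0. apply sinhc_gt_1; lra.
  - apply (strict_incr sinhc (fun t => Nh t / t ^ 2) s t); try lra.
    + intros x Hx. apply continuous_smooth. eexists. apply is_derive_sinhc. lra.
    + intros x Hx. apply is_derive_sinhc. lra.
    + intros x Hx. apply Rdiv_lt_0_compat; [apply Nh_pos; lra|apply pow_lt; lra].
Qed.
Lemma sinc_decr s t : 0 <= s -> s < t -> t <= PI -> sinc t < sinc s.
Proof.
  intros Hs Hst Ht. destruct (Req_dec s 0) as [->|Hs0].
  - rewrite sinc_0, sinc_pos by lra. generalize (sin_lt_x t Hst). intros.
    apply Rmult_lt_reg_r with t; auto. unfold Rdiv. rewrite Rmult_assoc, Rinv_l; lra.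
  - apply Ropp_lt_cancel. apply (strict_incr (fun t => - sinc t) (fun t => Nt t / t ^ 2) s t); try lra.
    + intros x Hx. apply continuous_smooth. eexists. apply (is_derive_opp sinc), is_derive_sinc. lra.
    + intros x Hx. evar_last; [apply (is_derive_opp sinc), is_derive_sinc; lra|].
      unfold opp; simpl. field. lra.
    + intros x Hx. apply Rdiv_lt_0_compat; [apply Nt_pos; lra|apply pow_lt; lra].
Qed.

Lemma sinh_2_ge t : 0 <= t -> t + t * t * t / 6 <= sinh t.
Proof.
  intros Ht. destruct (Req_dec t 0) as [->|H0]; [rewrite sinh_0; lra|].
  assert (P1 : forall x, 0 < x -> 0 < cosh x - 1 - x * x / 2).
  { intros x Hx. apply (incr_zero (fun x => cosh x - 1 - x * x / 2) (fun x => sinh x - x) x); [lra|rewrite cosh_0; lra| |].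
    - intros. evar_last.
      { apply (is_derive_minus (fun x => cosh x - 1) (fun x => x * x / 2)).
        - apply (is_derive_minus cosh (fun _ => 1)); [apply is_derive_cosh|apply (is_derive_const 1)].
        - auto_derive; auto; reflexivity. }
      unfold minus, plus, opp, zero; simpl. field.
    - intros s Hs. generalize (sinh_gt s ltac:(lra)). lra. }
  apply Rlt_le, Rlt_0_minus.
  apply (incr_zero (fun x => sinh x - (x + x * x * x / 6)) (fun x => cosh x - 1 - x * x / 2) t); [lra|rewrite sinh_0; lra| |].
  - intros s Hs. evar_last.
    { apply (is_derive_minus sinh (fun x => x + x * x * x / 6)); [apply is_derive_sinh|auto_derive; auto; reflexivity]. }
    unfold minus, plus, opp; simpl. field.
  - intros s Hs. apply P1; lra.
Qed.

Lemma sinhc_cont t : 0 < t -> continuous sinhc t.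
Proof. intros; apply continuous_smooth. eexists; apply is_derive_sinhc; auto. Qed.
Lemma sinc_cont t : 0 < t -> continuous sinc t.
Proof. intros; apply continuous_smooth. eexists; apply is_derive_sinc; auto. Qed.

Lemma at_right_pick (P : R -> Prop) b : 0 < b -> at_right 0 P -> exists t, 0 < t < b /\ P t.
Proof.
  intros Hb [d Hd]. exists (Rmin (d / 2) (b / 2)).
  assert (0 < Rmin (d / 2) (b / 2)) by (generalize (cond_pos d); intros; apply Rmin_pos; lra).
  assert (M1 := Rmin_l (d / 2) (b / 2)). assert (M2 := Rmin_r (d / 2) (b / 2)).
  split; [lra|]. apply Hd; [|lra]. apply Rabs_lt_between'. generalize (cond_pos d). lra.
Qed.

Lemma xi_spec x : 1 <= x -> 0 <= xi x /\ sinhc (xi x) = x.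
Proof.
  intros Hx. apply (iota_correct (V := R_CompleteNormedModule) (fun t => 0 <= t /\ sinhc t = x)).
  assert (Hu : forall s t, 0 <= s -> 0 <= t -> sinhc s = sinhc t -> s = t).
  { intros s t Hs Ht E. destruct (Rtotal_order s t) as [H|[H|H]]; auto.
    - generalize (sinhc_incr s t Hs H). lra.
    - generalize (sinhc_incr t s Ht H). lra. }
  destruct (Req_dec x 1) as [->|Hx1].
  - exists 0. split; [split; [lra|apply sinhc_0]|]. intros t [Ht E]. apply Hu; auto; [lra|].
    rewrite sinhc_0; auto.
  - destruct (at_right_pick (fun t => sinhc t < x) 1) as [a [Ha1 Ha2]]; [lra| |].
    { generalize (proj1 (filterlim_locally _ _) sinhc_lim (mkposreal (x - 1) ltac:(lra))).
      apply filter_imp. intros t Ht. apply Rabs_lt_between' in Ht. simpl in Ht. lra. }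
    set (b := 6 * x + 1).
    assert (Hb : x < sinhc b).
    { rewrite sinhc_pos by (unfold b; lra). generalize (sinh_2_ge b ltac:(unfold b; lra)). intros.
      apply Rmult_lt_reg_r with b; [unfold b; lra|]. unfold Rdiv at 1.
      rewrite Rmult_assoc, Rinv_l by (unfold b; lra). unfold b in *. nra. }
    destruct (IVT_interv (fun t => sinhc t - x) a b) as [t [Ht E]].
    + intros s Hs. apply continuity_pt_filterlim.
      apply (continuous_minus (V := R_NormedModule) sinhc (fun _ => x)); [apply sinhc_cont; lra|apply continuous_const].
    + unfold b; lra.
    + lra.
    + lra.
    + exists t. split; [split; lra|]. intros s [Hs E']. apply Hu; lra.
Qed.

Lemma zeta_spec x : 0 < x <= 1 -> 0 <= zeta x <= PI /\ sinc (zeta x) = x.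
Proof.
  intros Hx. assert (HPI := PI_RGT_0).
  apply (iota_correct (V := R_CompleteNormedModule) (fun t => 0 <= t <= PI /\ sinc t = x)).
  assert (Hu : forall s t, 0 <= s <= PI -> 0 <= t <= PI -> sinc s = sinc t -> s = t).
  { intros s t Hs Ht E. destruct (Rtotal_order s t) as [H|[H|H]]; auto.
    - generalize (sinc_decr s t ltac:(lra) H ltac:(lra)). lra.
    - generalize (sinc_decr t s ltac:(lra) H ltac:(lra)). lra. }
  destruct (Req_dec x 1) as [->|Hx1].
  - exists 0. split; [split; [lra|apply sinc_0]|]. intros t [Ht E]. apply Hu; auto; [lra|].
    rewrite sinc_0; auto.
  - destruct (at_right_pick (fun t => x < sinc t) 1) as [a [Ha1 Ha2]]; [lra| |].
    { generalize (proj1 (filterlim_locally _ _) sinc_lim (mkposreal (1 - x) ltac:(lra))).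
      apply filter_imp. intros t Ht. apply Rabs_lt_between' in Ht. simpl in Ht. lra. }
    assert (HP3 := PI2_3_2).
    destruct (IVT_interv (fun t => x - sinc t) a PI) as [t [Ht E]].
    + intros s Hs. apply continuity_pt_filterlim.
      apply (continuous_minus (V := R_NormedModule) (fun _ => x) sinc); [apply continuous_const|apply sinc_cont; lra].
    + lra.
    + lra.
    + rewrite sinc_pos, sin_PI by lra. lra.
    + exists t. split; [split; lra|]. intros s [Hs E']. apply Hu; lra.
Qed.

Lemma xi_pos x : 1 < x -> 0 < xi x.
Proof.
  intros Hx. destruct (xi_spec x ltac:(lra)) as [H1 H2]. destruct (Req_dec (xi x) 0) as [E|]; [|lra].
  rewrite E, sinhc_0 in H2. lra.
Qed.
Lemma zeta_range x : 0 < x < 1 -> 0 < zeta x < PI.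
Proof.
  intros Hx. destruct (zeta_spec x ltac:(lra)) as [H1 H2]. split.
  - destruct (Req_dec (zeta x) 0) as [E|]; [|lra]. rewrite E, sinc_0 in H2. lra.
  - destruct (Req_dec (zeta x) PI) as [E|]; [|lra]. assert (P := PI_RGT_0).
    rewrite E, sinc_pos, sin_PI in H2 by auto. lra.
Qed.

(** ** The first positive solution of [tan t = t] *)

Lemma tan_fixpoint_iff t : tan_fixpoint t <-> 0 < t /\ Nt t = 0.
Proof.
  unfold tan_fixpoint, Nt. split.
  - intros (H1 & H2 & H3). split; auto. unfold tan in H3. apply (f_equal (fun x => x * cos t)) in H3.
    unfold Rdiv in H3. rewrite Rmult_assoc, Rinv_l in H3 by auto. lra.
  - intros (H1 & H2). assert (E : cos t <> 0).
    { intros E. rewrite E in H2. generalize (sin2_cos2 t). unfold Rsqr. rewrite E.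
      replace (sin t) with 0 by lra. lra. }
    repeat split; auto. unfold tan. field_simplify_eq; auto. lra.
Qed.

Lemma sin_3PI2 : sin (3 * (PI / 2)) = -1.
Proof. replace (3 * (PI / 2)) with (PI / 2 + PI) by field. rewrite neg_sin, sin_PI2. ring. Qed.
Lemma cos_3PI2 : cos (3 * (PI / 2)) = 0.
Proof. replace (3 * (PI / 2)) with (PI / 2 + PI) by field. rewrite neg_cos, cos_PI2. ring. Qed.

(** [Nt] is positive on [(0, PI]] and decreases on [[PI, 2 PI]], so its zero between [PI] and [3 PI / 2] is
    the first one. *)
Lemma eta1_spec : PI < eta1 < 3 * (PI / 2) /\ Nt eta1 = 0.
Proof.
  assert (HPI := PI_RGT_0).
  destruct (IVT_interv (fun t => - Nt t) PI (3 * (PI / 2))) as [z [Hz E]].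
  - intros s Hs. apply continuity_pt_filterlim. apply (continuous_smooth (fun t => - Nt t)). eexists. apply (is_derive_opp Nt), Nt_derive.
  - lra.
  - generalize (Nt_pos PI ltac:(lra)). lra.
  - unfold Nt. rewrite sin_3PI2, cos_3PI2. lra.
  - assert (Hz1 : z <> PI) by (intros ->; generalize (Nt_pos PI ltac:(lra)); lra).
    assert (Hz2 : z <> 3 * (PI / 2)) by (intros ->; unfold Nt in E; rewrite sin_3PI2, cos_3PI2 in E; lra).
    assert (Hmin : forall s, tan_fixpoint s -> z <= s).
    { intros s Hs. apply tan_fixpoint_iff in Hs. destruct Hs as [Hs0 Hs].
      apply Rnot_lt_le. intros Hlt. destruct (Rle_lt_dec s PI).
      - generalize (Nt_pos s ltac:(lra)). lra.
      - generalize (Nt_decr s z ltac:(lra) Hlt ltac:(lra)). lra. }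
    assert (Hzf : tan_fixpoint z) by (apply tan_fixpoint_iff; lra).
    assert (Heta : tan_fixpoint eta1 /\ forall s, tan_fixpoint s -> eta1 <= s).
    { apply (iota_correct (V := R_CompleteNormedModule) (fun t => tan_fixpoint t /\ forall s, tan_fixpoint s -> t <= s)).
      exists z. split; [split; auto|]. intros t [Ht1 Ht2]. apply Rle_antisym; auto. }
    destruct Heta as [He1 He2]. assert (Ez : eta1 = z) by (apply Rle_antisym; auto). rewrite Ez. lra.
Qed.

Lemma eta1_sin : sin eta1 = eta1 * cos eta1.
Proof. generalize (proj2 eta1_spec). unfold Nt. lra. Qed.

Lemma omega1_cos : omega1 = cos eta1.
Proof.
  unfold omega1. rewrite eta1_sin. generalize PI_RGT_0 (proj1 eta1_spec). intros. field. lra.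
Qed.

Lemma omega1_sqr : omega1 ^ 2 * (1 + eta1 ^ 2) = 1.
Proof. rewrite omega1_cos. generalize (sin2_cos2 eta1). unfold Rsqr. rewrite eta1_sin. intros. nra. Qed.

Lemma omega1_bounds : - 1 < omega1 < 0.
Proof.
  assert (HPI := PI_RGT_0). assert (H := proj1 eta1_spec).
  assert (omega1 < 0). { rewrite omega1_cos. apply cos_lt_0; lra. }
  split; [|auto]. apply Rnot_le_lt. intros Hle. assert (E := omega1_sqr).
  assert (P1 : 1 <= omega1 ^ 2) by nra. assert (P2 : 0 < eta1 ^ 2) by (apply pow_lt; lra). nra.
Qed.

(** * The function [sinh w / w] on the quadrant *)

Definition Csinhc (w : C) : C := if Ceq_dec w 0 then RtoC 1 else (Csinh w / w)%C.

Lemma Csinhc_nz (w : C) : w <> 0 -> Csinhc w = (Csinh w / w)%C.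
Proof. intros H. unfold Csinhc. destruct (Ceq_dec w 0); [contradiction|reflexivity]. Qed.
Lemma Csinhc_00 : Csinhc 0 = 1.
Proof. unfold Csinhc. destruct (Ceq_dec 0 0) as [e|e]; [reflexivity|contradiction e; reflexivity]. Qed.

Lemma near_nz (z w : C) : Cmod (w - z) < Cmod z -> w <> 0.
Proof.
  intros H ->. replace (0 - z)%C with (- z)%C in H by ring. rewrite Cmod_opp in H. lra.
Qed.

Lemma Chol_Csinhc (w : C) : w <> 0 -> Chol Csinhc w.
Proof.
  intros H. apply (Chol_ext_loc (fun w => Csinh w / w)%C _ _ (Cmod w)).
  - apply Cmod_gt_0; auto.
  - intros z Hz. symmetry. apply Csinhc_nz. eapply near_nz; eauto.
  - apply Chol_div; auto; [apply Chol_Csinh|apply Chol_id].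
Qed.

Lemma cosh_2_bound x : Rabs x <= 1 -> Rabs (cosh x - 1) <= 3 * Rabs x * Rabs x.
Proof.
  intros H.
  replace (cosh x - 1) with (((exp x - 1 - x) + (exp (- x) - 1 - - x)) / 2) by (unfold cosh; field).
  generalize (exp_2_bound x ltac:(lra)) (exp_2_bound (- x) ltac:(rewrite Rabs_Ropp; lra)).
  rewrite !Rabs_Ropp. intros A B.
  apply Rabs_le_between in A. apply Rabs_le_between in B. apply Rabs_le. lra.
Qed.

Lemma Csinh_3_bound (h : C) : Cmod h <= 1 -> Cmod (Csinh h - h) <= 40 * (Cmod h * Cmod h * Cmod h).
Proof.
  intros Hh. assert (Hx := Re_le_Cmod h). assert (Hy := Im_le_Cmod h).
  set (m := Cmod h) in *. assert (Hm : 0 <= m) by apply Cmod_ge_0.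
  destruct h as [x y]; simpl in Hx, Hy.
  assert (PX := Rabs_pos x). assert (PY := Rabs_pos y).
  assert (H2 : forall p q, 0 <= p <= m -> 0 <= q <= m -> 0 <= p * q <= m * m)
    by (intros; split; [apply Rmult_le_pos; lra|apply Rmult_le_compat; lra]).
  assert (H3 : forall p q r, 0 <= p <= m -> 0 <= q <= m -> 0 <= r <= m -> 0 <= p * q * r <= m * m * m).
  { intros p q r Hp Hq Hr'. destruct (H2 p q Hp Hq). split; [apply Rmult_le_pos; lra|apply Rmult_le_compat; lra]. }
  assert (A1 := sinh_3_bound x ltac:(lra)). assert (A2 := cosh_2_bound x ltac:(lra)).
  assert (A3 := cos_2_bound y). assert (A4 := sin_3_bound y). assert (A5 := sin_1_bound y).
  assert (XXX := H3 (Rabs x) (Rabs x) (Rabs x) ltac:(lra) ltac:(lra) ltac:(lra)).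
  assert (YYY := H3 (Rabs y) (Rabs y) (Rabs y) ltac:(lra) ltac:(lra) ltac:(lra)).
  assert (XYY := H3 (Rabs x) (Rabs y) (Rabs y) ltac:(lra) ltac:(lra) ltac:(lra)).
  assert (XXY := H3 (Rabs x) (Rabs x) (Rabs y) ltac:(lra) ltac:(lra) ltac:(lra)).
  assert (YY := H2 (Rabs y) (Rabs y) ltac:(lra) ltac:(lra)).
  assert (XX := H2 (Rabs x) (Rabs x) ltac:(lra) ltac:(lra)).
  assert (Sx : Rabs (sinh x) <= 4 * Rabs x).
  { replace (sinh x) with (x + (sinh x - x)) by ring. eapply Rle_trans; [apply Rabs_triang|].
    assert (Rabs x * Rabs x <= 1) by nra. nra. }
  eapply Rle_trans; [apply Cmod_le_sum|]. rewrite re_minus, im_minus. simpl.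
  replace (sinh x * cos y - x) with ((sinh x - x) + sinh x * (cos y - 1)) by ring.
  replace (cosh x * sin y - y) with ((cosh x - 1) * sin y + (sin y - y)) by ring.
  assert (B1 : Rabs (sinh x * (cos y - 1)) <= 4 * Rabs x * (Rabs y * Rabs y)).
  { rewrite Rabs_mult. apply Rmult_le_compat; try apply Rabs_pos; lra. }
  assert (B2 : Rabs ((cosh x - 1) * sin y) <= 3 * Rabs x * Rabs x * Rabs y).
  { rewrite Rabs_mult. apply Rmult_le_compat; try apply Rabs_pos; lra. }
  generalize (Rabs_triang (sinh x - x) (sinh x * (cos y - 1))) (Rabs_triang ((cosh x - 1) * sin y) (sin y - y)).
  lra.
Qed.
Lemma Ccosh_2_bound (h : C) : Cmod h <= 1 -> Cmod (Ccosh h - 1) <= 20 * (Cmod h * Cmod h).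
Proof.
  intros Hh. rewrite Ccosh_exp.
  replace (/ 2 * (Cexp h + Cexp (- h)) - 1)%C with (/ 2 * ((Cexp h - 1 - h) + (Cexp (- h) - 1 - - h)))%C
    by (field; apply Cmod_nz; rewrite Cmod_R, Rabs_pos_eq; lra).
  rewrite Cmod_mult. assert (E : Cmod (/ 2) = / 2).
  { rewrite Cmod_inv, Cmod_R, Rabs_pos_eq; try lra. apply Cmod_nz; rewrite Cmod_R, Rabs_pos_eq; lra. }
  rewrite E. assert (A := Cexp_2_bound h Hh). assert (B := Cexp_2_bound (- h) ltac:(rewrite Cmod_opp; auto)).
  rewrite Cmod_opp in B. generalize (Cmod_triangle (Cexp h - 1 - h) (Cexp (- h) - 1 - - h)). lra.
Qed.

Lemma Ccont_Csinhc_0 : Ccont Csinhc (RtoC 0).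
Proof.
  apply Ccont_eps. intros eps He. exists (Rmin 1 (eps / 40)). split; [apply Rmin_pos; lra|].
  intros w Hw. replace (w - 0)%C with w in Hw by ring.
  assert (M1 := Rmin_l 1 (eps / 40)). assert (M2 := Rmin_r 1 (eps / 40)).
  rewrite Csinhc_00.
  destruct (Ceq_dec w 0) as [->|H0].
  - rewrite Csinhc_00.
    replace (1 - 1)%C with (RtoC 0) by ring. rewrite Cmod_0. auto.
  - rewrite Csinhc_nz by auto. assert (P := proj1 (Cmod_gt_0 w) H0).
    replace (Csinh w / w - 1)%C with ((Csinh w - w) / w)%C by (field; auto).
    rewrite Cmod_div by auto. apply Rmult_lt_reg_r with (Cmod w); auto.
    unfold Rdiv. rewrite Rmult_assoc, Rinv_l, Rmult_1_r by lra.
    eapply Rle_lt_trans; [apply Csinh_3_bound; lra|].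
    assert (Cmod w * Cmod w < eps / 40) by nra. nra.
Qed.
Lemma Ccont_Csinhc (w : C) : Ccont Csinhc w.
Proof.
  destruct (Ceq_dec w 0) as [->|]; [apply Ccont_Csinhc_0|apply Chol_cont, Chol_Csinhc; auto].
Qed.

Lemma Csinhc_real t : 0 <= t -> Csinhc (t, 0) = (sinhc t, 0).
Proof.
  intros Ht. destruct (Req_dec t 0) as [->|H].
  - unfold Csinhc. destruct (Ceq_dec (0, 0) 0) as [|n]; [rewrite sinhc_0; auto|exfalso; apply n; auto].
  - rewrite Csinhc_nz by (intros E; apply (f_equal Re) in E; simpl in E; lra).
    rewrite sinhc_pos by lra. unfold Csinh; simpl. rewrite cos_0, sin_0.
    apply injective_projections; simpl; field; nra.
Qed.
Lemma Csinhc_imag v : 0 <= v -> Csinhc (0, v) = (sinc v, 0).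
Proof.
  intros Ht. destruct (Req_dec v 0) as [->|H].
  - unfold Csinhc. destruct (Ceq_dec (0, 0) 0) as [|n]; [rewrite sinc_0; auto|exfalso; apply n; auto].
  - rewrite Csinhc_nz by (intros E; apply (f_equal Im) in E; simpl in E; lra).
    rewrite sinc_pos by lra. unfold Csinh; simpl. rewrite cosh_0, sinh_0.
    apply injective_projections; simpl; field; nra.
Qed.

Lemma Csinh_zero u v : 0 <= u -> 0 <= v < 2 * PI -> Csinh (u, v) = 0 -> u = 0 /\ (v = 0 \/ v = PI).
Proof.
  intros Hu Hv E. assert (M := Cmod_Csinh_sqr u v). rewrite E, Cmod_0 in M.
  assert (sinh u = 0) by nra. assert (S : sin v = 0) by nra.
  assert (Hu0 : u = 0).
  { destruct (Req_dec u 0); auto. generalize (sinh_pos u ltac:(lra)). lra. }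
  split; auto. destruct (Rtotal_order v PI) as [H1|[H1|H1]]; auto.
  - left. destruct (Req_dec v 0); auto. generalize (sin_gt_0 v ltac:(lra) H1). lra.
  - generalize (sin_lt_0 v H1 ltac:(lra)). lra.
Qed.

Lemma Csinhc_zero u v : 0 <= u -> 0 <= v < 2 * PI -> Csinhc (u, v) = 0 -> u = 0 /\ v = PI.
Proof.
  intros Hu Hv E. destruct (Ceq_dec (u, v) 0) as [E0|E0].
  - rewrite E0, Csinhc_00 in E.
    apply RtoC_inj in E. lra.
  - rewrite Csinhc_nz in E by auto.
    assert (Ez : Csinh (u, v) = 0).
    { replace (Csinh (u, v)) with (Csinh (u, v) / (u, v) * (u, v))%C by (field; auto). rewrite E. ring. }
    destruct (Csinh_zero u v Hu Hv Ez) as [Eu [Ev|Ev]]; auto. exfalso. apply E0. rewrite Eu, Ev. reflexivity.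
Qed.

(** The image of the quarter strip avoids the sector just below the positive real axis; this makes the
    Cauchy integrands holomorphic and leaves room for the cut of a logarithm.  If [sinh w = (x - i e) w],
    then [sinh u cos v] is positive, so [v] lies in the first or the fourth quadrant.  In the first,
    [tan v / v] would be less than [tanh u / u], whereas one is above and the other below [1].  In the
    fourth, [v <= 7 PI / 4] gives [|sin v| >= cos v], so the negative number [cosh u sin v] exceeds
    [sinh u cos v] in modulus, which [x v - e u] and [x u + e v] do not allow. *)
Lemma no_crossing u v x e : 0 <= u -> 0 <= v <= 7 * (PI / 4) -> 0 < e < x -> Csinhc (u, v) <> (x, - e).
Proof.
  intros Hu Hv He E. assert (HPI := PI_RGT_0).
  destruct (Req_dec u 0) as [->|Hu0].
  { rewrite Csinhc_imag in E by lra. apply (f_equal Im) in E. simpl in E. lra. }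
  destruct (Req_dec v 0) as [->|Hv0].
  { rewrite Csinhc_real in E by lra. apply (f_equal Im) in E. simpl in E. lra. }
  assert (Hw : (u, v) <> RtoC 0) by (intros A; apply (f_equal Re) in A; simpl in A; lra).
  rewrite Csinhc_nz in E by auto.
  assert (E2 : Csinh (u, v) = ((x, (- e)%R) * (u, v))%C) by (rewrite <- E; field; auto).
  assert (S1 := f_equal Re E2). assert (S2 := f_equal Im E2). simpl in S1, S2.
  assert (Hu1 : 0 < u) by lra. assert (Hv1 : 0 < v) by lra.
  assert (Psh := sinh_pos u ltac:(lra)). assert (Pch := cosh_pos u).
  assert (xu : 0 < x * u) by (apply Rmult_lt_0_compat; lra).
  assert (ev : 0 < e * v) by (apply Rmult_lt_0_compat; lra).
  assert (eu : 0 < e * u) by (apply Rmult_lt_0_compat; lra).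
  assert (xv : 0 < x * v) by (apply Rmult_lt_0_compat; lra).
  assert (Pc : 0 < cos v).
  { apply Rnot_le_lt. intros Hc. assert (sinh u * cos v <= 0) by nra. lra. }
  destruct (Rlt_le_dec v (PI / 2)) as [Hq|Hq].
  - assert (T1 := Nt_pos v ltac:(lra)). assert (T2 := Nh_pos u ltac:(lra)). unfold Nt in T1. unfold Nh in T2.
    assert (A1 : cosh u * sinh u * (v * cos v) < cosh u * sinh u * sin v).
    { apply Rmult_lt_compat_l; [apply Rmult_lt_0_compat; auto|lra]. }
    assert (A2 : sinh u * (x * v) < x * v * (u * cosh u)).
    { rewrite Rmult_comm. apply Rmult_lt_compat_l; lra. }
    assert (A3 : cosh u * sinh u * (v * cos v) = cosh u * v * (x * u) + cosh u * v * (e * v)).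
    { replace (cosh u * sinh u * (v * cos v)) with (cosh u * v * (sinh u * cos v)) by ring. rewrite S1. ring. }
    assert (A4 : 0 < cosh u * v * (e * v)) by (apply Rmult_lt_0_compat; [apply Rmult_lt_0_compat|]; auto).
    assert (A5 : cosh u * sinh u * sin v = sinh u * (x * v) - sinh u * (e * u)).
    { replace (cosh u * sinh u * sin v) with (sinh u * (cosh u * sin v)) by ring. rewrite S2. ring. }
    assert (A6 : 0 < sinh u * (e * u)) by (apply Rmult_lt_0_compat; lra). lra.
  - assert (Hq2 : 3 * (PI / 2) < v).
    { apply Rnot_le_lt. intros Hv3. assert (cos v <= 0) by (apply cos_le_0; lra). lra. }
    set (s := 2 * PI - v).
    assert (Cs : cos v = cos s) by (unfold s; rewrite cos_minus, cos_2PI, sin_2PI; ring).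
    assert (Ss : sin v = - sin s) by (unfold s; rewrite sin_minus, cos_2PI, sin_2PI; ring).
    assert (Hcs : cos s <= sin s).
    { rewrite <- sin_shift. apply sin_incr_1; unfold s; lra. }
    assert (Hch : sinh u < cosh u) by (unfold sinh, cosh; generalize (exp_pos (- u)); lra).
    rewrite Cs in S1, Pc. rewrite Ss in S2.
    assert (cosh u * cos s <= cosh u * sin s) by (apply Rmult_le_compat_l; lra).
    assert (sinh u * cos s <= cosh u * cos s) by (apply Rmult_le_compat_r; lra).
    assert (e * u < x * u) by (apply Rmult_lt_compat_r; lra). lra.
Qed.

(** * Power series with a known second derivative *)

(** The coefficients of the second antiderivative that vanishes to second order at [0]. *)
Definition integrate2 (E : nat -> R) (n : nat) : R :=
  match n with
  | S (S m) => E m / (INR (S m) * INR (S (S m)))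
  | _ => 0
  end.

Lemma integrate2_derive2 E n : PS_derive (PS_derive (integrate2 E)) n = E n.
Proof. unfold PS_derive, integrate2. field. split; apply not_0_INR; lia. Qed.

Lemma CV_ge (E : nat -> R) r M : 0 < r -> (forall m, Rabs (E m) <= M * / r ^ m) -> Rbar_le r (CV_radius E).
Proof.
  intros Hr H. destruct (CV_radius_bounded E) as [Hub _]. apply Hub. exists M. intros n.
  rewrite Rabs_mult, (Rabs_pos_eq (r ^ n)) by (left; apply pow_lt; auto).
  specialize (H n). assert (P := pow_lt r n Hr).
  apply Rle_trans with (M * / r ^ n * r ^ n); [apply Rmult_le_compat_r; lra|].
  right; field; lra.
Qed.

Lemma integrate2_bound E r M : 0 < r -> (forall m, Rabs (E m) <= M * / r ^ m) ->
  forall m, Rabs (integrate2 E m) <= M * r ^ 2 * / r ^ m.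
Proof.
  intros Hr H m.
  assert (HM : 0 <= M).
  { specialize (H 0%nat). simpl in H. rewrite Rinv_1, Rmult_1_r in H. generalize (Rabs_pos (E 0%nat)); lra. }
  assert (Hpos : forall k, 0 <= M * r ^ 2 * / r ^ k).
  { intros. apply Rmult_le_pos; [apply Rmult_le_pos; auto; apply pow_le; lra|].
    left; apply Rinv_0_lt_compat, pow_lt; auto. }
  destruct m as [|[|m]]; unfold integrate2; try (rewrite Rabs_R0; auto).
  unfold Rdiv. rewrite Rabs_mult.
  assert (P1 : 1 <= INR (S m)) by (rewrite S_INR; generalize (pos_INR m); lra).
  assert (P2 : 1 <= INR (S (S m))) by (rewrite S_INR; lra).
  rewrite (Rabs_pos_eq (/ _)) by (left; apply Rinv_0_lt_compat; nra).
  replace (M * r ^ 2 * / r ^ S (S m)) with (M * / r ^ m * 1)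
    by (simpl; field; split; [apply pow_nonzero|]; lra).
  apply Rmult_le_compat; auto; try apply Rabs_pos.
  - left; apply Rinv_0_lt_compat; nra.
  - rewrite <- Rinv_1. apply Rinv_le_contravar; nra.
Qed.

Lemma zero_derive_lim (D : R -> R) T L :
  (forall t, 0 < t < T -> is_derive D t 0) -> filterlim D (at_right 0) (locally L) ->
  forall t, 0 < t < T -> D t = L.
Proof.
  intros HD HL t Ht.
  assert (Hc : forall s, 0 < s < T -> D s = D t).
  { intros s Hs. destruct (Req_dec s t) as [->|Hne]; auto.
    destruct (MVT_gen D s t (fun _ => 0)) as [c [_ E]].
    - intros x Hx. apply HD. generalize (Rmin_case s t (fun x => 0 < x)) (Rmax_case s t (fun x => x < T)). intros A B.
      specialize (A ltac:(lra) ltac:(lra)). specialize (B ltac:(lra) ltac:(lra)). lra.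
    - intros x Hx. apply continuity_pt_filterlim. apply continuous_smooth. exists 0. apply HD.
      generalize (Rmin_case s t (fun x => 0 < x)) (Rmax_case s t (fun x => x < T)). intros A B.
      specialize (A ltac:(lra) ltac:(lra)). specialize (B ltac:(lra) ltac:(lra)). lra.
    - lra. }
  apply Rminus_diag_uniq, Rabs_eq_0, Rle_antisym; [|apply Rabs_pos].
  apply le_epsilon. intros eps He. rewrite Rplus_0_l.
  destruct (at_right_pick _ T ltac:(lra) (proj1 (filterlim_locally _ _) HL (mkposreal eps He))) as [s [Hs1 Hs2]].
  change (Rabs (D s - L) < eps) in Hs2. rewrite (Hc s Hs1) in Hs2. lra.
Qed.

(** Two integrations along the curve [phi]: [F] minus the integrated series, and then [j] minus the
    series integrated twice, have derivative [0] in [t] and a known limit at [0]. *)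
Lemma double_integral E r M (phi dphi F k j : R -> R) (F0 T : R) : 0 < r ->
  (forall m, Rabs (E m) <= M * / r ^ m) ->
  (forall t, 0 < t < T -> is_derive phi t (dphi t) /\ dphi t <> 0 /\ Rabs (phi t) < r /\
     is_derive F t (k t) /\ is_pseries E (phi t) (k t / dphi t) /\ is_derive j t (dphi t * F t)) ->
  filterlim phi (at_right 0) (locally 0) -> filterlim F (at_right 0) (locally F0) ->
  filterlim j (at_right 0) (locally 0) ->
  forall t, 0 < t < T -> j t = PSeries (integrate2 E) (phi t) + F0 * phi t.
Proof.
  intros Hr HE H Hphi HF Hj.
  assert (CV2 : Rbar_le r (CV_radius (integrate2 E))) by (apply (CV_ge _ r (M * r ^ 2)); auto; apply integrate2_bound; auto).
  assert (CV1 : Rbar_le r (CV_radius (PS_derive (integrate2 E)))) by (rewrite CV_radius_derive; auto).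
  assert (D2 : forall x, Rabs x < r -> is_derive (PSeries (integrate2 E)) x (PSeries (PS_derive (integrate2 E)) x)).
  { intros x Hx. apply is_derive_PSeries. eapply Rbar_lt_le_trans; [|exact CV2]. exact Hx. }
  assert (D1 : forall x, Rabs x < r -> is_derive (PSeries (PS_derive (integrate2 E))) x (PSeries E x)).
  { intros x Hx. rewrite <- (PSeries_ext _ E x (integrate2_derive2 E)).
    apply is_derive_PSeries. eapply Rbar_lt_le_trans; [|exact CV1]. exact Hx. }
  assert (L1 : forall a, Rbar_le r (CV_radius a) -> filterlim (fun t => PSeries a (phi t)) (at_right 0) (locally (a 0%nat))).
  { intros a Ha. eapply filterlim_comp; [exact Hphi|]. rewrite <- PSeries_0.
    apply (continuous_smooth (PSeries a)). apply ex_derive_PSeries. rewrite Rabs_R0.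
    eapply Rbar_lt_le_trans; [|exact Ha]. exact Hr. }
  assert (HF1 : forall t, 0 < t < T -> F t - PSeries (PS_derive (integrate2 E)) (phi t) = F0).
  { apply zero_derive_lim.
    - intros t Ht. destruct (H t Ht) as (A1 & A2 & A3 & A4 & A5 & A6).
      evar_last.
      { apply (is_derive_minus F (fun t => PSeries (PS_derive (integrate2 E)) (phi t))); [exact A4|].
        apply (is_derive_comp (PSeries (PS_derive (integrate2 E))) phi); [apply D1; auto|exact A1]. }
      rewrite (is_pseries_unique _ _ _ A5). unfold minus, plus, opp, scal; simpl. unfold mult; simpl. field. auto.
    - replace (locally F0) with (locally (F0 - PS_derive (integrate2 E) 0)).
      2: { f_equal. unfold PS_derive, integrate2. ring. }
      apply (filterlim_comp_2 (H := locally (- PS_derive (integrate2 E) 0%nat)) _ _ Rplus HF).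
      + eapply filterlim_comp; [apply (L1 _ CV1)|]. apply (filterlim_opp (V := R_NormedModule)).
      + apply (filterlim_plus (V := R_NormedModule)). }
  intros t Ht.
  assert (G : j t - (PSeries (integrate2 E) (phi t) + F0 * phi t) = 0); [|lra].
  revert t Ht. apply zero_derive_lim.
  - intros t Ht. destruct (H t Ht) as (A1 & A2 & A3 & A4 & A5 & A6).
    evar_last.
    { apply (is_derive_minus j (fun t => PSeries (integrate2 E) (phi t) + F0 * phi t)); [exact A6|].
      apply (is_derive_plus (fun t => PSeries (integrate2 E) (phi t)) (fun t => F0 * phi t)).
      - apply (is_derive_comp (PSeries (integrate2 E)) phi); [apply D2; auto|exact A1].
      - apply is_derive_scal; exact A1. }
    rewrite <- (HF1 t Ht). unfold minus, plus, opp, scal; simpl. unfold mult; simpl. ring.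
  - replace (locally 0) with (locally (0 + - (integrate2 E 0 + F0 * 0))).
    2: { f_equal. unfold integrate2. ring. }
    apply (filterlim_comp_2 (H := locally (- (integrate2 E 0%nat + F0 * 0))) _ _ Rplus Hj).
    + eapply filterlim_comp; [|apply (filterlim_opp (V := R_NormedModule))].
      apply (filterlim_comp_2 (H := locally (F0 * 0)) _ _ Rplus (L1 _ CV2)).
      * eapply filterlim_comp; [exact Hphi|]. apply (filterlim_scal_r (K := R_AbsRing) (V := R_NormedModule) F0 0).
      * apply (filterlim_plus (V := R_NormedModule)).
    + apply (filterlim_plus (V := R_NormedModule)).
Qed.

(** * The expansion around [omega = 1] *)

Definition half (w : C) : C := (Re w / 2, Im w / 2).

Lemma half_scal w : half w = (RtoC (/ 2) * w)%C.
Proof. unfold half. destruct w. apply injective_projections; simpl; field. Qed.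

Lemma Chol_half w : Chol half w.
Proof.
  apply (Chol_ext_loc (fun w => RtoC (/ 2) * w)%C _ _ 1); [lra|intros; symmetry; apply half_scal|].
  apply Chol_mult; [apply Chol_const|apply Chol_id].
Qed.

(** The derivative in [w] of [w ^ 2 / (cosh w - 1) = w ^ 2 / (2 sinh (w / 2) ^ 2)], which is
    [dJ / d omega + 2 / omega ^ 2]: subtracting the pole of the rate function at [omega = 0] makes
    the larger radius [1 - omega1] available. *)
Definition dFom (w : C) : C :=
  if Ceq_dec w 0 then RtoC 0
  else (w * (RtoC 2 * Csinh (half w) - w * Ccosh (half w)) / (RtoC 2 * Csinh (half w) ^ 3))%C.

Lemma dFom_nz (w : C) : w <> 0 -> dFom w =
  (w * (RtoC 2 * Csinh (half w) - w * Ccosh (half w)) / (RtoC 2 * Csinh (half w) ^ 3))%C.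
Proof. intros H. unfold dFom. destruct (Ceq_dec w 0); [contradiction|reflexivity]. Qed.

Lemma C2_nz : RtoC 2 <> RtoC 0.
Proof. intros E. apply RtoC_inj in E. lra. Qed.

Lemma Chol_dFom (w : C) : w <> 0 -> Csinh (half w) <> 0 -> Chol dFom w.
Proof.
  intros H HS.
  apply (Chol_ext_loc (fun w => w * (RtoC 2 * Csinh (half w) - w * Ccosh (half w)) / (RtoC 2 * Csinh (half w) ^ 3))%C _ _ (Cmod w)).
  - apply Cmod_gt_0; auto.
  - intros z Hz. symmetry. apply dFom_nz. eapply near_nz; eauto.
  - assert (Hs : Chol (fun w => Csinh (half w)) w) by (apply Chol_comp; [apply Chol_Csinh|apply Chol_half]).
    assert (Hc : Chol (fun w => Ccosh (half w)) w) by (apply Chol_comp; [apply Chol_Ccosh|apply Chol_half]).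
    apply Chol_div.
    + apply Cmult_neq_0; [apply C2_nz|apply Cpow_nz; auto].
    + apply Chol_mult; [apply Chol_id|]. apply Chol_minus; apply Chol_mult; auto; [apply Chol_const|apply Chol_id].
    + apply Chol_mult; [apply Chol_const|]. apply (Chol_mult _ (fun w => Csinh (half w) ^ 2)%C); auto.
      apply (Chol_mult _ (fun w => Csinh (half w) ^ 1)%C); auto.
      apply (Chol_mult _ (fun w => 1%C)); auto. apply Chol_const.
Qed.

Lemma Ccont_dFom_0 : Ccont dFom (RtoC 0).
Proof.
  apply Ccont_eps. intros eps He. exists (Rmin (1 / 10) (eps / 10000)). split; [apply Rmin_pos; lra|].
  intros w Hw. replace (w - 0)%C with w in Hw by ring.
  assert (M1 := Rmin_l (1/10) (eps / 10000)). assert (M2 := Rmin_r (1/10) (eps / 10000)).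
  assert (E0 : dFom (RtoC 0) = RtoC 0) by (unfold dFom; destruct (Ceq_dec 0 0) as [e|e]; [reflexivity|contradiction e; reflexivity]).
  rewrite E0. replace (dFom w - 0)%C with (dFom w) by ring.
  destruct (Ceq_dec w 0) as [->|H0]; [rewrite E0, Cmod_0; auto|].
  rewrite dFom_nz by auto. assert (P := proj1 (Cmod_gt_0 w) H0).
  set (m := Cmod w) in *. set (h := half w).
  assert (Ew : w = (RtoC 2 * h)%C).
  { unfold h. destruct w as [x y]. unfold half. apply injective_projections; simpl; field. }
  assert (Hh : Cmod h = m / 2).
  { unfold m. rewrite Ew, Cmod_mult, Cmod_R, Rabs_pos_eq by lra. field. }
  assert (B1 := Csinh_3_bound h ltac:(lra)). assert (B2 := Ccosh_2_bound h ltac:(lra)).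
  rewrite Hh in B1, B2.
  assert (S1 : m / 4 <= Cmod (Csinh h)).
  { generalize (Cmod_lip (Csinh h) h). rewrite Hh. intros A. apply Rabs_le_between in A.
    assert (40 * (m / 2 * (m / 2) * (m / 2)) <= m / 4).
    { replace (40 * (m / 2 * (m / 2) * (m / 2))) with (5 * (m * m) * m) by field.
      assert (m * m <= 1 / 100) by nra. nra. }
    lra. }
  assert (N1 : Cmod (RtoC 2 * Csinh h - w * Ccosh h) <= 20 * (m * m * m)).
  { replace (RtoC 2 * Csinh h - w * Ccosh h)%C with (RtoC 2 * (Csinh h - h) + - (w * (Ccosh h - 1)))%C
      by (rewrite Ew; ring).
    eapply Rle_trans; [apply Cmod_triangle|]. rewrite Cmod_opp, !Cmod_mult, Cmod_R, Rabs_pos_eq by lra. fold m.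
    assert (m * Cmod (Ccosh h - 1) <= m * (20 * (m / 2 * (m / 2)))) by (apply Rmult_le_compat_l; lra). nra. }
  assert (SN : Csinh h <> 0) by (apply Cmod_nz; lra).
  rewrite Cmod_div by (apply Cmult_neq_0; [apply C2_nz|apply Cpow_nz; auto]).
  rewrite !Cmod_mult, Cmod_R, Rabs_pos_eq, Cmod_pow by lra. fold m.
  apply Rle_lt_trans with (m * (20 * (m * m * m)) / (2 * (m / 4) ^ 3)).
  - apply Rmult_le_compat.
    + apply Rmult_le_pos; [lra|apply Cmod_ge_0].
    + left. apply Rinv_0_lt_compat. apply Rmult_lt_0_compat; [lra|apply pow_lt; lra].
    + apply Rmult_le_compat_l; lra.
    + apply Rinv_le_contravar; [apply Rmult_lt_0_compat; [lra|apply pow_lt; lra]|].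
      apply Rmult_le_compat_l; [lra|]. apply pow_incr; lra.
  - replace (m * (20 * (m * m * m)) / (2 * (m / 4) ^ 3)) with (640 * m) by (field; lra). lra.
Qed.

Lemma Csinh_half_nz u v : 0 <= u -> 0 <= v < 2 * PI -> (u, v) <> RtoC 0 -> Csinh (half (u, v)) <> 0.
Proof.
  intros Hu Hv H E. unfold half in E; simpl in E.
  destruct (Csinh_zero (u / 2) (v / 2)) as [E1 E2]; auto; try lra.
  apply H. replace u with 0 by lra. replace v with 0 by lra. reflexivity.
Qed.

Definition pom (w : C) : C := (Csinhc w - 1)%C.

(** The right and the top side of [[0, 10] x [0, eta1]]; the top side starts at the saddle point. *)
Definition Gom : contour := [(RtoC 1, (10, 0), Ci, 0, eta1); ((- (1))%C, (0, eta1), RtoC 1, 0, 10)].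

Lemma eta1_num : 3 < eta1 < 5.
Proof. generalize (proj1 eta1_spec) PI_bounds. lra. Qed.

Lemma Gom_oriented : oriented Gom.
Proof. generalize eta1_num. simpl. lra. Qed.

Lemma on_Gom (w : C) : on Gom w ->
  (exists v, 0 <= v <= eta1 /\ w = (10, v)) \/ (exists u, 0 <= u <= 10 /\ w = (u, eta1)).
Proof.
  intros [[t [Ht ->]]|[[t [Ht ->]]|[]]].
  - left. exists t. split; auto. apply (vpt 10 t).
  - right. exists t. split; auto. apply (hpt eta1 t).
Qed.

Lemma Gom_quadrant (w : C) : on Gom w -> exists u v, w = (u, v) /\ 0 <= u <= 10 /\ 0 <= v <= eta1 /\ 0 < u + v.
Proof.
  intros H. generalize eta1_num. intros He. destruct (on_Gom w H) as [[v [Hv ->]]|[u [Hu ->]]].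
  - exists 10, v. repeat split; auto; lra.
  - exists u, eta1. repeat split; auto; lra.
Qed.

Lemma pair_nz (u v : R) : 0 <= u -> 0 <= v -> 0 < u + v -> (u, v) <> RtoC 0.
Proof. intros Hu Hv H E. assert (A := f_equal Re E). assert (B := f_equal Im E). simpl in A, B. lra. Qed.

Lemma Csinhc_re u v : 0 < v -> Re (Csinhc (u, v)) = (sinh u * cos v * u + cosh u * sin v * v) / (u ^ 2 + v ^ 2).
Proof.
  intros Hv. rewrite Csinhc_nz by (intros E; apply (f_equal Im) in E; simpl in E; lra).
  unfold Csinh; simpl. field. nra.
Qed.

(** On the horizontal line through the saddle point [i eta1] the real part of [sinh w / w] is at
    most its value [omega1] there. *)
Lemma Gom_far (w : C) : on Gom w -> 1 - omega1 <= Cmod (pom w).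
Proof.
  intros H. assert (He := eta1_num). assert (Ho := omega1_bounds). destruct (on_Gom w H) as [[v [Hv ->]]|[u [Hu ->]]].
  - assert (Hw : (10, v) <> RtoC 0) by (apply pair_nz; lra).
    assert (S1 : 176 <= Cmod (Csinh (10, v))).
    { assert (M := Cmod_Csinh_sqr 10 v). assert (P := Cmod_ge_0 (Csinh (10, v))).
      assert (sinh 10 >= 176) by (generalize (sinh_2_ge 10 ltac:(lra)); lra).
      apply Rnot_lt_le. intros Hlt. assert (0 <= sin v ^ 2) by apply pow2_ge_0. nra. }
    assert (S2 : Cmod (10, v) <= 15).
    { eapply Rle_trans; [apply Cmod_le_sum|]. simpl. rewrite !Rabs_pos_eq by lra. lra. }
    assert (S3 : 11 <= Cmod (Csinhc (10, v))).
    { rewrite Csinhc_nz, Cmod_div by auto. assert (P := proj1 (Cmod_gt_0 _) Hw).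
      apply Rmult_le_reg_r with (Cmod (10, v)); auto. unfold Rdiv.
      rewrite Rmult_assoc, Rinv_l, Rmult_1_r by lra. lra. }
    unfold pom. generalize (Cmod_lip (Csinhc (10, v)) (Csinhc (10, v) - 1)).
    replace (Csinhc (10, v) - (Csinhc (10, v) - 1))%C with (RtoC 1) by ring.
    rewrite Cmod_1. intros A. apply Rabs_le_between in A. lra.
  - apply Rle_trans with (- Re (pom (u, eta1))).
    + unfold pom. rewrite re_minus, re_RtoC. rewrite Csinhc_re by lra. rewrite eta1_sin.
      rewrite omega1_cos in *. set (c := cos eta1) in *.
      assert (A1 : u * u <= sinh u * u).
      { apply Rmult_le_compat_r; [lra|]. destruct (Req_dec u 0) as [->|]; [rewrite sinh_0; lra|].
        left; apply sinh_gt; lra. }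
      assert (A2 := cosh_ge_1 u).
      assert (D : 0 < u ^ 2 + eta1 ^ 2) by nra.
      assert ((sinh u * c * u + cosh u * (eta1 * c) * eta1) / (u ^ 2 + eta1 ^ 2) <= c); [|lra].
      apply Rmult_le_reg_r with (u ^ 2 + eta1 ^ 2); auto.
      unfold Rdiv. rewrite Rmult_assoc, Rinv_l, Rmult_1_r by lra.
      assert (u ^ 2 + eta1 ^ 2 <= sinh u * u + cosh u * (eta1 * eta1)) by nra. nra.
    + eapply Rle_trans; [|apply Re_le_Cmod]. rewrite <- Rabs_Ropp. apply Rle_abs.
Qed.

Lemma dFom_hol u v : 0 <= u -> 0 <= v <= eta1 -> (u, v) <> RtoC 0 -> Chol dFom (u, v).
Proof.
  intros Hu Hv H. generalize eta1_num PI_bounds. intros.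
  apply Chol_dFom; auto. apply Csinh_half_nz; auto; lra.
Qed.
Lemma dFom_cont u v : 0 <= u -> 0 <= v <= eta1 -> Ccont dFom (u, v).
Proof.
  intros Hu Hv. destruct (Ceq_dec (u, v) (RtoC 0)) as [->|H]; [apply Ccont_dFom_0|].
  apply Chol_cont, dFom_hol; auto.
Qed.
Lemma pom_cont w : Ccont pom w.
Proof. unfold pom. apply (Ccont_minus_c Csinhc (RtoC 1)), Ccont_Csinhc. Qed.
Lemma pom_hol (w : C) : w <> 0 -> Chol pom w.
Proof. intros. apply Chol_minus; [apply Chol_Csinhc; auto|apply Chol_const]. Qed.

Definition kh_om (t : R) : R := t * (2 * sinh (t / 2) - t * cosh (t / 2)) / (2 * sinh (t / 2) ^ 3).
Definition kt_om (v : R) : R := v * (2 * sin (v / 2) - v * cos (v / 2)) / (2 * sin (v / 2) ^ 3).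

Lemma dFom_real t : 0 < t -> dFom (t, 0) = (kh_om t, 0).
Proof.
  intros Ht. rewrite dFom_nz by (apply pair_nz; lra). unfold half, Csinh, Ccosh, kh_om; simpl.
  replace (0 / 2) with 0 by field. rewrite cos_0, sin_0. assert (P := sinh_pos (t / 2) ltac:(lra)).
  apply injective_projections; simpl; field; repeat split; try lra; try nra.
Qed.
Lemma dFom_imag v : 0 < v < 2 * PI -> dFom (0, v) = (0, - kt_om v).
Proof.
  intros Hv. rewrite dFom_nz by (apply pair_nz; lra). unfold half, Csinh, Ccosh, kt_om; simpl.
  replace (0 / 2) with 0 by field. rewrite cosh_0, sinh_0.
  assert (P := sin_gt_0 (v / 2) ltac:(lra) ltac:(lra)).
  apply injective_projections; simpl; field; repeat split; try lra; try nra.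
Qed.
Lemma dFom_00 : dFom (0, 0) = (0, 0).
Proof. unfold dFom. destruct (Ceq_dec (0, 0) 0) as [e|e]; [reflexivity|contradiction e; reflexivity]. Qed.

Lemma cauchy_om y : Rabs y < 1 -> exists e1, 0 < e1 /\ forall e, 0 < e < e1 ->
  (cint (fun w => dFom w / (pom w - below y e)) Gom
   + seg (fun w => dFom w / (pom w - below y e)) (0, 0) 1 0 10
   - seg (fun w => dFom w / (pom w - below y e)) (0, 0) Ci 0 eta1)%C = 0.
Proof.
  intros Hy. apply Rabs_lt_between in Hy. exists (1 + y). split; [lra|]. intros e He.
  assert (He1 := eta1_num). assert (Hs := proj1 eta1_spec). assert (HP := PI_bounds).
  set (Phi := fun w => (dFom w / (pom w - below y e))%C).
  assert (Hnz : forall u v, 0 <= u -> 0 <= v <= eta1 -> (pom (u, v) - below y e)%C <> 0).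
  { intros u v Hu Hv E. apply (no_crossing u v (1 + y) e Hu); try lra.
    replace (Csinhc (u, v)) with ((pom (u, v) - below y e) + (below y e + 1))%C by (unfold pom; ring).
    rewrite E. unfold below. apply injective_projections; simpl; ring. }
  assert (H0 : rint Phi 0 10 0 eta1 = 0).
  { apply goursat_corner; try lra.
    - intros [u v] [Hu Hv] Hne. simpl in Hu, Hv. apply Chol_div; auto.
      + apply Hnz; lra.
      + apply dFom_hol; try lra. exact Hne.
      + apply (Chol_minus pom (fun _ => below y e)); [apply pom_hol; exact Hne|apply Chol_const].
    - apply Ccont_div; [apply Hnz; lra|apply dFom_cont; lra|apply Ccont_minus_c, pom_cont]. }
  rewrite <- H0. unfold rint. simpl cint. ring.
Qed.

Definition Eom : nat -> R := bcoef dFom pom Gom.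

Lemma Gom_dFom_cont w : on Gom w -> Ccont dFom w.
Proof. intros H. destruct (Gom_quadrant w H) as (u & v & -> & Hu & Hv & _). apply dFom_cont; lra. Qed.

Lemma Eom_bound : exists M, 0 <= M /\ forall m, Rabs (Eom m) <= M * / (1 - omega1) ^ m.
Proof.
  assert (Ho := omega1_bounds).
  apply (bcoef_bound dFom pom Gom 1 (1 - omega1) Gom_oriented ltac:(lra) Gom_dFom_cont (fun w _ => pom_cont w) Gom_far).
Qed.

Lemma pom_real t : 0 <= t -> pom (t, 0) = (sinhc t - 1, 0).
Proof. intros. unfold pom. rewrite Csinhc_real by auto. apply injective_projections; simpl; ring. Qed.
Lemma pom_imag v : 0 <= v -> pom (0, v) = (sinc v - 1, 0).
Proof. intros. unfold pom. rewrite Csinhc_imag by auto. apply injective_projections; simpl; ring. Qed.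

Lemma HRom t : 0 <= t <= 10 -> Ccont dFom (t, 0) /\ Ccont pom (t, 0) /\ Im (dFom (t, 0)) = 0 /\ Im (pom (t, 0)) = 0.
Proof.
  intros Ht. assert (He := eta1_num). repeat split; [apply dFom_cont; lra|apply pom_cont| |rewrite pom_real by lra; auto].
  destruct (Req_dec t 0) as [->|]; [rewrite dFom_00; auto|]. rewrite dFom_real by lra. auto.
Qed.
Lemma HIom v : 0 <= v <= eta1 -> Ccont dFom (0, v) /\ Ccont pom (0, v) /\ Re (dFom (0, v)) = 0 /\ Im (pom (0, v)) = 0.
Proof.
  intros Ht. assert (He := eta1_num). assert (HP := PI_bounds). repeat split; [apply dFom_cont; lra|apply pom_cont| |rewrite pom_imag by lra; auto].
  destruct (Req_dec v 0) as [->|]; [rewrite dFom_00; auto|]. rewrite dFom_imag by lra. auto.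
Qed.

Lemma ext_near (f g : R -> R) (t l : R) : 0 < t -> (forall s, 0 < s -> f s = g s) -> is_derive f t l -> is_derive g t l.
Proof.
  intros Ht E H. apply (is_derive_ext_loc f g); auto. exists (mkposreal t Ht). intros s Hs.
  apply Rabs_lt_between' in Hs. simpl in Hs. apply E. lra.
Qed.

Lemma Hphi_om t : 0 < t < 10 -> is_derive (fun t => Re (pom (t, 0))) t (Nh t / t ^ 2) /\
  continuous (fun t => Nh t / t ^ 2) t /\ 0 < Nh t / t ^ 2.
Proof.
  intros Ht. split; [|split].
  - apply (ext_near (fun t => sinhc t - 1) (fun t => Re (pom (t, 0))) t (Nh t / t ^ 2)); [lra|intros; rewrite pom_real by lra; auto|].
    evar_last; [apply (is_derive_minus sinhc (fun _ => 1)); [apply is_derive_sinhc; lra|apply (is_derive_const 1)]|].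
    unfold minus, plus, opp, zero; simpl; ring.
  - apply (continuous_smooth (fun t => Nh t / t ^ 2)). eexists. apply (is_derive_div Nh (fun t => t ^ 2)); [apply Nh_derive|apply (is_derive_pow (fun x => x) 2), is_derive_id|].
    apply pow_nonzero; lra.
  - apply Rdiv_lt_0_compat; [apply Nh_pos; lra|apply pow_lt; lra].
Qed.

Lemma Nt_pos_eta v : 0 < v < eta1 -> 0 < Nt v.
Proof.
  intros Hv. destruct (Rle_lt_dec v PI); [apply Nt_pos; lra|].
  rewrite <- (proj2 eta1_spec). apply Nt_decr; try lra. generalize (proj1 eta1_spec); lra.
Qed.

Lemma Hpsi_om v : 0 < v < eta1 -> is_derive (fun v => Re (pom (0, v))) v (- Nt v / v ^ 2) /\
  continuous (fun v => - Nt v / v ^ 2) v /\ - Nt v / v ^ 2 < 0.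
Proof.
  intros Hv. split; [|split].
  - apply (ext_near (fun t => sinc t - 1) (fun v => Re (pom (0, v))) v (- Nt v / v ^ 2)); [lra|intros; rewrite pom_imag by lra; auto|].
    evar_last; [apply (is_derive_minus sinc (fun _ => 1)); [apply is_derive_sinc; lra|apply (is_derive_const 1)]|].
    unfold minus, plus, opp, zero; simpl; ring.
  - apply (continuous_smooth (fun v => - Nt v / v ^ 2)). eexists. apply (is_derive_div (fun v => - Nt v) (fun v => v ^ 2)); [apply (is_derive_opp Nt), Nt_derive|apply (is_derive_pow (fun x => x) 2), is_derive_id|].
    apply pow_nonzero; lra.
  - assert (0 < Nt v / v ^ 2) by (apply Rdiv_lt_0_compat; [apply Nt_pos_eta; lra|apply pow_lt; lra]).
    unfold Rdiv in *. rewrite <- Ropp_mult_distr_l. lra.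
Qed.

Lemma Eom_real t : 0 < t < 10 -> Rabs (sinhc t - 1) < 1 -> is_pseries Eom (sinhc t - 1) (kh_om t / (Nh t / t ^ 2)).
Proof.
  intros Ht Hx. assert (Ho := omega1_bounds). assert (He := eta1_num).
  assert (H := bcoef_real dFom pom Gom 1 (1 - omega1) 10 eta1 (fun t => Nh t / t ^ 2) (fun v => - Nt v / v ^ 2)
    Gom_oriented ltac:(lra) Gom_dFom_cont (fun w _ => pom_cont w) Gom_far ltac:(lra) ltac:(lra) HRom HIom Hphi_om Hpsi_om cauchy_om t Ht).
  cbv beta zeta in H; rewrite pom_real, dFom_real in H by lra. apply H. exact Hx.
Qed.
Lemma Eom_imag v : 0 < v < eta1 -> Rabs (sinc v - 1) < 1 -> is_pseries Eom (sinc v - 1) (kt_om v / (- Nt v / v ^ 2)).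
Proof.
  intros Hv Hx. assert (Ho := omega1_bounds). assert (He := eta1_num). assert (HP := PI_bounds). assert (Hs := proj1 eta1_spec).
  assert (H := bcoef_imag dFom pom Gom 1 (1 - omega1) 10 eta1 (fun t => Nh t / t ^ 2) (fun v => - Nt v / v ^ 2)
    Gom_oriented ltac:(lra) Gom_dFom_cont (fun w _ => pom_cont w) Gom_far ltac:(lra) ltac:(lra) HRom HIom Hphi_om Hpsi_om cauchy_om v Hv).
  cbv beta zeta in H; rewrite pom_imag, dFom_imag in H by lra.
  replace (kt_om v / (- Nt v / v ^ 2)) with (Im (0, - kt_om v) / - (- Nt v / v ^ 2)); [apply H; exact Hx|].
  assert (P := Nt_pos_eta v Hv). simpl. field. split; lra.
Qed.

(** ** The rate function on its two branches *)

Definition jh (t : R) : R := / 2 * t ^ 2 - t * tanh (t / 2).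
Definition jt (v : R) : R := v * tan (v / 2) - / 2 * v ^ 2.

Lemma J_BS_hyp x : 1 <= x -> J_BS x = jh (xi x).
Proof. intros. unfold J_BS. destruct (Rle_dec 1 x); [reflexivity|lra]. Qed.
Lemma J_BS_trig x : x < 1 -> J_BS x = jt (zeta x).
Proof. intros. unfold J_BS. destruct (Rle_dec 1 x); [lra|reflexivity]. Qed.

Lemma J_BS_1 : J_BS 1 = 0.
Proof.
  rewrite J_BS_hyp by lra. destruct (xi_spec 1 ltac:(lra)) as [H1 H2].
  assert (E : xi 1 = 0).
  { destruct (Req_dec (xi 1) 0); auto. generalize (sinhc_gt_1 (xi 1) ltac:(lra)). lra. }
  rewrite E. unfold jh. ring.
Qed.

Lemma sinh_2 t : sinh t = 2 * sinh (t / 2) * cosh (t / 2).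
Proof.
  unfold sinh, cosh. replace (exp t) with (exp (t / 2) * exp (t / 2)) by (rewrite <- exp_plus; f_equal; field).
  replace (exp (- t)) with (exp (- (t / 2)) * exp (- (t / 2))) by (rewrite <- exp_plus; f_equal; field). field.
Qed.
Lemma cosh_2 t : cosh t = 1 + 2 * sinh (t / 2) ^ 2.
Proof.
  unfold sinh, cosh. replace (exp t) with (exp (t / 2) * exp (t / 2)) by (rewrite <- exp_plus; f_equal; field).
  replace (exp (- t)) with (exp (- (t / 2)) * exp (- (t / 2))) by (rewrite <- exp_plus; f_equal; field).
  assert (exp (t / 2) * exp (- (t / 2)) = 1) by (rewrite <- exp_plus, Rplus_opp_r; apply exp_0). nra.
Qed.
Lemma sin_2 t : sin t = 2 * sin (t / 2) * cos (t / 2).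
Proof. replace t with (2 * (t / 2)) at 1 by field. apply sin_2a. Qed.
Lemma cos_2 t : cos t = 1 - 2 * sin (t / 2) ^ 2.
Proof. replace t with (2 * (t / 2)) at 1 by field. rewrite cos_2a_sin. ring. Qed.

Lemma is_derive_sinh_half t : is_derive (fun t => sinh (t / 2)) t (cosh (t / 2) / 2).
Proof.
  evar_last; [apply (is_derive_comp sinh (fun t => t / 2)); [apply is_derive_sinh|auto_derive; auto; reflexivity]|].
  unfold scal; simpl. unfold mult; simpl. field.
Qed.
Lemma is_derive_cosh_half t : is_derive (fun t => cosh (t / 2)) t (sinh (t / 2) / 2).
Proof.
  evar_last; [apply (is_derive_comp cosh (fun t => t / 2)); [apply is_derive_cosh|auto_derive; auto; reflexivity]|].
  unfold scal; simpl. unfold mult; simpl. field.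
Qed.

(** The derivative of the rate function with respect to [log omega] is [w tanh (w / 2)]. *)
Lemma is_derive_jh t : 0 < t -> is_derive jh t (Nh t / t ^ 2 / sinhc t * (t * tanh (t / 2))).
Proof.
  intros Ht. assert (Pc := cosh_pos (t / 2)). assert (Ps := sinh_pos (t / 2) ltac:(lra)).
  assert (Hcs := cosh_sinh (t / 2)). assert (Hd : is_derive (fun t => / 2 * t ^ 2) t t) by (auto_derive; auto; field).
  unfold jh, tanh. evar_last.
  { apply (is_derive_minus (fun t => / 2 * t ^ 2) (fun t => t * (sinh (t / 2) / cosh (t / 2)))); [exact Hd|].
    apply (is_derive_mult (fun t => t) (fun t => sinh (t / 2) / cosh (t / 2))); [apply is_derive_id| |apply Rmult_comm].
    apply (is_derive_div (fun t => sinh (t / 2)) (fun t => cosh (t / 2))); [apply is_derive_sinh_half|apply is_derive_cosh_half|lra]. }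
  rewrite sinhc_pos by auto. unfold Nh. rewrite (sinh_2 t), (cosh_2 t).
  unfold minus, plus, opp, mult, one; simpl. unfold Rdiv.
  set (s := sinh (t * / 2)) in *. set (c := cosh (t * / 2)) in *.
  change (t / 2) with (t * / 2) in *. fold s c in Pc, Ps, Hcs.
  field [Hcs]. repeat split; lra.
Qed.

Lemma is_derive_sin_half t : is_derive (fun t => sin (t / 2)) t (cos (t / 2) / 2).
Proof. auto_derive; auto. unfold Rdiv. field. Qed.
Lemma is_derive_cos_half t : is_derive (fun t => cos (t / 2)) t (- sin (t / 2) / 2).
Proof. auto_derive; auto. unfold Rdiv. field. Qed.

Lemma is_derive_jt v : 0 < v < PI -> is_derive jt v (- Nt v / v ^ 2 / sinc v * (- (v * tan (v / 2)))).
Proof.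
  intros Hv. assert (Pc := cos_gt_0 (v / 2) ltac:(lra) ltac:(lra)). assert (Ps := sin_gt_0 (v / 2) ltac:(lra) ltac:(lra)).
  assert (Hcs := sin2_cos2 (v / 2)). unfold Rsqr in Hcs.
  assert (Hd : is_derive (fun t => / 2 * t ^ 2) v v) by (auto_derive; auto; field).
  unfold jt, tan. evar_last.
  { apply (is_derive_minus (fun t => t * (sin (t / 2) / cos (t / 2))) (fun t => / 2 * t ^ 2)); [|exact Hd].
    apply (is_derive_mult (fun t => t) (fun t => sin (t / 2) / cos (t / 2))); [apply is_derive_id| |apply Rmult_comm].
    apply (is_derive_div (fun t => sin (t / 2)) (fun t => cos (t / 2))); [apply is_derive_sin_half|apply is_derive_cos_half|lra]. }
  rewrite sinc_pos by lra. unfold Nt. rewrite (sin_2 v), (cos_2 v).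
  unfold minus, plus, opp, mult, one; simpl. unfold Rdiv.
  change (v / 2) with (v * / 2) in *.
  set (s := sin (v * / 2)) in *. set (c := cos (v * / 2)) in *.
  assert (Hcs' : c * c = 1 - s * s) by lra. field [Hcs']. repeat split; lra.
Qed.

(** Adding [2 / omega ^ 2] turns [dJ / d omega = w ^ 2 / (1 + cosh w)] into [w ^ 2 / (cosh w - 1)]:
    the pole of [J] at [omega = 0] is [2 / omega]. *)
Definition Fh_om (t : R) : R := t ^ 2 / (2 * sinh (t / 2) ^ 2).
Definition Ft_om (v : R) : R := v ^ 2 / (2 * sin (v / 2) ^ 2).

Lemma is_derive_Fh_om t : 0 < t -> is_derive Fh_om t (kh_om t).
Proof.
  intros Ht. assert (Ps := sinh_pos (t / 2) ltac:(lra)). unfold Fh_om, kh_om. evar_last.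
  { apply (is_derive_div (fun t => t ^ 2) (fun t => 2 * sinh (t / 2) ^ 2)).
    - apply (is_derive_pow (fun t => t) 2), is_derive_id.
    - apply is_derive_scal, (is_derive_pow (fun t => sinh (t / 2)) 2), is_derive_sinh_half.
    - assert (0 < sinh (t / 2) ^ 2) by (apply pow_lt; auto). lra. }
  unfold mult, one; simpl. field. lra.
Qed.
Lemma is_derive_Ft_om v : 0 < v < 2 * PI -> is_derive Ft_om v (kt_om v).
Proof.
  intros Hv. assert (Ps := sin_gt_0 (v / 2) ltac:(lra) ltac:(lra)). unfold Ft_om, kt_om. evar_last.
  { apply (is_derive_div (fun t => t ^ 2) (fun t => 2 * sin (t / 2) ^ 2)).
    - apply (is_derive_pow (fun t => t) 2), is_derive_id.
    - apply is_derive_scal, (is_derive_pow (fun t => sin (t / 2)) 2), is_derive_sin_half.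
    - assert (0 < sin (v / 2) ^ 2) by (apply pow_lt; auto). lra. }
  unfold mult, one; simpl. field. lra.
Qed.

Lemma at_right_half : filterlim (fun t => t / 2) (at_right 0) (at_right 0).
Proof.
  intros P [d Hd]. exists d. intros y Hy Hy0. apply Hd; [|lra].
  apply Rabs_lt_between' in Hy. apply Rabs_lt_between'. simpl in *. lra.
Qed.

Lemma F_lim (f g : R -> R) : filterlim f (at_right 0) (locally 1) ->
  (forall t, 0 < t -> g t = 2 / f (t / 2) ^ 2) -> filterlim g (at_right 0) (locally 2).
Proof.
  intros Hf E. apply (filterlim_ext_loc (fun t => 2 / f (t / 2) ^ 2)).
  { exists (mkposreal 1 Rlt_0_1). intros t _ Ht. symmetry. apply E. auto. }
  replace (locally 2) with (locally (2 / 1 ^ 2)) by (f_equal; field).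
  apply (filterlim_comp _ _ _ (fun t => f (t / 2)) (fun x => 2 / x ^ 2) _ (locally 1)).
  - apply (filterlim_comp _ _ _ _ f _ (at_right 0)); [apply at_right_half|exact Hf].
  - apply (continuous_smooth (fun x => 2 / x ^ 2)). auto_derive. lra.
Qed.

Lemma Fh_om_lim : filterlim Fh_om (at_right 0) (locally 2).
Proof.
  apply (F_lim sinhc); [apply sinhc_lim|]. intros t Ht. rewrite sinhc_pos by lra. unfold Fh_om.
  assert (Ps := sinh_pos (t / 2) ltac:(lra)). field. lra.
Qed.
Lemma Ft_om_lim : filterlim Ft_om (at_right 0) (locally 2).
Proof.
  apply (F_lim sinc); [apply sinc_lim|]. intros t Ht. rewrite sinc_pos by lra. unfold Ft_om.
  destruct (Req_dec (sin (t / 2)) 0) as [E|E].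
  - rewrite E. unfold Rdiv. rewrite !pow_i by lia. rewrite !Rmult_0_r, !Rmult_0_l, Rinv_0, pow_i by lia. rewrite !Rinv_0. ring.
  - field. lra.
Qed.

Lemma is_derive_inv2 (phi : R -> R) t l : is_derive phi t l -> 1 + phi t <> 0 ->
  is_derive (fun t => 2 / (1 + phi t) - 2) t (- 2 * l / (1 + phi t) ^ 2).
Proof.
  intros H H0. evar_last.
  { apply (is_derive_comp (fun x => 2 / (1 + x) - 2) phi); [|exact H]. auto_derive; [exact H0|reflexivity]. }
  unfold scal; simpl. unfold mult; simpl. field. auto.
Qed.

Lemma lim_minus1 (f : R -> R) : filterlim f (at_right 0) (locally 1) -> filterlim (fun t => f t - 1) (at_right 0) (locally 0).
Proof.
  intros H. replace (locally 0) with (locally (1 - 1)) by (f_equal; ring).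
  apply (filterlim_comp _ _ _ f (fun x => x - 1) _ (locally 1)); auto.
  apply (continuous_smooth (fun x => x - 1)). auto_derive; auto.
Qed.

Lemma lim_at_0 (f : R -> R) : ex_derive f 0 -> filterlim f (at_right 0) (locally (f 0)).
Proof. intros H P HP. apply (filter_le_within (F := locally 0)). exact (continuous_smooth f 0 H P HP). Qed.

Lemma jh_lim : filterlim jh (at_right 0) (locally 0).
Proof.
  replace (locally 0) with (locally (jh 0)) by (f_equal; unfold jh; ring). apply lim_at_0. unfold jh, tanh.
  apply (ex_derive_minus (fun t => / 2 * t ^ 2)); [auto_derive; auto|].
  apply (ex_derive_mult (fun t => t)); [apply ex_derive_id|].
  apply (ex_derive_div (fun t => sinh (t / 2))); [eexists; apply is_derive_sinh_half|eexists; apply is_derive_cosh_half|].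
  apply Rgt_not_eq, cosh_pos.
Qed.
Lemma jt_lim : filterlim jt (at_right 0) (locally 0).
Proof.
  replace (locally 0) with (locally (jt 0)) by (f_equal; unfold jt; ring). apply lim_at_0. unfold jt, tan.
  auto_derive. repeat split; auto. rewrite Rmult_0_l, cos_0. lra.
Qed.

Lemma jh_series t : 0 < t -> sinhc t < 2 ->
  jh t = PSeries (integrate2 Eom) (sinhc t - 1) + 2 * (sinhc t - 1) + 2 / sinhc t - 2.
Proof.
  intros Ht Hs. destruct Eom_bound as [M [HM0 HM]]. assert (Ho := omega1_bounds).
  assert (H10 : 2 < sinhc 10).
  { rewrite sinhc_pos by lra. generalize (sinh_2_ge 10 ltac:(lra)). lra. }
  assert (Hlt10 : t < 10).
  { apply Rnot_le_lt. intros Hle. destruct (Req_dec t 10) as [->|]; [lra|].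
    generalize (sinhc_incr 10 t ltac:(lra) ltac:(lra)). lra. }
  assert (K : jh t - (2 / (1 + (sinhc t - 1)) - 2) = PSeries (integrate2 Eom) (sinhc t - 1) + 2 * (sinhc t - 1)).
  2: { replace (1 + (sinhc t - 1)) with (sinhc t) in K by ring. lra. }
  set (T := (t + Rmin 10 (xi 2)) / 2).
  assert (Ht2 : t < xi 2).
  { destruct (xi_spec 2 ltac:(lra)) as [X1 X2]. apply Rnot_le_lt. intros Hle.
    destruct (Req_dec t (xi 2)) as [E|]; [rewrite E, X2 in Hs; lra|]. generalize (sinhc_incr (xi 2) t ltac:(lra) ltac:(lra)). lra. }
  assert (Hm : t < Rmin 10 (xi 2)) by (apply Rmin_glb_lt; auto).
  assert (HT : forall s, 0 < s < T -> s < 10 /\ 0 < sinhc s - 1 < 1).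
  { intros s Hs'. generalize (Rmin_l 10 (xi 2)) (Rmin_r 10 (xi 2)). intros A B.
    destruct (xi_spec 2 ltac:(lra)) as [X1 X2]. unfold T in Hs'.
    generalize (sinhc_gt_1 s ltac:(lra)) (sinhc_incr s (xi 2) ltac:(lra) ltac:(lra)). lra. }
  apply (double_integral Eom (1 - omega1) M (fun t => sinhc t - 1) (fun t => Nh t / t ^ 2) Fh_om kh_om
    (fun t => jh t - (2 / (1 + (sinhc t - 1)) - 2)) 2 T); auto; try lra.
  - intros s Hs'. destruct (HT s Hs') as [B1 B2].
    assert (Pn := Nh_pos s ltac:(lra)). assert (P2 := pow_lt s 2 ltac:(lra)).
    assert (D1 : is_derive (fun t => sinhc t - 1) s (Nh s / s ^ 2)).
    { evar_last; [apply (is_derive_minus sinhc (fun _ => 1)); [apply is_derive_sinhc; lra|apply (is_derive_const 1)]|].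
      unfold minus, plus, opp, zero; simpl; ring. }
    split; [exact D1|]. split; [apply Rgt_not_eq, Rdiv_lt_0_compat; lra|].
    split; [rewrite Rabs_pos_eq; lra|]. split; [apply is_derive_Fh_om; lra|].
    split; [apply Eom_real; [lra|rewrite Rabs_pos_eq; lra]|].
    evar_last.
    { apply (is_derive_minus jh); [apply is_derive_jh; lra|apply is_derive_inv2; [exact D1|lra]]. }
    cbv beta. replace (1 + (sinhc s - 1)) with (sinhc s) by ring. rewrite sinhc_pos by lra.
    assert (Ps := sinh_pos (s / 2) ltac:(lra)). assert (Pc := cosh_pos (s / 2)). assert (Hcs := cosh_sinh (s / 2)).
    unfold Fh_om, tanh. rewrite (sinh_2 s). unfold minus, plus, opp; simpl.
    set (a := sinh (s / 2)) in *. set (c := cosh (s / 2)) in *.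
    field [Hcs]. repeat split; lra.
  - apply lim_minus1, sinhc_lim.
  - apply Fh_om_lim.
  - replace (locally 0) with (locally (0 - (2 / (1 + 0) - 2))) by (f_equal; field).
    apply (filterlim_comp_2 (H := locally (- (2 / (1 + 0) - 2))) _ _ Rplus jh_lim); [|apply (filterlim_plus (V := R_NormedModule))].
    apply (filterlim_comp _ _ _ (fun t => sinhc t - 1) (fun x => - (2 / (1 + x) - 2)) _ (locally 0)); [apply lim_minus1, sinhc_lim|].
    apply (continuous_smooth (fun x => - (2 / (1 + x) - 2))). auto_derive. lra.
  - unfold T. lra.
Qed.

Lemma jt_series t : 0 < t < PI ->
  jt t = PSeries (integrate2 Eom) (sinc t - 1) + 2 * (sinc t - 1) + 2 / sinc t - 2.
Proof.
  intros Ht. destruct Eom_bound as [M [HM0 HM]]. assert (Ho := omega1_bounds). assert (He := proj1 eta1_spec).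
  assert (K : jt t - (2 / (1 + (sinc t - 1)) - 2) = PSeries (integrate2 Eom) (sinc t - 1) + 2 * (sinc t - 1)).
  2: { replace (1 + (sinc t - 1)) with (sinc t) in K by ring. lra. }
  assert (HT : forall s, 0 < s < PI -> -1 < sinc s - 1 < 0).
  { intros s Hs. generalize (sinc_decr 0 s ltac:(lra) ltac:(lra) ltac:(lra)) (sinc_decr s PI ltac:(lra) ltac:(lra) ltac:(lra)).
    rewrite sinc_0, (sinc_pos PI), sin_PI by lra. lra. }
  apply (double_integral Eom (1 - omega1) M (fun t => sinc t - 1) (fun t => - Nt t / t ^ 2) Ft_om kt_om
    (fun t => jt t - (2 / (1 + (sinc t - 1)) - 2)) 2 PI); auto; try lra.
  - intros s Hs'. assert (B2 := HT s Hs').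
    assert (Pn := Nt_pos s ltac:(lra)). assert (P2 := pow_lt s 2 ltac:(lra)).
    assert (D1 : is_derive (fun t => sinc t - 1) s (- Nt s / s ^ 2)).
    { evar_last; [apply (is_derive_minus sinc (fun _ => 1)); [apply is_derive_sinc; lra|apply (is_derive_const 1)]|].
      unfold minus, plus, opp, zero; simpl; ring. }
    split; [exact D1|]. split.
    { assert (0 < Nt s / s ^ 2) by (apply Rdiv_lt_0_compat; lra). unfold Rdiv in *. rewrite <- Ropp_mult_distr_l. lra. }
    split; [rewrite Rabs_left; lra|]. split; [apply is_derive_Ft_om; lra|].
    split; [apply Eom_imag; [lra|rewrite Rabs_left; lra]|].
    evar_last.
    { apply (is_derive_minus jt); [apply is_derive_jt; lra|apply is_derive_inv2; [exact D1|lra]]. }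
    cbv beta. replace (1 + (sinc s - 1)) with (sinc s) by ring. rewrite sinc_pos by lra.
    assert (Ps := sin_gt_0 (s / 2) ltac:(lra) ltac:(lra)). assert (Pc := cos_gt_0 (s / 2) ltac:(lra) ltac:(lra)).
    assert (Hcs := sin2_cos2 (s / 2)). unfold Rsqr in Hcs.
    unfold Ft_om, tan. rewrite (sin_2 s). unfold minus, plus, opp; simpl.
    set (a := sin (s / 2)) in *. set (c := cos (s / 2)) in *.
    assert (Hcs' : c * c = 1 - a * a) by lra. field [Hcs']. repeat split; lra.
  - apply lim_minus1, sinc_lim.
  - apply Ft_om_lim.
  - replace (locally 0) with (locally (0 - (2 / (1 + 0) - 2))) by (f_equal; field).
    apply (filterlim_comp_2 (H := locally (- (2 / (1 + 0) - 2))) _ _ Rplus jt_lim); [|apply (filterlim_plus (V := R_NormedModule))].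
    apply (filterlim_comp _ _ _ (fun t => sinc t - 1) (fun x => - (2 / (1 + x) - 2)) _ (locally 0)); [apply lim_minus1, sinc_lim|].
    apply (continuous_smooth (fun x => - (2 / (1 + x) - 2))). auto_derive. lra.
Qed.

Lemma J_BS_formula x : 0 < x < 2 -> J_BS x = PSeries (integrate2 Eom) (x - 1) + 2 * (x - 1) + 2 / x - 2.
Proof.
  intros Hx. destruct (Rtotal_order x 1) as [H|[->|H]].
  - rewrite J_BS_trig by auto. rewrite jt_series by (apply zeta_range; lra).
    rewrite (proj2 (zeta_spec x ltac:(lra))). reflexivity.
  - rewrite J_BS_1. replace (1 - 1) with 0 by ring. rewrite PSeries_0. unfold integrate2. field.
  - rewrite J_BS_hyp by lra. destruct (xi_spec x ltac:(lra)) as [X1 X2].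
    rewrite jh_series, X2; [reflexivity|apply xi_pos; lra|lra].
Qed.

(** * Taylor coefficients from a convergent expansion *)

Lemma taylor_coef_pseries (f : R -> R) (a : nat -> R) (x0 r : R) : 0 < r -> Rbar_lt 0 (CV_radius a) ->
  (forall x, Rabs (x - x0) < r -> is_pseries a (x - x0) (f x)) -> forall n, taylor_coef f x0 n = a n.
Proof.
  intros Hr Hcv H n. unfold taylor_coef.
  rewrite (Derive_n_ext_loc f (fun x => PSeries a (x + - x0))).
  - rewrite Derive_n_comp_trans. replace (x0 + - x0) with 0 by ring. rewrite Derive_n_coef by auto.
    field. apply INR_fact_neq_0.
  - exists (mkposreal r Hr). intros x Hx. symmetry. apply is_pseries_unique. apply H. exact Hx.
Qed.

Lemma is_pseries_deg1 (p0 p1 : R) x :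
  is_pseries (fun n => match n with O => p0 | S O => p1 | _ => 0 end) x (p0 + p1 * x).
Proof.
  apply is_pseries_R. unfold is_series.
  apply (filterlim_ext_loc (fun _ => p0 + p1 * x)); [|apply filterlim_const].
  exists 1%nat. intros N HN. induction N as [|N IH]; [lia|]. destruct N as [|N].
  - rewrite sum_Sn, sum_O. unfold plus; simpl. ring.
  - rewrite sum_Sn, <- IH by lia. unfold plus; simpl. ring.
Qed.

Lemma is_pseries_geom x : Rabs x < 1 -> is_pseries (fun n => 2 * (-1) ^ n) x (2 / (1 + x)).
Proof.
  intros Hx. apply is_pseries_R.
  assert (H : is_series (fun n => (- x) ^ n) (/ (1 - - x))) by (apply is_series_geom; rewrite Rabs_Ropp; auto).
  apply (is_series_scal 2) in H.
  replace (2 / (1 + x)) with (scal 2 (/ (1 - - x))).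
  - eapply is_series_ext; [|exact H]. intros n. unfold scal; simpl. unfold mult; simpl.
    replace (- x) with (-1 * x) by ring. rewrite Rpow_mult_distr. ring.
  - unfold scal; simpl. unfold mult; simpl. unfold Rdiv. do 2 f_equal. ring.
Qed.

(** The contour integrals, then [2 (omega - 1) - 2], then the pole [2 / omega]. *)
Definition cJ_form (n : nat) : R :=
  integrate2 Eom n + (match n with O => -2 | S O => 2 | _ => 0 end) + 2 * (-1) ^ n.

Lemma cJ_form_series w : Rabs (w - 1) < 1 -> is_pseries cJ_form (w - 1) (J_BS w).
Proof.
  intros Hw. assert (Hw' := Hw). apply Rabs_lt_between in Hw'. rewrite J_BS_formula by lra.
  destruct Eom_bound as [M [HM0 HM]]. assert (Ho := omega1_bounds).
  assert (CV2 : Rbar_le (1 - omega1) (CV_radius (integrate2 Eom))) by (apply (CV_ge _ _ (M * (1 - omega1) ^ 2)); [lra|apply integrate2_bound; auto; lra]).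
  assert (A : is_pseries (integrate2 Eom) (w - 1) (PSeries (integrate2 Eom) (w - 1))).
  { apply PSeries_correct, CV_radius_inside. eapply Rbar_lt_le_trans; [|exact CV2]. simpl. lra. }
  assert (B := is_pseries_deg1 (-2) 2 (w - 1)). assert (D := is_pseries_geom (w - 1) Hw).
  assert (S1 := is_pseries_plus _ _ _ _ _ (is_pseries_plus _ _ _ _ _ A B) D).
  replace (PSeries (integrate2 Eom) (w - 1) + 2 * (w - 1) + 2 / w - 2) with
    (plus (plus (PSeries (integrate2 Eom) (w - 1)) (-2 + 2 * (w - 1))) (2 / (1 + (w - 1)))).
  - exact S1.
  - unfold plus; simpl. replace (1 + (w - 1)) with w by ring. ring.
Qed.

Lemma cJ_form_asym : exists K, forall n, (2 <= n)%nat -> Rabs (cJ_form n - (-1) ^ n * 2) <= K * / (1 - omega1) ^ n.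
Proof.
  destruct Eom_bound as [M [HM0 HM]]. assert (Ho := omega1_bounds).
  exists (M * (1 - omega1) ^ 2). intros n Hn.
  replace (cJ_form n - (-1) ^ n * 2) with (integrate2 Eom n).
  - apply integrate2_bound; [lra|exact HM].
  - unfold cJ_form. destruct n as [|[|n]]; try lia. ring.
Qed.

Lemma cJ_form_bounded : exists K, forall n, Rabs (cJ_form n) <= K.
Proof.
  destruct cJ_form_asym as [K HK]. assert (Ho := omega1_bounds).
  assert (K0 : 0 <= K).
  { specialize (HK 2%nat (Nat.le_refl _)). assert (P := pow_lt (1 - omega1) 2 ltac:(lra)).
    generalize (Rabs_pos (cJ_form 2 - (-1) ^ 2 * 2)). intros A.
    apply Rmult_le_reg_r with (/ (1 - omega1) ^ 2); [apply Rinv_0_lt_compat; auto|]. lra. }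
  exists (Rmax (Rmax (Rabs (cJ_form 0)) (Rabs (cJ_form 1))) (K + 2)). intros n.
  destruct n as [|[|n]].
  - eapply Rle_trans; [|apply Rmax_l]. apply Rmax_l.
  - eapply Rle_trans; [|apply Rmax_l]. apply Rmax_r.
  - eapply Rle_trans; [|apply Rmax_r]. set (m := S (S n)).
    replace (cJ_form m) with ((cJ_form m - (-1) ^ m * 2) + (-1) ^ m * 2) by ring.
    eapply Rle_trans; [apply Rabs_triang|]. rewrite Rabs_mult, pow_1_abs, (Rabs_pos_eq 2) by lra.
    assert (K * / (1 - omega1) ^ m <= K).
    { rewrite <- (Rmult_1_r K) at 2. apply Rmult_le_compat_l; auto. rewrite <- Rinv_1.
      apply Rinv_le_contravar; [lra|]. apply pow_R1_Rle. lra. }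
    generalize (HK m ltac:(unfold m; lia)). lra.
Qed.

(** Beyond radius [1] the coefficients would tend to [0], but their moduli tend to [2]. *)
Lemma CV_cJ_form : CV_radius cJ_form = Finite 1.
Proof.
  assert (Ho := omega1_bounds).
  apply Rbar_le_antisym.
  - apply Rbar_not_lt_le. intros Hlt.
    assert (Hex : ex_pseries cJ_form 1).
    { apply CV_radius_inside. rewrite Rabs_pos_eq by lra. exact Hlt. }
    apply ex_pseries_R in Hex. apply ex_series_lim_0 in Hex.
    destruct cJ_form_asym as [K HK].
    assert (L2 : is_lim_seq (fun n => K * (/ (1 - omega1)) ^ n) 0).
    { replace (Finite 0) with (Rbar_mult K 0) by (simpl; f_equal; ring).
      apply is_lim_seq_scal_l, is_lim_seq_geom. rewrite Rabs_pos_eq.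
      - rewrite <- Rinv_1. apply Rinv_lt_contravar; lra.
      - left; apply Rinv_0_lt_compat; lra. }
    apply is_lim_seq_spec in Hex. apply is_lim_seq_spec in L2.
    destruct (Hex (mkposreal (/2) ltac:(lra))) as [N1 H1]. destruct (L2 (mkposreal 1 ltac:(lra))) as [N2 H2].
    set (n := (N1 + N2 + 2)%nat). specialize (H1 n ltac:(unfold n; lia)). specialize (H2 n ltac:(unfold n; lia)).
    specialize (HK n ltac:(unfold n; lia)). simpl in H1, H2.
    rewrite pow1, Rmult_1_r, Rminus_0_r in H1. rewrite pow_inv, Rminus_0_r in H2.
    assert (T : Rabs ((-1) ^ n * 2) <= Rabs (cJ_form n) + Rabs (cJ_form n - (-1) ^ n * 2)).
    { replace ((-1) ^ n * 2) with (cJ_form n + - (cJ_form n - (-1) ^ n * 2)) at 1 by ring.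
      eapply Rle_trans; [apply Rabs_triang|]. rewrite Rabs_Ropp. lra. }
    rewrite Rabs_mult, pow_1_abs, (Rabs_pos_eq 2) in T by lra.
    apply Rabs_lt_between in H2. lra.
  - destruct cJ_form_bounded as [K HK]. apply (CV_ge cJ_form 1 K); [lra|].
    intros m. rewrite pow1, Rinv_1, Rmult_1_r. auto.
Qed.

Lemma cJ_coef_eq n : cJ_coef n = cJ_form n.
Proof.
  apply (taylor_coef_pseries J_BS cJ_form 1 1); [lra| |].
  - rewrite CV_cJ_form. simpl. lra.
  - intros x Hx. apply cJ_form_series; auto.
Qed.

Theorem part_i_series : CV_radius cJ_coef = Finite 1
    /\ (forall w : R, Rabs (w - 1) < 1 -> is_pseries cJ_coef (w - 1) (J_BS w)).
Proof.
  split.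
  - rewrite <- CV_cJ_form. apply CV_radius_ext. apply cJ_coef_eq.
  - intros w Hw. eapply is_pseries_ext; [|apply cJ_form_series; auto]. intros n. symmetry. apply cJ_coef_eq.
Qed.

Theorem part_i_asym : is_bigO eventually (fun n : nat => cJ_coef n - (-1) ^ n * 2) (fun n : nat => / (1 - omega1) ^ n).
Proof.
  destruct cJ_form_asym as [K HK]. assert (Ho := omega1_bounds). exists K, 2%nat. intros n Hn.
  rewrite cJ_coef_eq, (Rabs_pos_eq (/ _)); [apply HK; auto|].
  left. apply Rinv_0_lt_compat, pow_lt. lra.
Qed.

(** * The first terms of the expansions *)

(** Boundedness on the cube [|T| <= 1, |a| <= 3, |b| <= 3]; it passes to polynomials. *)
Definition bdd (f : R -> R -> R -> R) : Prop :=
  exists K, forall T a b, Rabs T <= 1 -> Rabs a <= 3 -> Rabs b <= 3 -> Rabs (f T a b) <= K.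

Lemma bdd_const c : bdd (fun _ _ _ => c).
Proof. exists (Rabs c). intros; lra. Qed.
Lemma bdd_T : bdd (fun T _ _ => T).
Proof. exists 1. intros; lra. Qed.
Lemma bdd_a : bdd (fun _ a _ => a).
Proof. exists 3. intros; lra. Qed.
Lemma bdd_b : bdd (fun _ _ b => b).
Proof. exists 3. intros; lra. Qed.
Lemma bdd_plus f g : bdd f -> bdd g -> bdd (fun T a b => f T a b + g T a b).
Proof.
  intros [K HK] [L HL]. exists (K + L). intros T a b H1 H2 H3.
  eapply Rle_trans; [apply Rabs_triang|]. generalize (HK T a b H1 H2 H3) (HL T a b H1 H2 H3). lra.
Qed.
Lemma bdd_mult f g : bdd f -> bdd g -> bdd (fun T a b => f T a b * g T a b).
Proof.
  intros [K HK] [L HL]. exists (K * L). intros T a b H1 H2 H3.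
  rewrite Rabs_mult. apply Rmult_le_compat; auto; apply Rabs_pos.
Qed.
Lemma bdd_pow f n : bdd f -> bdd (fun T a b => f T a b ^ n).
Proof. intros H. induction n; simpl; [apply bdd_const|apply bdd_mult; auto]. Qed.

Ltac bdd := repeat first [apply bdd_const | apply bdd_T | apply bdd_a | apply bdd_b
  | apply bdd_pow | apply bdd_plus | apply bdd_mult].

(** Exact quotients by the fifth power, from expanding the polynomial identities [Q1_eq] and [Q2_eq]. *)
Definition Q1 (T a b : R) : R := (-3071/6048000) + 1/2*b + (-2)*a + (-46589/282240000)*T + (-1/24)*T*b + (-636511/25401600000)*T^2 + 1/240*T^2*b + (-1027661/444528000000)*T^3 + (-17/40320)*T^3*b + (-1513/100800)*T^3*a + (-3)*T^3*a^2 + (-4771/32928000000)*T^4 + (-13/63000)*T^4*b + (-131093/35280000)*T^4*a + (-1/2)*T^4*a*b + 21/20*T^4*a^2 + (-1933867/298722816000000)*T^5 + (-221/8820000)*T^5*b + (-927923/2116800000)*T^5*a + 1/8*T^5*a*b + (-439/2800)*T^5*a^2 + (-626893/2987228160000000)*T^6 + (-787/470400000)*T^6*b + (-307747/9878400000)*T^6*a + (-1/48)*T^6*a*b + (-13603/84000)*T^6*a^2 + (-38387/7841473920000000)*T^7 + (-42869/592704000000)*T^7*b + (-86731/59270400000)*T^7*a + (-51/11200)*T^7*a*b + (-55873/1960000)*T^7*a^2 + (-3/2)*T^7*a^2*b + 18/5*T^7*a^3 + (-14911/188195374080000000)*T^8 + (-3749/1778112000000)*T^8*b + (-579001/12446784000000)*T^8*a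 + (-2189/5880000)*T^8*a*b + (-589/235200)*T^8*a^2 + 9/10*T^8*a^2*b + (-573/350)*T^8*a^3 + (-407/501854330880000000)*T^9 + (-3071/74680704000000)*T^9*b + (-3071/3111696000000)*T^9*a + (-1973/117600000)*T^9*a*b + (-10441/82320000)*T^9*a^2 + (-381/1400)*T^9*a^2*b + (-4803/7000)*T^9*a^3 + (-37/9033377955840000000)*T^10 + (-37/74680704000000)*T^10*b + (-481/37340352000000)*T^10*a + (-1147/2469600000)*T^10*a*b + (-19499/4939200000)*T^10*a^2 + (-429/14000)*T^10*a^2*b + (-8339/98000)*T^10*a^3 + (-37/12546358272000000)*T^11*b + (-37/448084224000000)*T^11*a + (-37/4939200000)*T^11*a*b + (-703/9878400000)*T^11*a^2 + (-1517/980000)*T^11*a^2*b + (-1517/294000)*T^11*a^3 + 9/5*T^11*a^3*b + (-666/175)*T^11*a^4 + (-37/622339200000)*T^12*a*b + (-37/59270400000)*T^12*a^2 + (-37/980000)*T^12*a^2*b + (-37/245000)*T^12*a^3 + (-222/175)*T^12*a^3*b + (-333/350)*T^12*a^4 + (-37/82320000)*T^13*a^2*b + (-37/17640000)*T^13*a^3 + (-111/1750)*T^13*a^3*b + (-111/1400)*T^13*a^4 + (-37/24500)*T^14*a^3*b + (-37/14000)*T^14*a^4 + (-333/175)*T^15*a^4*b.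

Lemma Q1_bdd : bdd Q1.
Proof. unfold Q1. bdd. Qed.

(** [sinh w / w] and [cosh w] in terms of [T = w ^ 2], with [a] and [b] for the scaled remainders. *)
Definition sT (T a : R) : R := 1 + T / 6 + T ^ 2 / 120 + T ^ 3 / 5040 + T ^ 4 * a.
Definition cT (T b : R) : R := 1 + T / 2 + T ^ 2 / 24 + T ^ 3 / 720 + T ^ 4 * b.
Definition poly1 (X : R) : R := 3 / 2 * X ^ 2 - 9 / 5 * X ^ 3 + 333 / 175 * X ^ 4.

Lemma Q1_eq T a b :
  T / 2 * (1 + cT T b) - T * sT T a - (1 + cT T b) * poly1 (sT T a - 1) = T ^ 5 * Q1 T a b.
Proof. unfold sT, cT, poly1, Q1. field. Qed.

Definition Q2 (y a b : R) : R := 2703/1400 + 24167/8400*y + 3*y*a + 871/336*y^2 + (-39/10)*y^2*a + 111523/67200*y^3 + 949/350*y^3*a + 27449/33600*y^4 + 11749/1400*y^4*a + 21613/67200*y^5 + 1143/140*y^5*a + 3/2*y^5*a^2 + 6851/67200*y^6 + 7467/1400*y^6*a + (-27/5)*y^6*a^2 + 21059/806400*y^7 + 3447/1400*y^7*a + 3051/350*y^7*a^2 + 1073/201600*y^8 + 9663/11200*y^8*a + 3681/350*y^8*a^2 + 37/44800*y^9 + 1961/8400*y^9*a + 1287/200*y^9*a^2 + 37/403200*y^10 + 37/800*y^10*a + 999/350*y^10*a^2 + (-9/5)*y^10*a^3 + 37/6451200*y^11 + 37/5600*y^11*a + 111/140*y^11*a^2 + 1332/175*y^11*a^3 + 37/67200*y^12*a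 + 111/700*y^12*a^2 + 666/175*y^12*a^3 + 111/5600*y^13*a^2 + 222/175*y^13*a^3 + 111/350*y^14*a^3 + 333/175*y^15*a^4.

Lemma Q2_bdd : bdd Q2.
Proof. unfold Q2. bdd. Qed.

Lemma Q2_eq y a b :
  poly1 (y + y ^ 2 / 2 + y ^ 3 / 6 + y ^ 4 / 24 + y ^ 5 * a) - (3 / 2 * y ^ 2 - 3 / 10 * y ^ 3 + 109 / 1400 * y ^ 4)
  = y ^ 5 * Q2 y a b.
Proof. unfold poly1, Q2. field. Qed.

(** One integration from [0]: repeated, it gives the remainders of Taylor polynomials. *)
Lemma remainder_step (f df : R -> R) n : (forall t, is_derive f t (df t)) -> f 0 = 0 ->
  (forall t, Rabs t <= 1 -> Rabs (df t) <= 3 * Rabs t ^ n) ->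
  forall t, Rabs t <= 1 -> Rabs (f t) <= 3 * Rabs t ^ S n.
Proof.
  intros Hd H0 H t Ht. replace (f t) with (f t - f 0) by (rewrite H0; ring).
  replace (3 * Rabs t ^ S n) with (3 * Rabs t ^ n * Rabs t) by (simpl; ring).
  apply (mvt_bound f df); auto. intros s Hs. eapply Rle_trans; [apply H; lra|].
  apply Rmult_le_compat_l; [lra|]. apply pow_incr. split; [apply Rabs_pos|auto].
Qed.

Ltac rstep df := apply (remainder_step _ df);
  [intros t; auto_derive; auto; simpl; try field
  |cbv beta; rewrite ?sinh_0, ?cosh_0, ?sin_0, ?cos_0, ?exp_0; field | ].
Ltac hstep F P df := apply (remainder_step _ df);
  [intros t; evar_last;
    [apply (is_derive_minus F P); [lazymatch F with sinh => apply is_derive_sinh | cosh => apply is_derive_cosh end|auto_derive; auto; reflexivity]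
    |unfold minus, plus, opp; simpl; field]
  |cbv beta; rewrite ?sinh_0, ?cosh_0; field | ].

Lemma cosh_8 : forall t, Rabs t <= 1 -> Rabs (cosh t - (1 + t ^ 2 / 2 + t ^ 4 / 24 + t ^ 6 / 720)) <= 3 * Rabs t ^ 8.
Proof.
  hstep cosh (fun t => 1 + t ^ 2 / 2 + t ^ 4 / 24 + t ^ 6 / 720) (fun t => sinh t - (t + t ^ 3 / 6 + t ^ 5 / 120)).
  hstep sinh (fun t => t + t ^ 3 / 6 + t ^ 5 / 120) (fun t => cosh t - (1 + t ^ 2 / 2 + t ^ 4 / 24)).
  hstep cosh (fun t => 1 + t ^ 2 / 2 + t ^ 4 / 24) (fun t => sinh t - (t + t ^ 3 / 6)).
  hstep sinh (fun t => t + t ^ 3 / 6) (fun t => cosh t - (1 + t ^ 2 / 2)).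
  hstep cosh (fun t => 1 + t ^ 2 / 2) (fun t => sinh t - t).
  intros t Ht. replace (3 * Rabs t ^ 3) with (3 * Rabs t * Rabs t * Rabs t) by ring. apply sinh_3_bound; auto.
Qed.
Lemma sinh_9 : forall t, Rabs t <= 1 -> Rabs (sinh t - (t + t ^ 3 / 6 + t ^ 5 / 120 + t ^ 7 / 5040)) <= 3 * Rabs t ^ 9.
Proof.
  hstep sinh (fun t => t + t ^ 3 / 6 + t ^ 5 / 120 + t ^ 7 / 5040) (fun t => cosh t - (1 + t ^ 2 / 2 + t ^ 4 / 24 + t ^ 6 / 720)).
  exact cosh_8.
Qed.
Lemma cos_8 : forall t, Rabs t <= 1 -> Rabs (cos t - (1 - t ^ 2 / 2 + t ^ 4 / 24 - t ^ 6 / 720)) <= 3 * Rabs t ^ 8.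
Proof.
  rstep (fun t => - (sin t - (t - t ^ 3 / 6 + t ^ 5 / 120))).
  rstep (fun t => - (cos t - (1 - t ^ 2 / 2 + t ^ 4 / 24))).
  rstep (fun t => sin t - (t - t ^ 3 / 6)).
  rstep (fun t => cos t - (1 - t ^ 2 / 2)).
  rstep (fun t => - (sin t - t)).
  intros t Ht. rewrite Rabs_Ropp. eapply Rle_trans; [apply sin_3_bound|].
  assert (0 <= Rabs t ^ 3) by (apply pow_le, Rabs_pos). simpl in *. lra.
Qed.
Lemma sin_9 : forall t, Rabs t <= 1 -> Rabs (sin t - (t - t ^ 3 / 6 + t ^ 5 / 120 - t ^ 7 / 5040)) <= 3 * Rabs t ^ 9.
Proof.
  rstep (fun t => cos t - (1 - t ^ 2 / 2 + t ^ 4 / 24 - t ^ 6 / 720)). exact cos_8.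
Qed.
Lemma exp_5 : forall t, Rabs t <= 1 -> Rabs (exp t - (1 + t + t ^ 2 / 2 + t ^ 3 / 6 + t ^ 4 / 24)) <= 3 * Rabs t ^ 5.
Proof.
  rstep (fun t => exp t - (1 + t + t ^ 2 / 2 + t ^ 3 / 6)).
  rstep (fun t => exp t - (1 + t + t ^ 2 / 2)).
  rstep (fun t => exp t - (1 + t)).
  intros t Ht. replace (exp t - (1 + t)) with (exp t - 1 - t) by ring.
  replace (3 * Rabs t ^ 2) with (3 * Rabs t * Rabs t) by ring. apply exp_2_bound; auto.
Qed.

Lemma tanh_half t : (1 + cosh t) * tanh (t / 2) = sinh t.
Proof.
  rewrite (cosh_2 t), (sinh_2 t). unfold tanh. assert (Pc := cosh_pos (t / 2)). assert (E := cosh_sinh (t / 2)).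
  field [E]. lra.
Qed.
Lemma tan_half t : cos (t / 2) <> 0 -> (1 + cos t) * tan (t / 2) = sin t.
Proof.
  intros Hc. rewrite (cos_2 t), (sin_2 t). unfold tan. assert (E := sin2_cos2 (t / 2)). unfold Rsqr in E.
  assert (E' : cos (t / 2) * cos (t / 2) = 1 - sin (t / 2) * sin (t / 2)) by lra. field [E']. auto.
Qed.

Lemma quot_bound x y n : 0 < y -> Rabs x <= 3 * Rabs y ^ n -> Rabs (x / y ^ n) <= 3.
Proof.
  intros Hy H. rewrite (Rabs_pos_eq y) in H by lra. assert (P := pow_lt y n Hy).
  unfold Rdiv. rewrite Rabs_mult, (Rabs_pos_eq (/ _)) by (left; apply Rinv_0_lt_compat; auto).
  apply Rmult_le_reg_r with (y ^ n); auto. rewrite Rmult_assoc, Rinv_l by lra. lra.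
Qed.

(** [T = t ^ 2] on the hyperbolic branch and [T = - t ^ 2] on the trigonometric one: both branches
    satisfy the same polynomial relation between [J], [cosh] and [sinh t / t]. *)
Lemma branch_h t : 0 < t <= 1 -> exists a b, Rabs a <= 3 /\ Rabs b <= 3 /\
  sinhc t = sT (t ^ 2) a /\ (1 + cT (t ^ 2) b) * jh t = t ^ 2 / 2 * (1 + cT (t ^ 2) b) - t ^ 2 * sT (t ^ 2) a /\ 1 <= 1 + cT (t ^ 2) b.
Proof.
  intros Ht. assert (Ha : Rabs t <= 1) by (rewrite Rabs_pos_eq; lra).
  exists ((sinh t - (t + t ^ 3 / 6 + t ^ 5 / 120 + t ^ 7 / 5040)) / t ^ 9).
  exists ((cosh t - (1 + t ^ 2 / 2 + t ^ 4 / 24 + t ^ 6 / 720)) / t ^ 8).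
  split; [apply quot_bound; [lra|apply sinh_9; auto]|].
  split; [apply quot_bound; [lra|apply cosh_8; auto]|].
  set (a := _ / t ^ 9). set (b := _ / t ^ 8).
  assert (Es : sT (t ^ 2) a = sinh t / t) by (unfold sT, a; field; lra).
  assert (Ec : cT (t ^ 2) b = cosh t) by (unfold cT, b; field; lra).
  rewrite Es, Ec. split; [apply sinhc_pos; lra|]. split.
  - unfold jh. rewrite Rmult_minus_distr_l. replace ((1 + cosh t) * (t * tanh (t / 2))) with (t * ((1 + cosh t) * tanh (t / 2))) by ring.
    rewrite tanh_half. field. lra.
  - generalize (cosh_pos t). lra.
Qed.
Lemma branch_t t : 0 < t <= 1 -> exists a b, Rabs a <= 3 /\ Rabs b <= 3 /\
  sinc t = sT (- t ^ 2) a /\ (1 + cT (- t ^ 2) b) * jt t = - t ^ 2 / 2 * (1 + cT (- t ^ 2) b) - - t ^ 2 * sT (- t ^ 2) a /\ 1 <= 1 + cT (- t ^ 2) b.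
Proof.
  intros Ht. assert (HP := PI_bounds). assert (Ha : Rabs t <= 1) by (rewrite Rabs_pos_eq; lra).
  exists ((sin t - (t - t ^ 3 / 6 + t ^ 5 / 120 - t ^ 7 / 5040)) / t ^ 9).
  exists ((cos t - (1 - t ^ 2 / 2 + t ^ 4 / 24 - t ^ 6 / 720)) / t ^ 8).
  split; [apply quot_bound; [lra|apply sin_9; auto]|].
  split; [apply quot_bound; [lra|apply cos_8; auto]|].
  set (a := _ / t ^ 9). set (b := _ / t ^ 8).
  assert (Es : sT (- t ^ 2) a = sin t / t) by (unfold sT, a; field; lra).
  assert (Ec : cT (- t ^ 2) b = cos t) by (unfold cT, b; field; lra).
  rewrite Es, Ec. split; [apply sinc_pos; lra|]. split.
  - unfold jt. rewrite Rmult_minus_distr_l. replace ((1 + cos t) * (t * tan (t / 2))) with (t * ((1 + cos t) * tan (t / 2))) by ring.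
    rewrite tan_half; [field; lra|]. apply Rgt_not_eq, cos_gt_0; lra.
  - generalize (cos_gt_0 t). intros. lra.
Qed.

(** Near [0] the variable [X = omega - 1] is comparable to [T], so an error [O(T ^ 5)] is [O(X ^ 5)]. *)
Lemma branch_bound K T a b j : Rabs T <= 1 / 10 -> Rabs a <= 3 -> Rabs b <= 3 -> Rabs (Q1 T a b) <= K ->
  (1 + cT T b) * j = T / 2 * (1 + cT T b) - T * sT T a -> 1 <= 1 + cT T b ->
  Rabs (j - poly1 (sT T a - 1)) <= 12 ^ 5 * K * Rabs ((sT T a - 1) ^ 5).
Proof.
  intros HT Ha Hb HQ E Hc. set (X := sT T a - 1) in *.
  assert (E2 : (1 + cT T b) * (j - poly1 X) = T ^ 5 * Q1 T a b).
  { rewrite Rmult_minus_distr_l, E. apply Q1_eq. }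
  assert (HX : Rabs T <= 12 * Rabs X).
  { set (A := 1 / 6 + T / 120 + T ^ 2 / 5040 + T ^ 3 * a).
    assert (EX : X = T * A) by (unfold X, A, sT; field).
    assert (HA : 1 / 12 <= A).
    { assert (T3 : Rabs (T ^ 3 * a) <= 1 / 1000 * 3).
      { rewrite Rabs_mult, <- RPow_abs. apply Rmult_le_compat; auto; [apply pow_le, Rabs_pos|apply Rabs_pos|].
        apply Rle_trans with ((1 / 10) ^ 3); [apply pow_incr; split; [apply Rabs_pos|auto]|lra]. }
      apply Rabs_le_between in T3. apply Rabs_le_between in HT. assert (0 <= T ^ 2) by apply pow2_ge_0. unfold A. lra. }
    rewrite EX, Rabs_mult, (Rabs_pos_eq A) by lra. generalize (Rabs_pos T). nra. }
  apply Rle_trans with (Rabs ((1 + cT T b) * (j - poly1 X))).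
  - rewrite Rabs_mult, (Rabs_pos_eq (1 + cT T b)) by lra. generalize (Rabs_pos (j - poly1 X)). nra.
  - rewrite E2, Rabs_mult, <- !RPow_abs.
    replace (12 ^ 5 * K * Rabs X ^ 5) with ((12 * Rabs X) ^ 5 * K) by ring.
    apply Rmult_le_compat; auto; [apply pow_le, Rabs_pos|apply Rabs_pos|].
    apply pow_incr. split; [apply Rabs_pos|auto].
Qed.

Lemma J_expansion : exists K d, 0 <= K /\ 0 < d /\ forall w, Rabs (w - 1) < d ->
  Rabs (J_BS w - poly1 (w - 1)) <= K * Rabs ((w - 1) ^ 5).
Proof.
  destruct Q1_bdd as [K HK].
  assert (HK0 : 0 <= K).
  { eapply Rle_trans; [apply Rabs_pos|]. apply (HK 0 0 0); rewrite Rabs_R0; lra. }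
  assert (U := sinhc_gt_1 (3 / 10) ltac:(lra)). assert (HP := PI_bounds).
  assert (L := sinc_decr 0 (3 / 10) ltac:(lra) ltac:(lra) ltac:(lra)). rewrite sinc_0 in L.
  assert (L2 := sinc_decr (3 / 10) PI ltac:(lra) ltac:(lra) ltac:(lra)). rewrite (sinc_pos PI), sin_PI in L2 by lra.
  exists (12 ^ 5 * K), (Rmin (sinhc (3 / 10) - 1) (1 - sinc (3 / 10))).
  split; [apply Rmult_le_pos; [lra|auto]|]. split; [apply Rmin_pos; lra|].
  intros w Hw. apply Rabs_lt_between in Hw.
  assert (M1 := Rmin_l (sinhc (3 / 10) - 1) (1 - sinc (3 / 10))). assert (M2 := Rmin_r (sinhc (3 / 10) - 1) (1 - sinc (3 / 10))).
  destruct (Rtotal_order w 1) as [H|[->|H]].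
  - destruct (zeta_range w ltac:(lra)) as [Z1 Z2]. destruct (zeta_spec w ltac:(lra)) as [_ Z3].
    rewrite J_BS_trig by auto. set (t := zeta w) in *.
    assert (Ht : t < 3 / 10).
    { apply Rnot_le_lt. intros Hle. destruct (Req_dec t (3 / 10)) as [E|]; [rewrite E in Z3; lra|].
      generalize (sinc_decr (3 / 10) t ltac:(lra) ltac:(lra) ltac:(lra)). lra. }
    destruct (branch_t t ltac:(lra)) as (a & b & Ha & Hb & E1 & E2 & E3).
    assert (HT : Rabs (- t ^ 2) <= 1 / 10) by (rewrite Rabs_Ropp, Rabs_pos_eq by apply pow2_ge_0; nra).
    rewrite <- Z3, E1. apply (branch_bound K _ a b); auto. apply HK; auto. lra.
  - rewrite J_BS_1. unfold poly1. replace (1 - 1) with 0 by ring.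
    replace (0 - (3 / 2 * 0 ^ 2 - 9 / 5 * 0 ^ 3 + 333 / 175 * 0 ^ 4)) with 0 by ring.
    rewrite Rabs_R0. apply Rmult_le_pos; [apply Rmult_le_pos; [lra|auto]|apply Rabs_pos].
  - assert (Z1 := xi_pos w H). destruct (xi_spec w ltac:(lra)) as [_ Z3].
    rewrite J_BS_hyp by lra. set (t := xi w) in *.
    assert (Ht : t < 3 / 10).
    { apply Rnot_le_lt. intros Hle. destruct (Req_dec t (3 / 10)) as [E|]; [rewrite E in Z3; lra|].
      generalize (sinhc_incr (3 / 10) t ltac:(lra) ltac:(lra)). lra. }
    destruct (branch_h t ltac:(lra)) as (a & b & Ha & Hb & E1 & E2 & E3).
    assert (HT : Rabs (t ^ 2) <= 1 / 10) by (rewrite Rabs_pos_eq by apply pow2_ge_0; nra).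
    rewrite <- Z3, E1. apply (branch_bound K _ a b); auto. apply HK; auto. lra.
Qed.

Theorem part_i_expansion : is_bigO (locally 1)
  (fun w : R => J_BS w - (3 / 2 * (w - 1) ^ 2 - 9 / 5 * (w - 1) ^ 3 + 333 / 175 * (w - 1) ^ 4))
  (fun w : R => (w - 1) ^ 5).
Proof.
  destruct J_expansion as (K & d & HK & Hd & H). exists K, (mkposreal d Hd). intros w Hw. apply H. exact Hw.
Qed.

Theorem part_ii_expansion : is_bigO (locally 0)
  (fun y : R => J_BS (exp y) - (3 / 2 * y ^ 2 - 3 / 10 * y ^ 3 + 109 / 1400 * y ^ 4))
  (fun y : R => y ^ 5).
Proof.
  destruct J_expansion as (K & d & HK & Hd & H). destruct Q2_bdd as [L HL].
  assert (Hd' : 0 < Rmin 1 (d / 3)) by (apply Rmin_pos; lra).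
  exists (K * 3 ^ 5 + L), (mkposreal _ Hd'). intros y Hy.
  change (Rabs (y - 0) < Rmin 1 (d / 3)) in Hy. rewrite Rminus_0_r in Hy.
  assert (M1 := Rmin_l 1 (d / 3)). assert (M2 := Rmin_r 1 (d / 3)).
  assert (B := exp_1_bound y ltac:(lra)).
  specialize (H (exp y) ltac:(lra)).
  destruct (Req_dec y 0) as [->|Hy0].
  { rewrite exp_0, J_BS_1. replace (0 - _) with 0 by ring. rewrite Rabs_R0, <- RPow_abs, Rabs_R0. lra. }
  set (a := (exp y - (1 + y + y ^ 2 / 2 + y ^ 3 / 6 + y ^ 4 / 24)) / y ^ 5).
  assert (Ha : Rabs a <= 3).
  { unfold a. assert (P : 0 < Rabs y) by (apply Rabs_pos_lt; auto).
    assert (P5 := pow_lt _ 5 P).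
    unfold Rdiv. rewrite Rabs_mult, Rabs_inv, <- RPow_abs.
    apply Rmult_le_reg_r with (Rabs y ^ 5); auto. rewrite Rmult_assoc, Rinv_l by lra. rewrite Rmult_1_r.
    apply exp_5; lra. }
  assert (EX : exp y - 1 = y + y ^ 2 / 2 + y ^ 3 / 6 + y ^ 4 / 24 + y ^ 5 * a) by (unfold a; field; auto).
  assert (E2 := Q2_eq y a 0). rewrite <- EX in E2.
  specialize (HL y a 0 ltac:(lra) Ha ltac:(rewrite Rabs_R0; lra)).
  replace (J_BS (exp y) - (3 / 2 * y ^ 2 - 3 / 10 * y ^ 3 + 109 / 1400 * y ^ 4))
    with ((J_BS (exp y) - poly1 (exp y - 1)) + y ^ 5 * Q2 y a 0) by (rewrite <- E2; ring).
  eapply Rle_trans; [apply Rabs_triang|]. rewrite (Rabs_mult (y ^ 5)).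
  assert (F : Rabs ((exp y - 1) ^ 5) <= 3 ^ 5 * Rabs (y ^ 5)).
  { rewrite <- !RPow_abs, <- Rpow_mult_distr. apply pow_incr. split; [apply Rabs_pos|auto]. }
  assert (K * Rabs ((exp y - 1) ^ 5) <= K * (3 ^ 5 * Rabs (y ^ 5))) by (apply Rmult_le_compat_l; auto).
  assert (Rabs (y ^ 5) * Rabs (Q2 y a 0) <= Rabs (y ^ 5) * L) by (apply Rmult_le_compat_l; auto; apply Rabs_pos).
  lra.
Qed.

(** * Numerical values at the saddle point *)

Lemma shift_3PI2 d : sin (3 * (PI / 2) - d) = - cos d /\ cos (3 * (PI / 2) - d) = - sin d.
Proof. rewrite sin_minus, cos_minus, sin_3PI2, cos_3PI2. lra. Qed.

Ltac factn := repeat match goal with |- context [INR (fact ?n)] =>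
  let v := eval vm_compute in (Z.of_nat (fact n)) in
  replace (INR (fact n)) with (IZR v) by (rewrite INR_IZR_INZ; f_equal; vm_compute; reflexivity) end.

Lemma cos_approx_3 x : cos_approx x 3 = 1 - x ^ 2 / 2 + x ^ 4 / 24 - x ^ 6 / 720.
Proof. unfold cos_approx, cos_term, sum_f_R0. change (2*0)%nat with 0%nat. change (2*1)%nat with 2%nat. change (2*2)%nat with 4%nat. change (2*3)%nat with 6%nat. factn. simpl. field. Qed.
Lemma cos_approx_4 x : cos_approx x 4 = 1 - x ^ 2 / 2 + x ^ 4 / 24 - x ^ 6 / 720 + x ^ 8 / 40320.
Proof. unfold cos_approx, cos_term, sum_f_R0. change (2*0)%nat with 0%nat. change (2*1)%nat with 2%nat. change (2*2)%nat with 4%nat. change (2*3)%nat with 6%nat. change (2*4)%nat with 8%nat. factn. simpl. field. Qed.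
Lemma sin_approx_3 x : sin_approx x 3 = x - x ^ 3 / 6 + x ^ 5 / 120 - x ^ 7 / 5040.
Proof. unfold sin_approx, sin_term, sum_f_R0. change (2*0+1)%nat with 1%nat. change (2*1+1)%nat with 3%nat. change (2*2+1)%nat with 5%nat. change (2*3+1)%nat with 7%nat. factn. simpl. field. Qed.
Lemma sin_approx_4 x : sin_approx x 4 = x - x ^ 3 / 6 + x ^ 5 / 120 - x ^ 7 / 5040 + x ^ 9 / 362880.
Proof. unfold sin_approx, sin_term, sum_f_R0. change (2*0+1)%nat with 1%nat. change (2*1+1)%nat with 3%nat. change (2*2+1)%nat with 5%nat. change (2*3+1)%nat with 7%nat. change (2*4+1)%nat with 9%nat. factn. simpl. field. Qed.

Lemma eta1_bounds : 44934094 / 10 ^ 7 < eta1 < 44934095 / 10 ^ 7.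
Proof.
  assert (HP := PI_bounds). assert (HE := proj1 eta1_spec). assert (HN := proj2 eta1_spec).
  split; apply Rnot_le_lt; intros Hle.
  - (* [Nt] decreases past [PI], so it suffices to find its sign at [a]; the values of [sin] and [cos]
       are taken at the distance [d] to [3 PI / 2], where few Taylor terms are needed *)
    set (a := 44934094 / 10 ^ 7) in *.
    assert (Na : Nt a <= 0).
    { destruct (Req_dec eta1 a) as [E|]; [rewrite <- E; lra|]. rewrite <- HN. left. apply Nt_decr; unfold a in *; lra. }
    set (d := 3 * (PI / 2) - a).
    set (d0 := 3 * (3141592653 / 10 ^ 9 / 2) - a).
    assert (Hd : d0 <= d <= d0 + 2 / 10 ^ 9) by (unfold d, d0; lra).
    assert (Hd0 : 218 / 1000 < d0 < 219 / 1000) by (unfold d0, a; lra).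
    replace a with (3 * (PI / 2) - d) in Na by (unfold d; ring).
    unfold Nt in Na. rewrite (proj1 (shift_3PI2 d)), (proj2 (shift_3PI2 d)) in Na.
    replace (3 * (PI / 2) - d) with a in Na by (unfold d; ring).
    assert (S1 : sin d0 <= sin d) by (apply sin_incr_1; lra).
    assert (C1 : cos d <= cos d0) by (apply cos_decr_1; lra).
    destruct (sin_bound d0 1 ltac:(lra) ltac:(lra)) as [S2 _].
    destruct (cos_bound d0 1 ltac:(lra) ltac:(lra)) as [_ C2].
    assert (K : cos_approx d0 (2 * (1 + 1)) < a * sin_approx d0 (2 * 1 + 1)).
    { simpl mult. simpl plus. rewrite ?cos_approx_3, ?cos_approx_4, ?sin_approx_3, ?sin_approx_4. unfold d0, a. lra. }
    assert (0 < a) by (unfold a; lra). nra.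
  - set (a := 44934095 / 10 ^ 7) in *.
    assert (Na : 0 <= Nt a).
    { destruct (Req_dec eta1 a) as [E|]; [rewrite <- E; lra|]. rewrite <- HN. left. apply Nt_decr; unfold a in *; lra. }
    set (d := 3 * (PI / 2) - a).
    set (d0 := 3 * (3141592654 / 10 ^ 9 / 2) - a).
    assert (Hd : d0 - 2 / 10 ^ 9 <= d <= d0) by (unfold d, d0; lra).
    assert (Hd0 : 218 / 1000 < d0 < 219 / 1000) by (unfold d0, a; lra).
    replace a with (3 * (PI / 2) - d) in Na by (unfold d; ring).
    unfold Nt in Na. rewrite (proj1 (shift_3PI2 d)), (proj2 (shift_3PI2 d)) in Na.
    replace (3 * (PI / 2) - d) with a in Na by (unfold d; ring).
    assert (S1 : sin d <= sin d0) by (apply sin_incr_1; lra).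
    assert (C1 : cos d0 <= cos d) by (apply cos_decr_1; lra).
    destruct (sin_bound d0 1 ltac:(lra) ltac:(lra)) as [_ S2].
    destruct (cos_bound d0 1 ltac:(lra) ltac:(lra)) as [C2 _].
    assert (K : a * sin_approx d0 (2 * (1 + 1)) < cos_approx d0 (2 * 1 + 1)).
    { simpl mult. simpl plus. rewrite ?cos_approx_3, ?cos_approx_4, ?sin_approx_3, ?sin_approx_4. unfold d0, a. lra. }
    assert (0 < a) by (unfold a; lra). nra.
Qed.

Lemma exp_taylor n x : 0 < x <= 1 ->
  sum_f_R0 (fun k => x ^ k / INR (fact k)) n <= exp x <=
  sum_f_R0 (fun k => x ^ k / INR (fact k)) n + 3 * x ^ S n / INR (fact (S n)).
Proof.
  intros Hx.
  assert (D : forall k y, Derive_n exp k y = exp y) by (intros; apply is_derive_n_unique, is_derive_n_exp).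
  destruct (Taylor_Lagrange exp n 0 x ltac:(lra)) as [z [Hz E]].
  { intros t Ht k Hk. destruct k as [|k]; [exact I|]. apply (ex_derive_ext exp); [intros; symmetry; apply D|].
    auto_derive; auto. }
  rewrite D in E. rewrite E.
  assert (Es : sum_f_R0 (fun m => (x - 0) ^ m / INR (fact m) * Derive_n exp m 0) n = sum_f_R0 (fun k => x ^ k / INR (fact k)) n).
  { apply sum_eq. intros i _. rewrite D, exp_0, Rminus_0_r. ring. }
  rewrite Es, Rminus_0_r.
  assert (P : 0 < x ^ S n / INR (fact (S n))).
  { apply Rdiv_lt_0_compat; [apply pow_lt; lra|]. apply INR_fact_lt_0. }
  assert (exp z <= 3) by (apply exp_le_3'; rewrite Rabs_pos_eq; lra). assert (0 < exp z) by apply exp_pos.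
  replace (3 * x ^ S n / INR (fact (S n))) with (x ^ S n / INR (fact (S n)) * 3) by (unfold Rdiv; ring).
  split; [assert (0 <= x ^ S n / INR (fact (S n)) * exp z) by (apply Rmult_le_pos; lra); lra|].
  apply Rplus_le_compat_l. apply Rmult_le_compat_l; lra.
Qed.

Lemma exp_pow n x : exp (INR n * x) = exp x ^ n.
Proof.
  induction n as [|n IH]; [simpl; rewrite Rmult_0_l; apply exp_0|].
  rewrite S_INR, Rmult_plus_distr_r, Rmult_1_l, exp_plus, IH. simpl. ring.
Qed.

Definition ell1 : R := ln (Rabs omega1).

Lemma ell1_eta : ell1 = - (ln (1 + eta1 ^ 2) / 2).
Proof.
  unfold ell1. assert (H := omega1_sqr). assert (Ho := omega1_bounds).
  assert (P : 0 < 1 + eta1 ^ 2) by (generalize (pow2_ge_0 eta1); lra).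
  assert (E : ln (omega1 ^ 2 * (1 + eta1 ^ 2)) = 0) by (rewrite H; apply ln_1).
  rewrite <- pow2_abs in E. rewrite ln_mult in E; auto; [|apply pow_lt, Rabs_pos_lt; lra].
  rewrite ln_pow in E by (apply Rabs_pos_lt; lra). simpl in E. simpl. lra.
Qed.

Lemma exp_8_bounds x : 0 < x <= 1 -> let s := 1 + x + x ^ 2 / 2 + x ^ 3 / 6 + x ^ 4 / 24 + x ^ 5 / 120 + x ^ 6 / 720 + x ^ 7 / 5040 + x ^ 8 / 40320 in
  s <= exp x <= s + x ^ 9 / 120960.
Proof.
  intros Hx. destruct (exp_taylor 8 x Hx) as [A B]. revert A B. unfold sum_f_R0. factn. simpl. lra.
Qed.

(** The argument of [exp] is divided by [8] to make the Taylor bound sharp enough. *)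
Lemma ln_eta_bounds : 30535634 / 10 ^ 7 < ln (1 + eta1 ^ 2) < 30535642 / 10 ^ 7.
Proof.
  assert (He := eta1_bounds).
  assert (P : 0 < 1 + eta1 ^ 2) by (generalize (pow2_ge_0 eta1); lra).
  split.
  - rewrite <- (ln_exp (30535634 / 10 ^ 7)). apply ln_increasing; [apply exp_pos|].
    set (x := 30535634 / 10 ^ 7 / 8). replace (30535634 / 10 ^ 7) with (INR 8 * x) by (unfold x; simpl; field).
    rewrite exp_pow. destruct (exp_8_bounds x ltac:(unfold x; lra)) as [_ H].
    assert (B : exp x < 14647658952 / 10 ^ 10) by (eapply Rle_lt_trans; [exact H|]; unfold x; lra).
    assert (B2 : exp x ^ 8 <= (14647658952 / 10 ^ 10) ^ 8) by (apply pow_incr; split; [left; apply exp_pos|lra]).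
    assert (B3 : (14647658952 / 10 ^ 10) ^ 8 < 1 + (44934094 / 10 ^ 7) ^ 2) by lra.
    assert (B4 : (44934094 / 10 ^ 7) ^ 2 <= eta1 ^ 2) by (apply pow_incr; lra). lra.
  - rewrite <- (ln_exp (30535642 / 10 ^ 7)). apply ln_increasing; auto.
    set (x := 30535642 / 10 ^ 7 / 8). replace (30535642 / 10 ^ 7) with (INR 8 * x) by (unfold x; simpl; field).
    rewrite exp_pow. destruct (exp_8_bounds x ltac:(unfold x; lra)) as [H _].
    assert (B : 14647660037 / 10 ^ 10 < exp x) by (eapply Rlt_le_trans; [|exact H]; unfold x; lra).
    assert (B2 : (14647660037 / 10 ^ 10) ^ 8 <= exp x ^ 8) by (apply pow_incr; lra).
    assert (B3 : 1 + (44934095 / 10 ^ 7) ^ 2 < (14647660037 / 10 ^ 10) ^ 8) by lra.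
    assert (B4 : eta1 ^ 2 <= (44934095 / 10 ^ 7) ^ 2) by (apply pow_incr; lra). lra.
Qed.

Lemma ell1_bounds : - 15267821 / 10 ^ 7 < ell1 < - 15267817 / 10 ^ 7.
Proof. rewrite ell1_eta. generalize ln_eta_bounds. lra. Qed.

Lemma log_omega1_eq : log_omega1 = (ell1, PI).
Proof. unfold log_omega1, ell1. apply injective_projections; simpl; ring. Qed.

Lemma rho_sqr : rho_x ^ 2 = ell1 ^ 2 + PI ^ 2.
Proof. unfold rho_x. rewrite log_omega1_eq, Cmod2_alt. reflexivity. Qed.

Lemma rho_pos : 0 < rho_x.
Proof.
  assert (H := rho_sqr). assert (P := Cmod_ge_0 log_omega1). fold rho_x in P.
  assert (0 < PI ^ 2) by (apply pow_lt, PI_RGT_0). assert (0 <= ell1 ^ 2) by apply pow2_ge_0. nra.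
Qed.

Lemma sqr_bounds x a b : 0 < a -> a < x < b -> a ^ 2 < x ^ 2 < b ^ 2.
Proof. intros. nra. Qed.

Lemma rho_sqr_bounds : 122006668 / 10 ^ 7 - 5 / 10 ^ 6 < rho_x ^ 2 < 122006668 / 10 ^ 7 + 5 / 10 ^ 6.
Proof.
  rewrite rho_sqr. assert (H := ell1_bounds). assert (HP := PI_bounds).
  destruct (sqr_bounds (- ell1) (15267817 / 10 ^ 7) (15267821 / 10 ^ 7) ltac:(lra) ltac:(lra)) as [A1 A2].
  destruct (sqr_bounds PI (3141592653 / 10 ^ 9) (3141592654 / 10 ^ 9) ltac:(lra) ltac:(lra)) as [A3 A4].
  replace ((- ell1) ^ 2) with (ell1 ^ 2) in * by ring. lra.
Qed.

Lemma rho_bounds : 349 / 100 < rho_x < 3493 / 1000.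
Proof. assert (H := rho_sqr_bounds). assert (P := rho_pos). split; nra. Qed.

(** The saddle point contributes [eta1 sqrt (2 rho_x) rho_x], Wallis' product [1 / sqrt PI]. *)
Definition d_J : R := - (eta1 * sqrt (2 / PI) * rho_x * sqrt rho_x).

(** Fourth powers remove the square roots. *)
Lemma d_J_bounds : Rabs (d_J - (- 234048 / 10000)) < 1 / 10000.
Proof.
  assert (He := eta1_bounds). assert (HP := PI_bounds). assert (HR := rho_sqr_bounds). assert (P := rho_pos).
  set (D := eta1 * sqrt (2 / PI) * rho_x * sqrt rho_x).
  assert (HD : 0 <= D).
  { unfold D. repeat apply Rmult_le_pos; try apply sqrt_pos; lra. }
  assert (D4 : D ^ 4 * PI ^ 2 = eta1 ^ 4 * 4 * (rho_x ^ 2) ^ 3).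
  { unfold D. rewrite !Rpow_mult_distr.
    replace (sqrt (2 / PI) ^ 4) with ((sqrt (2 / PI) * sqrt (2 / PI)) * (sqrt (2 / PI) * sqrt (2 / PI))) by ring.
    replace (sqrt rho_x ^ 4) with ((sqrt rho_x * sqrt rho_x) * (sqrt rho_x * sqrt rho_x)) by ring.
    rewrite !sqrt_sqrt; [field; lra|lra|]. left. apply Rdiv_lt_0_compat; lra. }
  assert (E1 : (44934094 / 10 ^ 7) ^ 4 <= eta1 ^ 4) by (apply pow_incr; lra).
  assert (E2 : eta1 ^ 4 <= (44934095 / 10 ^ 7) ^ 4) by (apply pow_incr; lra).
  assert (R1 : (122006618 / 10 ^ 7) ^ 3 <= (rho_x ^ 2) ^ 3) by (apply pow_incr; lra).
  assert (R2 : (rho_x ^ 2) ^ 3 <= (122006718 / 10 ^ 7) ^ 3) by (apply pow_incr; lra).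
  assert (Q1 : (3141592653 / 10 ^ 9) ^ 2 <= PI ^ 2) by (apply pow_incr; lra).
  assert (Q2 : PI ^ 2 <= (3141592654 / 10 ^ 9) ^ 2) by (apply pow_incr; lra).
  assert (L : 234047 / 10000 < D).
  { apply Rnot_le_lt. intros Hle.
    assert (D ^ 4 <= (234047 / 10000) ^ 4) by (apply pow_incr; lra).
    assert (D ^ 4 * PI ^ 2 <= (234047 / 10000) ^ 4 * (3141592654 / 10 ^ 9) ^ 2).
    { apply Rmult_le_compat; auto; [apply pow_le; auto|apply pow2_ge_0]. }
    assert ((44934094 / 10 ^ 7) ^ 4 * 4 * (122006618 / 10 ^ 7) ^ 3 <= eta1 ^ 4 * 4 * (rho_x ^ 2) ^ 3).
    { apply Rmult_le_compat; lra. }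
    lra. }
  assert (U : D < 234049 / 10000).
  { apply Rnot_le_lt. intros Hle.
    assert ((234049 / 10000) ^ 4 <= D ^ 4) by (apply pow_incr; lra).
    assert ((234049 / 10000) ^ 4 * (3141592653 / 10 ^ 9) ^ 2 <= D ^ 4 * PI ^ 2) by (apply Rmult_le_compat; lra).
    assert (eta1 ^ 4 * 4 * (rho_x ^ 2) ^ 3 <= (44934095 / 10 ^ 7) ^ 4 * 4 * (122006718 / 10 ^ 7) ^ 3).
    { apply Rmult_le_compat; lra. }
    lra. }
  unfold d_J. fold D. apply Rabs_lt_between. lra.
Qed.

(** * A branch of the logarithm cut along the ray through [2 - i] *)

(** The cut must avoid the values of [sinh w / w] on the region, which include real numbers of both signs.
    By [no_crossing] the ray through [2 - i] is free; multiplication by [mcut] turns it into the negative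
    axis.  The imaginary part of the branch lies between [- kap] and [2 PI - kap]. *)
Definition mcut : C := (-2, -1).
Definition Clogk (w : C) : C := (Clogp (mcut * w) - Clogp mcut)%C.
Definition kap : R := PI + Im (Clogp mcut).

Lemma mcut_nz : mcut <> RtoC 0.
Proof. intros E. apply (f_equal Re) in E. simpl in E. lra. Qed.
Lemma slit_mcut : slit mcut.
Proof.
  unfold slit. assert (H := Cmod2_alt mcut). assert (P := Cmod_ge_0 mcut). unfold mcut in *; simpl in *. nra.
Qed.

Lemma slit_or_ray (w : C) : slit (mcut * w) \/ exists tau, 0 <= tau /\ w = (2 * tau, - tau).
Proof.
  destruct (Rlt_dec 0 (Cmod (mcut * w) + Re (mcut * w))) as [H|H]; [left; exact H|right].
  destruct (not_slit _ H) as [H1 H2]. destruct w as [x y]. unfold mcut in *. simpl in H1, H2.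
  exists (- y). split; [lra|]. apply injective_projections; simpl; lra.
Qed.

Lemma Cexp_opp_log z : slit z -> Cexp (- Clogp z) = (/ z)%C.
Proof.
  intros H. assert (Hz : z <> RtoC 0) by (apply Cmod_gt_0, slit_nz; auto).
  assert (E : (Cexp (Clogp z) * Cexp (- Clogp z))%C = 1).
  { rewrite <- Cexp_plus. replace (Clogp z + - Clogp z)%C with (RtoC 0) by ring.
    unfold Cexp; simpl. rewrite exp_0, cos_0, sin_0. apply injective_projections; simpl; ring. }
  rewrite Cexp_Clogp in E by auto.
  replace (Cexp (- Clogp z)) with (/ z * (z * Cexp (- Clogp z)))%C by (field; auto). rewrite E. ring.
Qed.

Lemma Cexp_Clogk w : slit (mcut * w) -> Cexp (Clogk w) = w.
Proof.
  intros H. unfold Clogk, Cminus. rewrite Cexp_plus, Cexp_Clogp, Cexp_opp_log by (auto using slit_mcut).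
  field. apply mcut_nz.
Qed.

Lemma Chol_Clogk w : slit (mcut * w) -> Chol Clogk w.
Proof.
  intros H. apply Chol_minus; [|apply Chol_const].
  apply (Chol_comp Clogp (fun w => mcut * w)%C); [apply Chol_Clogp; auto|].
  apply Chol_mult; [apply Chol_const|apply Chol_id].
Qed.

Lemma mcut_angle : - PI < Im (Clogp mcut) < - (PI / 2).
Proof.
  assert (H := Cexp_Clogp mcut slit_mcut). assert (B := Im_Clogp_bound mcut).
  assert (H1 := f_equal Re H). assert (H2 := f_equal Im H). unfold Cexp, mcut in H1, H2.
  change (exp (Re (Clogp mcut)) * cos (Im (Clogp mcut)) = -2) in H1.
  change (exp (Re (Clogp mcut)) * sin (Im (Clogp mcut)) = -1) in H2.
  set (a := Im (Clogp mcut)) in *. assert (P := exp_pos (Re (Clogp mcut))). set (e := exp _) in *.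
  assert (S : sin a < 0) by nra. assert (K : cos a < 0) by nra.
  assert (a < 0).
  { apply Rnot_le_lt. intros Ha. generalize (sin_ge_0 a Ha ltac:(lra)). lra. }
  split; [lra|]. apply Rnot_le_lt. intros Ha. generalize (cos_ge_0 a ltac:(lra) ltac:(lra)). lra.
Qed.

Lemma kap_range : 0 < kap < PI / 2.
Proof. unfold kap. generalize mcut_angle. lra. Qed.

Lemma Im_Clogk_range w : - kap < Im (Clogk w) < 2 * PI - kap.
Proof.
  unfold Clogk, kap. rewrite im_minus. generalize (Im_Clogp_bound (mcut * w)). lra.
Qed.

Lemma Re_Clogk (w : C) : w <> RtoC 0 -> Re (Clogk w) = ln (Cmod w).
Proof.
  intros H. unfold Clogk. rewrite re_minus. simpl Re. rewrite Cmod_mult, ln_mult.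
  - simpl. ring.
  - apply Cmod_gt_0, mcut_nz.
  - apply Cmod_gt_0; auto.
Qed.

Lemma angle_unique a b : Rabs (a - b) < 2 * PI -> cos a = cos b -> sin a = sin b -> a = b.
Proof.
  intros Hd Hc Hs.
  assert (E : cos (a - b) = 1) by (rewrite cos_minus, Hc, Hs; generalize (sin2_cos2 b); unfold Rsqr; lra).
  rewrite (cos_2 (a - b)) in E. assert (S : sin ((a - b) / 2) = 0) by nra.
  apply Rabs_lt_between in Hd. assert (HP := PI_RGT_0).
  destruct (Rtotal_order a b) as [H|[H|H]]; auto; exfalso.
  - generalize (sin_gt_0 (- ((a - b) / 2)) ltac:(lra) ltac:(lra)). rewrite sin_neg. lra.
  - generalize (sin_gt_0 ((a - b) / 2) ltac:(lra) ltac:(lra)). lra.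
Qed.

Lemma Clogk_polar r a : 0 < r -> - kap < a < 2 * PI - kap -> slit (mcut * (r * cos a, r * sin a)) ->
  Clogk (r * cos a, r * sin a) = (ln r, a).
Proof.
  intros Hr Ha Hs. set (w := (r * cos a, r * sin a)) in *.
  assert (Hm : Cmod w = r).
  { assert (E : Cmod w ^ 2 = r ^ 2).
    { rewrite Cmod2_alt. unfold w; simpl. assert (F := sin2_cos2 a). unfold Rsqr in F.
      transitivity (r * r * (sin a * sin a + cos a * cos a)); [ring|rewrite F; ring]. }
    assert (P := Cmod_ge_0 w). nra. }
  assert (Hw : w <> RtoC 0) by (apply Cmod_gt_0; lra).
  assert (HR := Re_Clogk w Hw). rewrite Hm in HR.
  assert (HE := Cexp_Clogk w Hs). unfold Cexp in HE. rewrite HR, exp_ln in HE by auto.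
  assert (E1 := f_equal Re HE). assert (E2 := f_equal Im HE). simpl in E1, E2.
  assert (HI : Im (Clogk w) = a).
  { apply angle_unique.
    - generalize (Im_Clogk_range w). intros. apply Rabs_lt_between. lra.
    - apply Rmult_eq_reg_l with r; [exact E1|lra].
    - apply Rmult_eq_reg_l with r; [exact E2|lra]. }
  rewrite <- HR, <- HI. destruct (Clogk w); reflexivity.
Qed.

Lemma slit_real x : x <> 0 -> slit (mcut * (x, 0)).
Proof.
  intros Hx. destruct (slit_or_ray (x, 0)) as [H|[tau [_ E]]]; auto.
  assert (E1 := f_equal Re E). assert (E2 := f_equal Im E). simpl in E1, E2. exfalso. lra.
Qed.

Lemma Clogk_pos x : 0 < x -> Clogk (x, 0) = (ln x, 0).
Proof.
  intros Hx. assert (H := slit_real x ltac:(lra)). assert (K := kap_range). assert (HP := PI_RGT_0).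
  replace (x, 0) with (x * cos 0, x * sin 0) in H |- * by (rewrite cos_0, sin_0; f_equal; ring).
  rewrite Clogk_polar; auto. lra.
Qed.
Lemma Clogk_neg x : x < 0 -> Clogk (x, 0) = (ln (- x), PI).
Proof.
  intros Hx. assert (H := slit_real x ltac:(lra)). assert (K := kap_range). assert (HP := PI_RGT_0).
  replace (x, 0) with ((- x) * cos PI, (- x) * sin PI) in H |- * by (rewrite cos_PI, sin_PI; f_equal; ring).
  rewrite Clogk_polar; auto; lra.
Qed.

(** * The function [log (sinh w / w)] on the quadrant *)

Definition plog (w : C) : C := Clogk (Csinhc w).

(** The height [7 PI / 4] is the largest that [no_crossing] allows; the contour passes the zero [i PI] of
    [sinh w / w] at distance [dlt]. *)
Definition top : R := 7 * (PI / 4).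
Definition dlt : R := 1 / 50.

(** The part of the quadrant on which [plog] is continuous: the zero [i PI] of [sinh w / w] is excluded. *)
Definition region (u v : R) : Prop := 0 <= u /\ 0 <= v <= top /\ (u <> 0 \/ v <> PI).

Lemma region_slit u v : region u v -> slit (mcut * Csinhc (u, v)).
Proof.
  intros (Hu & Hv & Hne). destruct (slit_or_ray (Csinhc (u, v))) as [H|[tau [Ht E]]]; auto. exfalso.
  unfold top in Hv. assert (HP := PI_RGT_0).
  destruct (Req_dec tau 0) as [->|H0].
  - destruct (Csinhc_zero u v Hu ltac:(lra)) as [A B]; [|tauto].
    rewrite E. apply injective_projections; simpl; ring.
  - apply (no_crossing u v (2 * tau) tau Hu Hv ltac:(lra) E).
Qed.

Lemma plog_cont u v : region u v -> Ccont plog (u, v).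
Proof.
  intros H. apply (Ccont_comp Clogk Csinhc); [|apply Ccont_Csinhc].
  apply Chol_cont, Chol_Clogk, region_slit; auto.
Qed.
Lemma plog_hol u v : region u v -> (u, v) <> RtoC 0 -> Chol plog (u, v).
Proof.
  intros H H0. apply (Chol_comp Clogk Csinhc); [|apply Chol_Csinhc; auto].
  apply Chol_Clogk, region_slit; auto.
Qed.
Lemma plog_exp u v : region u v -> Cexp (plog (u, v)) = Csinhc (u, v).
Proof. intros H. apply Cexp_Clogk, region_slit; auto. Qed.
Lemma region_nz u v : region u v -> Csinhc (u, v) <> RtoC 0.
Proof.
  intros (Hu & Hv & Hne) E. unfold top in Hv. assert (HP := PI_RGT_0).
  destruct (Csinhc_zero u v Hu ltac:(lra) E). tauto.
Qed.
Lemma plog_Re u v : region u v -> Re (plog (u, v)) = ln (Cmod (Csinhc (u, v))).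
Proof. intros H. apply Re_Clogk, region_nz; auto. Qed.

Lemma plog_real t : 0 <= t -> plog (t, 0) = (ln (sinhc t), 0).
Proof.
  intros Ht. unfold plog. rewrite Csinhc_real by auto. apply Clogk_pos.
  destruct (Req_dec t 0) as [->|]; [rewrite sinhc_0; lra|]. generalize (sinhc_gt_1 t ltac:(lra)). lra.
Qed.
Lemma plog_imag_low v : 0 <= v < PI -> plog (0, v) = (ln (sinc v), 0).
Proof.
  intros Hv. unfold plog. rewrite Csinhc_imag by lra. apply Clogk_pos.
  destruct (Req_dec v 0) as [->|]; [rewrite sinc_0; lra|]. rewrite sinc_pos by lra.
  apply Rdiv_lt_0_compat; [apply sin_gt_0; lra|lra].
Qed.
Lemma plog_imag_high v : PI < v < 2 * PI -> plog (0, v) = (ln (- sin v / v), PI).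
Proof.
  intros Hv. assert (HP := PI_RGT_0). unfold plog. rewrite Csinhc_imag by lra. rewrite sinc_pos by lra.
  assert (S := sin_lt_0 v ltac:(lra) ltac:(lra)).
  rewrite Clogk_neg.
  - do 2 f_equal. field. lra.
  - assert (0 < - sin v / v) by (apply Rdiv_lt_0_compat; lra). unfold Rdiv in *. lra.
Qed.

(** The derivative in [w] of [w tanh (w / 2) = dJ / d log omega]. *)
Definition dFlog (w : C) : C := ((Csinh w + w) / (1 + Ccosh w))%C.

Lemma dFlog_den u v : region u v -> (1 + Ccosh (u, v))%C <> RtoC 0.
Proof.
  intros (Hu & Hv & Hne) E. unfold top in Hv. assert (HP := PI_RGT_0).
  assert (E1 := f_equal Re E). assert (E2 := f_equal Im E). simpl in E1, E2.
  destruct (Req_dec u 0) as [->|Hu0].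
  - rewrite cosh_0 in E1. assert (Hc : cos v = -1) by lra. destruct Hne as [|Hne]; [lra|].
    assert (S : sin v = 0) by (generalize (sin2_cos2 v); unfold Rsqr; rewrite Hc; nra).
    destruct (Rtotal_order v PI) as [H|[H|H]]; [|lra|].
    + destruct (Req_dec v 0) as [->|]; [rewrite cos_0 in Hc; lra|]. generalize (sin_gt_0 v ltac:(lra) H). lra.
    + generalize (sin_lt_0 v H ltac:(lra)). lra.
  - assert (Ps := sinh_pos u ltac:(lra)). assert (Pc := cosh_gt_1 u ltac:(lra)).
    assert (S : sin v = 0) by nra. assert (Hc : cos v * cos v = 1) by (generalize (sin2_cos2 v); unfold Rsqr; rewrite S; lra).
    assert (cosh u * cos v = -1) by lra. assert (cos v = 1 \/ cos v = -1) as [K|K] by (assert ((cos v - 1) * (cos v + 1) = 0) by lra; apply Rmult_integral in H0; lra); rewrite K in *; lra.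
Qed.

Lemma dFlog_hol u v : region u v -> Chol dFlog (u, v).
Proof.
  intros H. apply Chol_div; [apply dFlog_den; auto| |].
  - apply Chol_plus; [apply Chol_Csinh|apply Chol_id].
  - apply Chol_plus; [apply Chol_const|apply Chol_Ccosh].
Qed.
Lemma dFlog_cont u v : region u v -> Ccont dFlog (u, v).
Proof. intros; apply Chol_cont, dFlog_hol; auto. Qed.

Definition kh_log (t : R) : R := (sinh t + t) / (1 + cosh t).
Definition kt_log (v : R) : R := (sin v + v) / (1 + cos v).

Lemma dFlog_real t : dFlog (t, 0) = (kh_log t, 0).
Proof.
  unfold dFlog, Csinh, Ccosh, kh_log; simpl. rewrite cos_0, sin_0. assert (P := cosh_pos t).
  apply injective_projections; simpl; field; repeat split; try lra; try nra.
Qed.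
Lemma dFlog_imag v : cos v <> -1 -> dFlog (0, v) = (0, kt_log v).
Proof.
  intros Hc. unfold dFlog, Csinh, Ccosh, kt_log; simpl. rewrite cosh_0, sinh_0.
  assert (1 + cos v <> 0) by lra.
  apply injective_projections; simpl; field; repeat split; try lra; nra.
Qed.

(** * The contour for [log omega] *)

(** The sides of [[0, 20] x [0, top]] off the axes, with a rectangular detour round [i PI]; [Gaxis] is the
    part of the imaginary axis above the detour, and contains the saddle point. *)
Definition Gouter : contour := [
  (RtoC 1, (20, 0), Ci, 0, PI - dlt); (RtoC 1, (20, 0), Ci, PI - dlt, PI + dlt); (RtoC 1, (20, 0), Ci, PI + dlt, top);
  ((- (1))%C, (0, PI - dlt), RtoC 1, 0, dlt); ((- (1))%C, (dlt, 0), Ci, PI - dlt, PI + dlt);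
  (RtoC 1, (0, PI + dlt), RtoC 1, 0, dlt); ((- (1))%C, (0, top), RtoC 1, 0, 20)].
Definition Gaxis : contour := [((- (1))%C, (0, 0), Ci, PI + dlt, top)].
Definition Glog : contour := Gouter ++ Gaxis.

Lemma on_app G H w : on (G ++ H) w <-> on G w \/ on H w.
Proof.
  induction G as [|[[[[k z] d] a] b] G IH]; simpl; [tauto|]. rewrite IH. tauto.
Qed.
Lemma oriented_app G H : oriented G -> oriented H -> oriented (G ++ H).
Proof. induction G as [|[[[[k z] d] a] b] G IH]; simpl; auto. intros [A B]; auto. Qed.
Lemma cint_app f G H : cint f (G ++ H) = (cint f G + cint f H)%C.
Proof. induction G as [|[[[[k z] d] a] b] G IH]; simpl; [ring|]. rewrite IH. ring. Qed.

Lemma Gouter_oriented : oriented Gouter.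
Proof. generalize PI_bounds. simpl. unfold dlt, top. lra. Qed.
Lemma Gaxis_oriented : oriented Gaxis.
Proof. generalize PI_bounds. simpl. unfold dlt, top. lra. Qed.
Lemma Glog_oriented : oriented Glog.
Proof. apply oriented_app; [apply Gouter_oriented|apply Gaxis_oriented]. Qed.

Lemma on_Gouter (w : C) : on Gouter w ->
  (exists v, 0 <= v <= top /\ w = (20, v)) \/
  (exists u v, 0 <= u <= dlt /\ PI - dlt <= v <= PI + dlt /\ region u v /\ w = (u, v)) \/
  (exists u, 0 <= u <= 20 /\ w = (u, top)).
Proof.
  assert (HP := PI_bounds). intros H.
  destruct H as [[t [Ht ->]]|[[t [Ht ->]]|[[t [Ht ->]]|[[t [Ht ->]]|[[t [Ht ->]]|[[t [Ht ->]]|[[t [Ht ->]]|[]]]]]]]].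
  - left. exists t. split; [unfold dlt, top in *; lra|apply vpt].
  - left. exists t. split; [unfold dlt, top in *; lra|apply vpt].
  - left. exists t. split; [unfold dlt, top in *; lra|apply vpt].
  - right; left. exists t, (PI - dlt). unfold region, dlt, top in *. repeat split; try lra. apply hpt.
  - right; left. exists dlt, t. unfold region, dlt, top in *. repeat split; try lra. apply vpt.
  - right; left. exists t, (PI + dlt). unfold region, dlt, top in *. repeat split; try lra. apply hpt.
  - right; right. exists t. split; [unfold dlt, top in *; lra|apply hpt].
Qed.

Lemma on_Gaxis (w : C) : on Gaxis w -> exists v, PI + dlt <= v <= top /\ w = (0, v).
Proof. intros [[t [Ht ->]]|[]]. exists t. split; auto. apply (vpt 0). Qed.

Lemma Glog_region (w : C) : on Glog w -> exists u v, w = (u, v) /\ region u v.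
Proof.
  assert (HP := PI_bounds). intros H. apply on_app in H. destruct H as [H|H].
  - destruct (on_Gouter w H) as [[v [Hv ->]]|[(u & v & Hu & Hv & Hr & ->)|[u [Hu ->]]]].
    + exists 20, v. split; auto. unfold region. repeat split; lra.
    + exists u, v. auto.
    + exists u, top. split; auto. unfold region, top. repeat split; lra.
  - destruct (on_Gaxis w H) as [v [Hv ->]]. exists 0, v. split; auto. unfold region, top, dlt in *. repeat split; lra.
Qed.

Lemma exp_7_2 : exp (7 / 2) <= 34.
Proof.
  replace (7 / 2) with (INR 7 * (1 / 2)) by (simpl; field). rewrite exp_pow.
  destruct (exp_8_bounds (1 / 2) ltac:(lra)) as [_ H].
  apply Rle_trans with ((1649 / 1000) ^ 7); [|lra]. apply pow_incr. split; [left; apply exp_pos|lra].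
Qed.
Lemma exp_155 : exp (155 / 100) <= 5.
Proof.
  replace (155 / 100) with (INR 2 * (155 / 200)) by (simpl; field). rewrite exp_pow.
  destruct (exp_8_bounds (155 / 200) ltac:(lra)) as [_ H].
  apply Rle_trans with ((22 / 10) ^ 2); [|lra]. apply pow_incr. split; [left; apply exp_pos|lra].
Qed.
Lemma ln_ge a x : exp a <= x -> a <= ln x.
Proof. intros H. rewrite <- (ln_exp a). destruct H as [H|H]; [left; apply ln_increasing; auto; apply exp_pos|rewrite H; lra]. Qed.
Lemma ln_le_opp a x : 0 < x -> x * exp a <= 1 -> ln x <= - a.
Proof.
  intros Hx H. rewrite <- (ln_exp (- a)). apply Rcomplements.ln_le; auto. rewrite exp_Ropp.
  apply Rmult_le_reg_r with (exp a); [apply exp_pos|]. rewrite Rinv_l; [auto|apply Rgt_not_eq, exp_pos].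
Qed.

Lemma Cmod_Csinhc (w : C) : w <> RtoC 0 -> Cmod (Csinhc w) * Cmod w = Cmod (Csinh w).
Proof. intros H. rewrite Csinhc_nz by auto. rewrite <- Cmod_mult. f_equal. field. auto. Qed.

Lemma far_side v : 0 <= v <= top -> 7 / 2 <= Cmod (plog (20, v)).
Proof.
  intros Hv. assert (HP := PI_bounds). unfold top in Hv.
  assert (Hr : region 20 v) by (unfold region, top; repeat split; lra).
  eapply Rle_trans; [|apply Re_le_Cmod]. eapply Rle_trans; [|apply Rle_abs]. rewrite plog_Re by auto.
  apply ln_ge. eapply Rle_trans; [apply exp_7_2|].
  assert (Hw : (20, v) <> RtoC 0) by (apply pair_nz; lra).
  assert (S1 : 1353 <= Cmod (Csinh (20, v))).
  { assert (M := Cmod_Csinh_sqr 20 v). assert (P := Cmod_ge_0 (Csinh (20, v))).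
    assert (sinh 20 >= 1353) by (generalize (sinh_2_ge 20 ltac:(lra)); lra).
    apply Rnot_lt_le. intros Hlt. assert (0 <= sin v ^ 2) by apply pow2_ge_0. nra. }
  assert (S2 : Cmod (20, v) <= 26).
  { eapply Rle_trans; [apply Cmod_le_sum|]. simpl. rewrite !Rabs_pos_eq by lra. lra. }
  rewrite <- Cmod_Csinhc in S1 by auto. assert (P := Cmod_ge_0 (Csinhc (20, v))). nra.
Qed.

(** Near [i PI] the function [sinh w / w] is small, so the real part of its logarithm is very negative. *)
Lemma far_box u v : 0 <= u <= dlt -> PI - dlt <= v <= PI + dlt -> region u v -> 7 / 2 <= Cmod (plog (u, v)).
Proof.
  intros Hu Hv Hr. assert (HP := PI_bounds). unfold dlt in *.
  eapply Rle_trans; [|apply Re_le_Cmod]. rewrite plog_Re by auto.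
  assert (Pz := proj1 (Cmod_gt_0 _) (region_nz u v Hr)).
  rewrite <- Rabs_Ropp. eapply Rle_trans; [|apply Rle_abs]. apply Ropp_le_cancel. rewrite Ropp_involutive.
  apply ln_le_opp; auto. assert (Ee := exp_7_2). assert (Pe := exp_pos (7 / 2)).
  assert (Hw : (u, v) <> RtoC 0) by (apply pair_nz; lra).
  assert (M := Cmod_Csinh_sqr u v).
  assert (Hs : 0 <= sinh u <= 21 / 1000).
  { destruct (Req_dec u 0) as [->|]; [rewrite sinh_0; lra|].
    generalize (sinh_pos u ltac:(lra)) (sinh_bounds u ltac:(lra)). intros.
    assert (3 * u * u * u <= 1 / 1000) by (assert (u * u <= 1 / 2500) by nra; nra). lra. }
  assert (Hsv : Rabs (sin v) <= 1 / 50).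
  { replace v with ((v - PI) + PI) by ring. rewrite neg_sin, Rabs_Ropp. eapply Rle_trans; [apply sin_1_bound|].
    apply Rabs_le. lra. }
  assert (S2 : sin v ^ 2 <= (1 / 50) ^ 2) by (rewrite <- pow2_abs; apply pow_incr; split; [apply Rabs_pos|auto]).
  assert (S1 : Cmod (Csinh (u, v)) <= 3 / 100).
  { assert (P := Cmod_ge_0 (Csinh (u, v))). apply Rnot_lt_le. intros Hlt. nra. }
  assert (W : 3 <= Cmod (u, v)).
  { eapply Rle_trans; [|apply Im_le_Cmod]. simpl. rewrite Rabs_pos_eq; lra. }
  rewrite <- Cmod_Csinhc in S1 by auto. assert (Cmod (Csinhc (u, v)) <= 1 / 100) by nra. nra.
Qed.

Lemma kap_quarter : kap < PI / 4.
Proof.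
  assert (H := Cexp_Clogp mcut slit_mcut). assert (K := kap_range).
  assert (H1 := f_equal Re H). assert (H2 := f_equal Im H). unfold Cexp, mcut in H1, H2.
  change (exp (Re (Clogp mcut)) * cos (Im (Clogp mcut)) = -2) in H1.
  change (exp (Re (Clogp mcut)) * sin (Im (Clogp mcut)) = -1) in H2.
  replace (Im (Clogp mcut)) with (kap - PI) in H1, H2 by (unfold kap; ring).
  rewrite cos_minus, cos_PI, sin_PI in H1. rewrite sin_minus, cos_PI, sin_PI in H2.
  assert (P := exp_pos (Re (Clogp mcut))). set (e := exp _) in *.
  assert (C : sin kap < cos kap) by nra.
  apply Rnot_le_lt. intros Hle. assert (HP := PI_RGT_0).
  assert (cos kap <= sin kap); [|lra].
  rewrite <- sin_shift. apply sin_incr_1; lra.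
Qed.

Lemma atan_lower x : 0 < x -> x - x ^ 3 / 3 <= atan x.
Proof.
  intros Hx. apply Rlt_le, Rlt_0_minus.
  apply (incr_zero (fun x => atan x - (x - x ^ 3 / 3)) (fun x => x ^ 4 / (1 + x ^ 2)) x); [lra|rewrite atan_0; field| |].
  - intros t Ht. evar_last.
    { apply (is_derive_minus atan (fun x => x - x ^ 3 / 3)); [apply is_derive_Reals, derivable_pt_lim_atan|auto_derive; auto; reflexivity]. }
    unfold minus, plus, opp; simpl. field. nra.
  - intros t Ht. assert (P := pow_lt t 2 ltac:(lra)). apply Rdiv_lt_0_compat; [apply pow_lt; lra|lra].
Qed.

Lemma sin_cos_top : sin top = - cos (PI / 4) /\ cos top = cos (PI / 4).
Proof.
  unfold top. replace (7 * (PI / 4)) with (2 * PI - PI / 4) by field.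
  rewrite sin_minus, cos_minus, sin_2PI, cos_2PI, sin_cos_PI4. lra.
Qed.

(** On the top line the argument [psi] of [sinh w / w] is at least [PI].  While [sinh u < 2 / 5 cosh u] the
    modulus of [sinh w / w] is so small that [psi] and the logarithm of the modulus together suffice;
    further right [psi] has grown by [atan (2 / 5)], which brings it above [7 / 2]. *)
Lemma far_top u : 0 <= u <= 20 -> 7 / 2 <= Cmod (plog (u, top)).
Proof.
  intros Hu. assert (HP := PI_bounds). destruct sin_cos_top as [St Ct]. assert (K1 := kap_range). assert (K2 := kap_quarter).
  assert (Hr : region u top) by (unfold region, top; repeat split; lra).
  assert (Hb : 549 / 100 < top < 55 / 10) by (unfold top; lra).
  set (q := cos (PI / 4)) in *.
  assert (Hq : 0 < q) by (apply cos_gt_0; lra).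
  assert (Hqq : q * q = 1 / 2).
  { generalize (sin2_cos2 (PI / 4)). unfold Rsqr. rewrite sin_cos_PI4. fold q. lra. }
  assert (Hw : (u, top) <> RtoC 0) by (apply pair_nz; lra).
  assert (HE := plog_exp u top Hr). assert (HI := Im_Clogk_range (Csinhc (u, top))). fold (plog (u, top)) in HI.
  set (psi := Im (plog (u, top))) in *. set (lr := Re (plog (u, top))) in *.
  assert (Pr := exp_pos lr). set (r := exp lr) in *.
  set (X := u * sinh u - top * cosh u). set (Y := top * sinh u + u * cosh u).
  assert (D : 0 < u ^ 2 + top ^ 2) by nra.
  assert (EG : Csinhc (u, top) = (q * X / (u ^ 2 + top ^ 2), - (q * Y) / (u ^ 2 + top ^ 2))).
  { rewrite Csinhc_nz by auto. unfold Csinh; simpl. rewrite St, Ct. unfold X, Y.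
    apply injective_projections; simpl; field; nra. }
  rewrite EG in HE. assert (E1 := f_equal Re HE). assert (E2 := f_equal Im HE).
  change (r * cos psi = q * X / (u ^ 2 + top ^ 2)) in E1. change (r * sin psi = - (q * Y) / (u ^ 2 + top ^ 2)) in E2.
  set (m := q / (u ^ 2 + top ^ 2) / r).
  assert (Pm : 0 < m) by (unfold m; repeat apply Rdiv_lt_0_compat; auto).
  assert (Ec : cos psi = m * X).
  { apply Rmult_eq_reg_l with r; [|lra]. rewrite E1. unfold m. field. split; lra. }
  assert (Es : sin psi = - (m * Y)).
  { apply Rmult_eq_reg_l with r; [|lra]. rewrite E2. unfold m. field. split; lra. }
  assert (Ps : 0 <= sinh u) by (destruct (Req_dec u 0) as [->|]; [rewrite sinh_0; lra|left; apply sinh_pos; lra]).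
  assert (Pc := cosh_ge_1 u).
  assert (HY : 0 <= Y) by (unfold Y; apply Rplus_le_le_0_compat; apply Rmult_le_pos; lra).
  assert (HYX : X < Y).
  { assert (sinh u < cosh u) by (unfold sinh, cosh; generalize (exp_pos (- u)); lra). unfold X, Y. nra. }
  assert (Hpsi : PI <= psi).
  { apply Rnot_lt_le. intros Hlt.
    assert (Hle : psi <= 0).
    { apply Rnot_lt_le. intros H0. generalize (sin_gt_0 psi H0 Hlt). rewrite Es.
      assert (0 <= m * Y) by (apply Rmult_le_pos; lra). lra. }
    assert (S1 : sin (- psi) <= sin (PI / 4)) by (apply sin_incr_1; lra).
    assert (C1 : cos (PI / 4) <= cos (- psi)) by (apply cos_decr_1; lra).
    rewrite sin_neg in S1. rewrite cos_neg in C1. rewrite sin_cos_PI4 in S1.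
    assert (m * X < m * Y) by (apply Rmult_lt_compat_l; auto). lra. }
  destruct (Rlt_le_dec (sinh u) (2 / 5 * cosh u)) as [Hc|Hc].
  - assert (E0 := cosh_sinh u).
    assert (S1 : Cmod (Csinh (u, top)) <= 84 / 100).
    { assert (M := Cmod_Csinh_sqr u top). rewrite St in M. fold q in M.
      assert (P := Cmod_ge_0 (Csinh (u, top))). apply Rnot_lt_le. intros Hlt.
      assert (sinh u * sinh u <= 191 / 1000) by nra. nra. }
    assert (W : 549 / 100 <= Cmod (u, top)).
    { eapply Rle_trans; [|apply Im_le_Cmod]. simpl. rewrite Rabs_pos_eq; lra. }
    rewrite <- Cmod_Csinhc in S1 by auto.
    assert (Pz := proj1 (Cmod_gt_0 _) (region_nz u top Hr)).
    assert (G : Cmod (Csinhc (u, top)) <= 16 / 100) by nra.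
    assert (L : lr <= - (155 / 100)).
    { unfold lr. rewrite plog_Re by auto. apply ln_le_opp; auto.
      generalize exp_155 (exp_pos (155 / 100)). intros. nra. }
    assert (Q : (7 / 2) ^ 2 <= Cmod (plog (u, top)) ^ 2).
    { rewrite Cmod2_alt. fold psi lr. assert (9869 / 1000 <= psi ^ 2) by nra. assert (2402 / 1000 <= lr ^ 2) by nra. lra. }
    assert (P := Cmod_ge_0 (plog (u, top))). nra.
  - eapply Rle_trans; [|apply Im_le_Cmod]. fold psi. rewrite Rabs_pos_eq by lra.
    set (a := atan (2 / 5)).
    assert (Ha := atan_lower (2 / 5) ltac:(lra)). fold a in Ha.
    assert (Hab := atan_bound (2 / 5)). fold a in Hab.
    assert (Ca : 0 < cos a) by (apply cos_gt_0; lra).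
    assert (Sa : sin a = 2 / 5 * cos a).
    { assert (T : tan a = 2 / 5) by apply tan_atan. unfold tan in T. rewrite <- T. field. lra. }
    assert (S1 : sin (psi - a) <= 0).
    { rewrite sin_minus, Es, Ec, Sa.
      assert (0 <= m * cos a * (Y + 2 / 5 * X)).
      { apply Rmult_le_pos; [apply Rmult_le_pos; lra|]. unfold X, Y.
        assert (0 <= top * (sinh u - 2 / 5 * cosh u)) by (apply Rmult_le_pos; lra).
        assert (0 <= u * (cosh u + 2 / 5 * sinh u)) by (apply Rmult_le_pos; lra). lra. }
      lra. }
    assert (PI <= psi - a); [|lra].
    apply Rnot_lt_le. intros Hlt. generalize (sin_gt_0 (psi - a) ltac:(lra) Hlt). lra.
Qed.

Lemma Gouter_far (w : C) : on Gouter w -> 7 / 2 <= Cmod (plog w).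
Proof.
  intros H. destruct (on_Gouter w H) as [[v [Hv ->]]|[(u & v & Hu & Hv & Hr & ->)|[u [Hu ->]]]].
  - apply far_side; auto.
  - apply far_box; auto.
  - apply far_top; auto.
Qed.

(** ** The segment of the imaginary axis between [i PI] and [2 i PI] *)

Definition ell (v : R) : R := ln (- sin v / v).

Lemma ell_split v : PI < v < 2 * PI -> ell v = ln (- sin v) - ln v.
Proof.
  intros Hv. assert (HP := PI_RGT_0). assert (S := sin_lt_0 v ltac:(lra) ltac:(lra)).
  unfold ell, Rdiv. rewrite ln_mult, ln_Rinv; try lra. apply Rinv_0_lt_compat; lra.
Qed.

Lemma near_open (f g : R -> R) a b (t l : R) : a < t < b -> (forall s, a < s < b -> f s = g s) ->
  is_derive f t l -> is_derive g t l.
Proof.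
  intros Ht E H. apply (is_derive_ext_loc f g); auto.
  exists (mkposreal (Rmin (t - a) (b - t)) ltac:(apply Rmin_pos; lra)). intros s Hs.
  apply Rabs_lt_between' in Hs. simpl in Hs. generalize (Rmin_l (t - a) (b - t)) (Rmin_r (t - a) (b - t)). intros. apply E. lra.
Qed.

Lemma is_derive_ell v : PI < v < 2 * PI -> is_derive ell v (cos v / sin v - / v).
Proof.
  intros Hv. assert (HP := PI_RGT_0). assert (S := sin_lt_0 v ltac:(lra) ltac:(lra)).
  apply (near_open (fun v => ln (- sin v) - ln v) ell PI (2 * PI)); auto.
  - intros s Hs. symmetry. apply ell_split; auto.
  - auto_derive; [split; lra|]. field. lra.
Qed.
Lemma is_derive_ell' v : PI < v < 2 * PI -> is_derive (fun v => cos v / sin v - / v) v (- / sin v ^ 2 + / v ^ 2).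
Proof.
  intros Hv. assert (HP := PI_RGT_0). assert (S := sin_lt_0 v ltac:(lra) ltac:(lra)).
  auto_derive; [repeat split; lra|]. generalize (sin2_cos2 v). unfold Rsqr. intros E.
  assert (E' : cos v * cos v = 1 - sin v * sin v) by lra. field [E']. lra.
Qed.

Lemma ell_eta : ell eta1 = ell1.
Proof.
  unfold ell, ell1. assert (Ho := omega1_bounds). rewrite Rabs_left by lra. f_equal. unfold omega1.
  generalize eta1_bounds. intros. field. lra.
Qed.
Lemma ell'_eta : cos eta1 / sin eta1 - / eta1 = 0.
Proof.
  assert (He := eta1_bounds). assert (Ho := omega1_bounds). rewrite omega1_cos in Ho. rewrite eta1_sin. field. lra.
Qed.

(** The derivative of [ell] vanishes at [eta1], and [ell'' <= - 4 / 5] throughout. *)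
Lemma ell_upper v : PI < v < 2 * PI -> ell v <= ell1 - 2 / 5 * (v - eta1) ^ 2.
Proof.
  intros Hv. assert (HP := PI_bounds). assert (He := proj1 eta1_spec).
  set (h := fun v => ell v + 2 / 5 * (v - eta1) ^ 2).
  set (h1 := fun v => cos v / sin v - / v + 4 / 5 * (v - eta1)).
  assert (D1 : forall x, PI < x < 2 * PI -> is_derive h x (h1 x)).
  { intros x Hx. evar_last; [apply (is_derive_plus ell (fun v => 2 / 5 * (v - eta1) ^ 2)); [apply is_derive_ell; auto|auto_derive; auto; reflexivity]|].
    unfold plus, h1; simpl. field. assert (S := sin_lt_0 x ltac:(lra) ltac:(lra)). lra. }
  assert (D2 : forall x, PI < x < 2 * PI -> is_derive h1 x (- / sin x ^ 2 + / x ^ 2 + 4 / 5)).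
  { intros x Hx. evar_last; [apply (is_derive_plus (fun v => cos v / sin v - / v) (fun v => 4 / 5 * (v - eta1))); [apply is_derive_ell'; auto|auto_derive; auto; reflexivity]|].
    unfold plus; simpl. field. assert (S := sin_lt_0 x ltac:(lra) ltac:(lra)). lra. }
  assert (N2 : forall x, PI < x < 2 * PI -> - / sin x ^ 2 + / x ^ 2 + 4 / 5 <= 0).
  { intros x Hx. assert (S := sin_lt_0 x ltac:(lra) ltac:(lra)).
    assert (0 < sin x ^ 2 <= 1).
    { split; [nra|]. generalize (sin2_cos2 x). unfold Rsqr. nra. }
    assert (1 <= / sin x ^ 2) by (rewrite <- Rinv_1 at 1; apply Rinv_le_contravar; lra).
    assert (/ x ^ 2 <= / 9) by (apply Rinv_le_contravar; nra). lra. }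
  assert (H0 : h1 eta1 = 0) by (unfold h1; rewrite ell'_eta; ring).
  assert (H1 : h eta1 = ell1) by (unfold h; rewrite ell_eta; ring).
  assert (Hin : forall x z, PI < z < 2 * PI -> Rmin eta1 z <= x <= Rmax eta1 z -> PI < x < 2 * PI).
  { intros x z Hz. unfold Rmin, Rmax. destruct (Rle_dec eta1 z); lra. }
  destruct (MVT_gen h eta1 v h1) as [c [Hc E]].
  { intros x Hx. apply D1, (Hin x v); auto. lra. }
  { intros x Hx. apply continuity_pt_filterlim, continuous_smooth. eexists. apply D1, (Hin x v); auto. }
  assert (Hc' := Hin c v Hv Hc).
  destruct (MVT_gen h1 eta1 c (fun x => - / sin x ^ 2 + / x ^ 2 + 4 / 5)) as [d [Hd E']].
  { intros x Hx. apply D2, (Hin x c); auto. lra. }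
  { intros x Hx. apply continuity_pt_filterlim, continuous_smooth. eexists. apply D2, (Hin x c); auto. }
  assert (N := N2 d (Hin d c Hc' Hd)). rewrite H0, Rminus_0_r in E'.
  assert (P : 0 <= (c - eta1) * (v - eta1)).
  { revert Hc. unfold Rmin, Rmax. destruct (Rle_dec eta1 v); intros; nra. }
  assert (h v <= ell1); [|unfold h in *; lra].
  rewrite E', H1 in E.
  assert ((- / sin d ^ 2 + / d ^ 2 + 4 / 5) * (c - eta1) * (v - eta1) <= 0) by (rewrite Rmult_assoc; nra). lra.
Qed.

Lemma Gaxis_far (w : C) : on Gaxis w -> rho_x <= Cmod (plog w).
Proof.
  intros H. assert (HP := PI_bounds). destruct (on_Gaxis w H) as [v [Hv ->]]. unfold top, dlt in Hv.
  rewrite plog_imag_high by lra. fold (ell v). assert (U := ell_upper v ltac:(lra)).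
  assert (Q : rho_x ^ 2 <= Cmod (ell v, PI) ^ 2).
  { rewrite Cmod2_alt, rho_sqr. simpl Re. simpl Im. assert (L := ell1_bounds). assert (0 <= (v - eta1) ^ 2) by apply pow2_ge_0. nra. }
  assert (P := Cmod_ge_0 (ell v, PI)). assert (P2 := rho_pos). nra.
Qed.

Lemma Glog_far (w : C) : on Glog w -> rho_x <= Cmod (plog w).
Proof.
  intros H. apply on_app in H. destruct H as [H|H]; [|apply Gaxis_far; auto].
  generalize (Gouter_far w H) rho_bounds. lra.
Qed.

Lemma Glog_dFlog_cont w : on Glog w -> Ccont dFlog w.
Proof. intros H. destruct (Glog_region w H) as (u & v & -> & Hr). apply dFlog_cont; auto. Qed.
Lemma Glog_plog_cont w : on Glog w -> Ccont plog w.
Proof. intros H. destruct (Glog_region w H) as (u & v & -> & Hr). apply plog_cont; auto. Qed.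

(** The region is the union of three rectangles: below, to the right of, and above the box round [i PI]. *)
Lemma cauchy_log y : Rabs y < rho_x -> exists e1, 0 < e1 /\ forall e, 0 < e < e1 ->
  (cint (fun w => dFlog w / (plog w - below y e)) Glog
   + seg (fun w => dFlog w / (plog w - below y e)) (0, 0) 1 0 20
   - seg (fun w => dFlog w / (plog w - below y e)) (0, 0) Ci 0 (PI - dlt))%C = 0.
Proof.
  intros Hy. assert (HP := PI_bounds). exists (PI / 4). split; [lra|]. intros e He.
  set (Phi := fun w => (dFlog w / (plog w - below y e))%C).
  assert (Hnz : forall u v, region u v -> (plog (u, v) - below y e)%C <> RtoC 0).
  { intros u v Hr E. assert (E2 := plog_exp u v Hr).
    replace (plog (u, v)) with (plog (u, v) - below y e + below y e)%C in E2 by ring. rewrite E in E2.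
    destruct Hr as (Hu & Hv & _).
    apply (no_crossing u v (exp y * cos e) (exp y * sin e) Hu Hv).
    - assert (Py := exp_pos y). assert (S := sin_gt_0 e ltac:(lra) ltac:(lra)).
      assert (sin e < cos e).
      { apply Rlt_le_trans with (sin (PI / 4)); [apply sin_increasing_1; lra|].
        rewrite sin_cos_PI4. apply cos_decr_1; lra. }
      split; [apply Rmult_lt_0_compat; auto|apply Rmult_lt_compat_l; auto].
    - rewrite <- E2. unfold Cexp, below; simpl. replace (0 + - e) with (- e) by ring.
      rewrite cos_neg, sin_neg, Rplus_0_l. f_equal. ring. }
  assert (HC : forall u v, region u v -> Ccont Phi (u, v)).
  { intros u v Hr. apply Ccont_div; [apply Hnz; auto|apply dFlog_cont; auto|apply Ccont_minus_c, plog_cont; auto]. }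
  assert (HH : forall u v, region u v -> (u, v) <> RtoC 0 -> Chol Phi (u, v)).
  { intros u v Hr H0. apply Chol_div; [apply Hnz; auto|apply dFlog_hol; auto|].
    apply (Chol_minus plog (fun _ => below y e)); [apply plog_hol; auto|apply Chol_const]. }
  assert (N1 : dlt = 1 / 50) by reflexivity. assert (N2 : top = 7 * (PI / 4)) by reflexivity.
  set (lo := PI - dlt). set (hi := PI + dlt).
  assert (N3 : lo = PI - dlt) by reflexivity. assert (N4 : hi = PI + dlt) by reflexivity.
  assert (I1 : rint Phi 0 20 0 lo = 0).
  { apply goursat_corner; try lra.
    - intros [u v] [Hu Hv] Hne. simpl in Hu, Hv. apply HH; auto. unfold region; repeat split; lra.
    - apply HC. unfold region; repeat split; lra. }
  assert (I2 : rint Phi dlt 20 lo hi = 0).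
  { apply goursat; try lra. intros [u v] [Hu Hv]. simpl in Hu, Hv. apply HH; [unfold region; repeat split; lra|].
    apply pair_nz; lra. }
  assert (I3 : rint Phi 0 20 hi top = 0).
  { apply goursat; try lra. intros [u v] [Hu Hv]. simpl in Hu, Hv. apply HH; [unfold region; repeat split; lra|].
    apply pair_nz; lra. }
  assert (S1 : seg Phi (0, lo) 1 0 20 = (seg Phi (0, lo) 1 0 dlt + seg Phi (0, lo) 1 dlt 20)%C).
  { apply seg_chasles; [lra|]. apply segcont_h; [lra|]. intros t Ht. apply HC. unfold region; repeat split; lra. }
  assert (S2 : seg Phi (0, hi) 1 0 20 = (seg Phi (0, hi) 1 0 dlt + seg Phi (0, hi) 1 dlt 20)%C).
  { apply seg_chasles; [lra|]. apply segcont_h; [lra|]. intros t Ht. apply HC. unfold region; repeat split; lra. }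
  unfold rint in I1, I2, I3. rewrite S1 in I1. rewrite S2 in I3.
  unfold Glog. rewrite cint_app. unfold Gouter, Gaxis. fold lo hi. simpl cint.
  assert (H := f_equal2 Cplus (f_equal2 Cplus I1 I2) I3). rewrite !Cplus_0_r in H.
  etransitivity; [|exact H]. ring.
Qed.

(** ** The second derivative of [J (e ^ y)] *)

Definition Elog : nat -> R := bcoef dFlog plog Glog.

Lemma Elog_bound : exists M, 0 <= M /\ forall m, Rabs (Elog m) <= M * / rho_x ^ m.
Proof.
  assert (Hr := rho_pos).
  exact (bcoef_bound dFlog plog Glog rho_x rho_x Glog_oriented (conj Hr (Rle_refl _)) Glog_dFlog_cont Glog_plog_cont Glog_far).
Qed.

Lemma HRlog t : 0 <= t <= 20 -> Ccont dFlog (t, 0) /\ Ccont plog (t, 0) /\ Im (dFlog (t, 0)) = 0 /\ Im (plog (t, 0)) = 0.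
Proof.
  intros Ht. assert (HP := PI_bounds).
  assert (Hr : region t 0) by (unfold region, top; repeat split; lra).
  split; [apply dFlog_cont; auto|]. split; [apply plog_cont; auto|]. rewrite dFlog_real, plog_real by lra. auto.
Qed.
Lemma HIlog v : 0 <= v <= PI - dlt -> Ccont dFlog (0, v) /\ Ccont plog (0, v) /\ Re (dFlog (0, v)) = 0 /\ Im (plog (0, v)) = 0.
Proof.
  unfold dlt. intros Hv. assert (HP := PI_bounds).
  assert (Hr : region 0 v) by (unfold region, top; repeat split; lra).
  split; [apply dFlog_cont; auto|]. split; [apply plog_cont; auto|]. rewrite plog_imag_low by lra.
  rewrite dFlog_imag; auto. intros Hc. apply (dFlog_den 0 v Hr). unfold Ccosh; simpl. rewrite cosh_0, sinh_0, Hc.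
  apply injective_projections; simpl; ring.
Qed.

Definition dphi_log (t : R) : R := Nh t / t ^ 2 / sinhc t.
Definition dpsi_log (v : R) : R := - Nt v / v ^ 2 / sinc v.

Lemma is_derive_ln_sinhc t : 0 < t -> is_derive (fun t => ln (sinhc t)) t (dphi_log t).
Proof.
  intros Ht. assert (P := sinhc_gt_1 t Ht).
  evar_last; [apply (is_derive_comp ln sinhc); [apply is_derive_ln; lra|apply is_derive_sinhc; auto]|].
  unfold scal; simpl. unfold mult; simpl. unfold dphi_log, Rdiv. simpl. ring.
Qed.
Lemma sinc_gt_0 v : 0 < v < PI -> 0 < sinc v.
Proof. intros Hv. rewrite sinc_pos by lra. apply Rdiv_lt_0_compat; [apply sin_gt_0; lra|lra]. Qed.
Lemma is_derive_ln_sinc v : 0 < v < PI -> is_derive (fun t => ln (sinc t)) v (dpsi_log v).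
Proof.
  intros Hv. assert (P := sinc_gt_0 v Hv).
  evar_last; [apply (is_derive_comp ln sinc); [apply is_derive_ln; lra|apply is_derive_sinc; lra]|].
  unfold scal; simpl. unfold mult; simpl. unfold dpsi_log, Rdiv. simpl. ring.
Qed.

Lemma dphi_log_pos t : 0 < t -> 0 < dphi_log t.
Proof.
  intros Ht. unfold dphi_log. generalize (sinhc_gt_1 t Ht). intros.
  apply Rdiv_lt_0_compat; [apply Rdiv_lt_0_compat; [apply Nh_pos; lra|apply pow_lt; lra]|lra].
Qed.
Lemma dpsi_log_neg v : 0 < v < PI -> dpsi_log v < 0.
Proof.
  intros Hv. unfold dpsi_log. assert (P := sinc_gt_0 v Hv).
  assert (0 < Nt v / v ^ 2 / sinc v).
  { apply Rdiv_lt_0_compat; [apply Rdiv_lt_0_compat; [apply Nt_pos; lra|apply pow_lt; lra]|lra]. }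
  unfold Rdiv in *. rewrite <- !Ropp_mult_distr_l. lra.
Qed.

Lemma Hphi_log t : 0 < t < 20 -> is_derive (fun t => Re (plog (t, 0))) t (dphi_log t) /\ continuous dphi_log t /\ 0 < dphi_log t.
Proof.
  intros Ht. split; [|split].
  - apply (ext_near (fun t => ln (sinhc t)) (fun t => Re (plog (t, 0))) t (dphi_log t)); [lra|intros; rewrite plog_real by lra; auto|].
    apply is_derive_ln_sinhc; lra.
  - assert (P := sinhc_gt_1 t ltac:(lra)). apply (continuous_smooth dphi_log). eexists.
    apply (is_derive_div (fun t => Nh t / t ^ 2) sinhc); [|apply is_derive_sinhc; lra|lra].
    apply (is_derive_div Nh (fun t => t ^ 2)); [apply Nh_derive|apply (is_derive_pow (fun x => x) 2), is_derive_id|].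
    apply pow_nonzero; lra.
  - apply dphi_log_pos; lra.
Qed.
Lemma Hpsi_log v : 0 < v < PI - dlt -> is_derive (fun v => Re (plog (0, v))) v (dpsi_log v) /\ continuous dpsi_log v /\ dpsi_log v < 0.
Proof.
  unfold dlt. intros Hv. assert (P := sinc_gt_0 v ltac:(lra)). split; [|split].
  - apply (near_open (fun t => ln (sinc t)) (fun v => Re (plog (0, v))) 0 PI v (dpsi_log v)); [lra|intros; rewrite plog_imag_low by lra; auto|].
    apply is_derive_ln_sinc; lra.
  - apply (continuous_smooth dpsi_log). eexists.
    apply (is_derive_div (fun v => - Nt v / v ^ 2) sinc); [|apply is_derive_sinc; lra|lra].
    apply (is_derive_div (fun v => - Nt v) (fun v => v ^ 2)); [apply (is_derive_opp Nt), Nt_derive|apply (is_derive_pow (fun x => x) 2), is_derive_id|].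
    apply pow_nonzero; lra.
  - apply dpsi_log_neg; lra.
Qed.

Lemma Elog_real t : 0 < t < 20 -> Rabs (ln (sinhc t)) < rho_x -> is_pseries Elog (ln (sinhc t)) (kh_log t / dphi_log t).
Proof.
  intros Ht Hx. assert (Hr := rho_pos). assert (HP := PI_bounds).
  assert (Hd : 0 < PI - dlt) by (unfold dlt; lra).
  assert (H := bcoef_real dFlog plog Glog rho_x rho_x 20 (PI - dlt) dphi_log dpsi_log
    Glog_oriented (conj Hr (Rle_refl _)) Glog_dFlog_cont Glog_plog_cont Glog_far ltac:(lra) Hd HRlog HIlog Hphi_log Hpsi_log cauchy_log t Ht).
  cbv beta zeta in H. rewrite plog_real, dFlog_real in H by lra. apply H. exact Hx.
Qed.
Lemma Elog_imag v : 0 < v < PI - dlt -> Rabs (ln (sinc v)) < rho_x -> is_pseries Elog (ln (sinc v)) (- kt_log v / dpsi_log v).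
Proof.
  intros Hv Hx. assert (Hr := rho_pos). assert (HP := PI_bounds).
  assert (Hd : 0 < PI - dlt) by (unfold dlt; lra).
  assert (H := bcoef_imag dFlog plog Glog rho_x rho_x 20 (PI - dlt) dphi_log dpsi_log
    Glog_oriented (conj Hr (Rle_refl _)) Glog_dFlog_cont Glog_plog_cont Glog_far ltac:(lra) Hd HRlog HIlog Hphi_log Hpsi_log cauchy_log v Hv).
  unfold dlt in Hv.
  assert (Hc : cos v <> -1).
  { intros Hc. assert (Hr2 : region 0 v) by (unfold region, top; repeat split; lra).
    apply (dFlog_den 0 v Hr2). unfold Ccosh; simpl. rewrite cosh_0, sinh_0, Hc. apply injective_projections; simpl; ring. }
  cbv beta zeta in H. rewrite plog_imag_low, dFlog_imag in H by (auto; lra).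
  replace (- kt_log v / dpsi_log v) with (Im (0, kt_log v) / - dpsi_log v); [apply H; exact Hx|].
  assert (P := dpsi_log_neg v ltac:(lra)). simpl. field. lra.
Qed.

(** ** The expansion of [J (e ^ y)] *)

Definition Fh_log (t : R) : R := t * tanh (t / 2).
Definition Ft_log (v : R) : R := - (v * tan (v / 2)).

Lemma is_derive_Fh_log t : is_derive Fh_log t (kh_log t).
Proof.
  assert (Pc := cosh_pos (t / 2)). assert (Hcs := cosh_sinh (t / 2)).
  unfold Fh_log, tanh, kh_log. evar_last.
  { apply (is_derive_mult (fun t => t) (fun t => sinh (t / 2) / cosh (t / 2))); [apply is_derive_id| |apply Rmult_comm].
    apply (is_derive_div (fun t => sinh (t / 2)) (fun t => cosh (t / 2))); [apply is_derive_sinh_half|apply is_derive_cosh_half|lra]. }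
  rewrite (sinh_2 t), (cosh_2 t). unfold plus, mult, one; simpl.
  set (s := sinh (t / 2)) in *. set (c := cosh (t / 2)) in *.
  replace (1 + (1 + 2 * (s * (s * 1)))) with (2 * (c * c)) by (rewrite Hcs; ring).
  field [Hcs]. lra.
Qed.

Lemma is_derive_Ft_log v : 0 < v < PI -> is_derive Ft_log v (- kt_log v).
Proof.
  intros Hv. assert (Pc := cos_gt_0 (v / 2) ltac:(lra) ltac:(lra)).
  assert (Hcs := sin2_cos2 (v / 2)). unfold Rsqr in Hcs.
  unfold Ft_log, tan, kt_log. evar_last.
  { apply (is_derive_opp (fun t => t * (sin (t / 2) / cos (t / 2)))).
    apply (is_derive_mult (fun t => t) (fun t => sin (t / 2) / cos (t / 2))); [apply is_derive_id| |apply Rmult_comm].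
    apply (is_derive_div (fun t => sin (t / 2)) (fun t => cos (t / 2))); [apply is_derive_sin_half|apply is_derive_cos_half|lra]. }
  rewrite (sin_2 v), (cos_2 v). unfold opp, plus, mult, one; simpl.
  set (s := sin (v / 2)) in *. set (c := cos (v / 2)) in *.
  assert (Hcs' : c * c = 1 - s * s) by lra.
  replace (1 + (1 - 2 * (s * (s * 1)))) with (2 * (c * c)) by (rewrite Hcs'; ring).
  field [Hcs']. lra.
Qed.

Lemma lim_ln (f : R -> R) : filterlim f (at_right 0) (locally 1) -> filterlim (fun t => ln (f t)) (at_right 0) (locally 0).
Proof.
  intros H. replace (locally 0) with (locally (ln 1)) by (f_equal; apply ln_1). apply (filterlim_comp _ _ _ f ln _ (locally 1)); auto.
  apply (continuous_smooth ln). eexists. apply is_derive_ln. lra.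
Qed.

Lemma Fh_log_lim : filterlim Fh_log (at_right 0) (locally 0).
Proof.
  replace (locally 0) with (locally (Fh_log 0)) by (f_equal; unfold Fh_log; ring). apply lim_at_0. eexists; apply is_derive_Fh_log.
Qed.
Lemma Ft_log_lim : filterlim Ft_log (at_right 0) (locally 0).
Proof.
  replace (locally 0) with (locally (Ft_log 0)) by (f_equal; unfold Ft_log; ring). apply lim_at_0. unfold Ft_log, tan.
  auto_derive. rewrite Rmult_0_l, cos_0. lra.
Qed.

Lemma exp_rho_bounds : 1 < exp rho_x < 34 /\ 1 / 34 < exp (- rho_x) < 1.
Proof.
  assert (Hr := rho_bounds).
  assert (A : 1 < exp rho_x < 34).
  { split; [rewrite <- exp_0; apply exp_increasing; lra|].
    eapply Rlt_le_trans; [|exact exp_7_2]. apply exp_increasing; lra. }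
  split; auto. rewrite exp_Ropp. split.
  - unfold Rdiv. rewrite Rmult_1_l. apply Rinv_lt_contravar; [nra|lra].
  - rewrite <- Rinv_1. apply Rinv_lt_contravar; lra.
Qed.

Lemma jh_series_log t : 0 < t -> sinhc t < exp rho_x -> jh t = PSeries (integrate2 Elog) (ln (sinhc t)).
Proof.
  intros Ht Hs. destruct Elog_bound as [M [HM0 HM]]. assert (Hr := rho_pos). destruct exp_rho_bounds as [HE _].
  set (T := xi (exp rho_x)). destruct (xi_spec (exp rho_x) ltac:(lra)) as [T1 T2]. fold T in T1, T2.
  assert (H20 : 34 < sinhc 20).
  { rewrite sinhc_pos by lra. generalize (sinh_2_ge 20 ltac:(lra)). lra. }
  assert (HT : T < 20).
  { apply Rnot_le_lt. intros Hle. destruct (Req_dec T 20) as [E|]; [rewrite E in T2; lra|].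
    generalize (sinhc_incr 20 T ltac:(lra) ltac:(lra)). lra. }
  assert (HtT : t < T).
  { apply Rnot_le_lt. intros Hle. destruct (Req_dec t T) as [E|]; [rewrite E in Hs; lra|].
    generalize (sinhc_incr T t ltac:(lra) ltac:(lra)). lra. }
  rewrite <- (Rplus_0_r (PSeries _ _)), <- (Rmult_0_l (ln (sinhc t))).
  apply (double_integral Elog rho_x M (fun t => ln (sinhc t)) dphi_log Fh_log kh_log jh 0 T); auto; try lra.
  - intros s Hs'. assert (B1 := sinhc_gt_1 s ltac:(lra)). assert (B2 := sinhc_incr s T ltac:(lra) ltac:(lra)).
    assert (L1 : 0 < ln (sinhc s)) by (rewrite <- ln_1; apply ln_increasing; lra).
    assert (L2 : ln (sinhc s) < rho_x) by (rewrite <- (ln_exp rho_x), <- T2; apply ln_increasing; lra).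
    split; [apply is_derive_ln_sinhc; lra|]. split; [apply Rgt_not_eq, dphi_log_pos; lra|].
    split; [rewrite Rabs_pos_eq; lra|]. split; [apply is_derive_Fh_log|].
    split; [apply Elog_real; [lra|rewrite Rabs_pos_eq; lra]|apply is_derive_jh; lra].
  - apply lim_ln, sinhc_lim.
  - apply Fh_log_lim.
  - apply jh_lim.
Qed.

Lemma jt_series_log t : 0 < t < PI -> exp (- rho_x) < sinc t -> jt t = PSeries (integrate2 Elog) (ln (sinc t)).
Proof.
  intros Ht Hs. destruct Elog_bound as [M [HM0 HM]]. assert (Hr := rho_pos). destruct exp_rho_bounds as [_ HE].
  assert (HP := PI_bounds).
  set (T := zeta (exp (- rho_x))). destruct (zeta_spec (exp (- rho_x)) ltac:(lra)) as [T1 T2]. fold T in T1, T2.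
  assert (Hd : sinc (PI - dlt) < 1 / 34).
  { unfold dlt. rewrite sinc_pos by lra. replace (sin (PI - 1 / 50)) with (sin (1 / 50)) by (symmetry; apply sin_PI_x).
    generalize (sin_lt_x (1 / 50) ltac:(lra)). intros.
    apply Rmult_lt_reg_r with (PI - 1 / 50); [lra|]. unfold Rdiv at 1. rewrite Rmult_assoc, Rinv_l by lra. lra. }
  assert (HT : T < PI - dlt).
  { apply Rnot_le_lt. intros Hle. destruct (Req_dec T (PI - dlt)) as [E|]; [rewrite E in T2; lra|].
    generalize (sinc_decr (PI - dlt) T ltac:(unfold dlt; lra) ltac:(lra) ltac:(lra)). lra. }
  assert (HtT : t < T).
  { apply Rnot_le_lt. intros Hle. destruct (Req_dec t T) as [E|]; [rewrite E in Hs; lra|].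
    generalize (sinc_decr T t ltac:(lra) ltac:(lra) ltac:(lra)). lra. }
  rewrite <- (Rplus_0_r (PSeries _ _)), <- (Rmult_0_l (ln (sinc t))).
  unfold dlt in HT.
  apply (double_integral Elog rho_x M (fun t => ln (sinc t)) dpsi_log Ft_log (fun v => - kt_log v) jt 0 T); auto; try lra.
  - intros s Hs'. assert (B1 := sinc_decr s T ltac:(lra) ltac:(lra) ltac:(lra)).
    assert (B2 := sinc_decr 0 s ltac:(lra) ltac:(lra) ltac:(lra)). rewrite sinc_0 in B2. assert (B3 := exp_pos (- rho_x)).
    assert (L1 : ln (sinc s) < 0) by (rewrite <- ln_1; apply ln_increasing; lra).
    assert (L2 : - rho_x < ln (sinc s)) by (rewrite <- (ln_exp (- rho_x)), <- T2; apply ln_increasing; lra).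
    split; [apply is_derive_ln_sinc; lra|]. split; [apply Rlt_not_eq, dpsi_log_neg; lra|].
    split; [rewrite Rabs_left; lra|]. split; [apply is_derive_Ft_log; lra|].
    split; [apply Elog_imag; [unfold dlt; lra|rewrite Rabs_left; lra]|apply is_derive_jt; lra].
  - apply lim_ln, sinc_lim.
  - apply Ft_log_lim.
  - apply jt_lim.
Qed.

Lemma J_exp_formula y : Rabs y < rho_x -> J_BS (exp y) = PSeries (integrate2 Elog) y.
Proof.
  intros Hy. apply Rabs_lt_between in Hy. assert (Py := exp_pos y). destruct (Rtotal_order y 0) as [H|[->|H]].
  - assert (E : exp y < 1) by (rewrite <- exp_0; apply exp_increasing; auto).
    rewrite J_BS_trig by auto. destruct (zeta_spec (exp y) ltac:(lra)) as [_ Z].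
    rewrite jt_series_log, Z, ln_exp; [reflexivity|apply zeta_range; lra|]. rewrite Z. apply exp_increasing; lra.
  - rewrite exp_0, J_BS_1, PSeries_0. reflexivity.
  - assert (E : 1 < exp y) by (rewrite <- exp_0; apply exp_increasing; auto).
    rewrite J_BS_hyp by lra. destruct (xi_spec (exp y) ltac:(lra)) as [_ Z].
    rewrite jh_series_log, Z, ln_exp; [reflexivity|apply xi_pos; auto|]. rewrite Z. apply exp_increasing; lra.
Qed.

Lemma CV_Elog : Rbar_le rho_x (CV_radius (integrate2 Elog)).
Proof.
  destruct Elog_bound as [M [HM0 HM]]. assert (Hr := rho_pos).
  apply (CV_ge _ _ (M * rho_x ^ 2)); [auto|apply integrate2_bound; auto].
Qed.

Lemma integrate2_Elog_series y : Rabs y < rho_x -> is_pseries (integrate2 Elog) y (J_BS (exp y)).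
Proof.
  intros Hy. rewrite J_exp_formula by auto. apply PSeries_correct, CV_radius_inside.
  eapply Rbar_lt_le_trans; [|exact CV_Elog]. exact Hy.
Qed.

Lemma dJ_coef_eq n : dJ_coef n = integrate2 Elog n.
Proof.
  assert (Hr := rho_pos).
  apply (taylor_coef_pseries (fun y => J_BS (exp y)) (integrate2 Elog) 0 rho_x); auto.
  - eapply Rbar_lt_le_trans; [|exact CV_Elog]. exact Hr.
  - intros x Hx. rewrite Rminus_0_r in *. apply integrate2_Elog_series; auto.
Qed.

Theorem part_ii_series : Rbar_le (Finite rho_x) (CV_radius dJ_coef)
    /\ (forall y : R, Rabs y < rho_x -> is_pseries dJ_coef y (J_BS (exp y))).
Proof.
  split.
  - rewrite (CV_radius_ext _ _ dJ_coef_eq). apply CV_Elog.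
  - intros y Hy. eapply is_pseries_ext; [|apply integrate2_Elog_series; auto]. intros n. symmetry. apply dJ_coef_eq.
Qed.

(** * Asymptotic tools *)

(** ** Wallis' product *)

Fixpoint wallis (k : nat) : R :=
  match k with O => 1 | S k' => wallis k' * ((2 * INR k' + 1) / (2 * INR k' + 2)) end.

Lemma wallis_pos k : 0 < wallis k.
Proof.
  induction k as [|k IH]; simpl; [lra|]. generalize (pos_INR k); intros.
  apply Rmult_lt_0_compat; auto. apply Rdiv_lt_0_compat; lra.
Qed.

Definition Isin (n : nat) : R := RInt (fun t => sin t ^ n) 0 (PI / 2).

Lemma sin_pow_cont n t : continuous (fun t => sin t ^ n) t.
Proof. apply (continuous_smooth (fun t => sin t ^ n)). auto_derive. auto. Qed.
Lemma sin_pow_int n : is_RInt (fun t => sin t ^ n) 0 (PI / 2) (Isin n).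
Proof.
  apply (RInt_correct (V := R_CompleteNormedModule)), cont_ex_RInt; [generalize PI_RGT_0; lra|].
  intros; apply sin_pow_cont.
Qed.

Lemma Isin_step n : (INR n + 2) * Isin (S (S n)) = (INR n + 1) * Isin n.
Proof.
  assert (HP := PI_RGT_0).
  assert (H1 : is_RInt (fun t => (INR n + 2) * sin t ^ S (S n) - (INR n + 1) * sin t ^ n) 0 (PI / 2)
    ((INR n + 2) * Isin (S (S n)) - (INR n + 1) * Isin n)).
  { apply (is_RInt_minus (V := R_NormedModule)); apply (is_RInt_scal (V := R_NormedModule)); apply sin_pow_int. }
  assert (H2 : is_RInt (fun t => (INR n + 2) * sin t ^ S (S n) - (INR n + 1) * sin t ^ n) 0 (PI / 2)
    (minus (- cos (PI / 2) * sin (PI / 2) ^ S n) (- cos 0 * sin 0 ^ S n))).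
  { apply (is_RInt_derive (fun t => - cos t * sin t ^ S n)).
    - intros t _. auto_derive; auto.
      replace (match n with 0%nat => 1 | S _ => INR n + 1 end) with (INR n + 1) by (destruct n; simpl; ring).
      assert (E := sin2_cos2 t). unfold Rsqr in E. assert (E' : cos t * cos t = 1 - sin t * sin t) by lra.
      simpl. ring [E'].
    - intros t _. apply (continuous_smooth (fun t => (INR n + 2) * sin t ^ S (S n) - (INR n + 1) * sin t ^ n)). auto_derive. auto. }
  assert (E := is_RInt_unique _ _ _ _ H1). rewrite (is_RInt_unique _ _ _ _ H2) in E.
  rewrite cos_PI2, sin_0 in E. unfold minus, plus, opp in E; simpl in E. lra.
Qed.

Lemma Isin_0 : Isin 0 = PI / 2.
Proof. unfold Isin. simpl. rewrite RInt_const. unfold scal; simpl. unfold mult; simpl. ring. Qed.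
Lemma Isin_1 : Isin 1 = 1.
Proof.
  unfold Isin. apply is_RInt_unique. apply (is_RInt_ext sin); [intros; simpl; ring|].
  replace 1 with (minus (- cos (PI / 2)) (- cos 0)) by (rewrite cos_PI2, cos_0; unfold minus, plus, opp; simpl; ring).
  apply (is_RInt_derive (fun t => - cos t)).
  - intros t _. auto_derive; auto. ring.
  - intros t _. apply (continuous_smooth sin). auto_derive. auto.
Qed.

Lemma Isin_even k : Isin (2 * k) = PI / 2 * wallis k.
Proof.
  induction k as [|k IH]; [simpl Nat.mul; rewrite Isin_0; simpl; ring|].
  replace (2 * S k)%nat with (S (S (2 * k))) by lia.
  assert (H := Isin_step (2 * k)). rewrite IH, mult_INR in H. replace (INR 2) with 2 in H by (simpl; ring). simpl wallis.
  generalize (pos_INR k); intros. apply Rmult_eq_reg_l with (2 * INR k + 2); [|lra].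
  rewrite H. field. lra.
Qed.
Lemma Isin_odd k : Isin (S (2 * k)) = / ((2 * INR k + 1) * wallis k).
Proof.
  induction k as [|k IH]; [simpl Nat.mul; rewrite Isin_1; simpl; field|].
  replace (S (2 * S k))%nat with (S (S (S (2 * k)))) by lia.
  assert (H := Isin_step (S (2 * k))). rewrite IH, S_INR, mult_INR in H. replace (INR 2) with 2 in H by (simpl; ring). simpl wallis.
  assert (P := wallis_pos k). rewrite S_INR.
  generalize (pos_INR k); intros. apply Rmult_eq_reg_l with (2 * INR k + 1 + 2); [|lra].
  rewrite H. field. repeat split; lra.
Qed.

Lemma Isin_decr n : Isin (S n) <= Isin n.
Proof.
  unfold Isin. assert (HP := PI_RGT_0). apply RInt_le; [lra|eexists; apply sin_pow_int|eexists; apply sin_pow_int|].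
  intros t Ht. simpl. rewrite <- (Rmult_1_l (sin t ^ n)) at 2. apply Rmult_le_compat_r.
  - apply pow_le, sin_ge_0; lra.
  - apply SIN_bound.
Qed.

(** The integrals [Isin] decrease, and those of even and odd index are [PI / 2 * wallis k] and
    [1 / ((2 k + 1) wallis k)]. *)
Lemma wallis_bounds k : (1 <= k)%nat -> / (INR k + / 2) <= PI * wallis k ^ 2 <= / INR k.
Proof.
  intros Hk. assert (HP := PI_RGT_0). assert (P := wallis_pos k). assert (K : 1 <= INR k) by (change 1 with (INR 1); apply le_INR; auto).
  split.
  - assert (H := Isin_decr (2 * k)). rewrite Isin_even, Isin_odd in H.
    apply Rmult_le_reg_r with ((2 * INR k + 1) / 2 / (wallis k)); [repeat apply Rdiv_lt_0_compat; lra|].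
    apply Rmult_le_reg_r with (/ (2 * INR k + 1)); [apply Rinv_0_lt_compat; lra|].
    apply Rle_trans with (/ ((2 * INR k + 1) * wallis k)); [right; field; split; lra|].
    eapply Rle_trans; [exact H|]. right; field; split; lra.
  - destruct k as [|k]; [lia|]. assert (H := Isin_decr (S (2 * k))).
    replace (S (S (2 * k))) with (2 * S k)%nat in H by lia. rewrite Isin_even, Isin_odd in H.
    assert (Q := wallis_pos k). simpl wallis in *. rewrite S_INR in *. generalize (pos_INR k). intros.
    set (x := wallis k) in *. set (y := INR k) in *.
    apply Rmult_le_reg_r with ((y + 1) / (2 * y + 1) / x); [repeat apply Rdiv_lt_0_compat; lra|].
    eapply Rle_trans; [|eapply Rle_trans; [exact H|]]; right; field; repeat split; lra.
Qed.

(** ** Exponentially small terms *)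

Lemma bernoulli h n : 0 <= h -> 1 + INR n * h <= (1 + h) ^ n.
Proof.
  intros Hh. induction n as [|n IH]; [simpl; lra|]. rewrite S_INR. simpl.
  assert (0 <= INR n * h) by (apply Rmult_le_pos; [apply pos_INR|auto]). nra.
Qed.

(** With [q = s ^ 2] and [/ s = 1 + h], Bernoulli's inequality bounds [s ^ n] by [1 / (n h)]. *)
Lemma geom_small q : 0 < q < 1 -> exists C, 0 <= C /\ forall n, (1 <= n)%nat -> q ^ n <= C / INR n ^ 2.
Proof.
  intros Hq. set (s := sqrt q).
  assert (Hs : 0 < s) by (apply sqrt_lt_R0; lra).
  assert (Hss : s * s = q) by (apply sqrt_sqrt; lra).
  assert (Hs1 : s < 1) by nra.
  set (h := / s - 1). assert (Hh : 0 < h).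
  { unfold h. assert (1 < / s) by (rewrite <- Rinv_1; apply Rinv_lt_contravar; lra). lra. }
  exists (/ h ^ 2). split; [left; apply Rinv_0_lt_compat, pow_lt; auto|].
  intros n Hn. assert (K : 1 <= INR n) by (change 1 with (INR 1); apply le_INR; auto).
  assert (B := bernoulli h n ltac:(lra)).
  assert (E : s ^ n * (1 + h) ^ n = 1).
  { rewrite <- Rpow_mult_distr. unfold h. replace (s * (1 + (/ s - 1))) with 1 by (field; lra). apply pow1. }
  assert (Ps := pow_lt s n Hs).
  assert (Hb : s ^ n * (INR n * h) <= 1) by nra.
  assert (Ph : 0 < INR n * h) by (apply Rmult_lt_0_compat; lra).
  rewrite <- Hss, Rpow_mult_distr.
  apply Rmult_le_reg_r with ((INR n * h) ^ 2); [apply pow_lt; auto|].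
  replace (/ h ^ 2 / INR n ^ 2 * (INR n * h) ^ 2) with 1 by (field; split; lra).
  replace (s ^ n * s ^ n * (INR n * h) ^ 2) with ((s ^ n * (INR n * h)) * (s ^ n * (INR n * h))) by ring.
  rewrite <- (Rmult_1_l 1). apply Rmult_le_compat; try lra; apply Rmult_le_pos; lra.
Qed.

(** ** Moments of [(1 + c s ^ 2) ^ - L] *)

Section Moments.
Variables (c a : R).
Hypothesis Hc : 0 < c.
Hypothesis Ha : 0 < a.

Definition rk (s : R) : R := / (1 + c * s ^ 2).
Definition mom (j L : nat) : R := RInt (fun s => s ^ j * rk s ^ L) (- a) a.

Lemma rk_den s : 0 < 1 + c * s ^ 2.
Proof. generalize (pow2_ge_0 s). intros. nra. Qed.
Lemma rk_pos s : 0 < rk s.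
Proof. apply Rinv_0_lt_compat, rk_den. Qed.

Lemma is_derive_rk s : is_derive rk s (- (2 * c * s) * rk s ^ 2).
Proof. unfold rk. assert (D := rk_den s). auto_derive; [simpl in D; lra|]. field. simpl in D. lra. Qed.

Lemma is_derive_rk_pow s L : is_derive (fun s => rk s ^ L) s (- (2 * c * INR L * s) * rk s ^ S L).
Proof.
  evar_last; [apply (is_derive_pow rk L), is_derive_rk|].
  destruct L as [|L]; [simpl; ring|]. change (pred (S L)) with L. set (x := INR (S L)). simpl. ring.
Qed.

Lemma mom_cont j L s : continuous (fun s => s ^ j * rk s ^ L) s.
Proof.
  apply (continuous_mult (U := R_UniformSpace) (K := R_AbsRing) (fun s => s ^ j) (fun s => rk s ^ L)).
  - apply (continuous_smooth (fun s => s ^ j)). auto_derive. auto.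
  - apply (continuous_smooth (fun s => rk s ^ L)). eexists. apply is_derive_rk_pow.
Qed.
Lemma mom_int j L : is_RInt (fun s => s ^ j * rk s ^ L) (- a) a (mom j L).
Proof.
  apply (RInt_correct (V := R_CompleteNormedModule)), cont_ex_RInt; [lra|]. intros; apply mom_cont.
Qed.

(** Integration by parts; the boundary term has the favourable sign. *)
Lemma mom_step j L : (1 <= L)%nat ->
  mom (2 * j + 2) (S L) <= (2 * INR j + 1) / (2 * c * INR L) * mom (2 * j) L.
Proof.
  intros HL. assert (K : 1 <= INR L) by (change 1 with (INR 1); apply le_INR; auto).
  set (u := (2 * j + 1)%nat).
  assert (H1 : is_RInt (fun s => (2 * INR j + 1) * (s ^ (2 * j) * rk s ^ L) - 2 * c * INR L * (s ^ (2 * j + 2) * rk s ^ S L)) (- a) a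
    ((2 * INR j + 1) * mom (2 * j) L - 2 * c * INR L * mom (2 * j + 2) (S L))).
  { apply (is_RInt_minus (V := R_NormedModule)); apply (is_RInt_scal (V := R_NormedModule)); apply mom_int. }
  assert (H2 : is_RInt (fun s => (2 * INR j + 1) * (s ^ (2 * j) * rk s ^ L) - 2 * c * INR L * (s ^ (2 * j + 2) * rk s ^ S L)) (- a) a
    (minus (a ^ u * rk a ^ L) ((- a) ^ u * rk (- a) ^ L))).
  { apply (is_RInt_derive (fun s => s ^ u * rk s ^ L)).
    - intros s _. evar_last.
      { apply (is_derive_mult (fun s => s ^ u) (fun s => rk s ^ L)); [|apply is_derive_rk_pow|apply Rmult_comm].
        apply (is_derive_pow (fun s => s) u), is_derive_id. }
      replace (pred u) with (2 * j)%nat by (unfold u; lia).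
      replace (INR u) with (2 * INR j + 1) by (unfold u; rewrite plus_INR, mult_INR; simpl; ring).
      replace (s ^ u) with (s * s ^ (2 * j)) by (unfold u; rewrite Nat.add_1_r; reflexivity).
      replace (s ^ (2 * j + 2)) with (s * s * s ^ (2 * j)) by (rewrite Nat.add_comm; simpl; ring).
      set (X := s ^ (2 * j)). set (Y := rk s ^ L). set (Z := rk s ^ S L).
      unfold plus, mult, one; simpl. ring.
    - intros s _. apply (continuous_minus (V := R_NormedModule) (fun s => (2 * INR j + 1) * (s ^ (2 * j) * rk s ^ L)) (fun s => 2 * c * INR L * (s ^ (2 * j + 2) * rk s ^ S L)));
      apply (continuous_mult (U := R_UniformSpace) (K := R_AbsRing)); try apply continuous_const; apply mom_cont. }
  assert (E := is_RInt_unique _ _ _ _ H1). rewrite (is_RInt_unique _ _ _ _ H2) in E.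
  assert (Eo : (- a) ^ u = - a ^ u).
  { unfold u. rewrite !pow_add, !pow_mult. replace ((- a) ^ 2) with (a ^ 2) by ring. simpl. ring. }
  assert (Er : rk (- a) = rk a) by (unfold rk; f_equal; ring).
  rewrite Eo, Er in E.
  assert (P : 0 < a ^ u * rk a ^ L) by (apply Rmult_lt_0_compat; apply pow_lt; [auto|apply rk_pos]).
  apply Rmult_le_reg_r with (2 * c * INR L); [apply Rmult_lt_0_compat; lra|].
  replace ((2 * INR j + 1) / (2 * c * INR L) * mom (2 * j) L * (2 * c * INR L)) with ((2 * INR j + 1) * mom (2 * j) L) by (field; split; lra).
  set (M1 := mom (2 * j) L) in *. set (M2 := mom (2 * j + 2) (S L)) in *.
  set (X := a ^ u) in *. set (Y := rk a ^ L) in *. set (n := INR L) in *.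
  unfold minus, plus, opp in E; simpl in E. lra.
Qed.

(** By Bernoulli's inequality the integrand is at most [1 / (1 + L c s ^ 2)], the derivative of [atan (k s) / k]. *)
Lemma mom_0 L : (1 <= L)%nat -> mom 0 L <= PI / sqrt (c * INR L).
Proof.
  intros HL. assert (K : 1 <= INR L) by (change 1 with (INR 1); apply le_INR; auto).
  set (k := sqrt (c * INR L)). assert (Hk : 0 < k) by (apply sqrt_lt_R0, Rmult_lt_0_compat; lra).
  assert (Hkk : k * k = c * INR L) by (apply sqrt_sqrt; left; apply Rmult_lt_0_compat; lra).
  assert (H2 : is_RInt (fun s => / (1 + (k * s) ^ 2)) (- a) a (minus (atan (k * a) / k) (atan (k * - a) / k))).
  { apply (is_RInt_derive (fun s => atan (k * s) / k)).
    - intros s _. assert (D : 0 < 1 + (k * s) ^ 2) by (generalize (pow2_ge_0 (k * s)); lra).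
      apply (is_derive_ext (fun s => / k * atan (k * s))); [intros; apply Rmult_comm|].
      evar_last.
      { apply is_derive_scal, (is_derive_comp atan (fun s => k * s)); [apply is_derive_Reals, derivable_pt_lim_atan|].
        apply is_derive_scal, is_derive_id. }
      unfold scal, one; simpl. unfold mult; simpl. field. simpl in D. split; lra.
    - intros s _. apply (continuous_smooth (fun s => / (1 + (k * s) ^ 2))). auto_derive. generalize (pow2_ge_0 (k * s)). simpl. lra. }
  apply Rle_trans with (minus (atan (k * a) / k) (atan (k * - a) / k)).
  - unfold mom. rewrite <- (is_RInt_unique _ _ _ _ H2). apply RInt_le; [lra|eexists; apply mom_int|eexists; exact H2|].
    intros s _. simpl (s ^ 0). rewrite Rmult_1_l. unfold rk. rewrite pow_inv.
    apply Rinv_le_contravar; [generalize (pow2_ge_0 (k * s)); lra|].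
    eapply Rle_trans; [|apply bernoulli; generalize (pow2_ge_0 s); intros; nra].
    replace ((k * s) ^ 2) with (k * k * s ^ 2) by ring. rewrite Hkk. lra.
  - unfold minus, plus, opp; simpl. replace (k * - a) with (- (k * a)) by ring. rewrite atan_opp.
    generalize (atan_bound (k * a)). intros B. apply Rmult_le_reg_r with k; auto.
    unfold Rdiv. rewrite Rmult_plus_distr_r, !Rmult_assoc. field_simplify; lra.
Qed.
End Moments.

(** * Complex-valued functions of a real variable *)

Definition CRder (f : R -> C) (t : R) (l : C) : Prop :=
  is_derive (fun t => Re (f t)) t (Re l) /\ is_derive (fun t => Im (f t)) t (Im l).
Definition CRcontinuous (f : R -> C) (t : R) : Prop :=
  continuous (fun t => Re (f t)) t /\ continuous (fun t => Im (f t)) t.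

Lemma CRder_cont f t l : CRder f t l -> CRcontinuous f t.
Proof.
  intros [H1 H2]. split; [apply (continuous_smooth (fun t => Re (f t)))|apply (continuous_smooth (fun t => Im (f t)))]; eexists; eauto.
Qed.

Lemma CRder_mult f g t l k : CRder f t l -> CRder g t k -> CRder (fun t => f t * g t)%C t (l * g t + f t * k)%C.
Proof.
  intros [F1 F2] [G1 G2]. split.
  - apply (is_derive_ext (fun t => Re (f t) * Re (g t) - Im (f t) * Im (g t))); [intros; symmetry; apply re_mult|].
    evar_last.
    { apply (is_derive_minus (fun t => Re (f t) * Re (g t)) (fun t => Im (f t) * Im (g t)));
      [apply (is_derive_mult (fun t => Re (f t)) (fun t => Re (g t)))|apply (is_derive_mult (fun t => Im (f t)) (fun t => Im (g t)))];
      eauto; apply Rmult_comm. }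
    rewrite re_plus, !re_mult. unfold minus, plus, opp, mult; simpl. ring.
  - apply (is_derive_ext (fun t => Re (f t) * Im (g t) + Im (f t) * Re (g t))); [intros; symmetry; apply im_mult|].
    evar_last.
    { apply (is_derive_plus (fun t => Re (f t) * Im (g t)) (fun t => Im (f t) * Re (g t)));
      [apply (is_derive_mult (fun t => Re (f t)) (fun t => Im (g t)))|apply (is_derive_mult (fun t => Im (f t)) (fun t => Re (g t)))];
      eauto; apply Rmult_comm. }
    rewrite im_plus, !im_mult. unfold plus, mult; simpl. ring.
Qed.

Lemma CRder_const (k : C) t : CRder (fun _ => k) t 0.
Proof. split; simpl; [apply (is_derive_const (Re k))|apply (is_derive_const (Im k))]. Qed.
Lemma CRder_RtoC (f : R -> R) t l : is_derive f t l -> CRder (fun t => RtoC (f t)) t (RtoC l).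
Proof. intros H. split; simpl; [exact H|apply (is_derive_const 0)]. Qed.

Lemma CRder_pow f t l n : CRder f t l -> CRder (fun t => f t ^ S n)%C t (RtoC (INR (S n)) * (f t ^ n * l))%C.
Proof.
  intros H. induction n as [|n IH].
  - replace (RtoC (INR 1) * (f t ^ 0 * l))%C with (l * 1 + f t * 0)%C by (simpl; ring).
    exact (CRder_mult f (fun _ => RtoC 1) t _ _ H (CRder_const 1 t)).
  - replace (RtoC (INR (S (S n))) * (f t ^ S n * l))%C with (l * f t ^ S n + f t * (RtoC (INR (S n)) * (f t ^ n * l)))%C.
    + exact (CRder_mult f (fun t => f t ^ S n)%C t _ _ H IH).
    + rewrite (S_INR (S n)), RtoC_plus. rewrite Cpow_S. ring.
Qed.

Lemma CRcont_continuous f t : CRcontinuous f t -> @continuous R_UniformSpace C_R_NormedModule f t.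
Proof.
  intros [H1 H2]. apply filterlim_locally. intros eps.
  assert (A := proj1 (filterlim_locally _ _) H1 eps). assert (B := proj1 (filterlim_locally _ _) H2 eps).
  generalize (filter_and _ _ A B). apply filter_imp. intros s [U V]. split; assumption.
Qed.

Lemma CR_ex_RInt f a b : a <= b -> (forall t, a <= t <= b -> CRcontinuous f t) ->
  @is_RInt C_R_NormedModule f a b (Cint f a b).
Proof.
  intros Hab H. apply (RInt_correct (V := C_R_CompleteNormedModule)), (ex_RInt_continuous (V := C_R_CompleteNormedModule)).
  rewrite Rmin_left, Rmax_right by lra. intros; apply CRcont_continuous; auto.
Qed.

Lemma CR_FTC F f a b : (forall t, CRder F t (f t)) -> (forall t, CRcontinuous f t) ->
  @is_RInt C_R_NormedModule f a b (F b - F a)%C.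
Proof.
  intros HF Hf. apply is_Cint_pair.
  - apply (is_RInt_derive (fun t => Re (F t))); intros t _; [apply HF|apply Hf].
  - apply (is_RInt_derive (fun t => Im (F t))); intros t _; [apply HF|apply Hf].
Qed.

(** * The model integral *)

(** [ysing = log omega1] is the value of [log omega] at the saddle point, and [Ymodel] its quadratic model
    along the imaginary axis. *)
Definition ysing : C := (ell1, PI).

Definition Ymodel (s : R) : C := (ell1 - s ^ 2 / 2, PI).
Definition qmodel (s : R) : C := (/ Ymodel s)%C.

Lemma Ymodel_eq s : Ymodel s = (ysing - RtoC (s ^ 2 / 2))%C.
Proof. unfold Ymodel, ysing. apply injective_projections; simpl; ring. Qed.
Lemma Ymodel_nz s : Ymodel s <> RtoC 0.
Proof. intros E. apply (f_equal Im) in E. simpl in E. generalize PI_RGT_0. lra. Qed.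
Lemma ysing_nz : ysing <> RtoC 0.
Proof. intros E. apply (f_equal Im) in E. simpl in E. generalize PI_RGT_0. lra. Qed.

Lemma qmodel_der s : CRder qmodel s (RtoC s * qmodel s ^ 2)%C.
Proof.
  assert (HP := PI_RGT_0).
  assert (D : 0 < (ell1 - s ^ 2 / 2) * (ell1 - s ^ 2 / 2) + PI * PI).
  { generalize (Rle_0_sqr (ell1 - s ^ 2 / 2)). unfold Rsqr. nra. }
  split; unfold qmodel, Ymodel; simpl.
  - auto_derive; [simpl in *; lra|]. field. simpl in *. lra.
  - auto_derive; [simpl in *; lra|]. field. simpl in *. lra.
Qed.

Lemma qmodel_pow_cont n s : CRcontinuous (fun s => qmodel s ^ n)%C s.
Proof.
  destruct n as [|n].
  - apply (CRder_cont _ _ 0%C). exact (CRder_const 1 s).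
  - eapply CRder_cont. apply CRder_pow, qmodel_der.
Qed.

Definition modelint (A : R) (N : nat) : C := Cint (fun s => qmodel s ^ N)%C (- A) A.

Lemma qmodel_even s : qmodel (- s) = qmodel s.
Proof. unfold qmodel, Ymodel. do 2 f_equal. f_equal. f_equal. ring. Qed.

Lemma CRcont_scal (k : C) f t : CRcontinuous f t -> CRcontinuous (fun t => k * f t)%C t.
Proof.
  intros [H1 H2]. split.
  - apply (continuous_ext (fun t => Re k * Re (f t) - Im k * Im (f t))); [intros; symmetry; apply re_mult|].
    apply (continuous_minus (V := R_NormedModule) (fun t => Re k * Re (f t)) (fun t => Im k * Im (f t)));
    apply (continuous_mult (U := R_UniformSpace) (K := R_AbsRing)); auto; apply continuous_const.
  - apply (continuous_ext (fun t => Re k * Im (f t) + Im k * Re (f t))); [intros; symmetry; apply im_mult|].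
    apply (continuous_plus (V := R_NormedModule) (fun t => Re k * Im (f t)) (fun t => Im k * Re (f t)));
    apply (continuous_mult (U := R_UniformSpace) (K := R_AbsRing)); auto; apply continuous_const.
Qed.
Lemma CRcont_plus f g t : CRcontinuous f t -> CRcontinuous g t -> CRcontinuous (fun t => f t + g t)%C t.
Proof.
  intros [H1 H2] [K1 K2]. split.
  - apply (continuous_ext (fun t => Re (f t) + Re (g t))); [intros; symmetry; apply re_plus|].
    apply (continuous_plus (V := R_NormedModule) (fun t => Re (f t)) (fun t => Re (g t))); auto.
  - apply (continuous_ext (fun t => Im (f t) + Im (g t))); [intros; symmetry; apply im_plus|].
    apply (continuous_plus (V := R_NormedModule) (fun t => Im (f t)) (fun t => Im (g t))); auto.
Qed.

Lemma modelint_int A N : 0 <= A -> @is_RInt C_R_NormedModule (fun s => qmodel s ^ N)%C (- A) A (modelint A N).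
Proof. intros HA. apply (CR_ex_RInt (fun s => qmodel s ^ N)%C); [lra|]. intros; apply qmodel_pow_cont. Qed.

(** Integration by parts; the boundary term disappears as [A] grows, so that over the whole line the
    integrals satisfy a two-term recursion. *)
Lemma modelint_step A N : 0 < A ->
  (RtoC (2 * A) * qmodel A ^ S N)%C = (RtoC (1 - 2 * INR (S N)) * modelint A (S N) + RtoC (2 * INR (S N)) * ysing * modelint A (S (S N)))%C.
Proof.
  intros HA. set (n := INR (S N)).
  set (f := fun s => (RtoC (1 - 2 * n) * qmodel s ^ S N + RtoC (2 * n) * ysing * qmodel s ^ S (S N))%C).
  assert (H1 : @is_RInt C_R_NormedModule f (- A) A (RtoC (1 - 2 * n) * modelint A (S N) + RtoC (2 * n) * ysing * modelint A (S (S N)))%C).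
  { apply (is_RInt_plus (V := C_R_NormedModule)); apply is_Cint_scal; apply (modelint_int A); lra. }
  assert (H2 : @is_RInt C_R_NormedModule f (- A) A (RtoC A * qmodel A ^ S N - RtoC (- A) * qmodel (- A) ^ S N)%C).
  { apply (CR_FTC (fun s => RtoC s * qmodel s ^ S N)%C).
    - intros s. assert (D := CRder_mult (fun s => RtoC s) (fun s => qmodel s ^ S N)%C s _ _
        (CRder_RtoC (fun s => s) s 1 (is_derive_id s)) (CRder_pow qmodel s _ N (qmodel_der s))).
      replace (f s) with (1 * qmodel s ^ S N + RtoC s * (RtoC (INR (S N)) * (qmodel s ^ N * (RtoC s * qmodel s ^ 2))))%C; [exact D|].
      unfold f. fold n. assert (E : (Ymodel s * qmodel s)%C = 1) by (unfold qmodel; field; apply Ymodel_nz).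
      rewrite Ymodel_eq in E. rewrite !Cpow_S.
      assert (E2 : (ysing * qmodel s)%C = (1 + RtoC (s ^ 2 / 2) * qmodel s)%C) by (rewrite <- E; ring).
      replace (RtoC (2 * n) * ysing * (qmodel s * (qmodel s * qmodel s ^ N)))%C with (RtoC (2 * n) * (ysing * qmodel s) * (qmodel s * qmodel s ^ N))%C by ring.
      rewrite E2. replace (s ^ 2 / 2) with (s * s * / 2) by field.
      rewrite RtoC_minus, !RtoC_mult, RtoC_inv by lra. simpl Cpow. field.
    - intros s. apply CRcont_plus; apply CRcont_scal; apply qmodel_pow_cont. }
  rewrite <- (is_RInt_unique (V := C_R_CompleteNormedModule) _ _ _ _ H1).
  rewrite (is_RInt_unique (V := C_R_CompleteNormedModule) _ _ _ _ H2).
  rewrite qmodel_even. unfold Rminus. rewrite RtoC_mult, RtoC_opp. ring.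
Qed.

(** ** Limits at infinity *)

Definition tends (f : R -> C) (l : C) : Prop :=
  forall eps, 0 < eps -> exists M, forall A, M < A -> Cmod (f A - l) < eps.

Lemma tends_plus f g l k : tends f l -> tends g k -> tends (fun A => f A + g A)%C (l + k)%C.
Proof.
  intros H1 H2 eps He.
  destruct (H1 (eps / 2) ltac:(lra)) as [M1 A1]. destruct (H2 (eps / 2) ltac:(lra)) as [M2 A2].
  exists (Rmax M1 M2). intros A HA. generalize (Rmax_l M1 M2) (Rmax_r M1 M2). intros.
  specialize (A1 A ltac:(lra)). specialize (A2 A ltac:(lra)).
  replace (f A + g A - (l + k))%C with ((f A - l) + (g A - k))%C by ring.
  eapply Rle_lt_trans; [apply Cmod_triangle|]. lra.
Qed.

Lemma tends_scal (c : C) f l : tends f l -> tends (fun A => c * f A)%C (c * l)%C.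
Proof.
  intros H eps He. assert (P : 0 < Cmod c + 1) by (generalize (Cmod_ge_0 c); lra).
  destruct (H (eps / (Cmod c + 1)) ltac:(apply Rdiv_lt_0_compat; lra)) as [M HM].
  exists M. intros A HA. specialize (HM A HA).
  replace (c * f A - c * l)%C with (c * (f A - l))%C by ring. rewrite Cmod_mult.
  apply Rmult_lt_compat_r with (r := Cmod c + 1) in HM; auto. unfold Rdiv in HM.
  rewrite Rmult_assoc, Rinv_l, Rmult_1_r in HM by lra.
  generalize (Cmod_ge_0 (f A - l)) (Cmod_ge_0 c). nra.
Qed.

Lemma tends_ext f g l : (forall A, 0 < A -> f A = g A) -> tends f l -> tends g l.
Proof.
  intros E H eps He. destruct (H eps He) as [M HM]. exists (Rmax M 0). intros A HA.
  generalize (Rmax_l M 0) (Rmax_r M 0). intros. rewrite <- E by lra. apply HM. lra.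
Qed.

Lemma tends_bound f l (k : C) a K : tends f l -> (forall A, a < A -> Cmod (f A - k) <= K) -> Cmod (l - k) <= K.
Proof.
  intros H HB. apply Rnot_lt_le. intros HK.
  destruct (H (Cmod (l - k) - K) ltac:(lra)) as [M HM].
  set (A := Rmax M a + 1). generalize (Rmax_l M a) (Rmax_r M a). intros.
  specialize (HM A ltac:(unfold A; lra)). specialize (HB A ltac:(unfold A; lra)).
  assert (T := Cmod_triangle (l - f A) (f A - k)). rewrite <- Cmod_opp in HM.
  replace (- (f A - l))%C with (l - f A)%C in HM by ring.
  replace (l - f A + (f A - k))%C with (l - k)%C in T by ring. lra.
Qed.

Lemma tends_pair f (a b : R) :
  (forall eps, 0 < eps -> exists M, forall A, M < A -> Rabs (Re (f A) - a) < eps) ->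
  (forall eps, 0 < eps -> exists M, forall A, M < A -> Rabs (Im (f A) - b) < eps) -> tends f (a, b).
Proof.
  intros H1 H2 eps He.
  destruct (H1 (eps / 2) ltac:(lra)) as [M1 A1]. destruct (H2 (eps / 2) ltac:(lra)) as [M2 A2].
  exists (Rmax M1 M2). intros A HA. generalize (Rmax_l M1 M2) (Rmax_r M1 M2). intros.
  specialize (A1 A ltac:(lra)). specialize (A2 A ltac:(lra)).
  eapply Rle_lt_trans; [apply Cmod_le_sum|]. rewrite re_minus, im_minus. simpl in *. lra.
Qed.

Lemma ln_diff_le x y : 0 < x -> 0 < y -> ln x - ln y <= (x - y) / y.
Proof.
  intros Hx Hy. rewrite <- ln_div by auto. assert (P : 0 < x / y) by (apply Rdiv_lt_0_compat; auto).
  generalize (exp_ineq1_le (ln (x / y))). rewrite exp_ln by auto. intros.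
  replace ((x - y) / y) with (x / y - 1) by (field; lra). lra.
Qed.

Lemma Ymodel_sqr_lower s : 1 + s ^ 2 <= Cmod (Ymodel s) ^ 2.
Proof.
  rewrite Cmod2_alt. simpl. assert (H := ell1_bounds). assert (HP := PI_bounds).
  assert (0 <= (s ^ 2 / 2 - 1) ^ 2) by apply pow2_ge_0. generalize (pow2_ge_0 s). intros. nra.
Qed.

Lemma Cmod_qmodel s : Cmod (qmodel s) = / Cmod (Ymodel s).
Proof. unfold qmodel. apply Cmod_inv, Ymodel_nz. Qed.

Lemma Cmod_qmodel_sqr s : Cmod (qmodel s) ^ 2 <= / (1 + s ^ 2).
Proof.
  rewrite Cmod_qmodel, pow_inv. apply Rinv_le_contravar; [generalize (pow2_ge_0 s); lra|apply Ymodel_sqr_lower].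
Qed.

Lemma qmodel_tends_0 : tends (fun A => RtoC (2 * A) * qmodel A)%C 0%C.
Proof.
  intros eps He. exists (Rmax 4 (8 / eps)). intros A HA.
  generalize (Rmax_l 4 (8 / eps)) (Rmax_r 4 (8 / eps)). intros H1 H2.
  replace (RtoC (2 * A) * qmodel A - 0)%C with (RtoC (2 * A) * qmodel A)%C by ring.
  rewrite Cmod_mult, Cmod_R, Cmod_qmodel, Rabs_pos_eq by lra.
  assert (L : A ^ 2 / 2 <= Cmod (Ymodel A)).
  { eapply Rle_trans; [|apply Rle_trans with (1 := Rle_abs _)]; [|rewrite Rabs_Ropp; apply (Re_le_Cmod (Ymodel A))].
    simpl. assert (H := ell1_bounds). lra. }
  apply Rle_lt_trans with (2 * A * / (A ^ 2 / 2)).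
  { apply Rmult_le_compat_l; [lra|]. apply Rinv_le_contravar; [nra|exact L]. }
  replace (2 * A * / (A ^ 2 / 2)) with (4 / A) by (field; lra).
  apply Rmult_lt_reg_r with A; [lra|]. unfold Rdiv. rewrite Rmult_assoc, Rinv_l by lra.
  assert (8 / eps * eps < A * eps) by (apply Rmult_lt_compat_r; lra).
  replace (8 / eps * eps) with 8 in H by (field; lra). lra.
Qed.

Lemma qmodel_pow_tends_0 n : tends (fun A => RtoC (2 * A) * qmodel A ^ S n)%C 0%C.
Proof.
  intros eps He. destruct (qmodel_tends_0 eps He) as [M HM]. exists M. intros A HA. specialize (HM A HA).
  eapply Rle_lt_trans; [|exact HM].
  replace (RtoC (2 * A) * qmodel A ^ S n - 0)%C with ((RtoC (2 * A) * qmodel A - 0) * qmodel A ^ n)%C by (rewrite Cpow_S; ring).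
  rewrite Cmod_mult, Cmod_pow. rewrite <- (Rmult_1_r (Cmod (RtoC (2 * A) * qmodel A - 0))) at 2.
  apply Rmult_le_compat_l; [apply Cmod_ge_0|]. rewrite <- (pow1 n). apply pow_incr. split; [apply Cmod_ge_0|].
  assert (H := Cmod_qmodel_sqr A). assert (/ (1 + A ^ 2) <= 1).
  { rewrite <- Rinv_1 at 2. apply Rinv_le_contravar; [lra|generalize (pow2_ge_0 A); lra]. }
  generalize (Cmod_ge_0 (qmodel A)). nra.
Qed.

Lemma qmodel_piece b d m r : b <= d -> (forall t, b <= t <= d -> Cmod (qmodel t) <= r) ->
  Cmod (Cint (fun s => qmodel s ^ S (S m))%C b d) <= r ^ m * (atan d - atan b).
Proof.
  intros Hbd Hr. rewrite <- Cnorm_R.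
  apply (norm_RInt_le (V := C_R_NormedModule) (fun s => qmodel s ^ S (S m))%C (fun s => r ^ m * / (1 + s ^ 2)) b d); auto.
  - intros s Hs. rewrite Cnorm_R, Cmod_pow. replace (S (S m)) with (m + 2)%nat by lia. rewrite pow_add.
    apply Rmult_le_compat; [apply pow_le, Cmod_ge_0|apply pow_le, Cmod_ge_0| |apply Cmod_qmodel_sqr].
    apply pow_incr. split; [apply Cmod_ge_0|auto].
  - apply (CR_ex_RInt (fun s => qmodel s ^ S (S m))%C); auto. intros; apply qmodel_pow_cont.
  - apply (is_RInt_scal (V := R_NormedModule) (fun s => / (1 + s ^ 2))).
    apply (is_RInt_derive atan).
    + intros s _. apply is_derive_Reals. apply derivable_pt_lim_atan.
    + intros s _. apply (continuous_smooth (fun s => / (1 + s ^ 2))). auto_derive. generalize (pow2_ge_0 s). simpl. lra.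
Qed.

Lemma Cmod_qmodel_decr a t : 0 < a -> a <= Rabs t -> Cmod (qmodel t) <= Cmod (qmodel a).
Proof.
  intros Ha Ht. rewrite !Cmod_qmodel.
  assert (P : 0 < Cmod (Ymodel a)) by (apply Cmod_gt_0, Ymodel_nz). apply Rinv_le_contravar; auto.
  apply Rsqr_incr_0_var; [|apply Cmod_ge_0]. rewrite !Rsqr_pow2, !Cmod2_alt. simpl.
  assert (H := ell1_bounds).
  assert (T : a ^ 2 <= t ^ 2) by (rewrite <- (pow2_abs t); apply pow_incr; lra).
  generalize (pow2_ge_0 a). intros. nra.
Qed.

Lemma modelint_tail a A m : 0 < a -> a < A -> Cmod (modelint A (S (S m)) - modelint a (S (S m))) <= PI * Cmod (qmodel a) ^ m.
Proof.
  intros Ha HA.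
  set (f := fun s => (qmodel s ^ S (S m))%C). set (I1 := Cint f (- A) (- a)). set (I2 := Cint f a A).
  assert (E : modelint A (S (S m)) = (I1 + modelint a (S (S m)) + I2)%C).
  { apply (is_RInt_unique (V := C_R_CompleteNormedModule)).
    apply (is_RInt_Chasles (V := C_R_NormedModule) _ (- A) a A (I1 + modelint a (S (S m)))%C I2).
    - apply (is_RInt_Chasles (V := C_R_NormedModule) _ (- A) (- a) a I1).
      + apply (CR_ex_RInt f); [lra|]. intros; apply qmodel_pow_cont.
      + apply modelint_int; lra.
    - apply (CR_ex_RInt f); [lra|]. intros; apply qmodel_pow_cont. }
  rewrite E. replace (I1 + modelint a (S (S m)) + I2 - modelint a (S (S m)))%C with (I1 + I2)%C by ring.
  eapply Rle_trans; [apply Cmod_triangle|].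
  set (r := Cmod (qmodel a)).
  assert (B1 : Cmod I1 <= r ^ m * (atan (- a) - atan (- A))).
  { apply qmodel_piece; [lra|]. intros t Ht. apply Cmod_qmodel_decr; auto. rewrite Rabs_left; lra. }
  assert (B2 : Cmod I2 <= r ^ m * (atan A - atan a)).
  { apply qmodel_piece; [lra|]. intros t Ht. apply Cmod_qmodel_decr; auto. rewrite Rabs_pos_eq; lra. }
  rewrite !atan_opp in B1. assert (P : 0 <= r ^ m) by (apply pow_le, Cmod_ge_0).
  assert (0 < atan a) by (rewrite <- atan_0; apply atan_increasing; lra). generalize (atan_bound A). intros. nra.
Qed.

(** A square root [c] of [- 2 ysing] factors [Ymodel]: [- 2 Ymodel s = (s - i c) (s + i c)]. *)
Section Root.
Variable c : C.
Hypothesis Hc : (c * c = - (2) * ysing)%C.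
Hypothesis Hre : 0 < Re c.

Lemma root_nz : c <> RtoC 0.
Proof. intros E. rewrite E in Hre. simpl in Hre. lra. Qed.

(** The logarithm of [(s - i c) / (s + i c)] up to a constant, written with a branch that is continuous on
    the whole line. *)
Definition logpart (s : R) : C :=
  (/ 2 * ln ((s + Im c) ^ 2 + Re c ^ 2) - / 2 * ln ((s - Im c) ^ 2 + Re c ^ 2),
   atan ((s + Im c) / Re c) + atan ((s - Im c) / Re c)).

Lemma logpart_der s : CRder logpart s (- Ci * c * qmodel s)%C.
Proof.
  destruct c as [c1 c2] eqn:Ec.
  assert (P1 : 0 < c1) by exact Hre.
  assert (D1 : 0 < (s + c2) ^ 2 + c1 ^ 2) by (generalize (pow2_ge_0 (s + c2)) (pow_lt c1 2 P1); lra).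
  assert (D2 : 0 < (s - c2) ^ 2 + c1 ^ 2) by (generalize (pow2_ge_0 (s - c2)) (pow_lt c1 2 P1); lra).
  assert (E : (- Ci * (c1, c2) * qmodel s)%C =
    ((s + c2) / ((s + c2) ^ 2 + c1 ^ 2) - (s - c2) / ((s - c2) ^ 2 + c1 ^ 2),
     c1 / ((s + c2) ^ 2 + c1 ^ 2) + c1 / ((s - c2) ^ 2 + c1 ^ 2))).
  { assert (H2 := f_equal Re Hc). assert (H3 := f_equal Im Hc). unfold ysing in H2, H3. simpl in H2, H3.
    unfold qmodel, Ymodel.
    replace ell1 with (- (c1 * c1 - c2 * c2) / 2) by lra.
    replace PI with (- (c1 * c2)) by lra.
    assert (K : ((s + c2) ^ 2 + c1 ^ 2) * ((s - c2) ^ 2 + c1 ^ 2) = 4 * ((- (c1 * c1 - c2 * c2) / 2 - s ^ 2 / 2) ^ 2 + (- (c1 * c2)) ^ 2)) by field.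
    assert (D : 0 < (- (c1 * c1 - c2 * c2) / 2 - s ^ 2 / 2) ^ 2 + (- (c1 * c2)) ^ 2) by (generalize (Rmult_lt_0_compat _ _ D1 D2); rewrite K; lra).
    apply injective_projections; simpl; field; simpl in *; repeat split; lra. }
  rewrite E. unfold logpart. rewrite Ec. split; simpl.
  - auto_derive; [simpl in *; repeat split; lra|]. field. simpl in *; split; lra.
  - evar_last.
    { apply (is_derive_plus (V := R_NormedModule) (fun s => atan ((s + c2) / c1)) (fun s => atan ((s - c2) / c1))).
      - apply (is_derive_comp atan (fun s => (s + c2) / c1)); [apply is_derive_Reals, derivable_pt_lim_atan|].
        instantiate (1 := / c1). auto_derive; auto. field. lra.
      - apply (is_derive_comp atan (fun s => (s - c2) / c1)); [apply is_derive_Reals, derivable_pt_lim_atan|].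
        instantiate (1 := / c1). auto_derive; auto. field. lra. }
    unfold plus, scal; simpl. unfold mult; simpl. field.
    assert (0 < c1 * c1 + (s + c2) * (s + c2)) by (simpl in *; lra).
    assert (0 < c1 * c1 + (s - c2) * (s - c2)) by (simpl in *; lra). simpl in *. repeat split; lra.
Qed.

Lemma logpart_tends : tends (fun A => logpart A - logpart (- A))%C (0, 2 * PI).
Proof.
  set (c1 := Re c) in *. set (c2 := Im c). apply tends_pair; intros eps He.
  - exists (Rmax (2 * Rabs c2) (16 * Rabs c2 / eps) + 1). intros A HA.
    generalize (Rmax_l (2 * Rabs c2) (16 * Rabs c2 / eps)) (Rmax_r (2 * Rabs c2) (16 * Rabs c2 / eps)) (Rabs_pos c2). intros M1 M2 M3.
    rewrite re_minus. unfold logpart; simpl. fold c1 c2.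
    set (X := (A + c2) * ((A + c2) * 1) + c1 * (c1 * 1)). set (Y := (A - c2) * ((A - c2) * 1) + c1 * (c1 * 1)).
    replace ((- A + c2) * ((- A + c2) * 1) + c1 * (c1 * 1)) with Y by (unfold Y; ring).
    replace ((- A - c2) * ((- A - c2) * 1) + c1 * (c1 * 1)) with X by (unfold X; ring).
    replace (/ 2 * ln X - / 2 * ln Y - (/ 2 * ln Y - / 2 * ln X) - 0) with (ln X - ln Y) by field.
    assert (AB : - A / 2 <= c2 <= A / 2) by (generalize (Rle_abs c2) (Rle_abs (- c2)); rewrite Rabs_Ropp; lra).
    assert (XL : A ^ 2 / 4 <= X) by (unfold X; nra). assert (YL : A ^ 2 / 4 <= Y) by (unfold Y; nra).
    assert (A2 : 0 < A ^ 2 / 4) by nra.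
    assert (S : forall U V, A ^ 2 / 4 <= U -> A ^ 2 / 4 <= V -> Rabs (U - V) = 4 * A * Rabs c2 -> ln U - ln V < eps).
    { intros U V HU HV HD. eapply Rle_lt_trans; [apply ln_diff_le; lra|].
      apply Rle_lt_trans with (Rabs (U - V) / (A ^ 2 / 4)).
      - apply Rle_trans with (Rabs (U - V) / V).
        + apply Rmult_le_compat_r; [left; apply Rinv_0_lt_compat; lra|apply Rle_abs].
        + apply Rmult_le_compat_l; [apply Rabs_pos|]. apply Rinv_le_contravar; lra.
      - rewrite HD. replace (4 * A * Rabs c2 / (A ^ 2 / 4)) with (16 * Rabs c2 / A) by (field; lra).
        apply Rmult_lt_reg_r with A; [lra|]. unfold Rdiv. rewrite Rmult_assoc, Rinv_l by lra.
        assert (HM : 16 * Rabs c2 / eps * eps < A * eps) by (apply Rmult_lt_compat_r; lra).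
        replace (16 * Rabs c2 / eps * eps) with (16 * Rabs c2) in HM by (field; lra). lra. }
    assert (HD : Rabs (X - Y) = 4 * A * Rabs c2).
    { replace (X - Y) with (4 * A * c2) by (unfold X, Y; ring). rewrite Rabs_mult, (Rabs_pos_eq (4 * A)) by lra. reflexivity. }
    apply Rabs_lt_between. split; [|apply S; auto].
    assert (ln Y - ln X < eps) by (apply S; auto; rewrite Rabs_minus_sym; auto). lra.
  - exists (Rabs c2 + c1 * (8 / eps)). intros A HA.
    rewrite im_minus. unfold logpart; simpl. fold c1 c2.
    replace ((- A + c2) / c1) with (- ((A - c2) / c1)) by (unfold Rdiv; ring).
    replace ((- A - c2) / c1) with (- ((A + c2) / c1)) by (unfold Rdiv; ring). rewrite !atan_opp.
    assert (E8 : 0 < 8 / eps) by (apply Rdiv_lt_0_compat; lra).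
    assert (Q : forall x, c1 * (8 / eps) < x -> Rabs (atan (x / c1) - PI / 2) < eps / 4).
    { intros x Hx. assert (L : 8 / eps < x / c1).
      { apply Rmult_lt_reg_r with c1; auto. unfold Rdiv at 2. rewrite Rmult_assoc, Rinv_l by lra. lra. }
      generalize (atan_bound (x / c1)). intros [_ U]. rewrite Rabs_minus_sym, Rabs_pos_eq by lra.
      assert (F := atan_far (x / c1) ltac:(lra)).
      assert (/ (x / c1) <= / (8 / eps)) by (apply Rinv_le_contravar; lra).
      replace (/ (8 / eps)) with (eps / 8) in H by (field; lra). lra. }
    generalize (Rle_abs c2) (Rle_abs (- c2)). rewrite Rabs_Ropp. intros.
    assert (Q1 := Q (A + c2) ltac:(lra)). assert (Q2 := Q (A - c2) ltac:(lra)).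
    apply Rabs_lt_between in Q1. apply Rabs_lt_between in Q2. apply Rabs_lt_between. lra.
Qed.

Lemma modelint_1_tends : tends (fun A => modelint A 1) (RtoC PI * c * / ysing)%C.
Proof.
  assert (Cn := root_nz). assert (Yn := ysing_nz).
  replace (RtoC PI * c * / ysing)%C with ((Ci * / c) * (0%R, (2 * PI)%R))%C.
  - apply (tends_ext (fun A => (Ci * / c) * (logpart A - logpart (- A)))%C); [|apply tends_scal, logpart_tends].
    intros A HA. symmetry. apply (is_RInt_unique (V := C_R_CompleteNormedModule)).
    replace ((Ci * / c) * (logpart A - logpart (- A)))%C with ((Ci * / c) * logpart A - (Ci * / c) * logpart (- A))%C by ring.
    apply (CR_FTC (fun s => (Ci * / c) * logpart s)%C); [|intros; apply qmodel_pow_cont].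
    intros s. assert (D := CRder_mult (fun _ => (Ci * / c)%C) logpart s _ _ (CRder_const _ s) (logpart_der s)).
    replace (qmodel s ^ 1)%C with (0 * logpart s + Ci * / c * (- Ci * c * qmodel s))%C; [exact D|].
    replace (qmodel s ^ 1)%C with (qmodel s) by (simpl; ring).
    assert (I : (Ci * Ci = - (1))%C) by (apply injective_projections; simpl; ring).
    field [I]. exact Cn.
  - replace (0%R, (2 * PI)%R) with (RtoC 2 * RtoC PI * Ci)%C by (apply injective_projections; simpl; ring).
    assert (I : (Ci * Ci = - (1))%C) by (apply injective_projections; simpl; ring).
    assert (Yc : ysing = (- / (2) * (c * c))%C) by (rewrite Hc; field; apply C2_nz).
    rewrite Yc. field [I]. repeat split; auto; apply C2_nz.
Qed.

Lemma modelint_tends N : tends (fun A => modelint A (S N)) (RtoC PI * c * RtoC (wallis N) * / ysing ^ S N)%C.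
Proof.
  assert (Yn := ysing_nz).
  induction N as [|N IH].
  - replace (RtoC PI * c * RtoC (wallis 0) * / ysing ^ 1)%C with (RtoC PI * c * / ysing)%C; [apply modelint_1_tends|].
    simpl. field. exact Yn.
  - set (n := INR (S N)). assert (Hn : 0 < n) by (apply lt_0_INR; lia).
    assert (Nn : RtoC (2 * n) <> RtoC 0) by (intros E; apply RtoC_inj in E; lra).
    assert (H := tends_plus _ _ _ _ (tends_scal (/ (RtoC (2 * n) * ysing))%C _ _ (qmodel_pow_tends_0 N))
       (tends_scal (RtoC (2 * n - 1) * / (RtoC (2 * n) * ysing))%C _ _ IH)).
    replace (RtoC PI * c * RtoC (wallis (S N)) * / ysing ^ S (S N))%C with
      (/ (RtoC (2 * n) * ysing) * 0 + RtoC (2 * n - 1) * / (RtoC (2 * n) * ysing) * (RtoC PI * c * RtoC (wallis N) * / ysing ^ S N))%C.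
    + revert H. apply tends_ext. intros A HA. rewrite (modelint_step A N HA). fold n.
      replace (RtoC (1 - 2 * n)) with (- RtoC (2 * n - 1))%C by (rewrite <- RtoC_opp; f_equal; ring).
      field. split; auto.
    + assert (E : RtoC (wallis (S N)) = (RtoC (wallis N) * (RtoC (2 * n - 1) * / RtoC (2 * n)))%C).
      { rewrite <- RtoC_inv, <- !RtoC_mult by lra. f_equal. simpl wallis. unfold n. rewrite S_INR.
        generalize (pos_INR N). intros. field. lra. }
      rewrite E, (Cpow_S ysing (S N)). field. repeat split; auto. apply Cpow_nz, Yn.
Qed.

Lemma modelint_model a m : 0 < a ->
  Cmod (RtoC PI * c * RtoC (wallis (S m)) * / ysing ^ S (S m) - modelint a (S (S m))) <= PI * Cmod (qmodel a) ^ m.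
Proof.
  intros Ha. apply (tends_bound _ _ _ a _ (modelint_tends (S m))). intros A HA. apply modelint_tail; auto.
Qed.
End Root.

(** * The argument of the singularity *)

Lemma theta_spec : 0 < theta_x < PI /\ ysing = (rho_x * cos theta_x, rho_x * sin theta_x).
Proof.
  assert (HP := PI_RGT_0). assert (HR := rho_pos).
  assert (Hs : slit log_omega1).
  { unfold slit. fold rho_x. rewrite log_omega1_eq. simpl. assert (H := rho_sqr). nra. }
  set (t := Im (Clogp log_omega1)).
  assert (B := Im_Clogp_bound log_omega1). fold t in B.
  assert (E : log_omega1 = (rho_x * cos t, rho_x * sin t)).
  { assert (E := Cexp_Clogp log_omega1 Hs). unfold Cexp in E. fold t in E.
    replace (exp (Re (Clogp log_omega1))) with rho_x in E; [symmetry; exact E|].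
    simpl. fold rho_x. rewrite exp_ln; auto. }
  assert (T : theta_x = t).
  { unfold theta_x, Carg. apply (iota_unique (V := R_CompleteNormedModule)); fold rho_x.
    - intros s [Hs1 Hs2]. rewrite E in Hs2.
      assert (C1 := f_equal Re Hs2). assert (C2 := f_equal Im Hs2). simpl in C1, C2.
      apply Rmult_eq_reg_l in C1; [|lra]. apply Rmult_eq_reg_l in C2; [|lra].
      apply angle_unique; auto. apply Rabs_lt_between. lra.
    - split; [lra|exact E]. }
  rewrite T. split; [|rewrite <- log_omega1_eq at 1; exact E].
  split; [|lra].
  apply Rnot_le_lt. intros Hle. rewrite log_omega1_eq in E. apply (f_equal Im) in E. simpl in E.
  destruct (Req_dec t 0) as [Z|Z].
  - rewrite Z, sin_0 in E. lra.
  - assert (S := sin_lt_0_var t ltac:(lra) ltac:(lra)). nra.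
Qed.

(** The square root of [- 2 ysing] with positive real part. *)
Definition rootc : C := (sqrt (2 * rho_x) * cos ((theta_x - PI) / 2), sqrt (2 * rho_x) * sin ((theta_x - PI) / 2)).

Lemma rootc_Re : 0 < Re rootc.
Proof.
  assert (T := proj1 theta_spec). assert (HR := rho_pos). simpl.
  apply Rmult_lt_0_compat; [apply sqrt_lt_R0; lra|apply cos_gt_0; lra].
Qed.

Lemma rootc_sqr : (rootc * rootc = - (2) * ysing)%C.
Proof.
  rewrite (proj2 theta_spec). unfold rootc. assert (HR := rho_pos).
  assert (S : sqrt (2 * rho_x) * sqrt (2 * rho_x) = 2 * rho_x) by (apply sqrt_sqrt; lra).
  set (r := sqrt (2 * rho_x)) in *. set (h := (theta_x - PI) / 2).
  replace theta_x with (2 * h + PI) by (unfold h; field). rewrite neg_cos, neg_sin, cos_2a, sin_2a.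
  replace rho_x with (r * r / 2) by lra.
  apply injective_projections; simpl; field.
Qed.

Lemma ysing_pow N : (ysing ^ N)%C = (rho_x ^ N * cos (INR N * theta_x), rho_x ^ N * sin (INR N * theta_x)).
Proof.
  induction N as [|N IH].
  - simpl. rewrite Rmult_0_l, cos_0, sin_0. apply injective_projections; simpl; ring.
  - rewrite Cpow_S, IH, (proj2 theta_spec), S_INR.
    replace ((INR N + 1) * theta_x) with (theta_x + INR N * theta_x) by ring.
    rewrite cos_plus, sin_plus. apply injective_projections; simpl; ring.
Qed.

(** The phase is [(theta_x - PI) / 2] from [rootc] and [- N theta_x] from [/ ysing ^ N]. *)
Lemma model_phase N : Im (rootc * / ysing ^ N)%C = - (sqrt (2 * rho_x) * / rho_x ^ N * cos (theta_x * (/ 2 - INR N))).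
Proof.
  assert (HR := rho_pos). assert (P := pow_lt rho_x N HR).
  set (A := INR N * theta_x). set (h := (theta_x - PI) / 2).
  assert (E : (/ ysing ^ N)%C = (/ rho_x ^ N * cos A, - (/ rho_x ^ N * sin A))).
  { assert (Yn := Cpow_nz ysing N ysing_nz). set (z := (/ rho_x ^ N * cos A, - (/ rho_x ^ N * sin A)) : C).
    assert (Z : (z * ysing ^ N)%C = 1).
    { rewrite ysing_pow. fold A. assert (C := sin2_cos2 A). unfold Rsqr in C.
      assert (C' : cos A * cos A = 1 - sin A * sin A) by lra.
      unfold z. apply injective_projections; simpl; field [C']; lra. }
    rewrite <- (Cmult_1_l (/ ysing ^ N)), <- Z. field. exact Yn. }
  rewrite E. unfold rootc. fold h. simpl.
  replace (theta_x * (/ 2 - INR N)) with (PI / 2 + (h - A)) by (unfold h, A; field).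
  rewrite (cos_plus (PI / 2)), cos_PI2, sin_PI2, sin_minus. ring.
Qed.

(** * The integrand at the saddle point *)

Lemma vanish_step (g dg : R -> R) a K k :
  (forall s, Rabs s <= a -> is_derive g s (dg s)) -> g 0 = 0 ->
  (forall s, Rabs s <= a -> Rabs (dg s) <= K * Rabs s ^ k) ->
  forall s, Rabs s <= a -> Rabs (g s) <= K * Rabs s ^ S k.
Proof.
  intros Hd H0 HK s Hs. assert (P := Rabs_pos s).
  assert (H := mvt_bound g dg s (K * Rabs s ^ k)). rewrite H0, Rminus_0_r in H.
  replace (K * Rabs s ^ S k) with (K * Rabs s ^ k * Rabs s) by (simpl; ring). apply H.
  - intros t Ht. apply Hd. lra.
  - intros t Ht. eapply Rle_trans; [apply HK; lra|].
    assert (Q := HK s Hs). assert (0 <= K * Rabs s ^ k) by (eapply Rle_trans; [apply Rabs_pos|exact Q]).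
    destruct (Rle_dec 0 K) as [K0|K0].
    + apply Rmult_le_compat_l; auto. apply pow_incr. split; [apply Rabs_pos|auto].
    + assert (0 <= Rabs s ^ k) by (apply pow_le; auto). assert (0 <= Rabs t ^ k) by (apply pow_le, Rabs_pos). nra.
Qed.

Lemma saddle_box s : Rabs s <= / 2 -> PI < eta1 + s < 2 * PI /\ sin (eta1 + s) <= - (2 / 5) /\ / 4 <= 1 + cos (eta1 + s).
Proof.
  intros Hs. apply Rabs_le_between in Hs. assert (HP := PI_bounds). assert (HE := eta1_bounds).
  set (d := 3 * (PI / 2) - (eta1 + s)). replace (eta1 + s) with (3 * (PI / 2) - d) by (unfold d; ring).
  destruct (shift_3PI2 d) as [-> ->]. assert (Hd : Rabs d <= 72 / 100) by (apply Rabs_le_between; unfold d; lra).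
  assert (B1 := cos_2_bound d). assert (B2 := sin_1_bound d).
  split; [unfold d; lra|].
  assert (Rabs d * Rabs d <= 72 / 100 * (72 / 100)) by (apply Rmult_le_compat; auto using Rabs_pos).
  apply Rabs_le_between in B1. apply Rabs_le_between in B2. lra.
Qed.

(** [lam] is the real part of [log omega] along the imaginary axis, [del] its deviation from the quadratic
    model; [del1] to [del4] are the derivatives of [del]. *)
Definition lam (s : R) : R := ell (eta1 + s).
Definition del (s : R) : R := lam s - (ell1 - s ^ 2 / 2).
Definition del1 (s : R) : R := cos (eta1 + s) / sin (eta1 + s) - / (eta1 + s) + s.
Definition del2 (s : R) : R := - / sin (eta1 + s) ^ 2 + / (eta1 + s) ^ 2 + 1.
Definition del3 (s : R) : R := 2 * cos (eta1 + s) / sin (eta1 + s) ^ 3 - 2 / (eta1 + s) ^ 3.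
Definition del4 (s : R) : R := - 2 / sin (eta1 + s) ^ 2 - 6 * cos (eta1 + s) ^ 2 / sin (eta1 + s) ^ 4 + 6 / (eta1 + s) ^ 4.

Lemma is_derive_lam s : Rabs s <= / 2 -> is_derive lam s (cos (eta1 + s) / sin (eta1 + s) - / (eta1 + s)).
Proof.
  intros Hs. destruct (saddle_box s Hs) as [B _]. unfold lam.
  evar_last; [apply (is_derive_comp ell (fun s => eta1 + s)); [apply is_derive_ell; auto|]|].
  - instantiate (1 := 1). auto_derive; auto.
  - unfold scal; simpl. unfold mult; simpl. ring.
Qed.

Lemma is_derive_del s : Rabs s <= / 2 -> is_derive del s (del1 s).
Proof.
  intros Hs. unfold del. evar_last.
  { apply (is_derive_minus (V := R_NormedModule) lam (fun s => ell1 - s ^ 2 / 2)); [apply is_derive_lam; auto|].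
    instantiate (1 := - s). auto_derive; auto. field. }
  unfold minus, plus, opp, del1; simpl. ring.
Qed.

Lemma is_derive_del123 s : Rabs s <= / 2 -> is_derive del1 s (del2 s) /\ is_derive del2 s (del3 s) /\ is_derive del3 s (del4 s).
Proof.
  intros Hs. destruct (saddle_box s Hs) as [B [S _]]. assert (HP := PI_RGT_0).
  assert (E := sin2_cos2 (eta1 + s)). unfold Rsqr in E.
  assert (E' : cos (eta1 + s) * cos (eta1 + s) = 1 - sin (eta1 + s) * sin (eta1 + s)) by lra.
  assert (S0 : sin (eta1 + s) <> 0) by lra. assert (V0 : eta1 + s <> 0) by lra.
  unfold del1, del2, del3, del4.
  split; [|split]; (auto_derive; [repeat split; auto; simpl; repeat apply Rmult_integral_contrapositive_currified; auto; lra|]); field [E']; auto.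
Qed.

(** [tan eta1 = eta1] gives [1 / sin eta1 ^ 2 = 1 + 1 / eta1 ^ 2]: the model is exact to second order. *)
Lemma del_at_0 : del 0 = 0 /\ del1 0 = 0 /\ del2 0 = 0.
Proof.
  assert (HE := eta1_bounds). unfold del, del1, del2, lam. rewrite !Rplus_0_r, ell_eta, ell'_eta.
  split; [simpl; field|split; [ring|]].
  destruct (saddle_box 0 ltac:(rewrite Rabs_R0; lra)) as [_ [S _]]. rewrite Rplus_0_r in S.
  assert (T := eta1_sin). assert (C := sin2_cos2 eta1). unfold Rsqr in C.
  assert (Q : sin eta1 * sin eta1 * (1 + eta1 * eta1) = eta1 * eta1) by (rewrite T in *; nra).
  apply Rmult_eq_reg_r with (eta1 ^ 2 * sin eta1 ^ 2); [|apply Rgt_not_eq; nra].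
  field_simplify; [|lra]. simpl in *; lra.
Qed.

Lemma del4_bound s : Rabs s <= / 2 -> Rabs (del4 s) <= 260.
Proof.
  intros Hs. destruct (saddle_box s Hs) as [B [S _]]. assert (HP := PI_bounds).
  assert (C := COS_bound (eta1 + s)). unfold del4.
  set (y := / sin (eta1 + s)). set (x := cos (eta1 + s)) in *. set (z := / (eta1 + s)).
  assert (Y : - (5 / 2) <= y <= 0).
  { unfold y. split; [|left; apply Rinv_lt_0_compat; lra].
    replace (5 / 2) with (/ (2 / 5)) by field. rewrite <- (Ropp_involutive (/ sin (eta1 + s))).
    apply Ropp_le_contravar. rewrite <- Rinv_opp. apply Rinv_le_contravar; lra. }
  assert (Z : 0 <= z <= 1).
  { unfold z. split; [left; apply Rinv_0_lt_compat; lra|]. rewrite <- Rinv_1. apply Rinv_le_contravar; lra. }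
  replace (-2 / sin (eta1 + s) ^ 2 - 6 * x ^ 2 / sin (eta1 + s) ^ 4 + 6 / (eta1 + s) ^ 4) with (-2 * y ^ 2 - 6 * x ^ 2 * y ^ 4 + 6 * z ^ 4)
    by (unfold y, z; field; split; lra).
  assert (Y2 : 0 <= y ^ 2 <= 25 / 4) by nra. assert (X2 : 0 <= x ^ 2 <= 1) by nra. assert (Z2 : 0 <= z ^ 2 <= 1) by nra.
  replace (y ^ 4) with (y ^ 2 * y ^ 2) by ring. replace (z ^ 4) with (z ^ 2 * z ^ 2) by ring.
  set (Y' := y ^ 2) in *. set (X' := x ^ 2) in *. set (Z' := z ^ 2) in *.
  assert (0 <= Y' * Y' <= 40) by nra. assert (0 <= Z' * Z' <= 1) by nra.
  assert (0 <= X' * (Y' * Y') <= 40) by nra.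
  apply Rabs_le_between. lra.
Qed.

Definition del_cubic : R := del3 0 / 6.

Lemma del_bound4 s : Rabs s <= / 2 -> Rabs (del s - del_cubic * s ^ 3) <= 260 * s ^ 4.
Proof.
  intros Hs. replace (s ^ 4) with (Rabs s ^ 4) by (rewrite RPow_abs; apply Rabs_pos_eq; replace (s ^ 4) with ((s ^ 2) ^ 2) by ring; apply pow2_ge_0).
  destruct del_at_0 as (Z0 & Z1 & Z2).
  apply (vanish_step (fun s => del s - del_cubic * s ^ 3) (fun s => del1 s - 3 * del_cubic * s ^ 2) (/ 2)); [| |clear s Hs|exact Hs].
  - intros t Ht. evar_last; [apply (is_derive_minus (V := R_NormedModule) del (fun s => del_cubic * s ^ 3)); [apply is_derive_del; auto|auto_derive; auto]|].
    unfold minus, plus, opp; simpl. ring.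
  - rewrite Z0. ring.
  - apply (vanish_step (fun s => del1 s - 3 * del_cubic * s ^ 2) (fun s => del2 s - 6 * del_cubic * s) (/ 2)).
    + intros t Ht. evar_last; [apply (is_derive_minus (V := R_NormedModule) del1 (fun s => 3 * del_cubic * s ^ 2)); [exact (proj1 (is_derive_del123 t Ht))|auto_derive; auto]|].
      unfold minus, plus, opp; simpl. ring.
    + rewrite Z1. ring.
    + apply (vanish_step (fun s => del2 s - 6 * del_cubic * s) (fun s => del3 s - 6 * del_cubic) (/ 2)).
      * intros t Ht. evar_last; [apply (is_derive_minus (V := R_NormedModule) del2 (fun s => 6 * del_cubic * s)); [exact (proj1 (proj2 (is_derive_del123 t Ht)))|auto_derive; auto]|].
        unfold minus, plus, opp; simpl. ring.
      * rewrite Z2. ring.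
      * apply (vanish_step (fun s => del3 s - 6 * del_cubic) del4 (/ 2)).
        -- intros t Ht. evar_last; [apply (is_derive_minus (V := R_NormedModule) del3 (fun _ => 6 * del_cubic)); [exact (proj2 (proj2 (is_derive_del123 t Ht)))|apply (is_derive_const (6 * del_cubic))]|].
           unfold minus, plus, opp, zero; simpl. ring.
        -- unfold del_cubic. field.
        -- intros t Ht. rewrite pow_O, Rmult_1_r. apply del4_bound; auto.
Qed.

Lemma del_bound3 : exists D, 0 <= D /\ forall s, Rabs s <= / 2 -> Rabs (del s) <= D * Rabs s ^ 3.
Proof.
  exists (Rabs del_cubic + 130). split; [generalize (Rabs_pos del_cubic); lra|]. intros s Hs.
  assert (H := del_bound4 s Hs). replace (del s) with ((del s - del_cubic * s ^ 3) + del_cubic * s ^ 3) by ring.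
  eapply Rle_trans; [apply Rabs_triang|]. rewrite Rabs_mult, <- RPow_abs.
  replace (s ^ 4) with (Rabs s ^ 3 * Rabs s) in H by (replace (s ^ 4) with ((s ^ 2) ^ 2) by ring; rewrite <- (pow2_abs s); ring).
  assert (0 <= Rabs s ^ 3) by apply pow_le, Rabs_pos. assert (Rabs s ^ 3 * Rabs s <= Rabs s ^ 3 * / 2) by (apply Rmult_le_compat_l; auto). lra.
Qed.

(** The values of [dFlog / i] along the imaginary axis, with their first two derivatives. *)
Definition kk (s : R) : R := kt_log (eta1 + s).
Definition kk1 (s : R) : R := 1 + (sin (eta1 + s) + (eta1 + s)) * sin (eta1 + s) / (1 + cos (eta1 + s)) ^ 2.
Definition kk2 (s : R) : R := sin (eta1 + s) / (1 + cos (eta1 + s))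
  + (sin (eta1 + s) + (eta1 + s)) * (cos (eta1 + s) * (1 + cos (eta1 + s)) + 2 * sin (eta1 + s) ^ 2) / (1 + cos (eta1 + s)) ^ 3.

Lemma is_derive_kk s : Rabs s <= / 2 -> is_derive kk s (kk1 s) /\ is_derive kk1 s (kk2 s).
Proof.
  intros Hs. destruct (saddle_box s Hs) as [_ [_ C]].
  assert (C0 : 1 + cos (eta1 + s) <> 0) by lra.
  unfold kk, kt_log, kk1, kk2. split.
  - auto_derive; [auto|]. assert (E := sin2_cos2 (eta1 + s)). unfold Rsqr in E. field. auto.
  - auto_derive; [simpl; repeat apply Rmult_integral_contrapositive_currified; auto; lra|]. field. auto.
Qed.

Lemma kk_0 : kk 0 = eta1.
Proof.
  unfold kk, kt_log. rewrite Rplus_0_r, eta1_sin. destruct (saddle_box 0 ltac:(rewrite Rabs_R0; lra)) as [_ [_ C]].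
  rewrite Rplus_0_r in C. field. lra.
Qed.

Lemma kk2_bound s : Rabs s <= / 2 -> Rabs (kk2 s) <= 2000.
Proof.
  intros Hs. destruct (saddle_box s Hs) as [B [S C]]. assert (HP := PI_bounds).
  apply Rabs_le_between in Hs. assert (HE := eta1_bounds).
  assert (B1 := SIN_bound (eta1 + s)). assert (B2 := COS_bound (eta1 + s)). unfold kk2.
  set (v := eta1 + s) in *. set (m := / (1 + cos v)).
  assert (M : 0 <= m <= 4).
  { unfold m. split; [left; apply Rinv_0_lt_compat; lra|]. replace 4 with (/ / 4) by field. apply Rinv_le_contravar; lra. }
  replace (sin v / (1 + cos v) + (sin v + v) * (cos v * (1 + cos v) + 2 * sin v ^ 2) / (1 + cos v) ^ 3) with
    (sin v * m + (sin v + v) * ((cos v * (1 + cos v) + 2 * sin v ^ 2) * (m * m * m))) by (unfold m; field; lra).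
  assert (M3 : 0 <= m * m * m <= 64).
  { assert (0 <= m * m <= 16) by nra. nra. }
  set (n := m * m * m) in *. set (x := cos v) in *. set (y := sin v) in *.
  assert (Q : -1 <= x * (1 + x) + 2 * y ^ 2 <= 4) by nra.
  set (q := x * (1 + x) + 2 * y ^ 2) in *.
  assert (QN : -256 <= q * n <= 256) by nra. assert (V : 0 <= y + v <= 6) by (unfold v in *; lra).
  assert (-1536 <= (y + v) * (q * n) <= 1536) by nra. assert (-4 <= y * m <= 4) by nra.
  apply Rabs_le_between. lra.
Qed.

Lemma kk_bound2 s : Rabs s <= / 2 -> Rabs (kk s - (eta1 + kk1 0 * s)) <= 2000 * s ^ 2.
Proof.
  intros Hs. rewrite <- (pow2_abs s).
  apply (vanish_step (fun s => kk s - (eta1 + kk1 0 * s)) (fun s => kk1 s - kk1 0) (/ 2)); [| |clear s Hs|exact Hs].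
  - intros t Ht. evar_last; [apply (is_derive_minus (V := R_NormedModule) kk (fun s => eta1 + kk1 0 * s)); [exact (proj1 (is_derive_kk t Ht))|auto_derive; auto]|].
    unfold minus, plus, opp; simpl. ring.
  - rewrite kk_0. ring.
  - apply (vanish_step (fun s => kk1 s - kk1 0) kk2 (/ 2)).
    + intros t Ht. evar_last; [apply (is_derive_minus (V := R_NormedModule) kk1 (fun s => kk1 0)); [exact (proj2 (is_derive_kk t Ht))|apply (is_derive_const (kk1 0))]|].
      unfold minus, plus, opp, zero; simpl. ring.
    + ring.
    + intros t Ht. rewrite pow_O, Rmult_1_r. apply kk2_bound; auto.
Qed.

Lemma kk_bound : exists D, 0 <= D /\ forall s, Rabs s <= / 2 -> Rabs (kk s) <= D.
Proof.
  exists (500 + eta1 + Rabs (kk1 0)). assert (HE := eta1_bounds). assert (P := Rabs_pos (kk1 0)). split; [lra|].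
  intros s Hs. assert (H := kk_bound2 s Hs).
  replace (kk s) with ((kk s - (eta1 + kk1 0 * s)) + (eta1 + kk1 0 * s)) by ring.
  eapply Rle_trans; [apply Rabs_triang|].
  assert (A : Rabs (eta1 + kk1 0 * s) <= eta1 + Rabs (kk1 0)).
  { eapply Rle_trans; [apply Rabs_triang|]. rewrite (Rabs_pos_eq eta1), Rabs_mult by lra. nra. }
  assert (s ^ 2 <= / 4) by (rewrite <- (pow2_abs s); generalize (Rabs_pos s); nra). lra.
Qed.

(** * Comparison with the model integral *)

Lemma pow_taylor1 (p q : C) (M : R) m : Cmod p <= M -> Cmod q <= M ->
  Cmod (p ^ S (S m) - q ^ S (S m) - RtoC (INR (S (S m))) * q ^ S m * (p - q)) <= INR (S (S m)) ^ 2 * M ^ m * Cmod (p - q) ^ 2.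
Proof.
  intros Hp Hq. assert (M0 : 0 <= M) by (eapply Rle_trans; [apply Cmod_ge_0|exact Hp]).
  induction m as [|m IH].
  - replace (p ^ 2 - q ^ 2 - RtoC (INR 2) * q ^ 1 * (p - q))%C with ((p - q) * (p - q))%C.
    + rewrite Cmod_mult. generalize (Cmod_ge_0 (p - q)). simpl. intros. nra.
    + replace (INR 2) with (1 + 1) by (simpl; ring). rewrite RtoC_plus. simpl. ring.
  - set (n := S (S m)) in *. set (x := Cmod (p - q)) in *.
    replace (p ^ S n - q ^ S n - RtoC (INR (S n)) * q ^ n * (p - q))%C with
      (p * (p ^ n - q ^ n - RtoC (INR n) * q ^ S m * (p - q)) + RtoC (INR n) * q ^ S m * ((p - q) * (p - q)))%C.
    2:{ rewrite (S_INR n), RtoC_plus. replace (q ^ n)%C with (q * q ^ S m)%C by reflexivity. rewrite !Cpow_S. replace (q ^ n)%C with (q * q ^ S m)%C by reflexivity. rewrite !Cpow_S. ring. }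
    eapply Rle_trans; [apply Cmod_triangle|]. rewrite !Cmod_mult. fold x.
    rewrite Cmod_R, Rabs_pos_eq by apply pos_INR. rewrite Cmod_pow.
    set (R := Cmod (p ^ n - q ^ n - RtoC (INR n) * q ^ S m * (p - q))) in *.
    apply Rle_trans with (M * (INR n ^ 2 * M ^ m * x ^ 2) + INR n * M ^ S m * (x * x)).
    + apply Rplus_le_compat.
      * apply Rmult_le_compat; auto; try apply Cmod_ge_0.
      * apply Rmult_le_compat_r; [apply Rmult_le_pos; apply Cmod_ge_0|]. apply Rmult_le_compat_l; [apply pos_INR|].
        apply pow_incr. split; [apply Cmod_ge_0|auto].
    + rewrite (S_INR n). simpl (M ^ S m).
      assert (Y : 0 <= M * M ^ m * (x * x)) by (apply Rmult_le_pos; [apply Rmult_le_pos; auto; apply pow_le; auto|apply Rmult_le_pos; apply Cmod_ge_0]).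
      replace (M * (INR n ^ 2 * M ^ m * x ^ 2) + INR n * (M * M ^ m) * (x * x)) with ((INR n ^ 2 + INR n) * (M * M ^ m * (x * x))) by ring.
      replace ((INR n + 1) ^ 2 * (M * M ^ m) * x ^ 2) with ((INR n ^ 2 + 2 * INR n + 1) * (M * M ^ m * (x * x))) by ring.
      apply Rmult_le_compat_r; auto. generalize (pos_INR n). lra.
Qed.

Definition Ytrue (s : R) : C := (lam s, PI).
Definition ptrue (s : R) : C := (/ Ytrue s)%C.

Lemma Ytrue_nz s : Ytrue s <> RtoC 0.
Proof. intros E. apply (f_equal Im) in E. simpl in E. generalize PI_RGT_0. lra. Qed.

(** Since [ell1 < 0], lowering the real part by [2 / 5 s ^ 2] increases the modulus by a multiple of [s ^ 2]. *)
Lemma Cmod_growth x s : Rabs s <= / 2 -> x <= ell1 - 2 / 5 * s ^ 2 -> rho_x * (1 + / 25 * s ^ 2) <= Cmod (x, PI).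
Proof.
  intros Hs Hx. assert (HR := rho_pos). assert (H := ell1_bounds).
  assert (Q : 0 <= s ^ 2 <= / 4) by (rewrite <- (pow2_abs s); generalize (Rabs_pos s); intros; nra).
  apply Rsqr_incr_0_var; [|apply Cmod_ge_0]. rewrite !Rsqr_pow2, Cmod2_alt, Rpow_mult_distr. simpl Re. simpl Im.
  set (u := s ^ 2) in *. assert (HB := rho_sqr_bounds). assert (E := rho_sqr). set (P := rho_x ^ 2) in *.
  assert ((ell1 - 2 / 5 * u) ^ 2 <= x ^ 2) by nra.
  assert (P * (2 / 25 * u + / 625 * (u * u)) <= 13 * (2 / 25 * u + / 625 * (u * u))) by (apply Rmult_le_compat_r; nra).
  nra.
Qed.

Lemma Cmod_ptrue s : Rabs s <= / 2 -> Cmod (ptrue s) <= rk (/ 25) s / rho_x.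
Proof.
  intros Hs. unfold ptrue. rewrite Cmod_inv by apply Ytrue_nz. unfold rk, Rdiv. rewrite <- Rinv_mult.
  assert (HR := rho_pos). assert (0 <= s ^ 2) by apply pow2_ge_0.
  rewrite Rmult_comm. apply Rinv_le_contravar; [apply Rmult_lt_0_compat; lra|].
  apply Cmod_growth; auto. destruct (saddle_box s Hs) as [B _].
  assert (U := ell_upper (eta1 + s) B). fold (lam s) in U. replace (eta1 + s - eta1) with s in U by ring. exact U.
Qed.

Lemma Cmod_qmodel_le s : Rabs s <= / 2 -> Cmod (qmodel s) <= rk (/ 25) s / rho_x.
Proof.
  intros Hs. rewrite Cmod_qmodel. unfold rk, Rdiv. rewrite <- Rinv_mult.
  assert (HR := rho_pos). assert (0 <= s ^ 2) by apply pow2_ge_0.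
  rewrite Rmult_comm. apply Rinv_le_contravar; [apply Rmult_lt_0_compat; lra|].
  apply Cmod_growth; auto. lra.
Qed.

Lemma Ytrue_del s : (ptrue s - qmodel s)%C = (- (RtoC (del s) * ptrue s * qmodel s))%C.
Proof.
  assert (E : RtoC (del s) = (Ytrue s - Ymodel s)%C).
  { unfold Ytrue, Ymodel, del. apply injective_projections; simpl; ring. }
  rewrite E. unfold ptrue, qmodel. field. split; [apply Ymodel_nz|apply Ytrue_nz].
Qed.

(** The terms of relative order [N ^ (- 1 / 2)]: being odd, they integrate to [0] over a symmetric
    interval. *)
Definition oddpart (N : nat) (s : R) : C :=
  (RtoC (kk1 0 * s) * qmodel s ^ N - RtoC (INR N * eta1 * del_cubic * s ^ 3) * qmodel s ^ S N)%C.

(** The relevant [s] are of order [N ^ (- 1 / 2)], so each of the three terms on the right is of relative order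
    [1 / N]. *)
Lemma integrand_error : exists K, 0 <= K /\ forall m s, Rabs s <= / 2 ->
  let N := S (S m) in
  Cmod (RtoC (kk s) * ptrue s ^ N - RtoC eta1 * qmodel s ^ N - oddpart N s) <=
  K / rho_x ^ N * (s ^ 2 * rk (/ 25) s ^ N + INR N * (s ^ 4 * rk (/ 25) s ^ S N) + INR N ^ 2 * (s ^ 6 * rk (/ 25) s ^ S (S N))).
Proof.
  destruct del_bound3 as (D & HD0 & HD). destruct kk_bound as (Dk & HDk0 & HDk).
  assert (HE := eta1_bounds). assert (HR := rho_bounds).
  set (E := Rabs (kk1 0) + 1000). assert (E0 : 0 <= E) by (unfold E; generalize (Rabs_pos (kk1 0)); lra).
  set (K4 := 260 * Dk + Rabs del_cubic * E). assert (K40 : 0 <= K4) by (unfold K4; generalize (Rabs_pos del_cubic); nra).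
  set (K6 := 2 * Dk * D ^ 2). assert (K60 : 0 <= K6) by (unfold K6; nra).
  exists (2000 + K4 + K6). split; [lra|].
  intros m s Hs N. set (r := rk (/ 25) s). set (n := INR N). set (M := r / rho_x).
  assert (R0 : 0 < r) by (apply rk_pos; lra). assert (M0 : 0 < M) by (apply Rdiv_lt_0_compat; lra).
  assert (N1 : 1 <= n) by (change 1 with (INR 1); apply le_INR; unfold N; lia).
  set (p := ptrue s). set (q := qmodel s). set (dl := del s). set (k := kk s).
  assert (Hp : Cmod p <= M) by (apply Cmod_ptrue; auto). assert (Hq : Cmod q <= M) by (apply Cmod_qmodel_le; auto).
  assert (Hd : (p - q)%C = (- (RtoC dl * p * q))%C) by apply Ytrue_del.
  assert (S0 := Rabs_pos s).
  assert (S2 : Rabs s * Rabs s = s ^ 2) by (rewrite <- (pow2_abs s); ring).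
  assert (Bk : Rabs k <= Dk) by (apply HDk; auto).
  assert (Bk2 : Rabs (k - (eta1 + kk1 0 * s)) <= 2000 * s ^ 2) by (apply kk_bound2; auto).
  assert (Bk1 : Rabs (k - eta1) <= E * Rabs s).
  { replace (k - eta1) with ((k - (eta1 + kk1 0 * s)) + kk1 0 * s) by ring.
    eapply Rle_trans; [apply Rabs_triang|]. rewrite Rabs_mult. unfold E. nra. }
  assert (Bd : Rabs dl <= D * Rabs s ^ 3) by (apply HD; auto).
  assert (Bd4 : Rabs (dl - del_cubic * s ^ 3) <= 260 * s ^ 4) by (apply del_bound4; auto).
  assert (Bd2 : dl ^ 2 <= D ^ 2 * s ^ 6).
  { rewrite <- (pow2_abs dl). replace (D ^ 2 * s ^ 6) with ((D * Rabs s ^ 3) ^ 2).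
    - apply pow_incr. split; [apply Rabs_pos|auto].
    - replace (s ^ 6) with ((s ^ 2) ^ 3) by ring. rewrite <- S2. ring. }
  assert (Bkd : Rabs (k * dl - eta1 * del_cubic * s ^ 3) <= K4 * s ^ 4).
  { replace (k * dl - eta1 * del_cubic * s ^ 3) with (k * (dl - del_cubic * s ^ 3) + del_cubic * s ^ 3 * (k - eta1)) by ring.
    eapply Rle_trans; [apply Rabs_triang|]. rewrite !Rabs_mult, <- RPow_abs. unfold K4.
    replace ((260 * Dk + Rabs del_cubic * E) * s ^ 4) with (Dk * (260 * s ^ 4) + Rabs del_cubic * Rabs s ^ 3 * (E * Rabs s)).
    - apply Rplus_le_compat.
      + apply Rmult_le_compat; auto using Rabs_pos.
      + apply Rmult_le_compat_l; auto. apply Rmult_le_pos; [apply Rabs_pos|apply pow_le; auto].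
    - replace (s ^ 4) with ((s ^ 2) ^ 2) by ring. rewrite <- S2. ring. }
  set (Rem := (p ^ N - q ^ N - RtoC n * q ^ S m * (p - q))%C).
  assert (BR : Cmod Rem <= n ^ 2 * (dl ^ 2 * M ^ S (S N))).
  { eapply Rle_trans; [apply (pow_taylor1 p q M m Hp Hq)|]. fold N. fold n.
    rewrite Hd, Cmod_opp, !Cmod_mult, Cmod_R. rewrite Rmult_assoc. apply Rmult_le_compat_l; [apply pow2_ge_0|].
    rewrite !Rpow_mult_distr, pow2_abs.
    replace (dl ^ 2 * M ^ S (S N)) with (M ^ m * (dl ^ 2 * M ^ 2 * M ^ 2)) by (unfold N; simpl; ring).
    apply Rmult_le_compat_l; [apply pow_le; lra|].
    apply Rmult_le_compat; try (apply pow_incr; split; [apply Cmod_ge_0|auto]).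
    - apply Rmult_le_pos; apply pow2_ge_0.
    - apply pow2_ge_0.
    - apply Rmult_le_compat_l; [apply pow2_ge_0|]. apply pow_incr; split; [apply Cmod_ge_0|auto]. }
  assert (ID : (RtoC k * p ^ N - RtoC eta1 * q ^ N - oddpart N s)%C =
    (RtoC (k - (eta1 + kk1 0 * s)) * q ^ N + (RtoC k * (Rem + RtoC n * (RtoC (dl ^ 2) * (p * q ^ S N)))
      - RtoC (n * (k * dl - eta1 * del_cubic * s ^ 3)) * q ^ S N))%C).
  { unfold oddpart. fold n q. set (w := eta1 * del_cubic * s ^ 3).
    replace (n * eta1 * del_cubic * s ^ 3) with (n * w) by (unfold w; ring). set (v := kk1 0 * s).
    assert (HX : (p - q + RtoC dl * p * q)%C = 0) by (rewrite Hd; ring).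
    transitivity (RtoC k * p ^ N - RtoC eta1 * q ^ N - (RtoC v * q ^ N - RtoC (n * w) * q ^ S N)
      - RtoC k * RtoC n * q ^ S m * ((p - q + RtoC dl * p * q) - RtoC dl * q * (p - q + RtoC dl * p * q)))%C.
    - rewrite HX. ring.
    - unfold Rem. replace (dl ^ 2) with (dl * dl) by ring. rewrite !RtoC_mult, !RtoC_minus, RtoC_plus, RtoC_mult. unfold N. rewrite !(Cpow_S q). ring. }
  rewrite ID. clear ID.
  assert (HqN : forall j, Cmod q ^ j <= M ^ j) by (intros j; apply pow_incr; split; [apply Cmod_ge_0|auto]).
  set (T2 := s ^ 2 * M ^ N). set (T4 := s ^ 4 * M ^ S N). set (T6 := s ^ 6 * M ^ S (S N)).
  assert (s2 : 0 <= s ^ 2) by apply pow2_ge_0.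
  assert (s4 : 0 <= s ^ 4) by (replace (s ^ 4) with ((s ^ 2) ^ 2) by ring; apply pow2_ge_0).
  assert (s6 : 0 <= s ^ 6) by (replace (s ^ 6) with ((s ^ 2) ^ 3) by ring; apply pow_le; auto).
  assert (P2 : 0 <= T2) by (apply Rmult_le_pos; auto; apply pow_le; lra).
  assert (P4 : 0 <= T4) by (apply Rmult_le_pos; auto; apply pow_le; lra).
  assert (P6 : 0 <= T6) by (apply Rmult_le_pos; auto; apply pow_le; lra).
  assert (DM : dl ^ 2 * M ^ S (S N) <= D ^ 2 * T6).
  { unfold T6. rewrite <- Rmult_assoc. apply Rmult_le_compat_r; auto. apply pow_le; lra. }
  assert (B1 : Cmod (RtoC (k - (eta1 + kk1 0 * s)) * q ^ N) <= 2000 * T2).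
  { rewrite Cmod_mult, Cmod_R, Cmod_pow. unfold T2. rewrite <- Rmult_assoc.
    apply Rmult_le_compat; auto using Rabs_pos. apply pow_le, Cmod_ge_0. }
  assert (B3 : Cmod (RtoC (n * (k * dl - eta1 * del_cubic * s ^ 3)) * q ^ S N) <= n * (K4 * T4)).
  { rewrite Cmod_mult, Cmod_R, Cmod_pow, Rabs_mult, (Rabs_pos_eq n) by lra. rewrite Rmult_assoc.
    apply Rmult_le_compat_l; [lra|]. unfold T4. rewrite <- Rmult_assoc.
    apply Rmult_le_compat; auto using Rabs_pos. apply pow_le, Cmod_ge_0. }
  assert (B2 : Cmod (RtoC k * (Rem + RtoC n * (RtoC (dl ^ 2) * (p * q ^ S N)))) <= n ^ 2 * (K6 * T6)).
  { rewrite Cmod_mult, Cmod_R.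
    assert (Q2 : Cmod (RtoC n * (RtoC (dl ^ 2) * (p * q ^ S N))) <= n ^ 2 * (dl ^ 2 * M ^ S (S N))).
    { rewrite !Cmod_mult, !Cmod_R, Cmod_pow, (Rabs_pos_eq n), (Rabs_pos_eq (dl ^ 2)) by (lra || apply pow2_ge_0).
      apply Rmult_le_compat.
      - lra.
      - apply Rmult_le_pos; [apply pow2_ge_0|]. apply Rmult_le_pos; [apply Cmod_ge_0|apply pow_le, Cmod_ge_0].
      - nra.
      - apply Rmult_le_compat_l; [apply pow2_ge_0|]. change (M ^ S (S N)) with (M * M ^ S N).
        apply Rmult_le_compat; auto using Cmod_ge_0. apply pow_le, Cmod_ge_0. }
    apply Rle_trans with (Dk * (2 * (n ^ 2 * (D ^ 2 * T6)))).
    - apply Rmult_le_compat; auto using Rabs_pos, Cmod_ge_0. eapply Rle_trans; [apply Cmod_triangle|].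
      assert (n ^ 2 * (dl ^ 2 * M ^ S (S N)) <= n ^ 2 * (D ^ 2 * T6)) by (apply Rmult_le_compat_l; [apply pow2_ge_0|auto]). lra.
    - unfold K6. right. ring. }
  set (F := s ^ 2 * r ^ N + n * (s ^ 4 * r ^ S N) + n ^ 2 * (s ^ 6 * r ^ S (S N))).
  assert (RN := pow_lt rho_x N ltac:(lra)). set (i := / rho_x ^ N).
  assert (Ipos : 0 < i) by (apply Rinv_0_lt_compat; auto).
  assert (MN : M ^ N = i * r ^ N) by (unfold M, i, Rdiv; rewrite Rpow_mult_distr, pow_inv; ring).
  assert (iR : 0 < / rho_x <= 1).
  { split; [apply Rinv_0_lt_compat; lra|]. rewrite <- Rinv_1. apply Rinv_le_contravar; lra. }
  assert (MR : 0 <= M <= r) by (unfold M, Rdiv; nra).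
  assert (rN : 0 <= i * r ^ N) by (apply Rmult_le_pos; [lra|apply pow_le; lra]).
  assert (M1 : M ^ S N <= i * r ^ S N) by (change (M ^ S N) with (M * M ^ N); change (r ^ S N) with (r * r ^ N); rewrite MN; nra).
  assert (rN1 : 0 <= i * r ^ S N) by (apply Rmult_le_pos; [lra|apply pow_le; lra]).
  assert (M2 : M ^ S (S N) <= i * r ^ S (S N)) by (change (M ^ S (S N)) with (M * M ^ S N); change (r ^ S (S N)) with (r * r ^ S N); assert (0 <= M ^ S N) by (apply pow_le; lra); nra).
  assert (L2 : T2 <= i * (s ^ 2 * r ^ N)) by (unfold T2; rewrite MN; right; ring).
  assert (L4 : T4 <= i * (s ^ 4 * r ^ S N)) by (unfold T4; nra).
  assert (L6 : T6 <= i * (s ^ 6 * r ^ S (S N))) by (unfold T6; nra).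
  set (K := 2000 + K4 + K6).
  apply Rle_trans with (K * (T2 + n * T4 + n ^ 2 * T6)).
  - eapply Rle_trans; [apply Cmod_triangle|]. unfold Cminus at 1.
    eapply Rle_trans; [apply Rplus_le_compat_l, Cmod_triangle|]. rewrite Cmod_opp.
    assert (0 <= n * T4) by nra. assert (0 <= n ^ 2 * T6) by (apply Rmult_le_pos; [apply pow2_ge_0|auto]).
    unfold K. nra.
  - unfold Rdiv. fold i. rewrite Rmult_assoc. apply Rmult_le_compat_l; [unfold K; lra|]. unfold F.
    assert (n * T4 <= n * (i * (s ^ 4 * r ^ S N))) by (apply Rmult_le_compat_l; lra).
    assert (n ^ 2 * T6 <= n ^ 2 * (i * (s ^ 6 * r ^ S (S N)))) by (apply Rmult_le_compat_l; [apply pow2_ge_0|auto]).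
    lra.
Qed.

Lemma odd_int (f : R -> C) a (l : C) : (forall s, f (- s) = (- f s)%C) ->
  @is_RInt C_R_NormedModule f (- a) a l -> l = 0%C.
Proof.
  intros Ho H.
  assert (H2 : @is_RInt C_R_NormedModule f (- a) a (opp l)).
  { apply (is_RInt_swap (V := C_R_NormedModule)).
    apply (is_RInt_ext (V := C_R_NormedModule) (fun y => opp (f (- y)))).
    - intros s _. rewrite Ho. apply injective_projections; simpl; ring.
    - apply (is_RInt_comp_opp (V := C_R_NormedModule)). rewrite Ropp_involutive. exact H. }
  assert (E := is_RInt_unique (V := C_R_CompleteNormedModule) _ _ _ _ H).
  rewrite (is_RInt_unique (V := C_R_CompleteNormedModule) _ _ _ _ H2) in E.
  destruct l as [x y]. assert (E1 := f_equal Re E). assert (E2 := f_equal Im E). simpl in E1, E2.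
  apply injective_projections; simpl in *; lra.
Qed.

Lemma ptrue_der s : Rabs s <= / 2 -> exists l, CRder ptrue s l.
Proof.
  intros Hs. assert (HP := PI_RGT_0). assert (D := is_derive_lam s Hs).
  assert (Q : lam s * lam s + PI * PI <> 0) by (generalize (Rle_0_sqr (lam s)); unfold Rsqr; nra).
  set (l := cos (eta1 + s) / sin (eta1 + s) - / (eta1 + s)) in *.
  assert (G1 : is_derive (fun x => x / (x * (x * 1) + PI * (PI * 1))) (lam s) ((PI * PI - lam s * lam s) / (lam s * lam s + PI * PI) ^ 2)).
  { auto_derive; [simpl; lra|]. field. lra. }
  assert (G2 : is_derive (fun x => - PI / (x * (x * 1) + PI * (PI * 1))) (lam s) (2 * PI * lam s / (lam s * lam s + PI * PI) ^ 2)).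
  { auto_derive; [simpl; lra|]. field. lra. }
  eexists (_, _). split; unfold ptrue, Ytrue; simpl.
  - apply (is_derive_comp _ lam s _ _ G1 D).
  - apply (is_derive_comp _ lam s _ _ G2 D).
Qed.

Lemma local_int_cont N s : Rabs s <= / 2 -> CRcontinuous (fun s => RtoC (kk s) * ptrue s ^ S N)%C s.
Proof.
  intros Hs. destruct (ptrue_der s Hs) as [l Hl]. eapply CRder_cont.
  apply (CRder_mult (fun s => RtoC (kk s)) (fun s => ptrue s ^ S N)%C); [|apply CRder_pow, Hl].
  exact (CRder_RtoC kk s _ (proj1 (is_derive_kk s Hs))).
Qed.

Lemma oddpart_odd N s : oddpart N (- s) = (- oddpart N s)%C.
Proof.
  unfold oddpart. rewrite qmodel_even. replace (kk1 0 * - s) with (- (kk1 0 * s)) by ring.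
  replace (INR N * eta1 * del_cubic * (- s) ^ 3) with (- (INR N * eta1 * del_cubic * s ^ 3)) by ring. rewrite !RtoC_opp. ring.
Qed.

Lemma oddpart_cont N s : CRcontinuous (oddpart N) s.
Proof.
  assert (A : CRcontinuous (fun s => RtoC (kk1 0 * s) * qmodel s ^ N)%C s).
  { destruct N as [|N]; eapply CRder_cont.
    - apply (CRder_mult (fun s => RtoC (kk1 0 * s)) (fun s => RtoC 1)); [apply (CRder_RtoC (fun s => kk1 0 * s)); auto_derive; auto; reflexivity|apply CRder_const].
    - apply (CRder_mult (fun s => RtoC (kk1 0 * s)) (fun s => qmodel s ^ S N)%C); [apply (CRder_RtoC (fun s => kk1 0 * s)); auto_derive; auto; reflexivity|apply CRder_pow, qmodel_der]. }
  assert (B : CRcontinuous (fun s => RtoC (INR N * eta1 * del_cubic * s ^ 3) * qmodel s ^ S N)%C s).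
  { eapply CRder_cont.
    apply (CRder_mult (fun s => RtoC (INR N * eta1 * del_cubic * s ^ 3)) (fun s => qmodel s ^ S N)%C); [|apply CRder_pow, qmodel_der].
    apply (CRder_RtoC (fun s => INR N * eta1 * del_cubic * s ^ 3)); auto_derive; auto; reflexivity. }
  assert (E := CRcont_plus _ _ _ A (CRcont_scal (- (1)) _ _ B)).
  destruct E as [E1 E2]. split; [revert E1|revert E2]; apply continuous_ext; intros t; f_equal; unfold oddpart; ring.
Qed.

(** Every step of the recursion gains a factor [1 / N], which the powers of [N] compensate. *)
Lemma mom_total : exists K, 0 <= K /\ forall m, let N := S (S m) in
  mom (/ 25) (/ 2) 2 N + INR N * mom (/ 25) (/ 2) 4 (S N) + INR N ^ 2 * mom (/ 25) (/ 2) 6 (S (S N)) <= K / (INR N * sqrt (INR N)).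
Proof.
  exists (2400 * (4 * (63 * PI))). assert (HP := PI_RGT_0). split; [lra|]. intros m N. set (L := S m).
  assert (L1 : 1 <= INR L) by (change 1 with (INR 1); apply le_INR; unfold L; lia).
  assert (NL : INR N = INR L + 1) by (unfold N; rewrite (S_INR (S m)); reflexivity).
  assert (M2 := mom_step (/ 25) (/ 2) ltac:(lra) ltac:(lra) 0 L ltac:(unfold L; lia)).
  assert (M0 := mom_0 (/ 25) (/ 2) ltac:(lra) ltac:(lra) L ltac:(unfold L; lia)).
  assert (M4 := mom_step (/ 25) (/ 2) ltac:(lra) ltac:(lra) 1 N ltac:(unfold N; lia)).
  assert (M6 := mom_step (/ 25) (/ 2) ltac:(lra) ltac:(lra) 2 (S N) ltac:(unfold N; lia)).
  change (2 * 0 + 2)%nat with 2%nat in M2. change (2 * 0)%nat with 0%nat in M2. change (S L) with N in M2.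
  change (2 * 1 + 2)%nat with 4%nat in M4. change (2 * 1)%nat with 2%nat in M4.
  change (2 * 2 + 2)%nat with 6%nat in M6. change (2 * 2)%nat with 4%nat in M6.
  rewrite (S_INR N) in M6.
  change (INR 0) with 0 in M2. change (INR 1) with 1 in M4. replace (INR 2) with (1 + 1) in M6 by (simpl; ring).
  set (n := INR N) in *. set (l := INR L) in *.
  set (u2 := mom (/ 25) (/ 2) 2 N) in *. set (u4 := mom (/ 25) (/ 2) 4 (S N)) in *. set (u6 := mom (/ 25) (/ 2) 6 (S (S N))) in *.
  set (u0 := mom (/ 25) (/ 2) 0 L) in *.
  set (t := sqrt l). set (w := sqrt n).
  assert (T : t * t = l) by (apply sqrt_sqrt; lra). assert (T0 : 0 < t) by (apply sqrt_lt_R0; lra).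
  assert (W : w * w = n) by (apply sqrt_sqrt; lra). assert (W0 : 0 < w) by (apply sqrt_lt_R0; lra).
  assert (S25 : sqrt (/ 25 * l) = / 5 * t).
  { rewrite sqrt_mult by lra. f_equal. replace (/ 25) with ((/ 5) * (/ 5)) by field. apply sqrt_square. lra. }
  rewrite S25 in M0. set (X := 63 * PI / (l * t)).
  assert (LT : 0 < l * t) by (apply Rmult_lt_0_compat; lra).
  assert (X0 : 0 < X) by (apply Rdiv_lt_0_compat; lra).
  assert (B2 : u2 <= X).
  { eapply Rle_trans; [exact M2|]. eapply Rle_trans; [apply Rmult_le_compat_l; [|exact M0]|].
    - left. apply Rdiv_lt_0_compat; lra.
    - apply Rmult_le_reg_r with (l * t); auto. unfold X.
      replace (63 * PI / (l * t) * (l * t)) with (63 * PI) by (field; lra).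
      replace ((2 * 0 + 1) / (2 * / 25 * l) * (PI / (/ 5 * t)) * (l * t)) with (125 / 2 * PI) by (field; lra). lra. }
  assert (B4 : n * u4 <= 40 * X).
  { apply Rmult_le_compat_l with (r := n) in M4; [|lra].
    replace (n * ((2 * 1 + 1) / (2 * / 25 * n) * u2)) with (75 / 2 * u2) in M4 by (field; lra). lra. }
  assert (B6 : n ^ 2 * u6 <= 2350 * X).
  { assert (Q : n * (n + 1) * u6 <= 125 / 2 * (75 / 2 * u2)).
    { apply Rmult_le_compat_l with (r := n * (n + 1)) in M6; [|apply Rmult_le_pos; lra].
      replace (n * (n + 1) * ((2 * (1 + 1) + 1) / (2 * / 25 * (n + 1)) * u4)) with (125 / 2 * (n * u4)) in M6 by (field; lra).
      apply Rmult_le_compat_l with (r := n) in M4; [|lra].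
      replace (n * ((2 * 1 + 1) / (2 * / 25 * n) * u2)) with (75 / 2 * u2) in M4 by (field; lra). lra. }
    destruct (Rle_dec u6 0) as [U|U]; [assert (n ^ 2 * u6 <= 0) by (generalize (pow2_ge_0 n); nra); lra|]. nra. }
  apply Rle_trans with (2400 * X); [lra|].
  apply Rle_trans with (2400 * (4 * (63 * PI) / (n * w))); [|right; field; split; lra].
  apply Rmult_le_compat_l; [lra|].
  assert (WT : w <= 2 * t) by nra.
  assert (NW : n * w <= 4 * (l * t)) by nra. assert (NW0 : 0 < n * w) by (apply Rmult_lt_0_compat; lra).
  apply Rmult_le_reg_r with ((l * t) * (n * w)); [apply Rmult_lt_0_compat; auto|].
  unfold X. replace (63 * PI / (l * t) * (l * t * (n * w))) with (63 * PI * (n * w)) by (field; lra).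
  replace (4 * (63 * PI) / (n * w) * (l * t * (n * w))) with (63 * PI * (4 * (l * t))) by (field; lra).
  apply Rmult_le_compat_l; lra.
Qed.

Lemma local_error : exists K, 0 <= K /\ forall m, let N := S (S m) in
  Cmod (Cint (fun s => RtoC (kk s) * ptrue s ^ N)%C (- / 2) (/ 2) - RtoC eta1 * modelint (/ 2) N) <= K * / rho_x ^ N / (INR N * sqrt (INR N)).
Proof.
  destruct integrand_error as (K1 & HK1 & H1). destruct mom_total as (K2 & HK2 & H2).
  exists (K1 * K2). split; [apply Rmult_le_pos; auto|]. intros m N.
  assert (RN := pow_lt rho_x N rho_pos).
  set (I1 := Cint (fun s => RtoC (kk s) * ptrue s ^ N)%C (- / 2) (/ 2)).
  assert (J1 : @is_RInt C_R_NormedModule (fun s => RtoC (kk s) * ptrue s ^ N)%C (- / 2) (/ 2) I1).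
  { apply (CR_ex_RInt (fun s => RtoC (kk s) * ptrue s ^ N)%C); [lra|]. intros t Ht. apply local_int_cont, Rabs_le_between. lra. }
  assert (J2 := modelint_int (/ 2) N ltac:(lra)).
  set (I3 := Cint (oddpart N) (- / 2) (/ 2)).
  assert (J3 : @is_RInt C_R_NormedModule (oddpart N) (- / 2) (/ 2) I3).
  { apply (CR_ex_RInt (oddpart N)); [lra|]. intros; apply oddpart_cont. }
  assert (Z3 := odd_int _ _ _ (oddpart_odd N) J3).
  assert (J := is_RInt_minus (V := C_R_NormedModule) _ _ _ _ _ _
    (is_RInt_minus (V := C_R_NormedModule) _ _ _ _ _ _ J1 (is_Cint_scal _ _ _ (RtoC eta1) _ J2)) J3).
  rewrite Z3 in J.
  set (a := / 2) in *.
  assert (JG := is_RInt_scal (V := R_NormedModule) _ _ _ (K1 / rho_x ^ N) _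
    (is_RInt_plus (V := R_NormedModule) _ _ _ _ _ _ (is_RInt_plus (V := R_NormedModule) _ _ _ _ _ _
      (mom_int (/ 25) a ltac:(lra) ltac:(unfold a; lra) 2 N)
      (is_RInt_scal (V := R_NormedModule) _ _ _ (INR N) _ (mom_int (/ 25) a ltac:(lra) ltac:(unfold a; lra) 4 (S N))))
      (is_RInt_scal (V := R_NormedModule) _ _ _ (INR N ^ 2) _ (mom_int (/ 25) a ltac:(lra) ltac:(unfold a; lra) 6 (S (S N)))))).
  assert (B := norm_RInt_le (V := C_R_NormedModule) _ _ (- a) a _ _ ltac:(unfold a; lra)
    (fun s Hs => Rle_trans _ _ _ (Req_le _ _ (Cnorm_R _)) (H1 m s (proj2 (Rabs_le_between s a) Hs))) J JG).
  rewrite Cnorm_R in B.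
  replace (I1 - RtoC eta1 * modelint a N)%C with (I1 - RtoC eta1 * modelint a N - 0)%C by ring.
  eapply Rle_trans; [exact B|].
  apply Rle_trans with (K1 / rho_x ^ N * (K2 / (INR N * sqrt (INR N)))).
  - apply Rmult_le_compat_l; [apply Rmult_le_pos; auto; left; apply Rinv_0_lt_compat; auto|]. exact (H2 m).
  - right. unfold Rdiv. ring.
Qed.

(** * Splitting off the saddle point *)

Definition Glow : contour := [((- (1))%C, (0, 0), Ci, PI + dlt, eta1 - / 2)].
Definition Gsaddle : contour := [((- (1))%C, (0, 0), Ci, eta1 - / 2, eta1 + / 2)].
Definition Ghigh : contour := [((- (1))%C, (0, 0), Ci, eta1 + / 2, top)].
Definition Gaway : contour := Gouter ++ Glow ++ Ghigh.

Lemma Gaway_oriented : oriented Gaway.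
Proof.
  assert (HP := PI_bounds). assert (HE := eta1_bounds).
  apply oriented_app; [apply Gouter_oriented|]. simpl. unfold dlt, top. lra.
Qed.

Lemma on_Gaway (w : C) : on Gaway w -> on Glog w /\ 7 / 2 <= Cmod (plog w).
Proof.
  assert (HP := PI_bounds). assert (HE := eta1_bounds). intros H. apply on_app in H. destruct H as [H|H].
  - split; [apply on_app; auto|apply Gouter_far; auto].
  - assert (V : exists v, PI + dlt <= v <= top /\ / 2 <= Rabs (v - eta1) /\ w = (0, v)).
    { destruct H as [[t [Ht ->]]|[[t [Ht ->]]|[]]]; exists t; (split; [unfold dlt, top in *; lra|split; [|apply (vpt 0)]]).
      - rewrite Rabs_left; lra.
      - rewrite Rabs_pos_eq; lra. }
    destruct V as (v & Hv & Hd & ->). split.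
    + apply on_app. right. left. exists v. split; auto. symmetry. apply (vpt 0).
    + unfold dlt, top in Hv. rewrite plog_imag_high by lra. fold (ell v). assert (U := ell_upper v ltac:(lra)).
      assert (D2 : / 4 <= (v - eta1) ^ 2) by (rewrite <- (pow2_abs (v - eta1)); nra).
      apply Rsqr_incr_0_var; [|apply Cmod_ge_0]. rewrite !Rsqr_pow2, Cmod2_alt. simpl Re. simpl Im.
      assert (L := ell1_bounds). assert (R := rho_sqr_bounds). rewrite rho_sqr in R. nra.
Qed.

Lemma cint_Glog_split (F : C -> C) : (forall w, on Glog w -> Ccont F w) -> cint F Glog = (cint F Gaway + cint F Gsaddle)%C.
Proof.
  intros HF. assert (HP := PI_bounds). assert (HE := eta1_bounds).
  assert (S : forall a b, PI + dlt <= a <= b -> b <= top -> segcont F (0, 0) Ci a b).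
  { intros a b Ha Hb t. rewrite Rmin_left, Rmax_right by lra. intros Ht. apply HF, on_app. right. left. exists t. split; [lra|auto]. }
  unfold Glog, Gaway. rewrite !cint_app. simpl.
  rewrite (seg_chasles F (0, 0) Ci (PI + dlt) (eta1 - / 2) top), (seg_chasles F (0, 0) Ci (eta1 - / 2) (eta1 + / 2) top).
  - ring.
  - unfold dlt, top in *; lra.
  - apply S; unfold dlt, top in *; lra.
  - unfold dlt, top in *; lra.
  - apply S; unfold dlt, top in *; lra.
Qed.

(** The factors [-1] of the orientation, [i] of the direction and [i] of [dFlog] cancel. *)
Lemma cint_Gsaddle N : cint (fun w => dFlog w / plog w ^ S N)%C Gsaddle = Cint (fun s => RtoC (kk s) * ptrue s ^ S N)%C (- / 2) (/ 2).
Proof.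
  assert (HP := PI_bounds). assert (HE := eta1_bounds).
  set (I1 := Cint (fun s => RtoC (kk s) * ptrue s ^ S N)%C (- / 2) (/ 2)).
  assert (J1 : @is_RInt C_R_NormedModule (fun s => RtoC (kk s) * ptrue s ^ S N)%C (- / 2) (/ 2) I1).
  { apply (CR_ex_RInt (fun s => RtoC (kk s) * ptrue s ^ S N)%C); [lra|]. intros t Ht. apply local_int_cont, Rabs_le_between. lra. }
  apply (is_Cint_scal _ _ _ Ci) in J1.
  assert (J2 : @is_RInt C_R_NormedModule (fun t => dFlog ((0, 0) + RtoC t * Ci) / plog ((0, 0) + RtoC t * Ci) ^ S N)%C (eta1 - / 2) (eta1 + / 2) (Ci * I1)%C).
  { replace (- / 2) with (1 * (eta1 - / 2) + - eta1) in J1 by lra. replace (/ 2) with (1 * (eta1 + / 2) + - eta1) in J1 at 2 by lra.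
    generalize (is_RInt_comp_lin (V := C_R_NormedModule) _ _ _ _ _ _ J1).
    apply (is_RInt_ext (V := C_R_NormedModule)). rewrite Rmin_left, Rmax_right by lra. intros t Ht.
    rewrite (vpt 0 t). destruct (saddle_box (t - eta1)) as (B & S1 & C); [apply Rabs_le_between; lra|].
    replace (eta1 + (t - eta1)) with t in B, S1, C by ring.
    rewrite dFlog_imag, plog_imag_high by lra. fold (ell t).
    replace (1 * t + - eta1) with (t - eta1) by ring.
    unfold ptrue, Ytrue, lam, kk. replace (eta1 + (t - eta1)) with t by ring.
    assert (An : (ell t, PI) <> RtoC 0) by (intros E; apply (f_equal Im) in E; simpl in E; lra).
    rewrite Cpow_inv by exact An. unfold Cdiv.
    replace (0%R, kt_log t) with (Ci * RtoC (kt_log t))%C by (apply injective_projections; simpl; ring).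
    set (Z := (Ci * (RtoC (kt_log t) * / (ell t, PI) ^ S N))%C).
    replace (Ci * RtoC (kt_log t) * / (ell t, PI) ^ S N)%C with Z by (unfold Z; ring).
    apply (scal_one (V := C_R_NormedModule) Z). }
  unfold Gsaddle, cint, seg. rewrite (is_RInt_unique (V := C_R_CompleteNormedModule) _ _ _ _ J2).
  assert (I : (Ci * Ci = - (1))%C) by (apply injective_projections; simpl; ring).
  ring [I].
Qed.

(** [7 / 2 > rho_x], so the rest of the contour is exponentially smaller. *)
Lemma far_small : exists K, 0 <= K /\ forall m, let N := S (S m) in
  / (7 / 2) ^ m <= K * / rho_x ^ N / (INR N * sqrt (INR N)).
Proof.
  assert (HR := rho_bounds).
  destruct (geom_small (rho_x * / (7 / 2))) as (K & HK0 & HK).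
  { split; [apply Rmult_lt_0_compat; lra|]. lra. }
  exists (49 / 4 * K). split; [lra|]. intros m N. specialize (HK N ltac:(unfold N; lia)).
  assert (N1 : 1 <= INR N) by (change 1 with (INR 1); apply le_INR; unfold N; lia).
  set (n := INR N) in *. set (w := sqrt n).
  assert (W : w * w = n) by (apply sqrt_sqrt; lra). assert (W0 : 0 < w) by (apply sqrt_lt_R0; lra).
  assert (Wn : w <= n) by nra.
  assert (RN := pow_lt rho_x N ltac:(lra)). assert (SN := pow_lt (7 / 2) m ltac:(lra)).
  rewrite Rpow_mult_distr, pow_inv in HK.
  replace (/ (7 / 2) ^ m) with (49 / 4 * / rho_x ^ N * (rho_x ^ N * / (7 / 2) ^ N)) by (unfold N; simpl pow at 3; field; simpl; split; try lra; apply Rgt_not_eq; simpl in RN; lra).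
  apply Rle_trans with (49 / 4 * / rho_x ^ N * (K / (n * w))); [|right; unfold Rdiv; ring].
  apply Rmult_le_compat_l; [apply Rmult_le_pos; [lra|left; apply Rinv_0_lt_compat; auto]|].
  eapply Rle_trans; [exact HK|]. apply Rmult_le_compat_l; auto. apply Rinv_le_contravar; nra.
Qed.

Lemma Elog_asym : exists K, 0 <= K /\ forall m, let N := S (S m) in
  Rabs (PI * Elog (S m) + eta1 * PI * wallis (S m) * (sqrt (2 * rho_x) * / rho_x ^ N * cos (theta_x * (/ 2 - INR N))))
   <= K * / rho_x ^ N / (INR N * sqrt (INR N)).
Proof.
  destruct local_error as (K1 & HK1 & H1). destruct far_small as (K2 & HK2 & H2).
  destruct (ccoef_bound dFlog plog Gaway (7 / 2) Gaway_oriented ltac:(lra)) as (M & HM0 & HM).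
  { intros w Hw. apply Glog_dFlog_cont, on_Gaway; auto. }
  { intros w Hw. apply Glog_plog_cont, on_Gaway; auto. }
  { intros w Hw. apply on_Gaway; auto. }
  assert (HP := PI_RGT_0). assert (HE := eta1_bounds).
  exists (K1 + (M + eta1 * PI) * K2). split.
  { apply Rplus_le_le_0_compat; auto. apply Rmult_le_pos; auto. nra. }
  intros m N. specialize (H1 m). specialize (H2 m). cbv zeta in H1, H2. fold N in H1, H2.
  set (T := / rho_x ^ N / (INR N * sqrt (INR N))).
  replace (K1 * / rho_x ^ N / (INR N * sqrt (INR N))) with (K1 * T) in H1 by (unfold T, Rdiv; ring).
  replace (K2 * / rho_x ^ N / (INR N * sqrt (INR N))) with (K2 * T) in H2 by (unfold T, Rdiv; ring).
  replace ((K1 + (M + eta1 * PI) * K2) * / rho_x ^ N / (INR N * sqrt (INR N))) with (K1 * T + (M + eta1 * PI) * (K2 * T)) by (unfold T, Rdiv; ring).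
  set (I1 := Cint (fun s => RtoC (kk s) * ptrue s ^ N)%C (- / 2) (/ 2)) in *.
  set (Q := (RtoC PI * rootc * RtoC (wallis (S m)) * / ysing ^ N)%C).
  assert (EQ : PI * Elog (S m) = Im (ccoef dFlog plog Gaway (S m)) + Im I1).
  { unfold Elog, bcoef. rewrite <- im_plus. replace (PI * (Im (ccoef dFlog plog Glog (S m)) / PI)) with (Im (ccoef dFlog plog Glog (S m))) by (field; lra).
    f_equal. unfold ccoef, I1. unfold N. rewrite <- (cint_Gsaddle (S m)). apply cint_Glog_split.
    intros w Hw. apply Ccont_div.
    - apply Cpow_nz, Cmod_nz. generalize (Glog_far w Hw) rho_pos. lra.
    - apply Glog_dFlog_cont; auto.
    - apply (Ccont_pow plog), Glog_plog_cont; auto. }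
  assert (EM : eta1 * PI * wallis (S m) * (sqrt (2 * rho_x) * / rho_x ^ N * cos (theta_x * (/ 2 - INR N))) = - Im (RtoC eta1 * Q)).
  { replace (RtoC eta1 * Q)%C with (RtoC (eta1 * PI * wallis (S m)) * (rootc * / ysing ^ N))%C by (unfold Q; rewrite !RtoC_mult; ring).
    assert (Hz := model_phase N). set (z := (rootc * / ysing ^ N)%C) in *. set (u := eta1 * PI * wallis (S m)).
    rewrite im_mult, Hz. change (Re (RtoC u)) with u. change (Im (RtoC u)) with 0. ring. }
  rewrite EQ, EM.
  replace (Im (ccoef dFlog plog Gaway (S m)) + Im I1 + - Im (RtoC eta1 * Q)) with
    (Im (ccoef dFlog plog Gaway (S m)) + Im (I1 - RtoC eta1 * modelint (/ 2) N)%C - Im (RtoC eta1 * (Q - modelint (/ 2) N))%C)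
    by (replace (RtoC eta1 * (Q - modelint (/ 2) N))%C with (RtoC eta1 * Q - RtoC eta1 * modelint (/ 2) N)%C by ring; rewrite !im_minus; ring).
  assert (S7 : / (7 / 2) ^ S m <= / (7 / 2) ^ m).
  { assert (P := pow_lt (7 / 2) m ltac:(lra)). apply Rinv_le_contravar; auto. simpl. lra. }
  assert (B1 : Rabs (Im (ccoef dFlog plog Gaway (S m))) <= M * (K2 * T)).
  { eapply Rle_trans; [apply Im_le_Cmod|]. eapply Rle_trans; [apply HM|]. apply Rmult_le_compat_l; auto. lra. }
  assert (B2 : Rabs (Im (I1 - RtoC eta1 * modelint (/ 2) N)%C) <= K1 * T) by (eapply Rle_trans; [apply Im_le_Cmod|exact H1]).
  assert (B3 : Rabs (Im (RtoC eta1 * (Q - modelint (/ 2) N))%C) <= eta1 * PI * (K2 * T)).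
  { eapply Rle_trans; [apply Im_le_Cmod|]. rewrite Cmod_mult, Cmod_R, Rabs_pos_eq by lra. rewrite Rmult_assoc.
    apply Rmult_le_compat_l; [lra|].
    eapply Rle_trans; [apply (modelint_model rootc rootc_sqr rootc_Re (/ 2) m); lra|]. apply Rmult_le_compat_l; [lra|].
    eapply Rle_trans; [|exact H2]. rewrite <- pow_inv. apply pow_incr. split; [apply Cmod_ge_0|].
    rewrite Cmod_qmodel. apply Rinv_le_contravar; [lra|].
    apply Rsqr_incr_0_var; [|apply Cmod_ge_0]. rewrite !Rsqr_pow2, Cmod2_alt. simpl Re. simpl Im.
    assert (L := ell1_bounds). assert (R := rho_sqr_bounds). rewrite rho_sqr in R. nra. }
  eapply Rle_trans; [apply Rabs_triang|]. rewrite Rabs_Ropp.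
  eapply Rle_trans; [apply Rplus_le_compat_r, Rabs_triang|]. lra.
Qed.

(** * The asymptotic formula *)

Lemma Rpower_half x k : 0 < x -> Rpower x (- (INR k + / 2)) = / (x ^ k * sqrt x).
Proof.
  intros Hx. rewrite Rpower_Ropp, Rpower_plus, Rpower_pow, Rpower_sqrt by auto. reflexivity.
Qed.

(** [wallis k ^ 2] is [1 / (PI k)] up to a factor [1 + O(1 / k)]. *)
Lemma wallis_power k : (1 <= k)%nat -> let x := INR k + 2 in
  Rabs (sqrt PI * wallis k / ((x - 1) * x) - / (x ^ 2 * sqrt x)) <= 14 / (x ^ 3 * sqrt x).
Proof.
  intros Hk x. assert (HP := PI_RGT_0). assert (W := wallis_bounds k Hk). assert (P0 := wallis_pos k).
  assert (K1 : 1 <= INR k) by (change 1 with (INR 1); apply le_INR; auto).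
  assert (X3 : 3 <= x) by (unfold x; lra).
  set (X := sqrt PI * wallis k).
  assert (SP : 0 < sqrt PI) by (apply sqrt_lt_R0; auto). assert (SPP : sqrt PI * sqrt PI = PI) by (apply sqrt_sqrt; lra).
  assert (X0 : 0 < X) by (apply Rmult_lt_0_compat; auto).
  assert (XX : X * X = PI * wallis k ^ 2) by (unfold X; rewrite <- SPP at 3; ring). rewrite <- XX in W.
  set (w := sqrt x). assert (Ww : w * w = x) by (apply sqrt_sqrt; lra). assert (W0 : 0 < w) by (apply sqrt_lt_R0; lra).
  assert (L : 1 <= X * w).
  { assert (A : / x <= X * X) by (eapply Rle_trans; [|apply W]; apply Rinv_le_contravar; unfold x; lra).
    assert (x * / x <= x * (X * X)) by (apply Rmult_le_compat_l; lra). rewrite Rinv_r in H by lra.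
    assert (0 < X * w) by (apply Rmult_lt_0_compat; auto). nra. }
  assert (U : X * w * x <= x + 4).
  { assert (A : X * X * (x - 2) <= 1).
    { replace 1 with (/ INR k * INR k) by (field; lra). unfold x. replace (INR k + 2 - 2) with (INR k) by ring.
      apply Rmult_le_compat_r; lra. }
    assert (B : (X * w) * (X * w) * (x - 2) <= x) by (replace ((X * w) * (X * w) * (x - 2)) with (X * X * (x - 2) * (w * w)) by ring; rewrite Ww; nra).
    set (z := X * w) in *. apply Rnot_lt_le. intros Hlt.
    assert (C : (x + 4) * (x + 4) < (z * x) * (z * x)) by (apply Rmult_le_0_lt_compat; lra).
    assert (D : (x + 4) * (x + 4) * (x - 2) < z * x * (z * x) * (x - 2)) by (apply Rmult_lt_compat_r; lra).
    replace (z * x * (z * x) * (x - 2)) with (z * z * (x - 2) * (x * x)) in D by ring.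
    assert (z * z * (x - 2) * (x * x) <= x * (x * x)) by (apply Rmult_le_compat_r; nra). nra. }
  replace (X / ((x - 1) * x) - / (x ^ 2 * w)) with ((X * w * x ^ 2 - x * (x - 1)) / ((x - 1) * (x ^ 3 * w))) by (field; repeat split; lra).
  set (z := X * w) in *. assert (Q : 0 <= z * x ^ 2 - x * (x - 1) <= 14 * (x - 1)) by nra.
  assert (D1 : 0 < x ^ 3 * w) by (apply Rmult_lt_0_compat; auto; apply pow_lt; lra).
  assert (D2 : 0 < (x - 1) * (x ^ 3 * w)) by (apply Rmult_lt_0_compat; lra).
  rewrite Rabs_pos_eq by (apply Rmult_le_pos; [lra|left; apply Rinv_0_lt_compat; auto]).
  apply Rle_trans with (14 * (x - 1) / ((x - 1) * (x ^ 3 * w))).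
  - apply Rmult_le_compat_r; [left; apply Rinv_0_lt_compat; auto|lra].
  - right. field. repeat split; lra.
Qed.

Lemma dJ_asym : exists K, 0 <= K /\ forall m, let x := INR (S (S (S m))) in
  Rabs (dJ_coef (S (S (S m))) - d_J * / rho_x ^ S (S (S m)) * cos (theta_x * (3 / 2 - x)) * / (x ^ 2 * sqrt x))
   <= K * (/ rho_x ^ S (S (S m)) * / (x ^ 3 * sqrt x)).
Proof.
  destruct Elog_asym as (K & HK & H). assert (HP := PI_RGT_0). assert (HR := rho_bounds). assert (HE := eta1_bounds).
  set (s := sqrt (2 * rho_x)). assert (s0 : 0 < s) by (apply sqrt_lt_R0; lra).
  set (sp := sqrt PI). assert (SP : 0 < sp) by (apply sqrt_lt_R0; auto). assert (SPP : sp * sp = PI) by (apply sqrt_sqrt; lra).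
  exists (rho_x * (8 * K / PI + eta1 * s * (14 / sp))). split.
  { apply Rmult_le_pos; [lra|]. apply Rplus_le_le_0_compat.
    - apply Rmult_le_pos; [lra|left; apply Rinv_0_lt_compat; auto].
    - apply Rmult_le_pos; [nra|left; apply Rdiv_lt_0_compat; lra]. }
  intros m x. specialize (H m). cbv zeta in H. set (N := S (S m)) in *.
  assert (XN : x = INR N + 1) by apply S_INR. assert (Xk : x = INR (S m) + 2) by (unfold x, N; rewrite !S_INR; ring).
  assert (N2 : 2 <= INR N) by (change 2 with (INR 2); apply le_INR; unfold N; lia).
  rewrite dJ_coef_eq. change (integrate2 Elog (S N)) with (Elog (S m) / (INR N * x)). replace (INR N) with (x - 1) in * by lra.
  assert (WP := wallis_power (S m) ltac:(lia)). cbv zeta in WP. rewrite <- Xk in WP. fold sp in WP.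
  assert (RN := pow_lt rho_x N ltac:(lra)). set (i := / rho_x ^ N) in *. assert (i0 : 0 < i) by (apply Rinv_0_lt_compat; auto).
  replace (/ rho_x ^ S N) with (i / rho_x) by (unfold i, Rdiv; change (rho_x ^ S N) with (rho_x * rho_x ^ N); rewrite Rinv_mult; apply Rmult_comm).
  replace (theta_x * (/ 2 - (x - 1))) with (theta_x * (3 / 2 - x)) in H by field.
  set (cs := cos (theta_x * (3 / 2 - x))) in *. assert (CB : Rabs cs <= 1) by (apply Rabs_le_between; apply COS_bound).
  set (w := sqrt x) in *. set (P := wallis (S m)) in *. fold s in H.
  set (err := PI * Elog (S m) + eta1 * PI * P * (s * i * cs)) in *.
  assert (Ww : w * w = x) by (apply sqrt_sqrt; lra). assert (W0 : 0 < w) by (apply sqrt_lt_R0; lra).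
  assert (dJ : d_J = - (eta1 * s * rho_x / sp)).
  { unfold d_J. rewrite sqrt_div by lra. fold sp. unfold s. rewrite sqrt_mult by lra. field. lra. }
  rewrite dJ.
  replace (Elog (S m) / ((x - 1) * x) - - (eta1 * s * rho_x / sp) * (i / rho_x) * cs * / (x ^ 2 * w)) with
    (err / PI / ((x - 1) * x) - eta1 * s * (/ sp) * i * cs * (sp * P / ((x - 1) * x) - / (x ^ 2 * w)))
    by (unfold err; field; repeat split; lra).
  assert (D3 : 0 < x ^ 3 * w) by (apply Rmult_lt_0_compat; auto; apply pow_lt; lra).
  assert (B1 : Rabs (err / PI / ((x - 1) * x)) <= i * (8 * K / PI) * / (x ^ 3 * w)).
  { set (v := sqrt (x - 1)) in *. assert (Vv : v * v = x - 1) by (apply sqrt_sqrt; lra). assert (V0 : 0 < v) by (apply sqrt_lt_R0; lra).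
    assert (G : x * w <= 4 * ((x - 1) * v)) by (assert (w <= 2 * v) by nra; nra).
    assert (G2 : x ^ 3 * w <= 8 * ((x - 1) * v * ((x - 1) * x))).
    { replace (x ^ 3 * w) with (x * (x * (x * w))) by ring.
      assert (x * (x * w) <= 2 * (x - 1) * (4 * ((x - 1) * v))) by (apply Rmult_le_compat; nra). nra. }
    assert (D4 : 0 < (x - 1) * v) by (apply Rmult_lt_0_compat; lra). assert (D5 : 0 < (x - 1) * x) by (apply Rmult_lt_0_compat; lra).
    unfold Rdiv. rewrite !Rabs_mult, (Rabs_pos_eq (/ PI)), (Rabs_pos_eq (/ ((x - 1) * x))) by (left; apply Rinv_0_lt_compat; lra).
    apply Rle_trans with (K * i / ((x - 1) * v) * / PI * / ((x - 1) * x)).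
    - apply Rmult_le_compat_r; [left; apply Rinv_0_lt_compat; lra|]. apply Rmult_le_compat_r; [left; apply Rinv_0_lt_compat; lra|]. exact H.
    - replace (K * i / ((x - 1) * v) * / PI * / ((x - 1) * x)) with (i * K / PI * / ((x - 1) * v * ((x - 1) * x))) by (field; repeat split; lra).
      replace (i * (8 * K * / PI) * / (x ^ 3 * w)) with (i * K / PI * / (x ^ 3 * w / 8)) by (field; repeat split; lra).
      apply Rmult_le_compat_l.
      + apply Rmult_le_pos; [nra|left; apply Rinv_0_lt_compat; auto].
      + apply Rinv_le_contravar; lra. }
  assert (B2 : Rabs (eta1 * s * (/ sp) * i * cs * (sp * P / ((x - 1) * x) - / (x ^ 2 * w))) <= i * (eta1 * s * (14 / sp)) * / (x ^ 3 * w)).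
  { rewrite Rabs_mult, (Rabs_mult _ cs).
    assert (C0 : 0 < eta1 * s * (/ sp) * i) by (repeat apply Rmult_lt_0_compat; try lra; apply Rinv_0_lt_compat; lra).
    rewrite (Rabs_pos_eq (eta1 * s * (/ sp) * i)) by lra.
    apply Rle_trans with (eta1 * s * (/ sp) * i * 1 * (14 / (x ^ 3 * w))).
    - apply Rmult_le_compat; auto using Rabs_pos.
      + apply Rmult_le_pos; [lra|apply Rabs_pos].
      + apply Rmult_le_compat_l; lra.
    - right. field. repeat split; lra. }
  replace (rho_x * (8 * K / PI + eta1 * s * (14 / sp)) * (i / rho_x * / (x ^ 3 * w))) with
    (i * (8 * K / PI) * / (x ^ 3 * w) + i * (eta1 * s * (14 / sp)) * / (x ^ 3 * w)) by (field; repeat split; lra).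
  eapply Rle_trans; [apply Rabs_triang|]. rewrite Rabs_Ropp. lra.
Qed.

Theorem part_ii_asym : exists d_J : R,
         Rabs (d_J - (- 234048 / 10000)) < 1 / 10000
         /\ is_bigO eventually
              (fun n : nat =>
                 dJ_coef n - d_J * / rho_x ^ n
                         * cos (theta_x * (3 / 2 - INR n))
                         * Rpower (INR n) (- (5 / 2)))
              (fun n : nat => / rho_x ^ n * Rpower (INR n) (- (7 / 2))).
Proof.
  exists d_J. split; [apply d_J_bounds|]. destruct dJ_asym as (K & HK & H). exists K. exists 3%nat.
  intros n Hn. destruct n as [|[|[|m]]]; try lia. specialize (H m). cbv zeta in H.
  assert (RN := pow_lt rho_x (S (S (S m))) rho_pos).
  set (n := S (S (S m))) in *. assert (N0 : 0 < INR n) by (apply lt_0_INR; unfold n; lia).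
  replace (5 / 2) with (INR 2 + / 2) by (simpl; field). replace (7 / 2) with (INR 3 + / 2) by (simpl; field).
  rewrite !Rpower_half by auto. rewrite (Rabs_pos_eq (/ rho_x ^ n * _)); [exact H|].
  apply Rmult_le_pos; left; apply Rinv_0_lt_compat; auto. apply Rmult_lt_0_compat; [apply pow_lt|apply sqrt_lt_R0]; auto.
Qed.

(** * The proposition *)

Theorem proposition4p1 :
  (* (i) *)
  ( CV_radius cJ_coef = Finite 1
    /\ (forall w : R, Rabs (w - 1) < 1 -> is_pseries cJ_coef (w - 1) (J_BS w))
    /\ is_bigO (locally 1)
         (fun w : R => J_BS w - (3 / 2 * (w - 1) ^ 2 - 9 / 5 * (w - 1) ^ 3
                                 + 333 / 175 * (w - 1) ^ 4))
         (fun w : R => (w - 1) ^ 5)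
    /\ is_bigO eventually
         (fun n : nat => cJ_coef n - (-1) ^ n * 2)
         (fun n : nat => / (1 - omega1) ^ n) )
  /\
  (* (ii) *)
  ( Rbar_le (Finite rho_x) (CV_radius dJ_coef)
    /\ (forall y : R, Rabs y < rho_x -> is_pseries dJ_coef y (J_BS (exp y)))
    /\ is_bigO (locally 0)
         (fun y : R => J_BS (exp y) - (3 / 2 * y ^ 2 - 3 / 10 * y ^ 3
                                       + 109 / 1400 * y ^ 4))
         (fun y : R => y ^ 5)
    /\ exists d_J : R,
         Rabs (d_J - (- 234048 / 10000)) < 1 / 10000
         /\ is_bigO eventually
              (fun n : nat =>
                 dJ_coef n - d_J * / rho_x ^ n
                         * cos (theta_x * (3 / 2 - INR n))
                         * Rpower (INR n) (- (5 / 2)))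
              (fun n : nat => / rho_x ^ n * Rpower (INR n) (- (7 / 2))) ).
Proof.
  split.
  - destruct part_i_series as [R S].
    exact (conj R (conj S (conj part_i_expansion part_i_asym))).
  - destruct part_ii_series as [R S].
    exact (conj R (conj S (conj part_ii_expansion part_ii_asym))).
Qed.
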